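(* Suppose that the standing assumptions hold, $\mathcal{E}(0)\le y_0$, $E(0)<d_0$, $u_0\in\mathcal{W}_1$; let $u$ be the weak solution of problem (P) and assume $M_1:=\sup_{\tau\in\mathbb{R}^+}\|u(\tau)\|_{m+1}<+\infty$. Then the following hold. (I) Assume that there exists a constant $a>0$ with $\mu'(s)+a\mu(s)\le0$ for all $s\ge0$. (1) If $m=1$, then $E(t)\le K_1e^{-\kappa t}$ for all $t\ge0$, where $K_1,\kappa>0$ are constants depending on $a$, $E(0)$ and $M_1$. (2) If $m>1$, then $E(t)\le K_2(1+t)^{\frac{2}{1-m}}$ for all $t\ge0$, where $K_2>0$ is a constant depending on $a$, $M_1$ and $E(0)$. (II) Assume that there exist constants $b>0$ and $\theta\in(1,2)$ with $\mu'(s)+b\mu(s)^\theta\le0$ for all $s\ge0$, that $M_2:=\sup_{\tau\in\mathbb{R}^-}\|\nabla u_0(\tau)\|_2<+\infty$, and let $\sigma\in(0,2-\theta)$. (1) If $m=1$, then $E(t)\le K_3(1+t)^{-\frac{\sigma}{\theta-1}}$ for all $t\ge0$, where $K_3>0$ is a constant depending on $\theta,b,\sigma,M_1,M_2$ and $E(0)$. (2) If $m>1$, then $E(t)\le K_4(1+t)^{-\min\left\{\frac{\sigma}{\theta-1},\frac{2}{m-1}\right\}}$ for all $t\ge0$, where $K_4>0$ is a constant depending on $\theta,b,\sigma,M_1,M_2$ and $E(0)$.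
   Context: Setting. $\Omega\subset\mathbb{R}^3$ is a bounded domain with boundary $\Gamma$ of class $C^2$; $\mathbb{R}^+=[0,+\infty)$, $\mathbb{R}^-=(-\infty,0]$; $\|\cdot\|_p$ is the $L^p(\Omega)$-norm. Problem (P) is $$u_{tt}-k(0)\Delta u-\int_0^{+\infty}k'(s)\Delta u(t-s)\,ds+|u_t|^{m-1}u_t=f(u)\ \text{ in }\Omega\times(0,T),$$ $u(x,t)=0$ on $\Gamma\times(-\infty,T)$, and $u(x,t)=u_0(x,t)$, $u_t(x,t)=\partial_tu_0(x,t)$ in $\Omega\times(-\infty,0]$, where $$f(u)=\sum_{i=1}^r a_i|u|^{p_i-1}u-\sum_{j=1}^l b_j|u|^{q_j-1}u,\qquad a_i,b_j>0,\ r,l\ge1.$$ Function spaces. $\mu(s)=-k'(s)$. $L^2_\mu(\mathbb{R}^-;H^1_0(\Omega))$ is the set of functions $v:\mathbb{R}^-\to H^1_0(\Omega)$ with $\int_0^{+\infty}\mu(s)\|\nabla v(-s)\|_2^2\,ds<+\infty$; $L^2_\mu(\mathbb{R}^-;L^2(\Omega))$ is defined similarly with $\|v(-s)\|_2^2$. Standing assumptions. (i) $1<p_1<\cdots<p_r\le5$, $1\le q_1<\cdots<q_l\le5$, and $p_i\ne q_j$ for all $i,j$. (ii) $m\ge1$, $\frac{m+1}{m}p_r<6$, $\frac{m+1}{m}q_l<6$. (iii) $k\in C^2(\mathbb{R}^+)$, $k'(s)<0$ for all $s>0$, $k(+\infty)=1$. (iv) $\mu\in C^1(\mathbb{R}^+)\cap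 L^1(\mathbb{R}^+)$, $\mu'(s)\le0$ for all $s>0$, $\mu(+\infty)=0$. (v) $u_0\in L^2_\mu(\mathbb{R}^-;H^1_0(\Omega))$ and $\partial_tu_0\in L^2_\mu(\mathbb{R}^-;L^2(\Omega))$, with $u_0:\mathbb{R}^-\to H_0^1(\Omega)$ and $\partial_tu_0:\mathbb{R}^-\to L^2(\Omega)$ weakly continuous at $t=0$. Weak solution. $u$ is a weak solution of (P) on $(-\infty,T]$ if $u\in C([0,T];H_0^1(\Omega))$, $u_t\in C([0,T];L^2(\Omega))\cap L^{m+1}(\Omega\times(0,T))$, $u=u_0$ for $t\le0$ (with $u_t(0)=\partial_tu_0(0)$), and for all $t\in[0,T]$ and all $\phi\in C([0,T];H^1_0(\Omega))\cap L^{m+1}(\Omega\times(0,T))$ with $\phi_t\in C([0,T];L^2(\Omega))$, $$\int_\Omega u_t(t)\phi(t)\,dx-\int_\Omega u_t(0)\phi(0)\,dx-\int_0^t\!\int_\Omega u_t\phi_t\,dxd\tau+k(0)\int_0^t\!\int_\Omega\nabla u\cdot\nabla\phi\,dxd\tau-\int_0^t\!\int_0^{+\infty}\!\int_\Omega\mu(s)\nabla u(\tau-s)\cdot\nabla\phi(\tau)\,dxdsd\tau+\int_0^t\!\int_\Omega|u_t|^{m-1}u_t\phi\,dxd\tau=\int_0^t\!\int_\Omega f(u)\phi\,dxd\tau.$$ Energies. $w^t(x,s)=u(x,t)-u(x,t-s)$ for $s\ge0$; $\mathcal{E}(t)=\frac12\big(\|u_t(t)\|_2^2+\|\nabla u(t)\|_2^2+\int_0^{+\infty}\mu(s)\|\nabla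 w^t(s)\|_2^2ds\big)$; $E(t)=\mathcal{E}(t)-\int_\Omega F(u(t))\,dx$ with $F(u)=\int_0^uf(s)\,ds$. Background convention. Under the standing assumptions a local weak solution is known to exist (on a time interval whose length depends only on an upper bound of $\mathcal{E}(0)$) and to satisfy $E(t)+\int_0^t\|u_t\|_{m+1}^{m+1}d\tau-\frac12\int_0^t\int_0^{+\infty}\mu'(s)\|\nabla w^\tau(s)\|_2^2\,dsd\tau=E(0)$. ''The weak solution'' means this solution extended to its maximal existence interval (which under the hypotheses of the claim is $(-\infty,+\infty)$). Potential well. Let $l_0$ be the index with $q_{l_0}<p_1<q_{l_0+1}$ if it exists; otherwise $l_0=0$ if $p_1<q_1$ and $l_0=l$ if $q_l<p_1$ (empty sums are $0$). For $v\in L^2_\mu(\mathbb{R}^-;H^1_0(\Omega))$ weakly continuous at $t=0$ put $$I(v)=\tfrac12\Big(\|\nabla v(0)\|_2^2+\int_0^{+\infty}\mu(s)\|\nabla v(0)-\nabla v(-s)\|_2^2ds\Big)-\sum_{i=1}^r\tfrac{a_i}{p_i+1}\|v(0)\|_{p_i+1}^{p_i+1}+\sum_{j=1}^{l_0}\tfrac{b_j}{q_j+1}\|v(0)\|_{q_j+1}^{q_j+1},$$ $$I_0(v)=\|\nabla v(0)\|_2^2+\int_0^{+\infty}\mu(s)\|\nabla v(0)-\nabla v(-s)\|_2^2ds-\sum_{i=1}^ra_i\|v(0)\|_{p_i+1}^{p_i+1}+\sum_{j=1}^{l_0}b_j\|v(0)\|_{q_j+1}^{q_j+1}.$$ Let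 $\mathcal{M}$ be the set of $v\in L^2_\mu(\mathbb{R}^-;H^1_0(\Omega))\setminus\{0\}$ weakly continuous at $t=0$ with $I_0(v)=0$; $d=\inf_{v\in\mathcal{M}}I(v)$; $\mathcal{W}$ is the set of $v\in L^2_\mu(\mathbb{R}^-;H^1_0(\Omega))$ weakly continuous at $t=0$ with $I(v)<d$; $\mathcal{W}_1=\{v\in\mathcal{W}:I_0(v)>0\}\cup\{0\}$. Constants. $\gamma_i=\sup\{\|v\|_{p_i+1}:v\in H^1_0(\Omega),\|\nabla v\|_2=1\}$; $G(y)=y-\sum_{i=1}^r\frac{a_i}{p_i+1}(2\gamma_i^2y)^{\frac{p_i+1}{2}}$ on $\mathbb{R}^+$; $y_0$ is the point where $G$ attains its maximum, and $d_0=G(y_0)$. *)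

(* Defs.v *)
From HB Require Import structures.
From mathcomp Require Import all_boot all_order all_algebra.
From mathcomp Require Import all_classical all_reals all_analysis.

Set Implicit Arguments.
Unset Strict Implicit.
Unset Printing Implicit Defensive.

Import Order.TTheory GRing.Theory Num.Theory.
Import numFieldNormedType.Exports.

Local Open Scope classical_set_scope.
Local Open Scope ring_scope.

Notation E3 R := (R * R * R)%type.

Section Euclidean.
Context {R : realType}.

Definition leb3 :=
  (@lebesgue_measure R \x @lebesgue_measure R \x @lebesgue_measure R)%E.

Definition dot3 (x y : E3 R) : R := x.1.1 * y.1.1 + x.1.2 * y.1.2 + x.2 * y.2.

Definition basis3 (i : 'I_3) : E3 R :=
  ((i == 0 :> nat)%N%:R, (i == 1 :> nat)%N%:R, (i == 2 :> nat)%N%:R).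

(* [Cn n f]: all iterated directional derivatives of order <= n exist and are
   continuous. *)
Fixpoint Cn (V : normedModType R) (n : nat) (f : V -> R) : Prop :=
  continuous f /\
  if n is n'.+1 then
    forall v : V, (forall x, derivable f x v) /\ Cn n' (fun x => 'D_v f x)
  else True.

Definition test_fun (V : normedModType R) (D : set V) (phi : V -> R) : Prop :=
  (forall n, Cn n phi) /\
  exists K : set V,
    [/\ compact K, K `<=` D & forall x, ~ K x -> phi x = 0].

Definition C2_boundary (Om : set (E3 R)) : Prop :=
  forall x, (closure Om `&` closure (~` Om)) x ->
  exists (rho : R) (e1 e2 e3 : E3 R) (g : (R * R)%type -> R),
    [/\ 0 < rho,
        [/\ dot3 e1 e1 = 1, dot3 e2 e2 = 1 & dot3 e3 e3 = 1],
        [/\ dot3 e1 e2 = 0, dot3 e1 e3 = 0 & dot3 e2 e3 = 0],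
        Cn 2 g &
        forall y, ball x rho y ->
          (Om y <-> g (dot3 e1 y, dot3 e2 y) < dot3 e3 y)].

Definition C2_domain (Om : set (E3 R)) : Prop :=
  [/\ open Om, connected Om, Om !=set0, bounded_set Om & C2_boundary Om].

End Euclidean.

(* A function on Omega is represented by a total function on R^3 whose values
   outside Omega are irrelevant; elements of L^p are compared with [aeeq]. *)

Section Spaces.
Context {R : realType} (Om : set (E3 R)).
Local Notation fld := (E3 R -> R).
Implicit Types (v w : fld) (p : R).

Definition aeeq v w : Prop := {ae @leb3 R, forall x, Om x -> v x = w x}.

Definition enrm p v : \bar R :=
  Lnorm (@leb3 R) p%:E (fun x => (\1_Om x * v x)%:E).

Definition nrm p v : R := fine (enrm p v).

Definition Lp p v : Prop := measurable_fun Om v /\ (enrm p v < +oo)%E.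

Definition ip v w : R := \int[@leb3 R]_(x in Om) (v x * w x).

Definition is_wgrad v (g : 'I_3 -> fld) : Prop :=
  forall i, Lp 2 (g i) /\
    forall phi : fld, test_fun Om phi ->
      ip v (fun x => 'D_(basis3 i) phi x) = - ip (g i) phi.

Definition H1 v : Prop := Lp 2 v /\ exists g, is_wgrad v g.

(* The weak gradient is unique up to a.e. equality; a representative is
   chosen. *)
Definition wgrad v : 'I_3 -> fld := xget (fun _ _ => 0) (is_wgrad v).

Definition egradnrm v : \bar R :=
  enrm 2 (fun x => Num.sqrt (\sum_(i < 3) wgrad v i x ^+ 2)).

Definition gradnrm v : R := fine (egradnrm v).

Definition gradip v w : R :=
  \int[@leb3 R]_(x in Om) (\sum_(i < 3) wgrad v i x * wgrad w i x).

Definition H10 v : Prop :=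
  H1 v /\ forall eps : R, 0 < eps ->
    exists phi : fld, [/\ test_fun Om phi,
      (enrm 2 (v \- phi)%R < eps%:E)%E &
      (egradnrm (v \- phi)%R < eps%:E)%E].

End Spaces.

Section Evolution.
Context {R : realType} (Om : set (E3 R)).
Local Notation fld := (E3 R -> R).
(* [X] is the space of values, [nX] its norm, [ipX] its inner product. *)
Implicit Types (X : fld -> Prop) (nX : fld -> \bar R) (ipX : fld -> fld -> R).
Implicit Types (v vt u phi : R -> fld).

Definition simple_evol X (D : set R) v : Prop :=
  exists (n : nat) (A : 'I_n -> set R) (c : 'I_n -> fld),
    [/\ forall i, measurable (A i), forall i, X (c i) &
        forall t x, D t -> v t x = \sum_(i < n) \1_(A i) t * c i x].

Definition strongly_measurable X nX (D : set R) v : Prop :=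
  exists s : nat -> R -> fld,
    (forall n, simple_evol X D (s n)) /\
    forall t, D t -> nX (v t \- s n t) @[n --> \oo] --> 0%E.

Definition L2mu X nX (mu : R -> R) v : Prop :=
  [/\ forall t, t <= 0 -> X (v t),
      strongly_measurable X nX `]-oo, 0] v &
      (\int[@lebesgue_measure R]_(s in `[0%R, +oo[) ((mu s)%:E * nX (v (- s)%R) `^ 2) < +oo)%E].

Definition weakly_cts0 X ipX v : Prop :=
  forall w, X w -> ipX (v t) w @[t --> 0^'-] --> ipX (v 0) w.

Definition CT X nX (T : R) v : Prop :=
  forall t, t \in `[0, T] -> X (v t) /\
    nX (v tau \- v t) @[tau --> within `[0, T] (nbhs t)] --> 0%E.

(* [vt] is the weak time derivative of [v] on the open set [D], as L^2(Omega)
   valued functions. *)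
Definition weak_dt (D : set R) v vt : Prop :=
  forall (psi : R -> R) (w : fld), test_fun D psi -> Lp Om 2 w ->
    \int[@lebesgue_measure R]_(t in D) (derive1 psi t * ip Om (v t) w) =
    - \int[@lebesgue_measure R]_(t in D) (psi t * ip Om (vt t) w).

(* L^q(Omega x (0,T)), through a jointly measurable representative *)
Definition Lcyl (q T : R) v : Prop :=
  exists h : (E3 R * R)%type -> R,
    [/\ measurable_fun (Om `*` `]0, T[) h,
        {ae @lebesgue_measure R, forall t, t \in `]0, T[ ->
           aeeq Om (v t) (fun x => h (x, t))} &
        (\int[(@leb3 R \x @lebesgue_measure R)%E]_(z in Om `*` `]0%R, T[)
           (`|h z| `^ q)%:E < +oo)%E].

End Evolution.

Section HalfLine.
Context {R : realType}.
Implicit Types (f : R -> R) (s : R).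

Definition dquot f s (h : R) : R := h^-1 * (f (s + h) - f s).

Definition dfilter s : set_system R := within [set h | 0 <= s + h] (0 : R)^'.

(* The derivative of a function on [0,+oo), one-sided at 0; values of [f] on
   negative numbers are never used. *)
Definition dRp f s : R := lim (dquot f s @ dfilter s).

Definition C1_Rp f : Prop :=
  (forall s, 0 <= s -> cvg (dquot f s @ dfilter s)) /\
  {within `[0, +oo[, continuous (dRp f)}.

Definition C2_Rp f : Prop := C1_Rp f /\ C1_Rp (dRp f).

End HalfLine.

(* [p i], [a i] (resp. [q j], [b j]) are numbered from 0; the number of
   source terms is [nr.+1], the number of absorption terms is [nl.+1]. *)
Record problem (R : realType) := Problem {
  Om : set (E3 R);
  ker : R -> R;
  dmp : R;
  nr : nat;
  nl : nat;
  acoef : 'I_nr.+1 -> R;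
  pexp : 'I_nr.+1 -> R;
  bcoef : 'I_nl.+1 -> R;
  qexp : 'I_nl.+1 -> R
}.

Section Problem.
Context {R : realType} (P : problem R).
Local Notation fld := (E3 R -> R).
Local Notation Om := (Om P).
Local Notation k := (ker P).
Local Notation m := (dmp P).
Local Notation a := (@acoef R P).
Local Notation p := (@pexp R P).
Local Notation b := (@bcoef R P).
Local Notation q := (@qexp R P).
Local Notation L := (@lebesgue_measure R).
Local Notation Linf := (`[0%R, +oo[%classic : set R).
Implicit Types (v phi : fld) (t T s : R).

Definition mu s : R := - dRp k s.
Definition dmu s : R := dRp mu s.

Definition assumptions_i : Prop :=
  [/\ [/\ forall i, 0 < a i, forall i j : 'I_(nr P).+1, (i < j)%N -> p i < p j,
          1 < p ord0 & p ord_max <= 5],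
      [/\ forall j, 0 < b j, forall i j : 'I_(nl P).+1, (i < j)%N -> q i < q j,
          1 <= q ord0 & q ord_max <= 5] &
      forall i j, p i != q j].

Definition assumptions_ii : Prop :=
  [/\ 1 <= m, (m + 1) / m * p ord_max < 6 & (m + 1) / m * q ord_max < 6].

Definition assumptions_iii : Prop :=
  [/\ C2_Rp k, forall s, 0 < s -> dRp k s < 0 & k s @[s --> +oo] --> (1 : R)].

Definition assumptions_iv : Prop :=
  [/\ C1_Rp mu, L.-integrable Linf (EFin \o mu),
      forall s, 0 < s -> dmu s <= 0 & mu s @[s --> +oo] --> (0 : R)].

Definition space0 (v : R -> fld) : Prop :=
  L2mu (H10 Om) (egradnrm Om) mu v /\ weakly_cts0 (H10 Om) (gradip Om) v.

(* [v0] plays the role of the time derivative of [u0]. *)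
Definition assumptions_v (u0 v0 : R -> fld) : Prop :=
  [/\ space0 u0, L2mu (Lp Om 2) (enrm Om 2) mu v0,
      weakly_cts0 (Lp Om 2) (ip Om) v0 & weak_dt Om `]-oo, 0[ u0 v0].

Definition source (z : R) : R :=
  \sum_i a i * `|z| `^ (p i - 1) * z - \sum_j b j * `|z| `^ (q j - 1) * z.

Definition sourceF (z : R) : R :=
  if 0 <= z then \int[L]_(s in `[0, z]) source s else - \int[L]_(s in `[z, 0]) source s.

(* [ut] is the time derivative of [u] on [0,T]. *)
Definition weak_solution (u0 v0 : R -> fld) T (u ut : R -> fld) : Prop :=
  [/\ [/\ CT (H10 Om) (egradnrm Om) T u, CT (Lp Om 2) (enrm Om 2) T ut,
          Lcyl Om (m + 1) T ut & weak_dt Om `]0, T[ u ut],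
      forall t, t <= 0 -> aeeq Om (u t) (u0 t),
      aeeq Om (ut 0) (v0 0) &
      forall t, t \in `[0, T] -> forall phi phit : R -> fld,
        CT (H10 Om) (egradnrm Om) T phi -> Lcyl Om (m + 1) T phi ->
        CT (Lp Om 2) (enrm Om 2) T phit -> weak_dt Om `]0, T[ phi phit ->
        ip Om (ut t) (phi t) - ip Om (ut 0) (phi 0)
        - \int[L]_(tau in `[0, t]) ip Om (ut tau) (phit tau)
        + k 0 * \int[L]_(tau in `[0, t]) gradip Om (u tau) (phi tau)
        - \int[L]_(tau in `[0, t]) \int[L]_(s in Linf)
            (mu s * gradip Om (u (tau - s)) (phi tau))
        + \int[L]_(tau in `[0, t])
            ip Om (fun x => `|ut tau x| `^ (m - 1) * ut tau x) (phi tau)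
        = \int[L]_(tau in `[0, t]) ip Om (fun x => source (u tau x)) (phi tau)].

Definition hist (u : R -> fld) t s : fld := u t \- u (t - s).

Definition memory (u : R -> fld) t : R :=
  \int[L]_(s in Linf) (mu s * gradnrm Om (hist u t s) ^+ 2).

Definition Ecal (u ut : R -> fld) t : R :=
  2^-1 * (nrm Om 2 (ut t) ^+ 2 + gradnrm Om (u t) ^+ 2 + memory u t).

Definition En (u ut : R -> fld) t : R :=
  Ecal u ut t - \int[@leb3 R]_(x in Om) sourceF (u t x).

(* Stated in [\bar R], so that finiteness of both dissipation terms is part of
   the identity. *)
Definition energy_identity (u ut : R -> fld) t : Prop :=
  ((En u ut t)%:E
   + \int[L]_(tau in `[0%R, t]) (enrm Om (m + 1) (ut tau) `^ (m + 1))
   - (2^-1)%:E * \int[L]_(tau in `[0%R, t]) \int[L]_(s in Linf)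
       ((dmu s)%:E * egradnrm Om (hist u tau s) `^ 2)
   = (En u ut 0%R)%:E)%E.

(* The solution of reference: it exists on every (-oo,T] and satisfies the
   energy identity. *)
Definition global_solution (u0 v0 u ut : R -> fld) : Prop :=
  (forall T, 0 < T -> weak_solution u0 v0 T u ut) /\
  (forall t, 0 <= t -> energy_identity u ut t).

(* [l0] counts the exponents [q j] below the first [p i]: as indices start at
   0, the exponent q_{l_0} is the one of index [l0.-1]. *)
Definition is_l0 (l0 : nat) : Prop :=
  [\/ exists j j' : 'I_(nl P).+1,
        [/\ l0 = j.+1, j' = j.+1 :> nat & q j < p ord0 < q j'],
      l0 = 0%N /\ p ord0 < q ord0 |
      l0 = (nl P).+1 /\ q ord_max < p ord0].

Definition Iwell (l0 : nat) (v : R -> fld) : R :=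
  2^-1 * (gradnrm Om (v 0) ^+ 2 + memory v 0)
  - \sum_i a i / (p i + 1) * nrm Om (p i + 1) (v 0) `^ (p i + 1)
  + \sum_(j < (nl P).+1 | (j < l0)%N)
      b j / (q j + 1) * nrm Om (q j + 1) (v 0) `^ (q j + 1).

Definition I0well (l0 : nat) (v : R -> fld) : R :=
  gradnrm Om (v 0) ^+ 2 + memory v 0
  - \sum_i a i * nrm Om (p i + 1) (v 0) `^ (p i + 1)
  + \sum_(j < (nl P).+1 | (j < l0)%N) b j * nrm Om (q j + 1) (v 0) `^ (q j + 1).

(* Elements of L^2_mu are classes of functions of time modulo null sets. *)
Definition zero_class (v : R -> fld) : Prop :=
  {ae L, forall t, t <= 0 -> aeeq Om (v t) (fun=> 0)}.

Definition Mwell (l0 : nat) : set (R -> fld) :=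
  [set v | [/\ space0 v, ~ zero_class v & I0well l0 v = 0]].

Definition depth (l0 : nat) : \bar R :=
  ereal_inf [set (Iwell l0 v)%:E | v in Mwell l0].

Definition Wwell (l0 : nat) : set (R -> fld) :=
  [set v | space0 v /\ ((Iwell l0 v)%:E < depth l0)%E].

Definition W1well (l0 : nat) : set (R -> fld) :=
  [set v | Wwell l0 v /\ 0 < I0well l0 v] `|`
  [set v | space0 v /\ zero_class v].

Definition gam (i : 'I_(nr P).+1) : R :=
  sup [set nrm Om (p i + 1) v | v in [set v | H10 Om v /\ gradnrm Om v = 1]].

Definition Gfun (y : R) : R :=
  y - \sum_i a i / (p i + 1) * (2 * gam i ^+ 2 * y) `^ ((p i + 1) / 2).

Definition G_max_at (y0 : R) : Prop :=
  0 <= y0 /\ forall y, 0 <= y -> Gfun y <= Gfun y0.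

Definition setting (l0 : nat) (y0 : R) : Prop :=
  C2_domain Om /\
  [/\ assumptions_i, assumptions_ii, assumptions_iii & assumptions_iv] /\
  is_l0 l0 /\ G_max_at y0.

(* Initial data in the well with E(0) = E0, whose solution satisfies
   sup_{tau >= 0} ||u(tau)||_{m+1} = M1. *)
Definition well_solution (l0 : nat) (y0 E0 M1 : R)
    (u0 v0 u ut : R -> fld) : Prop :=
  [/\ assumptions_v u0 v0, global_solution u0 v0 u ut,
      [/\ Ecal u ut 0 <= y0, En u ut 0 = E0 & E0 < Gfun y0],
      W1well l0 u0 &
      ereal_sup [set enrm Om (m + 1) (u tau) | tau in Linf] = M1%:E].

End Problem.

(* Main.v *)
(* The energy [E] is nonincreasing and differs from the nonnegative energy by a
   continuous potential, so the nonnegative energy cannot jump over the levels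
   between some [y1] and [y0] that the well forbids: it stays below [y1 < y0], where
   the sources absorb only a fraction [rho < 1] of the gradient term.  Hence [E] is
   nonnegative and comparable to the nonnegative energy.

   Testing the equation with [u] on ]S, S+T] bounds the time integral of [E] by the
   integrals of the kinetic and memory energies and of the damping term, up to
   boundary terms of size [E].  For every [la >= 1], elementary interpolation bounds
   each of these three terms by [la ^ r] times the rate at which the damping and the
   memory dissipate energy, plus a multiple of [1 / la].  For [T] large this gives
     E (S+T) <= C (la ^ r (E S - E (S+T)) + 1 / la),
   and the choice of [la] turns it into E (S+T) ^ (1+r) <= C' (E S - E (S+T)), hence
   the rate (1+t) ^ (-1/r), or exponential decay when r = 0.  For a kernel with
   mu' <= - b mu ^ theta the memory is interpolated with the weight mu ^ (1-sigma),
   which is integrable. *)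
Require Import Defs.
From HB Require Import structures.
From mathcomp Require Import all_boot all_order all_algebra.
From mathcomp Require Import all_classical all_reals all_analysis.
From mathcomp Require Import measurable_realfun.
From mathcomp Require Import lra ring.
Set Implicit Arguments.
Unset Strict Implicit.
Unset Printing Implicit Defensive.
Import Order.TTheory GRing.Theory Num.Theory.
Import numFieldNormedType.Exports.
Import HBSimple HBNNSimple.
Local Open Scope classical_set_scope.
Local Open Scope ring_scope.

(** Two obstacles shape the details. The dissipation rates in the energy identity are merely
    nonnegative functions of time, with no measurability at hand; their integrals are used as
    suprema over simple functions, which are monotone and superadditive over disjoint sets. The
    quantities that they bound (kinetic, memory and damping terms) are shown to be genuinely
    integrable. Moreover, u is an admissible test function only if it lies in L^(m+1) of the
    space-time cylinder, which calls for a jointly measurable representative.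

    The constants have to be fixed before the solution: [y1] and [rho] come from G and E(0) alone,
    the length T is dictated by the boundary terms, and only [la] is chosen along the solution, as a
    multiple of 1 / E(S+T).

    The embedding of H^1_0 into L^q, q <= 6, makes the constants gamma_i finite and the potential
    continuous in time. It comes from the Loomis-Whitney inequality for test functions, extended by
    density and Fatou's lemma. For m <= 5 it also absorbs the damping term into the gradient; for m
    > 5 this is done by the bound M1. *)

(** * Integrals of nonnegative functions without measurability *)

Section lower_integral.
Local Open Scope ereal_scope.
Context d (T : measurableType d) (R : realType) (mu : {measure set T -> \bar R}).
Implicit Types (D A B : set T) (f g : T -> \bar R).

Lemma ae_imp (P Q : T -> Prop) : (\forall x \ae mu, P x) ->
  (forall x, P x -> Q x) -> \forall x \ae mu, Q x.
Proof. by move=> aP PQ; exact: filterS aP. Qed.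

(** The integral of a nonnegative function is a supremum over the simple functions below it, and
    this supremum is monotone for arbitrary functions. *)
Lemma le_integral_ge0 D f g : (forall x, D x -> 0 <= f x) ->
  (forall x, D x -> f x <= g x) ->
  \int[mu]_(x in D) f x <= \int[mu]_(x in D) g x.
Proof.
move=> f0 fg; have g0 x : D x -> 0 <= g x by move=> Dx; rewrite (le_trans (f0 _ Dx)) ?fg.
rewrite !ge0_integralE//; apply: le_ereal_sup => _ [h hf <-]; exists h => // x.
rewrite (le_trans (hf x))// /patch; case: ifPn => //; rewrite inE; exact: fg.
Qed.

(** A simple function below [f] on [A] and one below [f] on [B] add up to one below [f] on the
    union. Without measurability only this inequality can be expected; it is what splits a
    dissipation integral at an intermediate time. *)
Lemma integral_setU_ge A B f : [disjoint A & B] ->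
  (forall x, 0 <= f x) ->
  \int[mu]_(x in A) f x + \int[mu]_(x in B) f x <= \int[mu]_(x in A `|` B) f x.
Proof.
move=> AB f0; rewrite !ge0_integralE//.
set S := (X in _ <= X).
have key (h1 h2 : {nnsfun T >-> R}) :
    (forall x, (h1 x)%:E <= (f \_ A) x) -> (forall x, (h2 x)%:E <= (f \_ B) x) ->
    sintegral mu h1 + sintegral mu h2 <= S.
  move=> h1f h2f; rewrite -sintegralD; apply: ereal_sup_ubound.
  exists (add_nnsfun h1 h2) => // x; rewrite /= EFinD.
  move: (h1f x) (h2f x); rewrite /patch in_setU.
  have [xA|xA] := boolP (x \in A); have [xB|xB] := boolP (x \in B) => //=.
  - by move: AB => /disj_setPS/(_ x); move: xA xB; rewrite !inE => xA xB /(_ (conj xA xB)).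
  - by move=> h1x h2x; rewrite -[leRHS]adde0 leeD.
  - by move=> h1x h2x; rewrite -[leRHS]add0e leeD.
  - by move=> h1x h2x; rewrite -[leRHS]adde0 leeD.
have [->|Sy] := eqVneq S +oo; first by rewrite leey.
have fin h : (0 <= sintegral mu h) -> sintegral mu h <= S -> sintegral mu h \is a fin_num.
  by move=> h0 hS; rewrite ge0_fin_numE// (le_lt_trans hS)// lt_neqAle Sy leey.
have nn0 D x : ((@nnsfun0 _ T R) x)%:E <= (f \_ D) x.
  by rewrite /patch; case: ifPn.
have sup1 (h2 : {nnsfun T >-> R}) : (forall x, (h2 x)%:E <= (f \_ B) x) ->
    ereal_sup [set sintegral mu h | h in [set h : {nnsfun T >-> R} | forall x, (h x)%:E <= (f \_ A) x]] + sintegral mu h2 <= S.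
  move=> h2f.
  have f2 : sintegral mu h2 \is a fin_num.
    apply: fin; first exact: sintegral_ge0.
    by have := key _ _ (nn0 A) h2f; rewrite sintegral0 add0e.
  rewrite -leeBrDr//; apply: ge_ereal_sup => _ [h1 /= h1f <-].
  by rewrite leeBrDr//; exact: key.
rewrite addeC -leeBrDr; last first.
  rewrite ge0_fin_numE; last first.
    by apply: ereal_sup_ubound; exists nnsfun0; [exact: nn0|rewrite sintegral0].
  have := sup1 _ (nn0 B); rewrite sintegral0 adde0 => /le_lt_trans; apply.
  by rewrite lt_neqAle Sy leey.
apply: ge_ereal_sup => _ [h2 /= h2f <-]; rewrite leeBrDr; first by rewrite addeC sup1.
rewrite ge0_fin_numE; last first.
  by apply: ereal_sup_ubound; exists nnsfun0; [exact: nn0|rewrite sintegral0].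
have := sup1 _ (nn0 B); rewrite sintegral0 adde0 => /le_lt_trans; apply.
by rewrite lt_neqAle Sy leey.
Qed.

(** The null set can be cut out of every simple function below one integrand: this keeps its
    integral and puts it below the other integrand. *)
Lemma ae_eq_integral_ge0 D f g : (forall x, 0 <= f x) -> (forall x, 0 <= g x) ->
  {ae mu, forall x, D x -> f x = g x} ->
  \int[mu]_(x in D) f x = \int[mu]_(x in D) g x.
Proof.
suff main (f' g' : T -> \bar R) : (forall x, 0 <= f' x) -> (forall x, 0 <= g' x) ->
  {ae mu, forall x, D x -> f' x = g' x} ->
  \int[mu]_(x in D) f' x <= \int[mu]_(x in D) g' x.
  move=> f0 g0 fg; apply/eqP; rewrite eq_le !main//.
  by apply: filterS fg => x /[apply].
move=> f0 g0 [N [mN N0 fgN]]; rewrite !ge0_integralE//.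
apply: ge_ereal_sup => _ [h /= hf <-]; apply: ereal_sup_ubound.
exists (proj_nnsfun h (measurableC mN)); last first.
  rewrite -!integralT_nnsfun; apply: ge0_ae_eq_integral => //.
  - by apply/measurable_EFinP; exact: measurable_funPT.
  - by apply/measurable_EFinP; exact: measurable_funPT.
  - by move=> x _; rewrite lee_fin.
  - by move=> x _; rewrite lee_fin.
  exists N; split => // x /=; apply: contra_notP => Nx _.
  by rewrite /= mindicE mem_set// mulr1.
move=> x /=; rewrite mindicE; have [Nx|Nx] := pselect (N x).
  rewrite memNset/= ?mulr0; last by move=> /(_ Nx).
  by rewrite /patch; case: ifPn.
rewrite mem_set// mulr1 (le_trans (hf x))// /patch; case: ifPn => // Dx.
suff -> : f' x = g' x by [].
by apply: contrapT => fg; apply: Nx; apply: fgN => /= /(_ (set_mem Dx)).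
Qed.

Lemma ae_eq_integral_all D f g : {ae mu, forall x, D x -> f x = g x} ->
  \int[mu]_(x in D) f x = \int[mu]_(x in D) g x.
Proof.
move=> fg; rewrite (integralE mu D f) (integralE mu D g); congr (_ - _).
  by apply: ae_eq_integral_ge0 => //; apply: filterS fg => x /[apply] ; rewrite !funeposE => ->.
by apply: ae_eq_integral_ge0 => //; apply: filterS fg => x /[apply] ; rewrite !funenegE => ->.
Qed.

(** As [N] may fail to be measurable, [c] cannot be taken out of its integral; its inverse is put in
    front of the positive part of the integrable function [h] instead. *)
Lemma Rintegral_le_lower D (h : T -> R) (N : T -> \bar R) (c e : R) : measurable D ->
  mu.-integrable D (EFin \o h) -> (0 < c)%R -> (forall x, D x -> 0 <= N x) ->
  (forall x, D x -> (h x)%:E <= c%:E * N x) -> \int[mu]_(x in D) N x <= e%:E ->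
  (\int[mu]_(x in D) h x <= c * e)%R.
Proof.
move=> mD ih c0 N0 hN Ne.
have mh : measurable_fun D (EFin \o h) by exact: measurable_int ih.
have h'0 x : D x -> 0 <= (c^-1)%:E * (Num.max (h x) 0%R)%:E.
  by rewrite -EFinM lee_fin => _; rewrite mulr_ge0 ?invr_ge0 ?(ltW c0)// le_max lexx orbT.
have mm : measurable_fun D (EFin \o (fun x => Num.max (h x) 0%R)).
  by apply/measurable_EFinP; apply: measurable_maxr => //; exact/measurable_EFinP.
have h1 : \int[mu]_(x in D) ((c^-1)%:E * (Num.max (h x) 0%R)%:E) <= e%:E.
  apply: le_trans Ne; apply: le_integral_ge0 => // x Dx.
  have [hx|hx] := leP (h x) 0%R; first by rewrite mule0 N0.
  by rewrite lee_pdivrMl//; exact: hN.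
rewrite ge0_integralZl_EFin// in h1; last 2 first.
  by move=> x _; rewrite lee_fin le_max lexx orbT.
  by rewrite invr_ge0 ltW.
rewrite lee_pdivrMl// in h1.
have h2 : \int[mu]_(x in D) (h x)%:E <= \int[mu]_(x in D) (Num.max (h x) 0%R)%:E.
  apply: le_integral => //.
    apply: (@le_integrable _ _ _ _ _ mD _ (EFin \o h)) => // x Dx.
    rewrite /= lee_fin ger0_norm ?le_max ?lexx ?orbT//.
    by rewrite ge_max normr_ge0 ler_norm.
  by move=> x _; rewrite lee_fin le_max lexx.
have fh := integrable_fin_num mD ih.
rewrite /Rintegral -lee_fin fineK//.
by rewrite (le_trans h2)// (le_trans h1)// EFinM.
Qed.

End lower_integral.

Section ae_summable.
Local Open Scope ereal_scope.
Context d (T : measurableType d) (R : realType) (mu : {measure set T -> \bar R}).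

(** The sum of the squared differences has a finite integral by termwise integration, hence is
    finite almost everywhere, and there its terms tend to 0. *)
Lemma ae_cvg_of_summable (D : set T) (u_ : (T -> R)^nat) (u : T -> R) :
  measurable D -> (forall n, measurable_fun D (u_ n)) -> measurable_fun D u ->
  (forall n, \int[mu]_(x in D) ((u_ n x - u x) ^+ 2)%:E <= ((2^-1) ^+ n)%:E) ->
  {ae mu, forall x, D x -> u_ ^~ x @ \oo --> u x}.
Proof.
move=> mD mu_ mu0 bnd.
pose f n x := ((u_ n x - u x) ^+ 2)%:E.
have mf n : measurable_fun D (f n).
  by apply/measurable_EFinP; apply: measurable_funX; exact: measurable_funB.
have f0 n x : D x -> 0 <= f n x by rewrite lee_fin sqr_ge0.
have S : \int[mu]_(x in D) (\sum_(n <oo) f n x) < +oo.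
  rewrite integral_nneseries//.
  apply: (@le_lt_trans _ _ (\sum_(n <oo) ((2^-1) ^+ n)%:E)).
    by apply: lee_nneseries => [n _ _|n _]; [exact: integral_ge0 (f0 n)|exact: bnd].
  have h1 : (`|2^-1 : R| < 1)%R by rewrite ger0_norm// invf_lt1// ltr1n.
  have cv := @cvg_geometric_series R 1%R _ h1.
  have -> : \sum_(n <oo) ((2^-1) ^+ n)%:E = limn (EFin \o series (geometric 1%R (2^-1 : R))).
    congr (limn _); apply/funext => n /=; rewrite sumEFin; congr EFin.
    by apply: eq_bigr => i _; rewrite /geometric/= mul1r.
  have : (EFin \o series (geometric 1%R (2^-1 : R))) @ \oo --> (1 * (1 - 2^-1)^-1)%:E.
    by apply/fine_cvgP; split; [exact: nearW|exact: cv].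
  by move=> /cvg_lim ->//; exact: ltry.
have iS : mu.-integrable D (fun x => \sum_(n <oo) f n x).
  apply/integrableP; split.
    by apply: ge0_emeasurable_sum => [k x Dx _|k _]; [exact: f0|exact: mf].
  apply: le_lt_trans S; apply: le_integral_ge0 => // x Dx.
  by rewrite gee0_abs// nneseries_ge0// => n _ _; exact: f0.
have := integrable_ae mD iS; apply: filterS => x fin Dx.
have {}fin := fin Dx.
have cf : (fun n => f n x) @ \oo --> 0.
  have := @nneseries_tail_cvg R (f ^~ x) xpredT.
  rewrite ltey_eq fin => /(_ isT (fun n _ => f0 n x Dx)) tc.
  apply: (@squeeze_cvge _ _ _ _ (cst 0) _ (fun n => \sum_(n <= k <oo) f k x)) => //; last exact: cvg_cst.
  apply: nearW => n; rewrite f0//=.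
  rewrite (nneseries_split _ 1)//.
    by rewrite addn1 big_nat1 leeDl// nneseries_ge0// => k _ _; exact: f0.
  by move=> k _; exact: f0.
have {}cf : (fun n => (u_ n x - u x) ^+ 2)%R @ \oo --> 0%R.
  by move: cf => /fine_cvgP[_].
apply/cvgrPdist_le => e e0.
move/cvgrPdist_le: cf => /(_ (e ^+ 2)%R (exprn_gt0 _ e0)).
apply: filterS => n; rewrite sub0r normrN ger0_norm ?sqr_ge0// => h.
by rewrite distrC -[leRHS](gtr0_norm e0) -ler_sqr ?nnegrE// !real_normK ?num_real.
Qed.

End ae_summable.

(** * Smooth cutoff functions and the fundamental lemma *)

Section smooth_functions.
Context {R : realType}.

Lemma CnW (V : normedModType R) n (f : V -> R) : Cn n.+1 f -> Cn n f.
Proof.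
elim: n f => [|n IH] f; first by case.
move=> [cf df]; split => // v; have [? ?] := df v; split => //; exact: IH.
Qed.

Lemma Cn_cst (V : normedModType R) n (c : R) : Cn n (fun _ : V => c).
Proof.
elim: n c => [|n IH] c; split => //; try exact: cst_continuous.
move=> v; split => [x|]; first exact: derivable_cst.
have -> : (fun x : V => 'D_v (fun=> c) x) = (fun=> 0).
  by apply/funext => x; exact: derive_cst.
exact: IH.
Qed.

Lemma CnD (V : normedModType R) n (f g : V -> R) :
  Cn n f -> Cn n g -> Cn n (fun x => f x + g x).
Proof.
elim: n f g => [|n IH] f g [cf df] [cg dg]; split => //.
- by move=> x; apply: cvgD; [exact: cf|exact: cg].
- by move=> x; apply: cvgD; [exact: cf|exact: cg].
- move=> v; have [df1 df2] := df v; have [dg1 dg2] := dg v; split => [x|].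
    exact: derivableD.
  have -> : (fun x : V => 'D_v (fun x => f x + g x) x) = (fun x => 'D_v f x + 'D_v g x).
    by apply/funext => x; exact: deriveD.
  exact: IH.
Qed.

Lemma CnM (V : normedModType R) n (f g : V -> R) :
  Cn n f -> Cn n g -> Cn n (fun x => f x * g x).
Proof.
elim: n f g => [|n IH] f g [cf df] [cg dg]; split => //.
- by move=> x; apply: cvgM; [exact: cf|exact: cg].
- by move=> x; apply: cvgM; [exact: cf|exact: cg].
- move=> v; have [df1 df2] := df v; have [dg1 dg2] := dg v; split => [x|].
    exact: derivableM.
  have -> : (fun x : V => 'D_v (fun x => f x * g x) x) =
            (fun x => f x * 'D_v g x + g x * 'D_v f x).
    by apply/funext => x; rewrite deriveM.
  by apply: CnD; apply: IH => //; apply: CnW.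
Qed.

Lemma CnZ (V : normedModType R) n (c : R) (f : V -> R) :
  Cn n f -> Cn n (fun x => c * f x).
Proof. by move=> cf; apply: CnM => //; exact: Cn_cst. Qed.

Lemma CnX (V : normedModType R) n (f : V -> R) k :
  Cn n f -> Cn n (fun x => f x ^+ k).
Proof.
move=> cf; elim: k => [|k IH].
  by under eq_fun do rewrite expr0; exact: Cn_cst.
by under eq_fun do rewrite exprS; exact: CnM.
Qed.

Lemma derive_lineE (V : normedModType R) (f : V -> R) x v :
  'D_v f x = 'D_1 (fun h : R => f (h *: v + x)) 0.
Proof.
rewrite /derive; set g1 := fun h => h^-1 *: _; set g2 := fun h => h^-1 *: _.
suff -> : g1 = g2 by [].
by apply/funext => h; rewrite /g1 /g2 /= addr0 scale0r add0r [h *: 1]mulr1.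
Qed.

(* [p.[1/x] exp(-1/x)], extended by [0] to [x <= 0]: this class of functions is
   stable under differentiation. *)
Definition flat (p : {poly R}) (x : R) : R :=
  if 0 < x then p.[x^-1] * expR (- x^-1) else 0.

Lemma exprn_expRN_le k (y : R) : 0 < y -> y ^+ k * expR (- y) <= k.+1`!%:R.
Proof.
move=> y0; rewrite expRN ler_pdivrMr ?expR_gt0//.
case: k => [|k].
  rewrite expr0 mul1r; apply: ltW; rewrite -expR0 ltr_expR//.
have h := expR_ge1Dxn k (ltW y0).
apply: (@le_trans _ _ (k.+1`!%:R * (1 + y ^+ k.+1 / k.+1`!%:R))).
  by rewrite mulrDr mulr1 mulrCA divff ?mulr1 ?lerDr//.
apply: ler_pM => //; first by rewrite addr_ge0// divr_ge0// exprn_ge0// ltW.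
by rewrite ler_nat [leqRHS]factS leq_pmull.
Qed.

(** Induction on the polynomial for all [k] at once: a factor [X] of the polynomial raises [k] by
    one. *)
Lemma horner_expRN_bounded (p : {poly R}) k :
  exists2 C : R, 0 <= C & forall y, 0 < y -> `|p.[y]| * y ^+ k * expR (- y) <= C.
Proof.
elim/poly_ind: p k => [|p c IH] k.
  by exists 0 => // y _; rewrite horner0 normr0 !mul0r.
have [C C0 HC] := IH k.+1.
exists (C + `|c| * k.+1`!%:R); first by rewrite addr_ge0// mulr_ge0.
move=> y y0; rewrite hornerMXaddC.
apply: (@le_trans _ _ ((`|p.[y]| * y + `|c|) * y ^+ k * expR (- y))).
  rewrite ler_wpM2r ?expR_ge0// ler_wpM2r ?exprn_ge0 ?(ltW y0)//.
  by rewrite (le_trans (ler_normD _ _))// normrM (gtr0_norm y0).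
rewrite 2!mulrDl lerD//.
  by rewrite -(mulrA _ y) -exprS HC.
by rewrite -mulrA ler_wpM2l// exprn_expRN_le.
Qed.

(** A quadratic bound makes the difference quotient at 0 vanish in the limit. *)
Lemma flat_le (p : {poly R}) :
  exists2 C : R, 0 <= C & forall x, `|flat p x| <= C * `|x| ^+ 2.
Proof.
have [C C0 HC] := horner_expRN_bounded p 2.
exists C => // x; rewrite /flat; case: ifPn => x0; last by rewrite normr0 mulr_ge0// exprn_ge0.
have xi : 0 < x^-1 by rewrite invr_gt0.
rewrite normrM (ger0_norm (expR_ge0 _)) (gtr0_norm x0).
have := HC _ xi; rewrite mulrAC -ler_pdivlMr ?exprn_gt0//.
by rewrite exprVn invrK.
Qed.

(** The chain rule turns p(1/x) exp(-1/x) into x^-2 (p - p')(1/x) exp(-1/x), which has the same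
    form; at 0 the quadratic bound gives the derivative 0. *)
Lemma is_derive_flat (p : {poly R}) (x : R) :
  is_derive x 1 (flat p) (flat ('X^2 * (p - p^`())) x).
Proof.
have [x0|x0|<-] := ltgtP 0 x.
- have Dn : \near x, (fun y => p.[y^-1] * expR (- y^-1)) x = flat p x.
    near=> y; rewrite /flat ifT//.
    by near: y; exact: lt_nbhsr.
  apply: (near_eq_is_derive Dn).
  rewrite /flat x0.
  have xn0 : x != 0 by rewrite gt_eqF.
  have d1 : is_derive x 1 (fun y : R => y^-1) (- x ^- 2).
    by have := is_deriveV xn0 (is_derive_id x 1); rewrite [_ *: 1]mulr1.
  have d2 : is_derive x 1 (fun y => p.[y^-1]) (p^`().[x^-1] * - x ^- 2).
    by have := @is_derive1_comp R (horner p) (fun y => y^-1) x _ _ (is_derive_poly p _) d1.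
  have d3 : is_derive x 1 (fun y => expR (- y^-1)) (expR (- x^-1) * x ^- 2).
    have d4 : is_derive x 1 (fun y : R => - y^-1) (x ^- 2).
      by rewrite -[x ^- 2]opprK; exact: is_deriveN.
    by have := @is_derive1_comp R expR (fun y => - y^-1) x _ _ (is_derive_expR _) d4.
  apply: is_derive_eq; rewrite hornerM hornerXn hornerD hornerN exprVn /= /GRing.scale/=.
  ring.
- have Dn : \near x, (fun=> 0) x = flat p x.
    near=> y; rewrite /flat ifF//; apply/negbTE; rewrite -leNgt ltW//.
    by near: y; exact: lt_nbhsl.
  apply: (near_eq_is_derive Dn).
  by rewrite /flat ltNge ltW//=; exact: is_derive_cst.
- have [C C0 HC] := flat_le p.
  have f0 q : flat q 0 = 0 by rewrite /flat ltxx.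
  rewrite f0.
  have cv : h^-1 *: ((flat p \o shift 0) (h *: (1 : R)) - flat p 0) @[h --> 0^'] --> (0 : R).
    apply/cvgr0Pnorm_le => e e0.
    have C1 : 0 < C + 1 by rewrite ltr_wpDl.
    near=> h.
    rewrite f0 subr0 /= addr0 [h *: 1]mulr1 [_ *: _]/GRing.scale/= normrM normfV.
    have h0 : h != 0 by near: h; exact: nbhs_dnbhs_neq.
    rewrite ler_pdivrMl ?normr_gt0//.
    rewrite (le_trans (HC h))// expr2 mulrA mulrC ler_wpM2l//.
    apply: (@le_trans _ _ ((C + 1) * `|h|)); first by rewrite ler_wpM2r// lerDl.
    rewrite -ler_pdivlMl// mulrC.
    near: h; apply: dnbhs0_le; exact: divr_gt0.
  apply: DeriveDef; first by apply/cvg_ex; exists 0.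
  exact: (cvg_lim _ cv).
Unshelve. all: by end_near. Qed.

(** The condition on [l] says that it is affine with linear part [c]. Its derivative along [v] is
    thus the constant [c v], and each differentiation only changes the polynomial and inserts a
    constant. *)
Lemma Cn_flat (V : normedModType R) n p (l c : V -> R) : continuous l ->
  (forall x v h, l (h *: v + x) = h * c v + l x) ->
  Cn n (flat p \o l).
Proof.
move=> cl lE; have cf q : continuous (flat q).
  move=> x; apply: differentiable_continuous; apply/derivable1_diffP.
  by apply: ex_derive; exact: is_derive_flat.
elim: n p => [|n IH] p.
  by split => // x; apply: continuous_comp; [exact: cl|exact: cf].
split; first by move=> x; apply: continuous_comp; [exact: cl|exact: cf].
move=> v; have D x : is_derive x v (flat p \o l) (c v * flat ('X^2 * (p - p^`())) (l x)).
  have d1 : is_derive (0 : R) 1 (fun h : R => h * c v + l x) (c v).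
    apply: is_derive_eq; rewrite /GRing.scale/= !(mulr0,mulr1,addr0,add0r)//.
  have d2 : is_derive (0 : R) 1 (fun h : R => flat p (h * c v + l x)) (flat ('X^2 * (p - p^`())) (l x) * c v).
    have := @is_derive1_comp R (flat p) (fun h => h * c v + l x) 0 _ _ (is_derive_flat p _) d1.
    by rewrite /= mul0r add0r.
  have E : (fun h : R => flat p (h * c v + l x)) = (fun h : R => (flat p \o l) (h *: v + x)).
    by apply/funext => h; rewrite /= lE.
  split.
    by apply/derivable1P; rewrite -E; exact: ex_derive.
  by rewrite mulrC -(derive_val (is_derive := d2)) E derive_lineE.
split => [x|]; first exact: ex_derive.
have -> : (fun x : V => 'D_v (flat p \o l) x) =
  (fun x => c v * (flat ('X^2 * (p - p^`())) \o l) x).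
  by apply/funext => x; rewrite derive_val.
exact/CnZ/IH.
Qed.

End smooth_functions.

Section boxes.
Context {R : realType}.
Local Notation E3 := (E3 R).

Definition box (a b : E3) : set E3 :=
  [set x | [/\ a.1.1 < x.1.1 < b.1.1, a.1.2 < x.1.2 < b.1.2 & a.2 < x.2 < b.2]].

Lemma box_setM (a b : E3) : box a b =
  (`]a.1.1, b.1.1[ `*` `]a.1.2, b.1.2[) `*` `]a.2, b.2[.
Proof.
by apply/seteqP; split => -[[x y] z] /=; rewrite !in_itv/=; [case|move=> [[]]].
Qed.

Lemma measurable_box (a b : E3) : measurable (box a b).
Proof. by rewrite box_setM; apply: measurableX => //; exact: measurableX. Qed.

(** The boxes are cubes with rational centre [q.1] and rational half-width [q.2], hence countably
    many. The closed cube inside [A] is what gives cutoff functions a compact support. *)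
Lemma open_box_subset (A : set E3) x : open A -> A x ->
  exists q : (rat * rat * rat) * rat,
    let a := (ratr q.1.1.1 - ratr q.2, ratr q.1.1.2 - ratr q.2, ratr q.1.2 - ratr q.2) in
    let b := (ratr q.1.1.1 + ratr q.2, ratr q.1.1.2 + ratr q.2, ratr q.1.2 + ratr q.2) in
    [/\ box a b x,
       ((`[a.1.1, b.1.1] `*` `[a.1.2, b.1.2]) `*` `[a.2, b.2]) `<=` A
     & box a b `<=` A].
Proof.
rewrite openE => oA Ax; have /nbhs_ballP[e /= e0 be] := oA _ Ax.
have [r] := @rat_in_itvoo R (e / 4) (e / 3) ltac:(by lra).
rewrite in_itv/= => /andP[r1 r2].
have r0 : 0 < ratr r :> R by apply: lt_trans r1; lra.
have c (y : R) : exists q : rat, y - ratr r < ratr q < y + ratr r.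
  have [q] := @rat_in_itvoo R (y - ratr r) (y + ratr r) ltac:(by lra).
  by rewrite in_itv/=; exists q.
move: x Ax be => [[x y] z] Ax be.
have [q1 q1P] := c x; have [q2 q2P] := c y; have [q3 q3P] := c z.
have sub : ((`[ratr q1 - ratr r, ratr q1 + ratr r] `*`
   `[ratr q2 - ratr r, ratr q2 + ratr r]) `*`
   `[ratr q3 - ratr r, ratr q3 + ratr r]) `<=` A.
  move=> [[x' y'] z'] /=; rewrite !in_itv/= => -[[/andP[h1 h2] /andP[h3 h4]] /andP[h5 h6]].
  have A0 : forall u v w : R, v - ratr r < w < v + ratr r -> w - ratr r <= u -> u <= w + ratr r ->
      `|v - u| < e.
    by move=> u v w /andP[? ?] ? ?; rewrite ltr_norml; apply/andP; split; lra.
  apply: be; split; [split|] => /=.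
  - exact: (A0 _ _ _ q1P).
  - exact: (A0 _ _ _ q2P).
  - exact: (A0 _ _ _ q3P).
exists ((q1, q2, q3), r) => /=; split => //.
  split => /=; apply/andP; split; lra.
move=> [[x' y'] z'] [/= /andP[? ?] /andP[? ?] /andP[? ?]]; apply: sub => /=.
by rewrite !in_itv/=; split; [split|]; apply/andP; split; apply: ltW.
Qed.

Lemma open_measurable3 (A : set E3) : open A -> measurable A.
Proof.
move=> oA.
pose bx (q : (rat * rat * rat) * rat) : set E3 :=
    box (ratr q.1.1.1 - ratr q.2, ratr q.1.1.2 - ratr q.2, ratr q.1.2 - ratr q.2)
    (ratr q.1.1.1 + ratr q.2, ratr q.1.1.2 + ratr q.2, ratr q.1.2 + ratr q.2).
have -> : A = \bigcup_(q in [set q | bx q `<=` A]) bx q.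
  apply/seteqP; split => [x Ax|x [q] qA]; last exact: qA.
  by have [q [? ? ?]] := open_box_subset oA Ax; exists q.
rewrite bigcup_mkcond; apply: countable_bigcupT_measurable => [|q].
  exact: countableP.
by case: ifP => // _; exact: measurable_box.
Qed.

Lemma continuous_measurable3 (f : E3 -> R) : continuous f -> measurable_fun setT f.
Proof.
move=> cf; apply: (measurability _ (RGenOInfty.measurableE R)).
move=> /= _ [_ [a ->]] <-; apply: measurableI => //; apply: open_measurable3.
by apply: open_comp => [x _|]; [exact: cf|exact: interval_open].
Qed.

End boxes.

Section bump.
Context {R : realType}.
Local Notation E3 := (E3 R).

Let Cn_affine n p (l : E3 -> R) (al : E3 -> R) (s k : R) : continuous al ->
  (forall x v h, al (h *: v + x) = h * al v + al x) ->
  (forall x, l x = s * al x + k) -> Cn n (fun x => flat p (l x)).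
Proof.
move=> cal hal lE.
have -> : (fun x => flat p (l x)) = flat p \o (fun x => s * al x + k).
  by apply/funext => x /=; rewrite lE.
apply: (@Cn_flat _ _ _ _ _ (fun v => s * al v)).
  by move=> x; apply: cvgD; [apply: cvgMr; exact: cal|exact: cvg_cst].
by move=> x v h; rewrite hal; ring.
Qed.

Definition bump (a b : E3) (x : E3) : R :=
  (flat 1 (x.1.1 - a.1.1) * flat 1 (b.1.1 - x.1.1)) *
  ((flat 1 (x.1.2 - a.1.2) * flat 1 (b.1.2 - x.1.2)) *
   (flat 1 (x.2 - a.2) * flat 1 (b.2 - x.2))).

Lemma Cn_bump n a b : Cn n (bump a b).
Proof.
have c1 : continuous (fun x : E3 => x.1.1).
  by move=> x; apply: continuous_comp; [exact: cvg_fst|exact: cvg_fst].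
have c2 : continuous (fun x : E3 => x.1.2).
  by move=> x; apply: continuous_comp; [exact: cvg_fst|exact: cvg_snd].
have c3 : continuous (fun x : E3 => x.2) by move=> x; exact: cvg_snd.
do !apply: CnM.
- by apply: (@Cn_affine _ _ _ _ 1 (- a.1.1) c1) => // x; rewrite mul1r.
- by apply: (@Cn_affine _ _ _ _ (-1) (b.1.1) c1) => // x; rewrite mulN1r addrC.
- by apply: (@Cn_affine _ _ _ _ 1 (- a.1.2) c2) => // x; rewrite mul1r.
- by apply: (@Cn_affine _ _ _ _ (-1) (b.1.2) c2) => // x; rewrite mulN1r addrC.
- by apply: (@Cn_affine _ _ _ _ 1 (- a.2) c3) => // x; rewrite mul1r.
- by apply: (@Cn_affine _ _ _ _ (-1) (b.2) c3) => // x; rewrite mulN1r addrC.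
Qed.

Lemma flat1_gt0 (x : R) : (0 < flat 1 x) = (0 < x).
Proof. by rewrite /flat; case: ifP => [_|_]; rewrite ?hornerC ?mul1r ?expR_gt0 ?ltxx. Qed.

Lemma flat1_ge0 (x : R) : 0 <= flat 1 x.
Proof. by rewrite /flat; case: ifP => [_|_]; rewrite ?hornerC ?mul1r ?expR_ge0. Qed.

Lemma flat1_lt1 (x : R) : flat 1 x < 1.
Proof.
rewrite /flat; case: ifP => [x0|_]; last exact: ltr01.
by rewrite hornerC mul1r expR_lt1 oppr_lt0 invr_gt0.
Qed.

Lemma bump_ge0 a b x : 0 <= bump a b x.
Proof. by rewrite /bump !mulr_ge0 ?flat1_ge0. Qed.

Lemma bump_lt1 a b x : bump a b x < 1.
Proof.
have M (u v : R) : 0 <= u < 1 -> 0 <= v < 1 -> 0 <= u * v < 1.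
  by move=> /andP[u0 u1] /andP[v0 v1]; rewrite mulr_ge0// mulr_ilt1.
have F (u : R) : 0 <= flat 1 u < 1 by rewrite flat1_ge0 flat1_lt1.
suff /andP[] : 0 <= bump a b x < 1 by [].
by apply: (M); [apply: (M)|apply: (M); apply: (M)].
Qed.

Lemma bump_gt0 a b x : box a b x -> 0 < bump a b x.
Proof.
move=> [/andP[h1 h2] /andP[h3 h4] /andP[h5 h6]].
by rewrite /bump; do !apply: mulr_gt0; rewrite flat1_gt0 subr_gt0.
Qed.

Lemma bump_eq0 a b x : ~ box a b x -> bump a b x = 0.
Proof.
move=> nb; apply/eqP; rewrite eq_le bump_ge0 andbT leNgt; apply/negP => b0.
apply: nb.
have P (u v : R) : 0 <= u -> 0 <= v -> 0 < u * v -> 0 < u /\ 0 < v.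
  move=> u0 v0 uv; split; rewrite lt_neqAle eq_sym ?u0 ?v0 andbT.
    by apply/eqP => e; rewrite e mul0r ltxx in uv.
  by apply/eqP => e; rewrite e mulr0 ltxx in uv.
have [] := P _ _ _ _ b0; rewrite ?mulr_ge0 ?flat1_ge0// => /P[||]; rewrite ?flat1_ge0//.
move=> h1 h2 /P[||]; rewrite ?mulr_ge0 ?flat1_ge0// => /P[||]; rewrite ?flat1_ge0// => h3 h4 /P[||]; rewrite ?flat1_ge0// => h5 h6.
move: h1 h2 h3 h4 h5 h6; rewrite !flat1_gt0 !subr_gt0 => h1 h2 h3 h4 h5 h6.
by split; apply/andP.
Qed.

(** Since [bump] lies in ]0, 1[ on the open box and vanishes outside, these smooth functions stay in
    [0, 1] and converge pointwise to the indicator of the box. *)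
Definition cutoff (a b : E3) (n : nat) (x : E3) : R := 1 - (1 - bump a b x) ^+ n.

Lemma cutoff_range a b n x : 0 <= cutoff a b n x <= 1.
Proof.
have b0 := bump_ge0 a b x; have b1 := ltW (bump_lt1 a b x).
rewrite /cutoff subr_ge0 exprn_ile1 ?subr_ge0//=; last by lra.
by rewrite lerBlDr lerDl exprn_ge0 // subr_ge0.
Qed.

Lemma cutoff_cvg a b x : cutoff a b ^~ x @ \oo --> (\1_(box a b) x : R).
Proof.
rewrite indicE; have [bx|bx] := pselect (box a b x).
  rewrite mem_set// -[X in _ --> X]subr0; apply: cvgB; first exact: cvg_cst.
  apply: cvg_expr; have := bump_gt0 bx; have := bump_lt1 a b x.
  by move=> ? ?; rewrite ger0_norm; lra.
rewrite memNset//; rewrite /cutoff bump_eq0//.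
under eq_fun do rewrite subr0 expr1n subrr.
exact: cvg_cst.
Qed.

Lemma test_fun_cutoff (Om : set E3) a b n :
  ((`[a.1.1, b.1.1] `*` `[a.1.2, b.1.2]) `*` `[a.2, b.2]) `<=` Om ->
  test_fun Om (cutoff a b n).
Proof.
move=> sub; split.
  move=> k; rewrite /cutoff.
  have -> : (fun x => 1 - (1 - bump a b x) ^+ n) =
     (fun x => 1 + (-1) * (1 + (-1) * bump a b x) ^+ n).
    by apply/funext => x; rewrite !mulN1r.
  apply: CnD; first exact: Cn_cst.
  by apply/CnZ/CnX/CnD; [exact: Cn_cst|apply/CnZ/Cn_bump].
exists ((`[a.1.1, b.1.1] `*` `[a.1.2, b.1.2]) `*` `[a.2, b.2]); split => //.
  by apply: compact_setX; [apply: compact_setX|]; exact: segment_compact.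
move=> x nx; rewrite /cutoff bump_eq0 ?subr0 ?expr1n ?subrr// => -[/andP[? ?] /andP[? ?] /andP[? ?]].
by apply: nx => /=; rewrite !in_itv/=; split; [split|]; apply/andP; split; apply: ltW.
Qed.

End bump.

Section fundamental_lemma.
Context {R : realType}.
Local Notation E3 := (E3 R).
Local Notation L3 := (@leb3 R).

Lemma leb3_box_lty (a b : E3) : (L3 (box a b) < +oo)%E.
Proof.
rewrite box_setM /leb3 product_measure1E//; last exact: measurableX.
set m := (X in (X * _)%E).
have -> : m = (lebesgue_measure `]a.1.1, b.1.1[%classic * lebesgue_measure `]a.1.2, b.1.2[%classic)%E.
  exact: product_measure1E.
have fin (u v : R) : lebesgue_measure `]u, v[%classic \is a fin_num.
  by rewrite lebesgue_measure_itv/=; case: ifP.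
by rewrite ltey_eq; apply/orP; left; apply: fin_numM; [apply: fin_numM|]; exact: fin.
Qed.

Lemma leb3_bounded_lty (Om : set E3) : measurable Om -> bounded_set Om -> (L3 Om < +oo)%E.
Proof.
move=> mO [M [_ /(_ (M + 1)) H]].
have {}H := H ltac:(by rewrite ltrDl).
apply: (@le_lt_trans _ _ (L3 (box (- (M + 2), - (M + 2), - (M + 2)) (M + 2, M + 2, M + 2)))); last exact: leb3_box_lty.
apply: le_measure; rewrite ?inE//; first exact: measurable_box.
move=> [[x y] z] Ox; have /= := H _ Ox; rewrite !prod_normE/=.
rewrite !ge_max => /andP[/andP[]]; rewrite !ler_norml => /andP[? ?] /andP[? ?] /andP[? ?].
by split => /=; apply/andP; split; lra.
Qed.

(** Dominated convergence along the cutoffs, which are test functions because the closed box lies in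
    [Om]. *)
Lemma integral_box_eq0 (Om : set E3) (g : E3 -> R) a b : measurable Om ->
  L3.-integrable Om (EFin \o g) ->
  (forall phi, test_fun Om phi -> ip Om g phi = 0) ->
  ((`[a.1.1, b.1.1] `*` `[a.1.2, b.1.2]) `*` `[a.2, b.2]) `<=` Om ->
  (\int[L3]_(x in box a b) (g x)%:E = 0)%E.
Proof.
move=> mO ig g0 sub.
have bO : box a b `<=` Om.
  move=> [[x y] z] [/= /andP[? ?] /andP[? ?] /andP[? ?]]; apply: sub => /=.
  by rewrite !in_itv/=; split; [split|]; apply/andP; split; apply: ltW.
have mg : measurable_fun Om (EFin \o g) := measurable_int _ ig.
have mc n : measurable_fun Om (cutoff a b n).
  apply: measurable_funTS; apply: continuous_measurable3.
  by have [/(_ 0%N)[]] := test_fun_cutoff n sub.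
pose f_ n x := (g x * cutoff a b n x)%:E; pose f x := (g x * \1_(box a b) x)%:E.
have mf_ n : measurable_fun Om (f_ n).
  by apply/measurable_EFinP; apply: measurable_funM => //; exact/measurable_EFinP.
have mf : measurable_fun Om f.
  apply/measurable_EFinP; apply: measurable_funM; first exact/measurable_EFinP.
  exact: measurable_indic (measurable_box a b).
have ff : {ae L3, forall x, Om x -> f_ ^~ x @ \oo --> f x}.
  apply: nearW => x _; apply/fine_cvgP; split; first exact: nearW.
  suff h : (fun n => g x * cutoff a b n x) @ \oo --> g x * (\1_(box a b) x : R) by exact: h.
  by apply: cvgM; [exact: cvg_cst|exact: cutoff_cvg].
have fle x n : (`|f_ n x| <= `|(g x)%:E|)%E.
  rewrite lee_fin normrM ler_piMr//.
  by have /andP[? ?] := cutoff_range a b n x; rewrite ger0_norm.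
have fg : {ae L3, forall x n, Om x -> (`|f_ n x| <= `|(g x)%:E|)%E}.
  by apply: nearW => x n _; exact: fle.
have [_ _] :=
  @dominated_convergence _ _ _ L3 Om mO f_ f _ mf_ mf ff (integrable_abse ig) fg.
have -> : (fun n => (\int[L3]_(x in Om) f_ n x)%E) = cst 0%E.
  apply/funext => n; rewrite /= -[RHS]/((0 : R)%:E) -(g0 _ (test_fun_cutoff n sub)) /ip /Rintegral fineK//.
  apply: integrable_fin_num => //.
  by apply: (@le_integrable _ _ _ L3 Om mO _ (EFin \o g)); [exact: mf_|move=> x _; exact: fle|exact: ig].
move=> /(cvg_unique _ (cvg_cst 0%E)) E.
have {}E := E (@ereal_hausdorff R).
apply: (etrans _ (esym E)); rewrite [RHS]integral_mkcond [LHS]integral_mkcond.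
congr (integral _ _ _); apply/funext => x; rewrite /patch /f indicE.
have [xb|xb] := boolP (x \in box a b).
  by rewrite mulr1 mem_set//; apply: bO; rewrite inE in xb.
by rewrite mulr0; case: ifP.
Qed.

Definition Gbox : set (set E3) := [set A | exists a b, A = box a b].

Lemma box_setI (a b a' b' : E3) : box a b `&` box a' b' =
  box (Num.max a.1.1 a'.1.1, Num.max a.1.2 a'.1.2, Num.max a.2 a'.2)
      (Num.min b.1.1 b'.1.1, Num.min b.1.2 b'.1.2, Num.min b.2 b'.2).
Proof.
apply/seteqP; split => [[[x y] z] [[/= /andP[? ?] /andP[? ?] /andP[? ?]] [/= /andP[? ?] /andP[? ?] /andP[? ?]]]|].
  by split => /=; rewrite gt_max lt_min; apply/andP; split; apply/andP.
move=> [[x y] z] [/=]; rewrite !gt_max !lt_min => /andP[/andP[? ?] /andP[? ?]]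
  /andP[/andP[? ?] /andP[? ?]] /andP[/andP[? ?] /andP[? ?]].
by split; split => /=; apply/andP.
Qed.

(** The preimage of an interval under a coordinate is a countable union of boxes growing in the two
    other directions, so all coordinates are measurable for the generated sigma-algebra. *)
Lemma measurable_gen_box : @measurable _ E3 = <<s Gbox >>.
Proof.
apply/seteqP; split; last first.
  apply: smallest_sub; first exact: sigma_algebra_measurable.
  by move=> _ [a [b ->]]; exact: measurable_box.
have sT : sigma_algebra [set: E3] <<s Gbox >> by exact: smallest_sigma_algebra.
pose E3G := g_sigma_algebraType Gbox.
have coord (pr : E3 -> R) : (forall u v : R, <<s Gbox >> (pr @^-1` `]u, v[)) ->
    forall A : set R, measurable A -> <<s Gbox >> (pr @^-1` A).
  move=> h A mA.
  have mf : @measurable_fun _ _ E3G R setT pr.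
    apply: (measurability _ (RGenOpens.measurableE R)).
    by move=> /= _ [_ [u [v ->]] <-]; rewrite setTI; exact: h.
  by have := mf measurableT A mA; rewrite setTI.
have nN (u : R) : exists n, - n%:R < u < n%:R.
  exists (Num.trunc `|u|).+1.
  by rewrite -ltr_norml; apply/truncnS_gt.
have cup (F : nat -> E3 * E3) : <<s Gbox >> (\bigcup_n box (F n).1 (F n).2).
  apply: (@bigcupT_measurable _ E3G) => n; apply: sub_sigma_algebra.
  by exists (F n).1, (F n).2.
have c1 : forall A : set R, measurable A -> <<s Gbox >> ((fun x : E3 => x.1.1) @^-1` A).
  apply: coord => u v.
  have := cup (fun n => ((u, - n%:R, - n%:R), (v, n%:R, n%:R))).
  congr (<<s _ >> _); apply/seteqP; split => [[[x y] z] [n _ []]|[[x y] z]] /=; rewrite in_itv//=.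
  move=> xuv; have [n /andP[n1 n2]] := nN (Num.max `|y| `|z|).
  move: n2; rewrite gt_max !ltr_norml => /andP[? ?].
  by exists n.
have c2 : forall A : set R, measurable A -> <<s Gbox >> ((fun x : E3 => x.1.2) @^-1` A).
  apply: coord => u v.
  have := cup (fun n => ((- n%:R, u, - n%:R), (n%:R, v, n%:R))).
  congr (<<s _ >> _); apply/seteqP; split => [[[x y] z] [n _ []]|[[x y] z]] /=; rewrite in_itv//=.
  move=> xuv; have [n /andP[n1 n2]] := nN (Num.max `|x| `|z|).
  move: n2; rewrite gt_max !ltr_norml => /andP[? ?].
  by exists n.
have c3 : forall A : set R, measurable A -> <<s Gbox >> ((fun x : E3 => x.2) @^-1` A).
  apply: coord => u v.
  have := cup (fun n => ((- n%:R, - n%:R, u), (n%:R, n%:R, v))).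
  congr (<<s _ >> _); apply/seteqP; split => [[[x y] z] [n _ []]|[[x y] z]] /=; rewrite in_itv//=.
  move=> xuv; have [n /andP[n1 n2]] := nN (Num.max `|x| `|y|).
  move: n2; rewrite gt_max !ltr_norml => /andP[? ?].
  by exists n.
have m1 : @measurable_fun _ _ E3G (R * R)%type setT (fun x : E3 => x.1).
  apply/measurable_fun_pairP; split => _ A mA; rewrite setTI; [exact: c1|exact: c2].
rewrite measurable_prod_measurableType; apply: smallest_sub; first exact: smallest_sigma_algebra.
move=> _ [A mA [B mB <-]].
have -> : A `*` B = ((fun x : E3 => x.1) @^-1` A) `&` ((fun x : E3 => x.2) @^-1` B) by [].
apply: (@measurableI _ E3G); last exact: c3.
by have := m1 measurableT A mA; rewrite setTI.
Qed.

(* Two finite measures with densities [g^+] and [g^-] that agree on the boxes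
   contained in a box agree on all its measurable subsets. *)
Lemma fundamental_lemma (Om : set E3) (g : E3 -> R) : open Om ->
  L3.-integrable Om (EFin \o g) ->
  (forall phi, test_fun Om phi -> ip Om g phi = 0) ->
  {ae L3, forall x, Om x -> g x = 0}.
Proof.
move=> oO ig g0; have mO := open_measurable3 oO.
pose qa (q : (rat * rat * rat) * rat) : E3 :=
  (ratr q.1.1.1 - ratr q.2, ratr q.1.1.2 - ratr q.2, ratr q.1.2 - ratr q.2).
pose qb (q : (rat * rat * rat) * rat) : E3 :=
  (ratr q.1.1.1 + ratr q.2, ratr q.1.1.2 + ratr q.2, ratr q.1.2 + ratr q.2).
pose cbox (a b : E3) := (`[a.1.1, b.1.1] `*` `[a.1.2, b.1.2]) `*` `[a.2, b.2].
have loc a b : cbox a b `<=` Om -> {ae L3, forall x, box a b x -> g x = 0}.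
  move=> sub; have mb := measurable_box a b.
  have bO : box a b `<=` Om.
    move=> [[x y] z] [/= /andP[? ?] /andP[? ?] /andP[? ?]]; apply: sub => /=.
    by rewrite /cbox/= !in_itv/=; split; [split|]; apply/andP; split; apply: ltW.
  have igb : L3.-integrable (box a b) (EFin \o g) by exact: integrableS ig.
  suff : ae_eq L3 (box a b) (EFin \o g) (cst 0%E).
    by move=> h0; apply: (ae_imp h0) => x h /h [].
  apply: (@integral_ae_eq _ _ _ L3 (box a b) mb _ _ igb).
    exact: measurable_cst.
  move=> E Eb mE; rewrite integral0.
  have -> : E = E `&` box a b by apply/esym/setIidPl.
  have mE' : <<s Gbox >> E by rewrite -measurable_gen_box.
  have igE (F : set E3) : measurable F -> L3.-integrable (F `&` box a b) (EFin \o g).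
    by move=> mF; apply: (@integrableS _ _ _ L3 (box a b)) => //; exact: measurableI.
  have gb a' b' : (\int[L3]_(x in box a' b' `&` box a b) (g x)%:E = 0)%E.
    rewrite box_setI; apply: (integral_box_eq0 mO ig g0).
    move=> [[x y] z] /=; rewrite !in_itv/= !ge_max !le_min.
    move=> [[/andP[/andP[? ?] /andP[? ?]] /andP[/andP[? ?] /andP[? ?]]] /andP[/andP[? ?] /andP[? ?]]].
    by apply: sub; rewrite /cbox/= !in_itv/=; split; [split|]; apply/andP.
  have P1 : (\int[L3]_(x in box a b) (g x)%:E = 0)%E by rewrite -[box a b in LHS]setIid gb.
  (* Dynkin induction over the intersection-stable class of boxes. Intersecting with the fixed box
     makes complements relative to a set on which [g] is integrable. *)
  move: E mE' {Eb mE}; apply: (@dynkin_induction _ E3 Gbox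
    (fun E => \int[L3]_(x in E `&` box a b) (g x)%:E = 0)%E).
  - exact: measurable_gen_box.
  - by move=> _ _ [a1 [b1 ->]] [a2 [b2 ->]]; rewrite box_setI; do 2 eexists.
  - by rewrite setTI.
  - by move=> _ [a' [b' ->]]; exact: gb.
  - move=> S mS S0; move: P1.
    rewrite -{1}[box a b](setTI) -(setUv S) setIUl integral_setU//.
    + by rewrite S0 add0e.
    + exact: measurableI.
    + by apply: measurableI => //; exact: measurableC.
    + rewrite -setIUl setUv setTI; exact: measurable_int igb.
    + by apply/disj_setPS => x [[Sx _] [nSx _]].
  - move=> F mF tF F0; rewrite setI_bigcupl integral_bigcup//.
    + by rewrite eseries0// => n _ _; exact: F0.
    + by apply: trivIset_setIr.
    + by move=> n; apply: measurableI; [exact: mF|exact: mb].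
    + by rewrite -setI_bigcupl; apply: igE; exact: bigcup_measurable.
(* The rational cubes are countably many, so one null set serves them all; [unpickle] enumerates
   them. *)
have cov : {ae L3, forall x (q : (rat * rat * rat) * rat), cbox (qa q) (qb q) `<=` Om -> box (qa q) (qb q) x -> g x = 0}.
  have : forall n, {ae L3, forall x, if unpickle n is Some q then
      cbox (qa q) (qb q) `<=` Om -> box (qa q) (qb q) x -> g x = 0 else True}.
    move=> n; case: unpickle => [q|]; last exact: nearW.
    have [sub|nsub] := pselect (cbox (qa q) (qb q) `<=` Om); last by apply: nearW => x /nsub.
    by apply: (ae_imp (loc _ _ sub)) => x h _ /h.
  by move=> /ae_foralln h0; apply: (ae_imp h0) => x h q; have := h (pickle q); rewrite pickleK.
apply: (ae_imp cov) => x h Ox.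
by have [q [bx cb _]] := open_box_subset oO Ox; exact: (h q).
Qed.

End fundamental_lemma.

(** * Iterated integrals and the Sobolev inequality *)

(** The optimal choice is [k = b / x]; for [b = 0] the choice [k = x / (a + 1)] is contradictory
    unless x = 0. The hypothesis is linear in [x], [a] and [b], so it can be integrated or summed:
    this is how every Cauchy-Schwarz inequality below is obtained. *)
Lemma sqr_le_of_amgm (R : realType) (x a b : R) : 0 <= x -> 0 <= a -> 0 <= b ->
  (forall k, 0 < k -> 2 * x <= k * a + b / k) -> x ^+ 2 <= a * b.
Proof.
move=> x0 a0 b0 H; have [->|xn0] := eqVneq x 0; first by rewrite expr0n/= mulr_ge0.
have {}x0 : 0 < x by rewrite lt_neqAle eq_sym xn0.
have [b_0|bn0] := eqVneq b 0.
  have a1 : 0 < a + 1 by rewrite ltr_wpDl.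
  have := H (x / (a + 1)) (divr_gt0 x0 a1); rewrite b_0 mul0r addr0 mulrAC ler_pdivlMr//.
  rewrite mulrDr mulr1 => h; exfalso.
  have : 0 <= x * a by rewrite mulr_ge0// ltW.
  lra.
have {}b0 : 0 < b by rewrite lt_neqAle eq_sym bn0.
have := H (b / x) (divr_gt0 b0 x0).
rewrite invf_div mulrCA divff// mulr1 mulrAC -lerBlDr.
have -> : 2 * x - x = x by ring.
by rewrite ler_pdivlMr// expr2 mulrC [b * a]mulrC.
Qed.

Section sigma_finite_fubini.
Local Open Scope ereal_scope.
Context d1 d2 (T1 : measurableType d1) (T2 : measurableType d2) (R : realType).

Definition sf_measure (m1 : {measure set T1 -> \bar R})
  & sigma_finite [set: T1] m1 : set T1 -> \bar R := m1.

HB.instance Definition _ m1 sf := Measure.on (@sf_measure m1 sf).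
HB.instance Definition _ m1 sf :=
  Measure_isSigmaFinite.Build _ _ _ (@sf_measure m1 sf) sf.

(* The canonical sigma-finite structure of [_ \x _] is only found for
   subprobabilities, so the left factor comes with an explicit proof of
   sigma-finiteness. *)
Variables (m1 : {measure set T1 -> \bar R}) (sf1 : sigma_finite [set: T1] m1).
Variable m2 : {sigma_finite_measure set T2 -> \bar R}.
Implicit Type f : T1 * T2 -> \bar R.

Lemma sf_tonelli1 f : measurable_fun setT f -> (forall p, 0 <= f p) ->
  \int[m1 \x m2]_p f p = \int[m1]_x \int[m2]_y f (x, y).
Proof. exact: (@fubini_tonelli1 _ _ _ _ R (sf_measure sf1) m2 f). Qed.

Lemma sf_tonelli2 f : measurable_fun setT f -> (forall p, 0 <= f p) ->
  \int[m1 \x m2]_p f p = \int[m2]_y \int[m1]_x f (x, y).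
Proof. exact: (@fubini_tonelli2 _ _ _ _ R (sf_measure sf1) m2 f). Qed.

Lemma sf_measurable_fun2 f : measurable_fun setT f -> (forall p, 0 <= f p) ->
  measurable_fun setT (fun y => \int[m1]_x f (x, y)).
Proof. exact: (@measurable_fun_fubini_tonelli_G _ _ _ _ R (sf_measure sf1) f). Qed.

Lemma sf_fubini1 f : (m1 \x m2).-integrable setT f ->
  \int[m1]_x \int[m2]_y f (x, y) = \int[m1 \x m2]_p f p.
Proof. exact: (@integral12_prod_meas1 _ _ _ _ R (sf_measure sf1) m2 f). Qed.

Lemma sf_fubini2 f : (m1 \x m2).-integrable setT f ->
  \int[m2]_y \int[m1]_x f (x, y) = \int[m1 \x m2]_p f p.
Proof. exact: (@integral21_prod_meas1 _ _ _ _ R (sf_measure sf1) m2 f). Qed.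

Lemma sf_ae_integrable2 f : (m1 \x m2).-integrable setT f ->
  {ae m2, forall y, m1.-integrable setT (fun x => f (x, y))}.
Proof. exact: (@ae_integrable2 _ _ _ _ R (sf_measure sf1) m2 f). Qed.

Lemma sf_integrable_fubini2 f : (m1 \x m2).-integrable setT f ->
  m2.-integrable setT (fun y => \int[m1]_x f (x, y)).
Proof.
move=> fi; apply/integrableP; split.
  exact: (@measurable_fubini_G _ _ _ _ R (sf_measure sf1) m2 f fi).
have mf := measurable_int _ fi.
apply: (@le_lt_trans _ _ (\int[m2]_y \int[m1]_x `|f (x, y)|)).
  apply: le_integral_ge0 => // y _; apply: le_abse_integral => //.
  by apply: (measurableT_comp mf); exact: measurable_pair2.
rewrite -(@sf_tonelli2 (fun p => `|f p|))//; last exact: measurableT_comp.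
by case/integrableP: fi.
Qed.

Lemma sigma_finite_prod : sigma_finite [set: T1 * T2] (m1 \x m2).
Proof.
have [F FT Foo] := sf1; have [G GT Goo] := sigma_finiteT m2.
pose H (n : nat) := if unpickle n is Some (i, j) then F i `*` G j else set0.
exists H.
  apply/seteqP; split => // -[x y] _.
  have [i _ Fx] : (\bigcup_i F i) x by rewrite -FT.
  have [j _ Gy] : (\bigcup_i G i) y by rewrite -GT.
  by exists (pickle (i, j)) => //; rewrite /H pickleK.
move=> n; rewrite /H; case: unpickle => [[i j]|]; last by rewrite measure0.
have [mF Fi] := Foo i; have [mG Gj] := Goo j.
split; first exact: measurableX.
by rewrite product_measure1E// lte_mul_pinfty// ge0_fin_numE.
Qed.

End sigma_finite_fubini.

(** * The Loomis-Whitney inequality *)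

Section loomis_whitney.
Local Open Scope ereal_scope.
Context d1 d2 d3 (T1 : measurableType d1) (T2 : measurableType d2)
  (T3 : measurableType d3) (R : realType).
Variables (m1 : {sigma_finite_measure set T1 -> \bar R})
  (m2 : {sigma_finite_measure set T2 -> \bar R})
  (m3 : {sigma_finite_measure set T3 -> \bar R}).
Variables (h f1 f2 f3 : (T1 * T2) * T3 -> R).
Hypotheses (h0 : forall p, (0 <= h p)%R) (f10 : forall p, (0 <= f1 p)%R)
  (f20 : forall p, (0 <= f2 p)%R) (f30 : forall p, (0 <= f3 p)%R).
Hypotheses (mh : measurable_fun setT h) (mf1 : measurable_fun setT f1)
  (mf2 : measurable_fun setT f2) (mf3 : measurable_fun setT f3).
Hypothesis hf1 : forall x y z, ((h (x, y, z)) ^+ 2)%:E <= \int[m1]_t (f1 (t, y, z))%:E.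
Hypothesis hf2 : forall x y z, ((h (x, y, z)) ^+ 2)%:E <= \int[m2]_t (f2 (x, t, z))%:E.
Hypothesis hf3 : forall x y z, ((h (x, y, z)) ^+ 2)%:E <= \int[m3]_t (f3 (x, y, t))%:E.

(** On a slice of fixed z, write h^3 as h^2 h with h^4 <= g1 g2 and h^2 <= g3. Cauchy-Schwarz on the
    slice gives H(z)^2 <= F1(z) F2(z) i3, and a second Cauchy-Schwarz in z yields the claim. *)
Lemma loomis_whitney (X i1 i2 i3 : R) :
  \int[m1 \x m2 \x m3]_p (h p ^+ 3)%:E = X%:E -> \int[m1 \x m2 \x m3]_p (f1 p)%:E = i1%:E ->
  \int[m1 \x m2 \x m3]_p (f2 p)%:E = i2%:E -> \int[m1 \x m2 \x m3]_p (f3 p)%:E = i3%:E ->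
  (X ^+ 2 <= i1 * (i2 * i3))%R.
Proof.
move=> hX hi1 hi2 hi3.
have sf12 := sigma_finite_prod (sigma_finiteT m1) m2.
have ge0i (f : (T1 * T2) * T3 -> R) i : (forall p, (0 <= f p)%R) -> \int[m1 \x m2 \x m3]_p (f p)%:E = i%:E -> (0 <= i)%R.
  by move=> f0 fi; rewrite -lee_fin -fi integral_ge0// => p _; rewrite lee_fin.
have X0 : (0 <= X)%R by apply: ge0i hX => p; rewrite exprn_ge0.
have i10 := ge0i _ _ f10 hi1; have i20 := ge0i _ _ f20 hi2; have i30 := ge0i _ _ f30 hi3.
have mE (f : (T1 * T2) * T3 -> R) : measurable_fun setT f -> measurable_fun setT (EFin \o f).
  by move=> mf; exact/measurable_EFinP.
have msl (f : (T1 * T2) * T3 -> R) z : measurable_fun setT f -> measurable_fun setT (fun p => f (p, z)).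
  move=> mf; apply: (measurableT_comp mf); exact: measurable_pair2.
pose g1 z y := \int[m1]_t (f1 (t, y, z))%:E.
pose g2 z x := \int[m2]_t (f2 (x, t, z))%:E.
pose g3 p := \int[m3]_t (f3 (p, t))%:E.
have mg1 z : measurable_fun setT (g1 z).
  apply: (@measurable_fun_fubini_tonelli_G _ _ _ _ R m1 (fun p => (f1 (p, z))%:E)).
    by apply/measurable_EFinP; exact: msl.
  by move=> p; rewrite lee_fin.
have mg2 z : measurable_fun setT (g2 z).
  apply: (@measurable_fun_fubini_tonelli_F _ _ _ _ R m2 (fun p => (f2 (p, z))%:E)).
    by apply/measurable_EFinP; exact: msl.
  by move=> p; rewrite lee_fin.
have mg3 : measurable_fun setT g3.
  by apply: (@measurable_fun_fubini_tonelli_F _ _ _ _ R m3 (EFin \o f3)) => [|p]; [exact: mE|rewrite lee_fin].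
have g10 z y : 0 <= g1 z y by apply: integral_ge0 => t _; rewrite lee_fin.
have g20 z y : 0 <= g2 z y by apply: integral_ge0 => t _; rewrite lee_fin.
have g30 p : 0 <= g3 p by apply: integral_ge0 => t _; rewrite lee_fin.
pose F1 z := \int[m1 \x m2]_p (f1 (p, z))%:E.
pose F2 z := \int[m1 \x m2]_p (f2 (p, z))%:E.
pose H z := \int[m1 \x m2]_p (h (p, z) ^+ 3)%:E.
have F1E z : F1 z = \int[m2]_y g1 z y.
  apply: (@fubini_tonelli2 _ _ _ _ R m1 m2 (fun p => (f1 (p, z))%:E)).
    by apply/measurable_EFinP; exact: msl.
  by move=> p; rewrite lee_fin.
have F2E z : F2 z = \int[m1]_x g2 z x.
  apply: (@fubini_tonelli1 _ _ _ _ R m1 m2 (fun p => (f2 (p, z))%:E)).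
    by apply/measurable_EFinP; exact: msl.
  by move=> p; rewrite lee_fin.
have G3E : \int[m1 \x m2]_p g3 p = i3%:E.
  rewrite -hi3; apply/esym; apply: (@sf_tonelli1 _ _ _ _ R _ sf12 m3 (EFin \o f3)); first exact: mE.
  by move=> p; rewrite lee_fin.
have mh3 : measurable_fun setT (fun p => h p ^+ 3)%R by exact: measurable_funX.
have tonz (f : (T1 * T2) * T3 -> R) i : (forall p, (0 <= f p)%R) -> measurable_fun setT f ->
    \int[m1 \x m2 \x m3]_p (f p)%:E = i%:E ->
    \int[m3]_z \int[m1 \x m2]_p (f (p, z))%:E = i%:E /\
    measurable_fun setT (fun z => \int[m1 \x m2]_p (f (p, z))%:E).
  move=> f0 mf <-; split.
    by apply/esym; apply: (@sf_tonelli2 _ _ _ _ R _ sf12 m3 (EFin \o f)); [exact: mE|move=> p; rewrite lee_fin].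
  by apply: (@sf_measurable_fun2 _ _ _ _ R _ sf12 (EFin \o f)); [exact: mE|move=> p; rewrite lee_fin].
have [iH mH] := tonz _ _ (fun p => exprn_ge0 3 (h0 p)) mh3 hX.
have [iF1 mF1] := tonz _ _ f10 mf1 hi1.
have [iF2 mF2] := tonz _ _ f20 mf2 hi2.
have F10 z : 0 <= F1 z by apply: integral_ge0 => p _; rewrite lee_fin.
have F20 z : 0 <= F2 z by apply: integral_ge0 => p _; rewrite lee_fin.
have H0 z : 0 <= H z by apply: integral_ge0 => p _; rewrite lee_fin exprn_ge0.
have slice z (k : R) : (0 < k)%R -> 2%:E * H z <= k%:E * (F1 z * F2 z) + (k^-1)%:E * i3%:E.
  move=> k0.
  have mp1 : measurable_fun setT (fun p : T1 * T2 => g2 z p.1 * g1 z p.2).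
    by apply: emeasurable_funM; apply: measurableT_comp.
  (* On the slice [g1 z] depends on the second variable only and [g2 z] on the first only, so the
     integral of their product factors. *)
  have -> : F1 z * F2 z = \int[m1 \x m2]_p (g2 z p.1 * g1 z p.2).
    rewrite (@fubini_tonelli1 _ _ _ _ R m1 m2) //=; last by move=> p; rewrite mule_ge0.
    under eq_integral => x _.
      rewrite /fubini_F /= ge0_integralZl//= -F1E; over.
    by rewrite ge0_integralZr//= -F2E muleC.
  rewrite -G3E -!ge0_integralZl_EFin//; last 5 first.
  - by rewrite invr_ge0 ltW.
  - by move=> p _; rewrite mule_ge0.
  - by rewrite ltW.
  - by move=> p _; rewrite lee_fin exprn_ge0.
  - by apply/measurable_EFinP; exact: (msl _ z mh3).
  rewrite -ge0_integralD//; last 4 first.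
  - by move=> p _; rewrite mule_ge0 ?mule_ge0 ?lee_fin ?(ltW k0).
  - by apply: measurable_funeM.
  - by move=> p _; rewrite mule_ge0 ?mule_ge0 ?lee_fin ?invr_ge0 ?(ltW k0).
  - by apply: measurable_funeM.
  apply: le_integral_ge0 => [[x y] _|[x y] _].
    by rewrite mule_ge0// lee_fin exprn_ge0.
  apply: (@le_trans _ _ (k%:E * (h (x, y, z) ^+ 2 * h (x, y, z) ^+ 2)%:E + (k^-1)%:E * (h (x, y, z) ^+ 2)%:E)).
    rewrite -!EFinM -EFinD lee_fin; set w := h _.
    have w0 : (0 <= w)%R := h0 _.
    have -> : (k * (w ^+ 2 * w ^+ 2) + k^-1 * w ^+ 2 = k^-1 * ((k * w ^+ 2 - w) ^+ 2) + 2 * w ^+ 3)%R.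
      by field; rewrite gt_eqF.
    by rewrite lerDr mulr_ge0// ?invr_ge0 ?(ltW k0)// sqr_ge0.
  apply: leeD; apply: lee_wpmul2l.
  - by rewrite lee_fin ltW.
  - by rewrite EFinM; apply: lee_pmul; rewrite ?lee_fin ?sqr_ge0.
  - by rewrite lee_fin invr_ge0 ltW.
  - exact: hf3.
have H2 z : F1 z \is a fin_num -> F2 z \is a fin_num -> H z \is a fin_num /\
    ((fine (H z)) ^+ 2 <= fine (F1 z) * (fine (F2 z) * i3))%R.
  move=> fF1 fF2; have fH : H z \is a fin_num.
    have := slice z _ ltr01; rewrite mul1e invr1 mul1e => /le_lt_trans h1.
    have : 2%:E * H z < +oo.
      by apply: h1; rewrite ltey_eq; apply/orP; left; rewrite fin_numD fin_numM.
    move=> h2; rewrite ge0_fin_numE//; apply: le_lt_trans h2.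
    by rewrite -[leLHS]mul1e lee_wpmul2r// lee_fin ler1n.
  split => //; rewrite mulrA; apply: sqr_le_of_amgm.
  - by rewrite fine_ge0.
  - by rewrite mulr_ge0// fine_ge0.
  - exact: i30.
  - move=> k k0; have := slice z k k0.
    by rewrite -(fineK fF1) -(fineK fF2) -(fineK fH) -!EFinM -EFinD lee_fin [(k^-1 * _)%R]mulrC.
have int_of (F : T3 -> \bar R) i : (forall z, 0 <= F z) -> measurable_fun setT F ->
    \int[m3]_z F z = i%:E -> {ae m3, forall z, F z \is a fin_num}.
  move=> F0 mF iF.
  have iiF : m3.-integrable setT F.
    apply/integrableP; split => //; under eq_integral => z _ do rewrite gee0_abs//.
    by rewrite iF ltry.
  by have := integrable_ae measurableT iiF; apply: filterS => z; apply.
apply: sqr_le_of_amgm => //; first exact: mulr_ge0.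
move=> k k0; rewrite -lee_fin EFinD !EFinM -iF1 -iH.
have -> : i2%:E * i3%:E * (k^-1)%:E = \int[m3]_z ((i3 * k^-1)%:E * F2 z).
  rewrite ge0_integralZl_EFin//; last by rewrite mulr_ge0// invr_ge0 ltW.
  have -> : \int[m3]_z F2 z = i2%:E by exact: iF2.
  by rewrite -!EFinM; congr EFin; ring.
have -> : 2%:E * \int[m3]_z \int[m1 \x m2]_p (h (p, z) ^+ 3)%:E = \int[m3]_z (2%:E * H z).
  by rewrite ge0_integralZl_EFin.
have -> : k%:E * \int[m3]_z \int[m1 \x m2]_p (f1 (p, z))%:E = \int[m3]_z (k%:E * F1 z).
  by rewrite ge0_integralZl_EFin// ltW.
rewrite -ge0_integralD//; last 4 first.
- by move=> z _; rewrite mule_ge0// lee_fin ltW.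
- by apply: measurable_funeM.
- by move=> z _; rewrite mule_ge0// lee_fin mulr_ge0// invr_ge0 ltW.
- by apply: measurable_funeM.
apply: ae_ge0_le_integral => //.
- by move=> z _; rewrite mule_ge0.
- by apply: measurable_funeM.
- by move=> z _; rewrite adde_ge0// mule_ge0// lee_fin ?mulr_ge0// ?invr_ge0 ltW.
- by apply: emeasurable_funD; apply: measurable_funeM.
move: (int_of _ _ F10 mF1 iF1) (int_of _ _ F20 mF2 iF2).
apply: filterS2 => z fF1 fF2 _; have [fH hz] := H2 z fF1 fF2.
rewrite -/(H z) -/(F1 z) -(fineK fF1) -(fineK fF2) -(fineK fH) -!EFinM -EFinD lee_fin.
set X1 := fine (F1 z) in hz *; set X2 := fine (F2 z) in hz *; set W := fine (H z) in hz *.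
have X10 : (0 <= X1)%R by rewrite fine_ge0.
have X20 : (0 <= X2)%R by rewrite fine_ge0.
have W0 : (0 <= W)%R by rewrite fine_ge0.
(* Arithmetic-geometric mean for [k * X1] and [i3 / k * X2], whose product does not depend on
   [k]. *)
have e : (4 * (k * X1) * (i3 / k * X2) = 4 * (X1 * (X2 * i3)))%R by field; rewrite gt_eqF.
rewrite -ler_sqr ?nnegrE ?mulr_ge0 ?addr_ge0 ?mulr_ge0 ?invr_ge0 ?(ltW k0)//.
apply: (@le_trans _ _ (4 * (k * X1) * (i3 / k * X2))%R); first by rewrite e exprMn; nra.
by have := sqr_ge0 (k * X1 - i3 / k * X2)%R; nra.
Qed.

End loomis_whitney.

(** Squaring the first bound and inserting the three others gives X^4 <= 16^3 X^3 d e f; then X^3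
    cancels. *)
Lemma loomis_whitney_solve (R : realFieldType) (X a b c d e f : R) :
  0 <= X -> 0 <= a -> 0 <= b -> 0 <= c -> 0 <= d -> 0 <= e -> 0 <= f ->
  X ^+ 2 <= a * (b * c) -> a ^+ 2 <= 16 * (X * d) -> b ^+ 2 <= 16 * (X * e) ->
  c ^+ 2 <= 16 * (X * f) -> X <= 16 ^+ 3 * (d * (e * f)).
Proof.
move=> X0 a0 b0 c0 d0 e0 f0 h ha hb hc.
have [->|Xn0] := eqVneq X 0; first by rewrite !mulr_ge0.
have {}X0 : 0 < X by rewrite lt_neqAle eq_sym Xn0.
have h4 : X ^+ 4 <= (16 * (X * d)) * ((16 * (X * e)) * (16 * (X * f))).
  apply: (@le_trans _ _ ((a * (b * c)) ^+ 2)).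
    rewrite (_ : X ^+ 4 = (X ^+ 2) ^+ 2); last by rewrite -exprM.
    by rewrite ler_sqr ?nnegrE ?sqr_ge0// !mulr_ge0.
  rewrite (exprMn 2 a) (exprMn 2 b); apply: ler_pM; rewrite ?mulr_ge0 ?sqr_ge0//.
  by apply: ler_pM; rewrite ?sqr_ge0.
rewrite -(ler_pM2l (exprn_gt0 3 X0)) -exprSr.
by apply: (le_trans h4); rewrite le_eqVlt; apply/orP; left; apply/eqP; ring.
Qed.

(** * Calculus along lines, test functions and their Sobolev inequality *)

Section line_calculus.
Context {R : realType}.
Local Notation L := (@lebesgue_measure R).

Lemma FTC2_all (F f : R -> R) (a b : R) : a < b ->
  (forall x : R, is_derive x (1 : R) F (f x)) ->
  continuous f -> (\int[L]_(x in `[a, b]) (f x)%:E = (F b)%:E - (F a)%:E)%E.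
Proof.
move=> ab dF cf; have cF : continuous F.
  by move=> x; apply: differentiable_continuous; apply/derivable1_diffP; exact: ex_derive.
apply: continuous_FTC2 => //.
- exact: continuous_subspaceT.
- split => [x _||]; first exact: ex_derive.
  + by apply: cvg_at_right_filter; exact: cF.
  + by apply: cvg_at_left_filter; exact: cF.
- by move=> x _; rewrite derive1E derive_val.
Qed.

(** Everything happens inside [-M, M]; integrating from -M, where [F] vanishes, bounds [F] by the
    total variation of its values. *)
Lemma FTC_csupp (F f : R -> R) (M : R) : 0 < M ->
  (forall x : R, is_derive x (1 : R) F (f x)) ->
  continuous f -> (forall x, M <= `|x| -> F x = 0) -> (forall x, M <= `|x| -> f x = 0) ->
  (\int[L]_x (f x)%:E = 0)%E /\
  forall x, (`|F x|%:E <= \int[L]_t `|f t|%:E)%E.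
Proof.
move=> M0 dF cf F0 f0.
have FM : F M = 0 by rewrite F0// ger0_norm ?(ltW M0).
have FNM : F (- M) = 0 by rewrite F0// normrN ger0_norm ?(ltW M0).
have mf : measurable_fun setT f by exact: continuous_measurable_fun.
split.
  transitivity (\int[L]_(x in `[(- M)%R, M]) (f x)%:E)%E.
    rewrite [RHS]integral_mkcond; apply: eq_integral => x _; rewrite /patch.
    case: ifPn => // xM; rewrite f0//; move: xM.
    apply: contraR; rewrite -ltNge ltr_norml => /andP[? ?].
    by rewrite inE/= in_itv/= !ltW.
  by rewrite (FTC2_all _ dF cf) ?FM ?FNM ?subee//; lra.
move=> x; have [xM|] := leP M `|x|.
  by rewrite (F0 _ xM) normr0; apply: integral_ge0 => t _; rewrite lee_fin.
rewrite ltr_norml => /andP[Mx xM].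
have := FTC2_all Mx dF cf; rewrite FNM sube0 => E.
rewrite -[leLHS]/(`|(F x)%:E|)%E -E.
apply: (@le_trans _ _ (\int[L]_(t in `[(- M)%R, x]) `|(f t)%:E|)%E).
  apply: le_abse_integral => //; apply/measurable_EFinP; exact: measurable_funTS.
apply: ge0_subset_integral => //.
apply/measurable_EFinP; exact: measurableT_comp.
Qed.

End line_calculus.

Section test_functions.
Context {R : realType}.
Local Notation E3 := (E3 R).
Local Notation L3 := (@leb3 R).
Local Notation L := (@lebesgue_measure R).
Implicit Types (Om : set E3) (phi psi : E3 -> R).

Lemma test_funD Om phi psi : test_fun Om phi -> test_fun Om psi ->
  test_fun Om (fun x => phi x + psi x).
Proof.
move=> [cp [K [cK KO K0]]] [cq [K' [cK' KO' K0']]]; split.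
  by move=> n; apply: CnD.
exists (K `|` K'); split; first exact: compactU.
  by move=> x []; [exact: KO|exact: KO'].
by move=> x nx; rewrite K0 ?K0' ?addr0// => h; apply: nx; [right|left].
Qed.

Lemma test_funM Om phi psi : test_fun Om phi -> (forall n, Cn n psi) ->
  test_fun Om (fun x => phi x * psi x).
Proof.
move=> [cp [K [cK KO K0]]] cq; split; first by move=> n; exact: CnM.
by exists K; split => // x nx; rewrite K0 ?mul0r.
Qed.

Lemma test_funZ Om phi c : test_fun Om phi -> test_fun Om (fun x => c * phi x).
Proof.
move=> tp; have := test_funM tp (fun n => Cn_cst E3 n c).
by congr test_fun; apply/funext => x; rewrite mulrC.
Qed.

Lemma test_fun_deriv Om phi v : test_fun Om phi -> test_fun Om (fun x => 'D_v phi x).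
Proof.
move=> [cp [K [cK KO K0]]]; split.
  by move=> n; have [_ /(_ v)[]] := cp n.+1.
exists K; split => // x nx.
have clK : closed K by apply: compact_closed => //; exact: norm_hausdorff.
have nK : \forall y \near x, ~ K y.
  by have := closed_openC clK; rewrite openE => /(_ _ nx).
have E : {near x, phi =1 cst 0} by near=> y; rewrite /= K0//; near: y.
by rewrite (near_eq_derive _ E) derive_cst.
Unshelve. all: by end_near. Qed.

Lemma test_fun_continuous Om phi : test_fun Om phi -> continuous phi.
Proof. by move=> [/(_ 0%N)[]]. Qed.

Lemma test_fun_derivable Om phi x v : test_fun Om phi -> derivable phi x v.
Proof. by move=> [/(_ 1%N)[_ /(_ v)[]]]. Qed.

Lemma test_fun_support Om phi : test_fun Om phi -> forall x, ~ Om x -> phi x = 0.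
Proof. by move=> [_ [K [_ KO K0]]] x nx; apply: K0 => /KO. Qed.

Lemma test_fun_bounded Om phi : test_fun Om phi ->
  exists2 M : R, 0 < M & (forall x, `|phi x| <= M) /\
  forall x, (M <= `|x.1.1|) || (M <= `|x.1.2|) || (M <= `|x.2|) -> phi x = 0.
Proof.
move=> tp; have cphi := test_fun_continuous tp; case: tp => _ [K [cK _ K0]].
have [M1 [_ H1]] := compact_bounded cK.
have [M2 [_ H2]] : bounded_set (phi @` K).
  apply: compact_bounded; apply: continuous_compact => //.
  exact: continuous_subspaceT.
pose M := `|M1| + `|M2| + 1.
have M1M : M1 < M by rewrite /M (le_lt_trans (ler_norm M1))// -addrA ltrDl ltr_wpDl.
have M2M : M2 < M.
  by rewrite /M (le_lt_trans (ler_norm M2))// addrAC ltrDr ltr_wpDl.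
have M0 : 0 < M by rewrite /M ltr_wpDl// addr_ge0.
exists (M + 1); first by rewrite addr_gt0.
split.
  move=> x; have [Kx|Kx] := pselect (K x).
    by rewrite (le_trans (H2 _ M2M _ _)) ?lerDl//; exists x.
  by rewrite K0// normr0 addr_ge0// ltW.
move=> [[x y] z] /= h; apply: K0 => Kx.
have := H1 _ M1M _ Kx; rewrite /= !prod_normE/= !ge_max => /andP[/andP[? ?] ?].
by move: h => /orP[/orP[]|] ?; lra.
Qed.

Lemma integrable_bounded_support (f : E3 -> R) (M : R) : measurable_fun setT f ->
  (forall x, `|f x| <= M) ->
  (forall x, (M <= `|x.1.1|) || (M <= `|x.1.2|) || (M <= `|x.2|) -> f x = 0) ->
  L3.-integrable setT (EFin \o f).
Proof.
move=> mf fM f0; set B := box (- M, - M, - M) (M, M, M).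
have mB : measurable B by exact: measurable_box.
have -> : EFin \o f = (EFin \o f) \_ B.
  apply/funext => -[[x y] z]; rewrite /patch; case: ifPn => // nB /=.
  rewrite f0//=; apply: contraR nB; rewrite !negb_or -!ltNge !ltr_norml.
  by move=> /andP[/andP[? ?] ?]; rewrite inE; split.
apply: ((@integrable_mkcond _ _ _ L3 B (EFin \o f) mB).1).
apply: (@measurable_bounded_integrable _ _ _ L3 f B mB).
- exact: leb3_box_lty.
- exact: measurable_funTS.
- exists M; split; first exact: num_real.
  by move=> M' MM' x _; exact: le_trans (fM x) (ltW MM').
Qed.

Lemma test_fun_measurable Om phi : test_fun Om phi -> measurable_fun setT phi.
Proof. by move=> /test_fun_continuous; exact: continuous_measurable3. Qed.

Lemma test_fun_integrable Om phi : test_fun Om phi -> L3.-integrable setT (EFin \o phi).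
Proof.
move=> tp; have [M _ [h1 h2]] := test_fun_bounded tp.
exact: (integrable_bounded_support (test_fun_measurable tp) h1 h2).
Qed.

Lemma is_derive_slice phi v (l : R -> E3) t :
  (forall h : R, l (h *: 1 + t) = h *: v + l t) -> derivable phi (l t) v ->
  is_derive t 1 (phi \o l) ('D_v phi (l t)).
Proof.
move=> lE dphi.
have E : (fun h : R => h^-1 *: ((phi \o l) (h *: 1 + t) - (phi \o l) t)) =
         (fun h : R => h^-1 *: (phi (h *: v + l t) - phi (l t))).
  by apply/funext => h /=; rewrite lE.
apply: DeriveDef; first by rewrite /derivable /= E.
by rewrite /derive /= E.
Qed.

Lemma basis3_slice (i : 'I_3) (x y z : R) :
  let l t : E3 := match val i with 0%N => (t, y, z) | 1%N => (x, t, z) | _ => (x, y, t) end in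
  forall t h : R, l (h *: 1 + t) = h *: (basis3 i : E3) + l t.
Proof.
move=> l t h; rewrite /l /basis3.
have s1 : h *: (1 : R) = h by rewrite /GRing.scale/= mulr1.
have s0 : h *: (0 : R) = 0 by rewrite /GRing.scale/= mulr0.
case: i l => -[|[|[|//]]] lti /= _; rewrite /GRing.scale/= /GRing.add/=;
  congr (_, _, _); rewrite /= ?s1 ?s0 ?mulr1 ?mulr0 ?add0r//.
Qed.

Lemma test_fun_slice Om phi : test_fun Om phi -> forall (i : 'I_3) (x y z : R),
  let l t : E3 := match val i with 0%N => (t, y, z) | 1%N => (x, t, z) | _ => (x, y, t) end in
  (\int[L]_t ('D_(basis3 i) phi (l t))%:E = 0)%E /\
  forall t, (`|phi (l t)|%:E <= \int[L]_t `|'D_(basis3 i) phi (l t)|%:E)%E.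
Proof.
move=> tp i x y z l; have td := test_fun_deriv (basis3 i) tp.
have [M M0 [_ h1]] := test_fun_bounded tp; have [M' M0' [_ h2]] := test_fun_bounded td.
have lM (g : E3 -> R) (N : R) : (forall x, (N <= `|x.1.1|) || (N <= `|x.1.2|) || (N <= `|x.2|) -> g x = 0) ->
    forall t, N <= `|t| -> g (l t) = 0.
  move=> h t Nt; apply: h; rewrite /l.
  by case: i l td h2 => -[|[|[|//]]] lti /= _ _ _; rewrite Nt ?orbT.
apply: (@FTC_csupp R (phi \o l) ((fun x => 'D_(basis3 i) phi x) \o l) (M + M')).
- exact: addr_gt0.
- move=> t; apply: is_derive_slice; last exact: test_fun_derivable tp.
  exact: basis3_slice.
- move=> t; apply: continuous_comp; last exact: (test_fun_continuous td).
  rewrite /l; case: (val i) => [|[|n]].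
  + exact: (cvg_pair (cvg_pair cvg_id (cvg_cst y)) (cvg_cst z)).
  + exact: (cvg_pair (cvg_pair (cvg_cst x) cvg_id) (cvg_cst z)).
  + exact: (cvg_pair (cvg_cst (x, y)) cvg_id).
- by move=> t h; apply: (lM _ _ h1); rewrite (le_trans _ h)// lerDl ltW.
- by move=> t h; apply: (lM _ _ h2); rewrite (le_trans _ h)// lerDr ltW.
Qed.

Let sfL2 := sigma_finite_prod (sigma_finiteT L) L.

(** The integral along each line in direction [i] vanishes, so that direction is integrated first;
    this is why the order of integration depends on [i]. *)
Lemma integral_partial_eq0 Om phi (i : 'I_3) : test_fun Om phi ->
  (\int[L3]_x ('D_(basis3 i) phi x)%:E = 0)%E.
Proof.
move=> tp; have td := test_fun_deriv (basis3 i) tp.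
have itd := test_fun_integrable td; have sl := test_fun_slice tp i.
have ae0 : {ae L, forall z, (\int[(L \x L)%E]_p ('D_(basis3 i) phi (p, z))%:E = 0)%E} ->
    (\int[L3]_x ('D_(basis3 i) phi x)%:E = 0)%E.
  move=> h; rewrite -(@sf_fubini2 _ _ _ _ R _ sfL2 L (fun x => ('D_(basis3 i) phi x)%:E) itd).
  rewrite (@ae_eq_integral_all _ _ _ L setT _ (cst 0%E)) ?integral0//.
  by apply: (ae_imp h).
have sint := @sf_ae_integrable2 _ _ _ _ R _ sfL2 L _ itd.
case: i td itd sl ae0 sint => -[|[|[|//]]] lti /= td itd sl ae0 sint.
- apply: ae0; apply: (ae_imp sint) => z fz.
  rewrite -(@integral21_prod_meas1 _ _ _ _ R L L _ fz).
  by apply: integral0_eq => y _; have [] := sl 0 y z.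
- apply: ae0; apply: (ae_imp sint) => z fz.
  rewrite -(@integral12_prod_meas1 _ _ _ _ R L L _ fz).
  by apply: integral0_eq => x _; have [] := sl x 0 z.
- rewrite -(@sf_fubini1 _ _ _ _ R _ sfL2 L _ itd).
  by apply: integral0_eq => -[x y] _; have [] := sl x y 0.
Qed.

Lemma partialM phi psi x v : derivable phi x v -> derivable psi x v ->
  'D_v (fun x => phi x * psi x) x = phi x * 'D_v psi x + psi x * 'D_v phi x.
Proof. by move=> h1 h2; rewrite (deriveM h1 h2). Qed.

Lemma ip_support Om phi (f : E3 -> R) : test_fun Om phi ->
  ip Om f phi = \int[L3]_x (f x * phi x).
Proof.
move=> tp; rewrite /ip Rintegral_mkcond; congr (Rintegral _ _ _).
apply/funext => x; rewrite /patch; case: ifPn => // xO.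
by rewrite (test_fun_support tp) ?mulr0// => Ox; move: xO; rewrite mem_set.
Qed.

Lemma integration_by_parts Om phi psi (i : 'I_3) : test_fun Om phi -> test_fun Om psi ->
  ip Om phi (fun x => 'D_(basis3 i) psi x) = - ip Om (fun x => 'D_(basis3 i) phi x) psi.
Proof.
move=> tp tq; have tdp := test_fun_deriv (basis3 i) tp; have tdq := test_fun_deriv (basis3 i) tq.
have tpq := test_funM tp tq.1; have := integral_partial_eq0 i tpq.
have E x : 'D_(basis3 i) (fun x => phi x * psi x) x =
    phi x * 'D_(basis3 i) psi x + 'D_(basis3 i) phi x * psi x.
  rewrite partialM; [|exact: test_fun_derivable tp|exact: test_fun_derivable tq].
  by rewrite [psi x * _]mulrC.
under eq_integral do rewrite E.
move=> /(congr1 fine); rewrite -/(Rintegral _ _ _) RintegralD//.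
- by rewrite (ip_support _ tdq) (ip_support _ tq) => /eqP; rewrite addr_eq0 => /eqP.
- exact: test_fun_integrable (test_funM tp tdq.1).
- exact: test_fun_integrable (test_funM tdp tq.1).
Qed.

Lemma test_fun_L2 Om phi : test_fun Om phi -> L3.-integrable setT (fun x => (phi x ^+ 2)%:E).
Proof.
move=> tp; have := test_fun_integrable (test_funM tp tp.1).
by congr (integrable _ _ _); apply/funext => x /=; rewrite expr2.
Qed.

Lemma test_funX Om phi k : test_fun Om phi -> (0 < k)%N -> test_fun Om (fun x => phi x ^+ k).
Proof.
move=> tp; case: k => // k _; have := test_funM tp (fun n => CnX k (tp.1 n)).
by congr test_fun; apply/funext => x; rewrite exprS.
Qed.

(* The Loomis-Whitney inequality applied to [phi ^+ 4], each directional integral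
   being controlled by Cauchy-Schwarz. *)
Lemma sobolev_test Om phi : test_fun Om phi ->
  \int[L3]_x (phi x ^+ 6) <=
  (16 ^+ 3) * ((\int[L3]_x ('D_(basis3 0) phi x ^+ 2)) *
  ((\int[L3]_x ('D_(basis3 1) phi x ^+ 2)) * \int[L3]_x ('D_(basis3 2%:R) phi x ^+ 2))).
Proof.
move=> tp; have i6 := test_fun_integrable (test_funX tp (isT : (0 < 6)%N)).
set X := \int[L3]_x (phi x ^+ 6).
have XE : (\int[L3]_x (phi x ^+ 6)%:E)%E = X%:E.
  by rewrite /X /Rintegral fineK//; exact: (integrable_fin_num _ i6).
have X0 : 0 <= X by apply: Rintegral_ge0 => x _; rewrite exprn_even_ge0.
have td (i : 'I_3) := test_fun_deriv (basis3 i) tp.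
pose f (i : 'I_3) x := `|'D_(basis3 i) (fun x => phi x ^+ 4) x|.
have fE i x : f i x = 4 * `|phi x ^+ 3 * 'D_(basis3 i) phi x|.
  have dp : derivable phi x (basis3 i) := test_fun_derivable tp.
  have E4 : (fun x => phi x ^+ 4) = (phi : E3 -> R) ^+ 4 by apply/funext => y; rewrite exprfctE.
  by rewrite /f E4 (deriveX 4 dp) /GRing.scale/= -mulrA normrM (@ger0_norm _ 4%:R).
have if_ i : L3.-integrable setT (EFin \o f i).
  by apply: (@integrable_norm _ _ _ L3); exact: test_fun_integrable (test_fun_deriv _ (test_funX tp (isT : (0 < 4)%N))).
pose I i := \int[L3]_x (f i x).
have IE i : (\int[L3]_x (f i x)%:E)%E = (I i)%:E.
  by rewrite /I /Rintegral fineK//; exact: (integrable_fin_num _ (if_ i)).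
have I0 i : 0 <= I i by apply: Rintegral_ge0 => x _; exact: normr_ge0.
pose d i := \int[L3]_x ('D_(basis3 i) phi x ^+ 2).
have d0 i : 0 <= d i by apply: Rintegral_ge0 => x _; exact: sqr_ge0.
(* Here h = phi^2, so that h^2 = phi^4 is bounded along lines by its directional integrals, while
   h^3 = phi^6. *)
have LW : X ^+ 2 <= I 0 * (I 1 * I 2%:R).
  have sl i := test_fun_slice (test_funX tp (isT : (0 < 4)%N)) i.
  have h4 (x : E3) : (phi x ^+ 2) ^+ 2 = `|phi x ^+ 4|.
    by rewrite -exprM ger0_norm// exprn_even_ge0.
  apply: (@loomis_whitney _ _ _ _ _ _ R L L L (fun x => phi x ^+ 2) (f 0) (f 1) (f 2%:R)) => //.
  - by move=> p; exact: sqr_ge0.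
  - by move=> p; exact: normr_ge0.
  - by move=> p; exact: normr_ge0.
  - by move=> p; exact: normr_ge0.
  - by apply: measurable_funX; exact: test_fun_measurable tp.
  - exact: (measurable_EFinP _ _).1 (measurable_int _ (if_ 0)).
  - exact: (measurable_EFinP _ _).1 (measurable_int _ (if_ 1)).
  - exact: (measurable_EFinP _ _).1 (measurable_int _ (if_ 2%:R)).
  - by move=> x y z; rewrite h4; have [_] := sl 0 x y z; exact.
  - by move=> x y z; rewrite h4; have [_] := sl 1 x y z; exact.
  - by move=> x y z; rewrite h4; have [_] := sl 2%:R x y z; exact.
  - rewrite -XE; congr (integral _ _ _); apply/funext => x.
    by rewrite -exprM.
(* The derivative of phi^4 is 4 phi^3 times that of phi; Cauchy-Schwarz separates phi^6, whose
   integral is X again. *)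
have ID i : I i ^+ 2 <= 16 * (X * d i).
  have : (I i / 4) ^+ 2 <= X * d i.
    apply: sqr_le_of_amgm => //; first by rewrite divr_ge0.
    move=> k k0.
    have i2 : L3.-integrable setT (EFin \o (fun x => 'D_(basis3 i) phi x ^+ 2)) := test_fun_L2 (td i).
    have -> : k * X + d i / k = \int[L3]_x (k * phi x ^+ 6 + 'D_(basis3 i) phi x ^+ 2 * k^-1).
      rewrite RintegralD//.
      + by rewrite RintegralZl// RintegralZr.
      + exact: (integrableZl measurableT k i6).
      + exact: (integrableZr measurableT k^-1 i2).
    have -> : 2 * (I i / 4) = \int[L3]_x (2^-1 * f i x).
      by rewrite RintegralZl// -/(I i); field.
    apply: le_Rintegral => //.
    + exact: (integrableZl measurableT 2^-1 (if_ i)).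
    + have j1 : L3.-integrable setT (fun x => (k * phi x ^+ 6)%:E) := integrableZl measurableT k i6.
      have j2 : L3.-integrable setT (fun x => ('D_(basis3 i) phi x ^+ 2 * k^-1)%:E) := integrableZr measurableT k^-1 i2.
      exact: (integrableD measurableT j1 j2).
    + move=> x _; rewrite fE; set u := phi x; set v := 'D__ _ _.
      have -> : k * u ^+ 6 + v ^+ 2 / k = k^-1 * ((k * (`|u ^+ 3|) - `|v|) ^+ 2) + 2 * (`|u ^+ 3| * `|v|).
        have -> : u ^+ 6 = `|u ^+ 3| ^+ 2 by rewrite real_normK ?num_real// -exprM.
        have -> : v ^+ 2 = `|v| ^+ 2 by rewrite real_normK ?num_real.
        by field; rewrite gt_eqF.
      rewrite normrM; have -> : 2^-1 * (4 * (`|u ^+ 3| * `|v|)) = 2 * (`|u ^+ 3| * `|v|) by field.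
      by rewrite lerDr mulr_ge0 ?invr_ge0 ?(ltW k0)// sqr_ge0.
  by move=> h; have := ler_wpM2l (ler0n R 16) h; congr (_ <= _); field.
by apply: (loomis_whitney_solve _ _ _ _ _ _ _ LW (ID 0) (ID 1) (ID 2%:R)) => //.
Qed.

End test_functions.

(** * The space H^1_0 *)

(** The pairings given by integrals are total functions, but bilinear only on the space where the
    integrals converge. One record covers L^2 and the gradient pairing on H^1 and H^1_0, where the
    pairing may be degenerate. *)
Record semi_inner (R : realType) (V : zmodType) (X : V -> Prop) (B : V -> V -> R) : Prop :=
  SemiInner {
    si_XD : forall v w, X v -> X w -> X (v + w);
    si_XN : forall v, X v -> X (- v);
    si_sym : forall v w, B v w = B w v;
    si_D : forall u v w, X u -> X v -> X w -> B (u + v) w = B u w + B v w;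
    si_N : forall v w, X v -> X w -> B (- v) w = - B v w;
    si_ge0 : forall v, 0 <= B v v;
    si_CS : forall v w, X v -> X w -> B v w ^+ 2 <= B v v * B w w
  }.

Section square_integrable.
Context d (T : measurableType d) (R : realType) (mu : {measure set T -> \bar R}).
Variables (D : set T) (mD : measurable D).
Implicit Types f g : T -> R.

Definition sqint f := measurable_fun D f /\ mu.-integrable D (fun x => (f x ^+ 2)%:E).

Lemma RintegralN_integrable (f : T -> R) : mu.-integrable D (EFin \o f) ->
  \int[mu]_(x in D) (- f x) = - \int[mu]_(x in D) f x.
Proof.
move=> fi; rewrite -[RHS]mulN1r -RintegralZl//.
by congr (Rintegral _ _ _); apply/funext => x; rewrite mulN1r.
Qed.

Lemma sqint_mul f g : sqint f -> sqint g -> mu.-integrable D (fun x => (f x * g x)%:E).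
Proof.
move=> [mf if_] [mg ig]; apply: (@le_integrable _ _ _ mu D mD _
  (fun x => (f x ^+ 2)%:E + (g x ^+ 2)%:E)%E).
- by apply/measurable_EFinP; exact: measurable_funM.
- move=> x _; rewrite -EFinD lee_fin [leRHS]ger0_norm ?addr_ge0 ?sqr_ge0// ler_norml.
  have := sqr_ge0 (f x + g x); have := sqr_ge0 (f x - g x).
  by move=> ? ?; apply/andP; split; nra.
- exact: integrableD.
Qed.

Lemma sqintD f g : sqint f -> sqint g -> sqint (fun x => f x + g x).
Proof.
move=> sf sg; have ifg := sqint_mul sf sg; case: sf sg => mf if_ [mg ig].
have m : measurable_fun D (fun x => f x + g x) by exact: measurable_funD.
split=> //; apply: (@le_integrable _ _ _ mu D mD _
  (fun x => 2%:E * (f x ^+ 2)%:E + 2%:E * (g x ^+ 2)%:E)%E).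
- by apply/measurable_EFinP; exact: measurable_funX.
- move=> x _; have : `|(f x + g x) ^+ 2| <= `|2 * f x ^+ 2 + 2 * g x ^+ 2|.
    rewrite [leLHS]ger0_norm ?sqr_ge0// [leRHS]ger0_norm; last by apply: addr_ge0; apply: mulr_ge0; rewrite ?sqr_ge0.
    by have := sqr_ge0 (f x - g x); nra.
  by [].
- by apply: integrableD => //; exact: integrableZl.
Qed.

Lemma sqintZ c f : sqint f -> sqint (fun x => c * f x).
Proof.
move=> [mf if_]; split; first by apply: measurable_funM.
have := integrableZl mD (c ^+ 2) if_; apply: eq_integrable => // x _.
by rewrite exprMn EFinM.
Qed.

Lemma sqintN f : sqint f -> sqint (fun x => - f x).
Proof.
move=> /(sqintZ (-1)); congr sqint.
by apply/funext => x; rewrite mulN1r.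
Qed.

Lemma sqint_integrable f : (mu D < +oo)%E -> sqint f -> mu.-integrable D (EFin \o f).
Proof.
move=> Doo sf; have s1 : sqint (cst 1).
  split; first exact: measurable_cst.
  apply: (@measurable_bounded_integrable _ _ _ mu (cst (1 ^+ 2)) D mD) => //.
  by exists 1; split => // M M1 x _ /=; rewrite normrX normr1 expr1n ltW.
have := sqint_mul sf s1; apply: eq_integrable => // x _.
by rewrite /= mulr1.
Qed.

Lemma sqint_CS f g : sqint f -> sqint g ->
  (\int[mu]_(x in D) (f x * g x)) ^+ 2 <=
  (\int[mu]_(x in D) (f x ^+ 2)) * \int[mu]_(x in D) (g x ^+ 2).
Proof.
move=> sf sg; have ifg := sqint_mul sf sg; case: sf sg => mf if_ [mg ig].
rewrite -real_normK ?num_real//; apply: sqr_le_of_amgm.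
- exact: normr_ge0.
- by apply: Rintegral_ge0 => x _; exact: sqr_ge0.
- by apply: Rintegral_ge0 => x _; exact: sqr_ge0.
- move=> k k0.
  have i1 : mu.-integrable D (fun x => (k * f x ^+ 2)%:E) by exact: (integrableZl mD k if_).
  have i2 : mu.-integrable D (fun x => (g x ^+ 2 * k^-1)%:E) by exact: (integrableZr mD k^-1 ig).
  rewrite -RintegralZl// -RintegralZr// -RintegralD//.
  apply: (@le_trans _ _ (2 * \int[mu]_(x in D) `|f x * g x|)).
    by rewrite ler_pM2l//; exact: le_normr_Rintegral.
  have ia : mu.-integrable D (EFin \o (fun x => `|f x * g x|)).
    exact: (integrable_norm ifg).
  rewrite -RintegralZl//; apply: le_Rintegral => //.
  + exact: (integrableZl mD 2 ia).
  + exact: (integrableD mD i1 i2).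
  + move=> x _; rewrite normrM.
    have -> : k * f x ^+ 2 + g x ^+ 2 / k = k^-1 * ((k * `|f x| - `|g x|) ^+ 2) + 2 * (`|f x| * `|g x|).
      rewrite -[f x ^+ 2]real_normK ?num_real// -[g x ^+ 2]real_normK ?num_real//.
      by field; rewrite gt_eqF.
    by rewrite lerDr mulr_ge0 ?invr_ge0 ?(ltW k0)// sqr_ge0.
Qed.

Lemma semi_inner_sqint : semi_inner sqint (fun f g => \int[mu]_(x in D) (f x * g x)).
Proof.
split.
- by move=> v w sv sw; exact: sqintD.
- by move=> v sv; exact: sqintN.
- by move=> v w; under eq_Rintegral do rewrite mulrC.
- move=> u v w su sv sw; rewrite -RintegralD//.
  + by congr (Rintegral _ _ _); apply/funext => x; rewrite mulrDl.
  + exact: (sqint_mul su sw).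
  + exact: (sqint_mul sv sw).
- move=> v w sv sw; rewrite -(RintegralN_integrable (sqint_mul sv sw)).
  by congr (Rintegral _ _ _); apply/funext => x; rewrite mulNr.
- by move=> v; apply: Rintegral_ge0 => x _; rewrite -expr2 sqr_ge0.
- move=> v w sv sw; apply: le_trans (sqint_CS sv sw) _.
  by rewrite le_eqVlt; apply/orP; left; apply/eqP; congr (_ * _).
Qed.

End square_integrable.

Section spaces.
Context {R : realType} (Om : set (E3 R)).
Hypotheses (oO : open Om) (bO : bounded_set Om).
Local Notation L3 := (@leb3 R).
Local Notation fld := (E3 R -> R).
Implicit Types v w : fld.

Let mO : measurable Om := open_measurable3 oO.
Let fO : (L3 Om < +oo)%E := leb3_bounded_lty mO bO.

Lemma enrm_poweR p v : p != 0 ->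
  (enrm Om p v `^ p = \int[L3]_(x in Om) (`|v x| `^ p)%:E)%E.
Proof.
move=> p0; rewrite /enrm (@poweR_Lnorm _ _ _ L3 _ p p0) [RHS]integral_mkcond.
congr (integral _ _ _); apply/funext => x; rewrite /patch indicE.
case: ifPn => xO; first by rewrite mul1r.
by rewrite mul0r [(`|_|)%E]abse0 poweR0r.
Qed.

Lemma enrm_lty p v : 0 < p ->
  (enrm Om p v < +oo)%E = (\int[L3]_(x in Om) (`|v x| `^ p)%:E < +oo)%E.
Proof.
move=> p0; rewrite -enrm_poweR ?gt_eqF//; apply/idP/idP.
  exact: poweR_lty.
by apply: lty_poweRy; rewrite gt_eqF.
Qed.

Lemma nrm_powR p v : p != 0 ->
  nrm Om p v `^ p = \int[L3]_(x in Om) (`|v x| `^ p).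
Proof. by move=> p0; rewrite /nrm -fine_poweR enrm_poweR. Qed.

Lemma powR2 (x : R) : `|x| `^ 2 = x ^+ 2.
Proof. by rewrite powR_mulrn// real_normK ?num_real. Qed.

Lemma nrm2_sqr v : nrm Om 2 v ^+ 2 = ip Om v v.
Proof.
rewrite -[LHS]powR2 ger0_norm ?fine_ge0 ?Lnorm_ge0// nrm_powR//.
by congr (Rintegral _ _ _); apply/funext => x; rewrite powR2 expr2.
Qed.

Lemma Lp2P v : Lp Om 2 v <-> sqint L3 Om v.
Proof.
rewrite /Lp enrm_lty//; have E : (fun x => (`|v x| `^ 2)%:E) = (fun x => (v x ^+ 2)%:E).
  by apply/funext => x; rewrite powR2.
split=> [[mv fv]|[mv /integrableP[_ fv]]]; split => //.
  apply/integrableP; split; first by apply/measurable_EFinP; exact: measurable_funX.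
  move: fv; rewrite E; congr (_ < _)%E; congr (integral _ _ _).
  by apply/funext => x; rewrite gee0_abs// lee_fin sqr_ge0.
rewrite E; move: fv; congr (_ < _)%E; congr (integral _ _ _).
by apply/funext => x; rewrite gee0_abs// lee_fin sqr_ge0.
Qed.

Lemma nrm2E v : Lp Om 2 v -> enrm Om 2 v = (nrm Om 2 v)%:E.
Proof. by move=> [_ fv]; rewrite /nrm fineK// ge0_fin_numE// Lnorm_ge0. Qed.

Lemma semi_inner_L2 : semi_inner (Lp Om 2) (ip Om).
Proof.
have -> : Lp Om 2 = sqint L3 Om by apply/funext => v; apply/propext; exact: Lp2P.
exact: (@semi_inner_sqint _ _ _ L3 Om mO).
Qed.

Lemma test_fun_Lp2 phi : test_fun Om phi -> Lp Om 2 phi.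
Proof.
move=> tp; apply/Lp2P; split.
  by apply: measurable_funTS; exact: test_fun_measurable tp.
apply: (@integrableS _ _ _ L3 setT) => //; exact: test_fun_L2 tp.
Qed.

Lemma ip_ae_congr v v' w : aeeq Om v v' -> ip Om v w = ip Om v' w.
Proof.
move=> vv'; rewrite /ip /Rintegral; congr fine; apply: ae_eq_integral_all.
by apply: (ae_imp vv') => x h Ox; rewrite h.
Qed.

Lemma is_wgrad_ae_congr v v' g : aeeq Om v v' -> is_wgrad Om v g -> is_wgrad Om v' g.
Proof.
move=> vv' gv i; have [lg h] := gv i; split => // phi tp.
by rewrite -h//; apply: ip_ae_congr; apply: (ae_imp vv') => x h' /h'.
Qed.

Lemma wgrad_ae_congr v v' : aeeq Om v v' -> wgrad Om v = wgrad Om v'.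
Proof.
move=> vv'; congr xget; apply/seteqP; split => g; first exact: is_wgrad_ae_congr.
by apply: is_wgrad_ae_congr; apply: (ae_imp vv') => x h /h.
Qed.

Lemma wgradP v : H1 Om v -> is_wgrad Om v (wgrad Om v).
Proof. by move=> [_ [g gv]]; exact: (@xgetPex _ (fun _ _ => 0) (is_wgrad Om v) (ex_intro _ g gv)). Qed.

Lemma wgrad_L2 v i : H1 Om v -> Lp Om 2 (wgrad Om v i).
Proof. by move=> /wgradP/(_ i)[]. Qed.

(** The difference of two weak gradients is orthogonal to all test functions, and it is integrable
    because [Om] has finite measure: the fundamental lemma applies. *)
Lemma is_wgrad_unique v g g' i : is_wgrad Om v g -> is_wgrad Om v g' ->
  aeeq Om (g i) (g' i).
Proof.
move=> /(_ i)[lg h] /(_ i)[lg' h']; have SI := semi_inner_L2.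
have ld : Lp Om 2 (g i - g' i) by apply: (si_XD SI) => //; exact: (si_XN SI).
have := @fundamental_lemma R Om (g i - g' i) oO (@sqint_integrable _ _ _ L3 Om mO _ fO ((Lp2P _).1 ld)) _.
move=> H; have {}H := H _; apply: (ae_imp (H _)).
  move=> phi tp; have lp := test_fun_Lp2 tp.
  rewrite (si_D SI)//; last exact: (si_XN SI).
  by rewrite (si_N SI)//; apply/eqP; rewrite subr_eq0 -eqr_opp -h// -h'.
by move=> x h0 Ox; apply/eqP; rewrite -subr_eq0; apply/eqP; exact: h0.
Qed.

End spaces.

Section fatou_bound.
Local Open Scope ereal_scope.
Context d (T : measurableType d) (R : realType) (mu : {measure set T -> \bar R}).

(** The limit is replaced almost everywhere by the lower limit of the sequence, to which Fatou's
    lemma applies. *)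
Lemma fatou_bound D (f_ : (T -> R)^nat) (f : T -> R) (M : \bar R) : measurable D ->
  (forall n, measurable_fun D (f_ n)) -> (forall n x, 0 <= f_ n x)%R ->
  {ae mu, forall x, D x -> f_ ^~ x @ \oo --> f x} ->
  (forall n, \int[mu]_(x in D) (f_ n x)%:E <= M) ->
  \int[mu]_(x in D) (f x)%:E <= M.
Proof.
move=> mD mf f0 cvgf fM.
have -> : \int[mu]_(x in D) (f x)%:E =
    \int[mu]_(x in D) limn_einf (fun n => (f_ n x)%:E).
  apply: ae_eq_integral_all; apply: (ae_imp cvgf) => x h Dx.
  have [] // := @cvg_limn_einf_sup R (fun n => (f_ n x)%:E) (f x)%:E.
  by apply: cvg_EFin; [exact: nearW|exact: h].
apply: le_trans (@fatou _ _ _ mu D mD (fun n x => (f_ n x)%:E) _ _) _.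
- by move=> n; exact/measurable_EFinP.
- by move=> n x _; rewrite lee_fin.
rewrite limn_einf_lim; apply: lime_le; first exact: is_cvg_einfs.
apply: nearW => n; apply: le_trans (fM n).
by apply: ereal_inf_lbound; exists n => //=.
Qed.

End fatou_bound.

Section generic_integrals.
Context d (T : measurableType d) (R : realType) (mu : {measure set T -> \bar R}).
Variables (D : set T) (mD : measurable D).

Lemma ae_and (P Q : T -> Prop) : (\forall x \ae mu, P x) -> (\forall x \ae mu, Q x) ->
  \forall x \ae mu, P x /\ Q x.
Proof. by move=> h1 h2; apply: filterI. Qed.

Lemma Rintegral_mulZl c (f g : T -> R) : sqint mu D f -> sqint mu D g ->
  \int[mu]_(x in D) (c * f x * g x) = c * \int[mu]_(x in D) (f x * g x).
Proof.
move=> sf sg; have i := sqint_mul mD sf sg; rewrite -RintegralZl//.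
by congr (Rintegral _ _ _); apply/funext => x; rewrite mulrA.
Qed.

Lemma integrable_sum_ord n (F : 'I_n -> T -> R) :
  (forall i, mu.-integrable D (EFin \o F i)) ->
  mu.-integrable D (fun x => (\sum_i F i x)%:E).
Proof.
move=> int; apply: (eq_integrable mD (fun x => \sum_i (F i x)%:E)%E).
  by move=> x _; rewrite sumEFin.
exact: (@integrable_sum _ _ _ mu D mD _ _ xpredT (fun i x => (F i x)%:E) (fun i _ => int i)).
Qed.

Lemma Rintegral_sum_ord n (F : 'I_n -> T -> R) :
  (forall i, mu.-integrable D (EFin \o F i)) ->
  \int[mu]_(x in D) (\sum_i F i x) = \sum_i \int[mu]_(x in D) F i x.
Proof.
elim: n F => [F _|n IH F int].
  by rewrite big_ord0; under eq_Rintegral do rewrite big_ord0; rewrite Rintegral_cst// mul0r.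
under eq_Rintegral do rewrite big_ord_recl.
rewrite RintegralD//; last exact: (integrable_sum_ord (fun i => int (lift ord0 i))).
by rewrite big_ord_recl IH// => i; exact: int.
Qed.

Lemma Rintegral_powR_normZ (c q : R) (f : T -> R) : measurable_fun D f ->
  (\int[mu]_(x in D) (`|f x| `^ q)%:E < +oo)%E ->
  \int[mu]_(x in D) (`|c * f x| `^ q) = `|c| `^ q * \int[mu]_(x in D) (`|f x| `^ q).
Proof.
move=> mf fq; rewrite -RintegralZl//.
  by congr (Rintegral _ _ _); apply/funext => x; rewrite normrM powRM.
apply/integrableP; split.
  apply/measurable_EFinP; apply: (measurableT_comp (measurable_powR q)).
  exact: measurableT_comp.
by move: fq; congr (_ < _)%E; congr (integral _ _ _); apply/funext => x; rewrite gee0_abs// lee_fin powR_ge0.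
Qed.

End generic_integrals.

Lemma sum_sqr_le_CS (R : realType) (n : nat) (x a b : 'I_n -> R) :
  (forall i, 0 <= a i) -> (forall i, 0 <= b i) -> (forall i, x i ^+ 2 <= a i * b i) ->
  (\sum_i x i) ^+ 2 <= (\sum_i a i) * \sum_i b i.
Proof.
move=> a0 b0 xab; rewrite -real_normK ?num_real//.
apply: sqr_le_of_amgm => [||| k k0]; rewrite ?sumr_ge0//.
rewrite mulr_sumr mulr_suml -big_split/=.
apply: (@le_trans _ _ (\sum_(i < n) 2 * `|x i|)).
  by rewrite -mulr_sumr ler_pM2l// ler_norm_sum.
apply: ler_sum => i _.
have : `|x i| ^+ 2 <= a i * b i by rewrite real_normK ?num_real.
move: `|x i| (normr_ge0 (x i)) => y y0 hy.
rewrite -(ler_pXn2r (n := 2)) ?nnegrE ?addr_ge0 ?mulr_ge0 ?invr_ge0 ?(ltW k0)//.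
have : 0 <= (k * a i - b i / k) ^+ 2 by exact: sqr_ge0.
have -> : (k * a i - b i / k) ^+ 2 = (k * a i + b i / k) ^+ 2 - 4 * (a i * b i).
  by field; rewrite gt_eqF.
by nra.
Qed.

Section gradient.
Context {R : realType} (Om : set (E3 R)).
Hypotheses (oO : open Om) (bO : bounded_set Om).
Local Notation L3 := (@leb3 R).
Local Notation fld := (E3 R -> R).
Local Notation wgrad := (wgrad Om).
Local Notation H1 := (H1 Om).
Local Notation H10 := (H10 Om).
Local Notation gradip := (gradip Om).
Implicit Types v w : fld.

Let mO : measurable Om := open_measurable3 oO.
Let SI := semi_inner_L2 oO.

Lemma aeeq_refl v : aeeq Om v v.
Proof. by apply/aeW => x. Qed.

Lemma Lp2D v w : Lp Om 2 v -> Lp Om 2 w -> Lp Om 2 (v + w).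
Proof. exact: (si_XD SI). Qed.

Lemma Lp2N v : Lp Om 2 v -> Lp Om 2 (- v).
Proof. exact: (si_XN SI). Qed.

Lemma Lp2Z c v : Lp Om 2 v -> Lp Om 2 (fun x => c * v x).
Proof. by move=> /Lp2P h; apply/Lp2P; exact: (@sqintZ _ _ _ L3 Om mO). Qed.

Lemma ipZl c v w : Lp Om 2 v -> Lp Om 2 w -> ip Om (fun x => c * v x) w = c * ip Om v w.
Proof.
move=> /Lp2P sv /Lp2P sw; exact: (@Rintegral_mulZl _ _ _ L3 Om mO c v w sv sw).
Qed.

Lemma test_partial_Lp2 phi i : test_fun Om phi -> Lp Om 2 (fun x => 'D_(basis3 i) phi x).
Proof. by move=> tp; apply: (test_fun_Lp2 oO); exact: test_fun_deriv. Qed.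

Lemma is_wgradD v w g h : Lp Om 2 v -> Lp Om 2 w -> is_wgrad Om v g ->
  is_wgrad Om w h -> is_wgrad Om (v + w) (fun i => g i + h i).
Proof.
move=> lv lw gv hw i; have [lg e1] := gv i; have [lh e2] := hw i.
split; first exact: Lp2D.
move=> phi tp; have lp := test_fun_Lp2 oO tp; have ldp := test_partial_Lp2 i tp.
by rewrite (si_D SI)// (si_D SI)// e1// e2// opprD.
Qed.

Lemma is_wgradN v g : Lp Om 2 v -> is_wgrad Om v g -> is_wgrad Om (- v) (fun i => - g i).
Proof.
move=> lv gv i; have [lg e1] := gv i; split; first exact: Lp2N.
move=> phi tp; have lp := test_fun_Lp2 oO tp; have ldp := test_partial_Lp2 i tp.
by rewrite (si_N SI)// (si_N SI)// e1.
Qed.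

Lemma is_wgradZ c v g : Lp Om 2 v -> is_wgrad Om v g ->
  is_wgrad Om (fun x => c * v x) (fun i x => c * g i x).
Proof.
move=> lv gv i; have [lg e1] := gv i; split; first exact: Lp2Z.
move=> phi tp; have lp := test_fun_Lp2 oO tp; have ldp := test_partial_Lp2 i tp.
by rewrite ipZl// ipZl// e1// mulrN.
Qed.

Lemma is_wgrad_test phi : test_fun Om phi ->
  is_wgrad Om phi (fun i x => 'D_(basis3 i) phi x).
Proof.
move=> tp i; split; first exact: test_partial_Lp2.
by move=> psi tpsi; exact: integration_by_parts.
Qed.

Lemma H1_test phi : test_fun Om phi -> H1 phi.
Proof.
by move=> tp; split; [exact: test_fun_Lp2|exists (fun i x => 'D_(basis3 i) phi x); exact: is_wgrad_test].
Qed.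

Lemma H1D v w : H1 v -> H1 w -> H1 (v + w).
Proof.
move=> [lv [g gv]] [lw [h hw]]; split; first exact: Lp2D.
by exists (fun i => g i + h i); exact: is_wgradD.
Qed.

Lemma H1N v : H1 v -> H1 (- v).
Proof.
move=> [lv [g gv]]; split; first exact: Lp2N.
by exists (fun i => - g i); exact: is_wgradN.
Qed.

Lemma H1Z c v : H1 v -> H1 (fun x => c * v x).
Proof.
move=> [lv [g gv]]; split; first exact: Lp2Z.
by exists (fun i x => c * g i x); exact: is_wgradZ.
Qed.

Lemma wgrad_eq v g i : H1 v -> is_wgrad Om v g -> aeeq Om (wgrad v i) (g i).
Proof. by move=> /wgradP h h'; exact: (is_wgrad_unique oO bO i h h'). Qed.

Lemma wgradD v w i : H1 v -> H1 w -> aeeq Om (wgrad (v + w) i) (wgrad v i + wgrad w i).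
Proof.
move=> hv hw; apply: (wgrad_eq (g := fun i => wgrad v i + wgrad w i)); first exact: H1D.
by apply: is_wgradD; [exact: hv.1|exact: hw.1|exact: wgradP|exact: wgradP].
Qed.

Lemma wgradN v i : H1 v -> aeeq Om (wgrad (- v) i) (- wgrad v i).
Proof.
move=> hv; apply: (wgrad_eq (g := fun i => - wgrad v i)); first exact: H1N.
by apply: is_wgradN; [exact: hv.1|exact: wgradP].
Qed.

Lemma wgradZ c v i : H1 v -> aeeq Om (wgrad (fun x => c * v x) i) (fun x => c * wgrad v i x).
Proof.
move=> hv; apply: (wgrad_eq (g := fun i x => c * wgrad v i x)); first exact: H1Z.
by apply: is_wgradZ; [exact: hv.1|exact: wgradP].
Qed.

Lemma gradipE v w : H1 v -> H1 w -> gradip v w = \sum_(i < 3) ip Om (wgrad v i) (wgrad w i).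
Proof.
move=> hv hw; have int i : L3.-integrable Om (fun x => (wgrad v i x * wgrad w i x)%:E).
  apply: (@sqint_mul _ _ _ L3 Om mO); apply/Lp2P; exact: wgrad_L2.
exact: (@Rintegral_sum_ord _ _ _ L3 Om mO _ (fun i x => wgrad v i x * wgrad w i x)).
Qed.

Lemma ip_ae_congr2 v v' w w' : aeeq Om v v' -> aeeq Om w w' -> ip Om v w = ip Om v' w'.
Proof. by move=> h h'; rewrite (ip_ae_congr _ h) (si_sym SI) (ip_ae_congr _ h') (si_sym SI). Qed.

Lemma semi_inner_H1 : semi_inner H1 gradip.
Proof.
have gl v i : H1 v -> Lp Om 2 (wgrad v i) by exact: wgrad_L2.
split.
- exact: H1D.
- exact: H1N.
- move=> v w; rewrite /Defs.gradip; congr (Rintegral _ _ _); apply/funext => x.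
  by apply: eq_bigr => i _; rewrite mulrC.
- move=> u v w hu hv hw; rewrite !gradipE//; last exact: H1D.
  rewrite -big_split /=; apply: eq_bigr => i _.
  by rewrite (ip_ae_congr _ (wgradD i hu hv)) (si_D SI)//; exact: gl.
- move=> v w hv hw; rewrite !gradipE//; last exact: H1N.
  rewrite -sumrN /=; apply: eq_bigr => i _.
  by rewrite (ip_ae_congr _ (wgradN i hv)) (si_N SI)//; exact: gl.
- move=> v; apply: Rintegral_ge0 => x _; apply: sumr_ge0 => i _.
  by rewrite -expr2 sqr_ge0.
- move=> v w hv hw; rewrite (gradipE hv hw) (gradipE hv hv) (gradipE hw hw).
  apply: sum_sqr_le_CS => i; [exact: (si_ge0 SI)|exact: (si_ge0 SI)|].
  by apply: (si_CS SI); exact: gl.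
Qed.

Lemma gradnrm_sqr v : gradnrm Om v ^+ 2 = gradip v v.
Proof.
rewrite /gradnrm /egradnrm -/(nrm _ _ _) nrm2_sqr// /ip /Defs.gradip.
congr (Rintegral _ _ _); apply/funext => x; rewrite -expr2 sqr_sqrtr.
  by apply: eq_bigr => i _; rewrite expr2.
by apply: sumr_ge0 => i _; rewrite sqr_ge0.
Qed.

Lemma gradnrm_ge0 v : 0 <= gradnrm Om v.
Proof. by rewrite fine_ge0// Lnorm_ge0. Qed.

Lemma egradnrmE v : H1 v -> egradnrm Om v = (gradnrm Om v)%:E.
Proof.
move=> hv; apply: nrm2E; apply/Lp2P; split.
  apply: (measurableT_comp (continuous_measurable_fun (@sqrt_continuous R))); apply: measurable_sum => i.
  by apply: measurable_funX; case: (wgrad_L2 i hv).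
have int i : L3.-integrable Om (fun x => (wgrad v i x ^+ 2)%:E).
  by have /Lp2P[] := wgrad_L2 i hv.
have := @integrable_sum_ord _ _ _ L3 Om mO _ (fun i x => wgrad v i x ^+ 2) int.
by congr (L3.-integrable Om _); apply/funext => x; rewrite sqr_sqrtr//;
apply: sumr_ge0 => i _; rewrite sqr_ge0.
Qed.

Lemma gradipZ c v : H1 v -> gradip (fun x => c * v x) (fun x => c * v x) = c ^+ 2 * gradip v v.
Proof.
move=> hv; rewrite !gradipE//; [|exact: H1Z..].
rewrite mulr_sumr; apply: eq_bigr => i _.
rewrite (ip_ae_congr2 (wgradZ c i hv) (wgradZ c i hv)) ipZl//; [|exact: wgrad_L2|].
  by rewrite (si_sym SI) ipZl; [rewrite mulrA -expr2|exact: wgrad_L2..].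
by apply: Lp2Z; exact: wgrad_L2.
Qed.

End gradient.

Section semi_inner_theory.
Context (R : realType) (V : zmodType) (X : V -> Prop) (B : V -> V -> R).
Hypothesis SI : semi_inner X B.

Lemma si_XB v w : X v -> X w -> X (v - w).
Proof. by move=> hv hw; apply: (si_XD SI) => //; exact: (si_XN SI). Qed.

Lemma si_Nr v w : X v -> X w -> B v (- w) = - B v w.
Proof. by move=> hv hw; rewrite (si_sym SI) (si_N SI)// (si_sym SI). Qed.

Lemma si_Dr u v w : X u -> X v -> X w -> B u (v + w) = B u v + B u w.
Proof. by move=> hu hv hw; rewrite (si_sym SI) (si_D SI)// (si_sym SI v) (si_sym SI w). Qed.

Lemma si_sqrD v w : X v -> X w -> B (v + w) (v + w) = B v v + 2 * B v w + B w w.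
Proof.
move=> hv hw; have hvw := si_XD SI hv hw.
by rewrite (si_D SI)// !si_Dr// (si_sym SI w v); ring.
Qed.

Lemma si_sqrN v : X v -> B (- v) (- v) = B v v.
Proof. by move=> hv; rewrite (si_N SI)//; [rewrite si_Nr// opprK|exact: (si_XN SI)]. Qed.

Lemma si_sqrB v w : X v -> X w -> B (v - w) (v - w) = B v v - 2 * B v w + B w w.
Proof.
move=> hv hw; rewrite si_sqrD//; last exact: (si_XN SI).
by rewrite si_Nr// si_sqrN//; ring.
Qed.

Lemma si_sqrD_le v w : X v -> X w -> B (v + w) (v + w) <= 2 * (B v v + B w w).
Proof.
move=> hv hw; rewrite si_sqrD//; have := si_ge0 SI (v - w).
by rewrite si_sqrB//; lra.
Qed.

Lemma si_sqrD_lt v w e : X v -> X w -> B v v < e / 4 -> B w w < e / 4 ->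
  B (v + w) (v + w) < e.
Proof. by move=> hv hw h1 h2; apply: le_lt_trans (si_sqrD_le hv hw) _; lra. Qed.

Lemma si_sqrB_le4 v w M : X v -> X w -> B v v <= M -> B w w < M ->
  B (v - w) (v - w) <= 4 * M.
Proof.
move=> hv hw h1 h2; apply: le_trans (si_sqrD_le hv (si_XN SI hw)) _.
by rewrite si_sqrN//; lra.
Qed.

End semi_inner_theory.

Lemma prod3_le_sum (R : realFieldType) (F : 'I_3 -> R) : (forall i, 0 <= F i) ->
  F 0 * (F 1 * F 2%:R) <= (\sum_i F i) ^+ 3.
Proof.
move=> F0; rewrite !big_ord_recl big_ord0 addr0.
rewrite (_ : lift ord0 (lift ord0 ord0) = 2%:R)//; last exact/val_inj.
rewrite (_ : lift ord0 ord0 = 1)//; last exact/val_inj.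
rewrite (_ : ord0 = 0)//; move: (F 0) (F 1) (F 2%:R) (F0 0) (F0 1) (F0 2%:R) => a b c a0 b0 c0.
have -> : (a + (b + c)) ^+ 3 = (a + (b + c)) * ((a + (b + c)) * (a + (b + c))) by ring.
by apply: ler_pM; rewrite ?mulr_ge0//; [lra|apply: ler_pM => //; lra].
Qed.

(** * The Sobolev inequality on H^1_0 *)

Section sobolev.
Context {R : realType} (Om : set (E3 R)).
Hypotheses (oO : open Om) (bO : bounded_set Om).
Local Notation L3 := (@leb3 R).
Local Notation fld := (E3 R -> R).
Local Notation wgrad := (wgrad Om).
Local Notation H1 := (H1 Om).
Local Notation H10 := (H10 Om).
Local Notation gradip := (gradip Om).
Implicit Types v w : fld.

Let mO : measurable Om := open_measurable3 oO.
Let fO : (L3 Om < +oo)%E := leb3_bounded_lty mO bO.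
Let SI := semi_inner_L2 oO.
Let SG := semi_inner_H1 oO bO.

(** Squared norms replace norms in the density condition, which makes the algebra of [semi_inner]
    available. *)
Lemma H10P v : H10 v <-> H1 v /\ forall eps, 0 < eps -> exists phi : fld,
  [/\ test_fun Om phi, ip Om (v - phi) (v - phi) < eps & gradip (v - phi) (v - phi) < eps].
Proof.
split=> -[hv h]; split => // e e0.
  have se : 0 < Num.sqrt e by rewrite sqrtr_gt0.
  have [phi [tp e1 e2]] := h _ se; exists phi; split => //.
    have d1 : Lp Om 2 (v - phi) by apply: (si_XB SI) => //; [exact: hv.1|exact: test_fun_Lp2].
    move: e1; rewrite (nrm2E d1) lte_fin => e1.
    rewrite -nrm2_sqr// -[e]sqr_sqrtr ?ltW// ltr_pXn2r ?nnegrE ?sqrtr_ge0//.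
    by rewrite fine_ge0// Lnorm_ge0.
  have d1 : H1 (v - phi) by apply: (si_XB SG) => //; exact: H1_test.
  move: e2; rewrite (egradnrmE oO d1) lte_fin => e2.
  rewrite -gradnrm_sqr// -[e]sqr_sqrtr ?ltW// ltr_pXn2r ?nnegrE ?sqrtr_ge0//.
  exact: gradnrm_ge0.
have [phi [tp e1 e2]] := h (e ^+ 2) (exprn_gt0 2 e0); exists phi; split => //.
  have d1 : Lp Om 2 (v - phi) by apply: (si_XB SI) => //; [exact: hv.1|exact: test_fun_Lp2].
  rewrite (nrm2E d1) lte_fin -(ltr_pXn2r (n := 2)) ?nnegrE ?(ltW e0)//.
    by rewrite nrm2_sqr.
  by rewrite fine_ge0// Lnorm_ge0.
have d1 : H1 (v - phi) by apply: (si_XB SG) => //; exact: H1_test.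
rewrite (egradnrmE oO d1) lte_fin -(ltr_pXn2r (n := 2)) ?nnegrE ?(ltW e0)//.
  by rewrite gradnrm_sqr.
exact: gradnrm_ge0.
Qed.

Lemma H10_H1 v : H10 v -> H1 v. Proof. by case. Qed.

Lemma H10_Lp2 v : H10 v -> Lp Om 2 v. Proof. by case=> -[]. Qed.

Lemma H10D v w : H10 v -> H10 w -> H10 (v + w).
Proof.
move=> /H10P[hv av] /H10P[hw aw]; apply/H10P; split; first exact: H1D.
move=> e e0; have e4 : 0 < e / 4 by rewrite divr_gt0.
have [phi [tp p1 p2]] := av _ e4; have [psi [tq q1 q2]] := aw _ e4.
have E : v + w - (phi + psi) = (v - phi) + (w - psi) by rewrite opprD addrACA.
exists (phi + psi); split; first exact: test_funD.
- rewrite E; apply: (si_sqrD_lt SI _ _ p1 q1).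
    by apply: (si_XB SI); [exact: hv.1|exact: test_fun_Lp2].
  by apply: (si_XB SI); [exact: hw.1|exact: test_fun_Lp2].
- rewrite E; apply: (si_sqrD_lt SG _ _ p2 q2).
    by apply: (si_XB SG) => //; exact: H1_test.
  by apply: (si_XB SG) => //; exact: H1_test.
Qed.

Lemma H10Z c v : H10 v -> H10 (fun x => c * v x).
Proof.
move=> /H10P[hv av]; apply/H10P; split; first exact: H1Z.
(* The added 1 covers the case c = 0. *)
move=> e e0; have c0 : 0 < c ^+ 2 + 1 by rewrite ltr_wpDl ?sqr_ge0.
have ec : 0 < e / (c ^+ 2 + 1) by rewrite divr_gt0.
have [phi [tp p1 p2]] := av _ ec.
have E : (fun x => c * v x) - (fun x => c * phi x) = (fun x => c * (v - phi) x).
  by apply/funext => x; rewrite /= -[LHS]/(c * v x - c * phi x) -mulrBr.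
have fin (y : R) : 0 <= y -> y < e / (c ^+ 2 + 1) -> c ^+ 2 * y < e.
  move=> y0; rewrite ltr_pdivlMr// => h; have := sqr_ge0 c; nra.
exists (fun x => c * phi x); split; first exact: test_funZ.
- have d1 : Lp Om 2 (v - phi) by apply: (si_XB SI); [exact: hv.1|exact: test_fun_Lp2].
  rewrite E ipZl//; last exact: Lp2Z.
  rewrite (si_sym SI) ipZl// mulrA -expr2; apply: fin => //; exact: (si_ge0 SI).
- have d1 : H1 (v - phi) by apply: (si_XB SG) => //; exact: H1_test.
  by rewrite E gradipZ//; apply: fin => //; exact: (si_ge0 SG).
Qed.

Lemma H10N v : H10 v -> H10 (- v).
Proof.
move=> /(H10Z (-1)); congr (Defs.H10 _ _).
by apply/funext => x; rewrite mulN1r.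
Qed.

Lemma semi_inner_H10 : semi_inner H10 gradip.
Proof.
split; [exact: H10D|exact: H10N|exact: (si_sym SG)| | |exact: (si_ge0 SG)|].
- by move=> u v w /H10_H1 hu /H10_H1 hv /H10_H1 hw; exact: (si_D SG).
- by move=> v w /H10_H1 hv /H10_H1 hw; exact: (si_N SG).
- by move=> v w /H10_H1 hv /H10_H1 hw; exact: (si_CS SG).
Qed.

Lemma sobolev_test_gradip phi : test_fun Om phi ->
  (\int[L3]_(x in Om) (phi x ^+ 6)%:E <= (16 ^+ 3 * gradip phi phi ^+ 3)%:E)%E.
Proof.
move=> tp; have i6 := test_fun_integrable (test_funX tp (isT : (0 < 6)%N)).
have p6 x : (0 <= (phi x ^+ 6)%:E)%E by rewrite lee_fin exprn_even_ge0.
apply: (@le_trans _ _ (\int[L3]_x (phi x ^+ 6)%:E)%E).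
  apply: (@ge0_subset_integral _ _ _ L3) => //.
  by apply/measurable_EFinP; exact: test_fun_measurable (test_funX tp (isT : (0 < 6)%N)).
have -> : (\int[L3]_x (phi x ^+ 6)%:E = (\int[L3]_x (phi x ^+ 6))%:E)%E.
  by rewrite /Rintegral fineK//; apply: integrable_fin_num.
rewrite lee_fin; apply: le_trans (sobolev_test tp) _.
rewrite ler_pM2l ?exprn_gt0// gradipE//; [|exact: H1_test..].
have D (i : 'I_3) : ip Om (wgrad phi i) (wgrad phi i) = \int[L3]_x ('D_(basis3 i) phi x ^+ 2).
  have h := wgrad_eq oO bO i (H1_test oO tp) (is_wgrad_test oO tp).
  rewrite (ip_ae_congr2 oO h h) (ip_support _ (test_fun_deriv _ tp)).
  by congr (Rintegral _ _ _); apply/funext => x; rewrite expr2.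
under eq_bigr do rewrite D.
have P (i : 'I_3) : 0 <= \int[L3]_x ('D_(basis3 i) phi x ^+ 2).
  by apply: Rintegral_ge0 => x _; exact: sqr_ge0.
exact: (prod3_le_sum P).
Qed.

(** Approximate by test functions, for which the inequality is known, and pass to the limit by
    Fatou. A positive [M] leaves room for the gradients of the approximants, at most 4 M, whence 64
    = 16 * 4. *)
Lemma sobolev6_aux v M : H10 v -> 0 < M -> gradip v v <= M ->
  (\int[L3]_(x in Om) (v x ^+ 6)%:E <= (64 ^+ 3 * M ^+ 3)%:E)%E.
Proof.
move=> hv M0 vM; have /H10P[h1 av] := hv.
(* The rate 2^-n in L^2 forces convergence almost everywhere; the cap by [M] controls the
   gradients. *)
have ph n : {phi : fld | [/\ test_fun Om phi,
    ip Om (v - phi) (v - phi) < Num.min M ((2^-1) ^+ n) &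
    gradip (v - phi) (v - phi) < Num.min M ((2^-1) ^+ n)]}.
  by apply: cid; apply: av; rewrite lt_min M0 exprn_gt0.
pose phi n := sval (ph n).
have tp n : test_fun Om (phi n) by rewrite /phi; case: (ph n) => ? [].
have d1 n : Lp Om 2 (v - phi n) by apply: (si_XB SI); [exact: h1.1|exact: test_fun_Lp2].
have mp n : measurable_fun Om (phi n).
  by apply: (@measurable_funTS _ _ _ _ Om); exact: test_fun_measurable (tp n).
have mv : measurable_fun Om v by case: (h1.1).
have cvgp : {ae L3, forall x, Om x -> phi ^~ x @ \oo --> v x}.
  apply: (@ae_cvg_of_summable _ _ _ L3 Om phi v mO mp mv) => n.
  have E : (\int[L3]_(x in Om) ((phi n x - v x) ^+ 2)%:E =
      (ip Om (v - phi n) (v - phi n))%:E)%E.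
    rewrite /ip /Rintegral fineK.
      congr (integral _ _ _); apply/funext => x.
      by rewrite -[(v - phi n) x]/(v x - phi n x); congr EFin; ring.
    apply: (@integrable_fin_num _ _ _ L3 Om) => //.
    by have /Lp2P s1 := d1 n; exact: (@sqint_mul _ _ _ L3 Om mO _ _ s1 s1).
  rewrite E lee_fin ltW//; rewrite /phi; case: (ph n) => p [] /= _ + _.
  by rewrite lt_min => /andP[].
apply: (@fatou_bound _ _ _ L3 Om (fun n x => phi n x ^+ 6)) => //.
- by move=> n; exact: (@measurable_funX _ _ _ Om).
- by move=> n x; rewrite exprn_even_ge0.
- apply: (ae_imp cvgp) => x h Ox; have {}h := h Ox.
  exact: (cvg_comp _ _ h (@exprn_continuous R 6 (v x))).
move=> n; apply: le_trans (sobolev_test_gradip (tp n)) _; rewrite lee_fin.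
have h2 : gradip (phi n) (phi n) <= 4 * M.
  have -> : phi n = v + (- (v - phi n)) by rewrite opprB addrCA subrr addr0.
  have hd : H1 (v - phi n) by apply: (si_XB SG) => //; exact: H1_test.
  apply: (si_sqrB_le4 SG h1 hd vM).
  by rewrite /phi; case: (ph n) => p [] /= _ _; rewrite lt_min => /andP[].
have -> : 64 ^+ 3 * M ^+ 3 = 16 ^+ 3 * (4 * M) ^+ 3 by ring.
rewrite ler_pM2l ?exprn_gt0// ler_pXn2r ?nnegrE//; last by rewrite mulr_ge0// ltW.
exact: (si_ge0 SG).
Qed.

(** One constant for all exponents 0 < q <= 6: the volume accounts for the points where the rescaled
    function is at most 1, the number 64^3 for the exponent 6. *)
Definition sobolev_cst : R := fine (L3 Om) + 64 ^+ 3.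

Lemma sobolev_cst_gt0 : 0 < sobolev_cst.
Proof. by rewrite ltr_wpDl ?fine_ge0// exprn_gt0. Qed.

(** With s the square root of [M], the function v / s has gradient norm at most 1, and y^q <= 1 +
    y^6 reduces every exponent to 6. *)
Lemma sobolev_aux q v M : 0 < q -> q <= 6 -> H10 v -> 0 < M -> gradip v v <= M ->
  (\int[L3]_(x in Om) (`|v x| `^ q)%:E <= (sobolev_cst * M `^ (q / 2))%:E)%E.
Proof.
move=> q0 q6 hv M0 vM; pose s := M `^ 2^-1.
have s0 : 0 < s by rewrite powR_gt0.
have s2 : s ^+ 2 = M by rewrite -powR_mulrn ?ltW// /s -powRrM mulVf// powRr1// ltW.
have mv : measurable_fun Om v by case: (H10_Lp2 hv).
pose b x : R := s `^ q * (1 + (v x ^+ 6) / s ^+ 6).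
have m6 : measurable_fun Om (fun x => v x ^+ 6 / s ^+ 6).
  by apply: measurable_funM => //; exact: (@measurable_funX _ _ _ Om).
have n6 x : 0 <= v x ^+ 6 / s ^+ 6 by rewrite divr_ge0// exprn_even_ge0.
apply: (@le_trans _ _ (\int[L3]_(x in Om) (b x)%:E)%E).
  apply: le_integral_ge0 => x _; rewrite lee_fin ?powR_ge0// /b.
  have -> : `|v x| = s * (`|v x| / s) by rewrite mulrCA divff ?gt_eqF// mulr1.
  have y0 : 0 <= `|v x| / s by rewrite divr_ge0// ltW.
  rewrite powRM ?(ltW s0)// ler_pM2l ?powR_gt0//.
  have -> : v x ^+ 6 / s ^+ 6 = (`|v x| / s) ^+ 6.
    by rewrite expr_div_n -normrX (ger0_norm (exprn_even_ge0 _ _)).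
  move: (`|v x| / s) y0 => y y0.
  have [y1|y1] := leP y 1.
    apply: (@le_trans _ _ 1); last by rewrite lerDl exprn_ge0.
    by rewrite -[leRHS](congr1 (@^~ q) (@powR1 R)); apply: ge0_ler_powR; rewrite ?nnegrE// ltW.
  apply: (@le_trans _ _ (y ^+ 6)); last by rewrite lerDr.
  by rewrite -powR_mulrn//; apply: ler_powR => //; exact: ltW.
rewrite /b; under eq_integral do rewrite EFinM.
rewrite (@ge0_integralZl_EFin _ _ _ L3 Om mO) ?powR_ge0//; last 2 first.
- by move=> x _; rewrite lee_fin addr_ge0.
- by apply/measurable_EFinP; apply: measurable_funD.
under eq_integral do rewrite EFinD.
rewrite (@ge0_integralD _ _ _ L3 Om mO)//; last 2 first.
- by move=> x _; rewrite lee_fin.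
- exact/measurable_EFinP.
rewrite (@integral_cst _ _ _ L3 Om mO) mul1e.
under eq_integral do rewrite mulrC EFinM.
rewrite (@ge0_integralZl_EFin _ _ _ L3 Om mO) ?invr_ge0 ?exprn_ge0 ?(ltW s0)//; last 2 first.
- by move=> x _; rewrite lee_fin exprn_even_ge0.
- by apply/measurable_EFinP; exact: (@measurable_funX _ _ _ Om).
have -> : s `^ q = M `^ (q / 2) by rewrite /s -powRrM mulrC.
rewrite [sobolev_cst * _]mulrC EFinM lee_wpmul2l ?lee_fin ?powR_ge0//.
rewrite /sobolev_cst EFinD; apply: leeD; first by rewrite fineK// ge0_fin_numE.
rewrite muleC; apply: (@le_trans _ _ ((64 ^+ 3 * M ^+ 3)%:E * (s ^+ 6)^-1%:E)%E).
  by rewrite lee_wpmul2r ?lee_fin ?invr_ge0 ?exprn_ge0 ?(ltW s0)//; exact: sobolev6_aux.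
rewrite -EFinM lee_fin (_ : s ^+ 6 = M ^+ 3); last by rewrite -s2 -exprM.
by rewrite mulfK// expf_neq0// gt_eqF.
Qed.

Lemma sobolev q v : 0 < q -> q <= 6 -> H10 v ->
  (\int[L3]_(x in Om) (`|v x| `^ q)%:E <= (sobolev_cst * gradip v v `^ (q / 2))%:E)%E.
Proof.
move=> q0 q6 hv; have := si_ge0 SG v; rewrite le_eqVlt => /orP[/eqP G0|G0]; last first.
  exact: sobolev_aux.
rewrite -G0 powR0 ?mulr0; last by rewrite mulf_neq0 ?invr_neq0 ?gt_eqF.
apply/lee_addgt0Pr => e e0; rewrite add0e.
have K0 := sobolev_cst_gt0.
(* For a vanishing gradient every positive [M] is allowed; this one makes the right-hand side equal
   to [e]. *)
apply: le_trans (sobolev_aux (M := (e / sobolev_cst) `^ (2 / q)) q0 q6 hv _ _) _.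
- by rewrite powR_gt0// divr_gt0.
- by rewrite -G0 powR_ge0.
rewrite -powRrM (_ : 2 / q * (q / 2) = 1); last by field; rewrite gt_eqF.
by rewrite powRr1 ?divr_ge0 ?(ltW e0) ?(ltW K0)// mulrCA divff ?mulr1// gt_eqF.
Qed.

Lemma H10_Lp q v : 0 < q -> q <= 6 -> H10 v -> Lp Om q v.
Proof.
move=> q0 q6 hv; split; first by case: (H10_Lp2 hv).
by rewrite enrm_lty//; apply: le_lt_trans (sobolev q0 q6 hv) _; rewrite ltry.
Qed.

Lemma sobolev_Rintegral q v : 0 < q -> q <= 6 -> H10 v ->
  \int[L3]_(x in Om) (`|v x| `^ q) <= sobolev_cst * gradip v v `^ (q / 2).
Proof.
move=> q0 q6 hv; rewrite -lee_fin /Rintegral fineK; first exact: sobolev.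
rewrite ge0_fin_numE; last by apply: integral_ge0 => x _; rewrite lee_fin powR_ge0.
by apply: le_lt_trans (sobolev q0 q6 hv) _; rewrite ltry.
Qed.

Lemma nrmZ q c v : 0 < q -> Lp Om q v -> nrm Om q (fun x => c * v x) = `|c| * nrm Om q v.
Proof.
move=> q0 [mv fv]; have qn : q != 0 by rewrite gt_eqF.
apply: (@powR_injective R q) => //; rewrite ?nnegrE ?mulr_ge0 ?fine_ge0 ?Lnorm_ge0//.
rewrite powRM ?fine_ge0 ?Lnorm_ge0// !nrm_powR//.
move: fv; rewrite enrm_lty// => fv; exact: (@Rintegral_powR_normZ _ _ _ L3 Om mO).
Qed.

End sobolev.

(** * The source term *)

Section powers.
Context {R : realType}.
Implicit Types (p q x y z : R).

Lemma powRr_pred p z : 0 < z -> z `^ p = z `^ (p - 1) * z.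
Proof.
move=> z0; rewrite -[X in _ * X]powRr1 ?ltW// -powRD ?subrK//.
by rewrite (gt_eqF z0) implybT.
Qed.

Lemma powR_small (r e x : R) : 0 < r -> 0 < e -> 0 <= x -> x <= e `^ r^-1 -> x `^ r <= e.
Proof.
move=> r0 e0 x0 xe; have -> : e = (e `^ r^-1) `^ r.
  by rewrite -powRrM mulVf ?gt_eqF// powRr1// ltW.
by apply: ge0_ler_powR; rewrite ?nnegrE ?powR_ge0// ltW.
Qed.

Lemma is_derive_norm_powR p z : 0 < p ->
  is_derive z 1 (fun y => `|y| `^ (p + 1)) ((p + 1) * (`|z| `^ (p - 1) * z)).
Proof.
move=> p0; have [z0|z0|<-] := ltgtP 0 z.
- have Dn : \near z, (fun y => y `^ (p + 1)) z = `|z| `^ (p + 1).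
    near=> y; rewrite gtr0_norm//.
    by near: y; exact: lt_nbhsr.
  apply: (near_eq_is_derive Dn); rewrite gtr0_norm//.
  have := is_derive1_powR (p + 1) z0; rewrite addrK (powRr_pred p)//.
- have Dn : \near z, (fun y => (- y) `^ (p + 1)) z = `|z| `^ (p + 1).
    near=> y; rewrite ltr0_norm//.
    by near: y; exact: lt_nbhsl.
  apply: (near_eq_is_derive Dn); rewrite ltr0_norm//.
  have nz0 : 0 < - z by rewrite oppr_gt0.
  have d1 : is_derive z 1 (fun y : R => - y) (- 1) by exact: is_deriveN.
  have := @is_derive1_comp R ((@powR R)^~ (p + 1)) (fun y => - y) z _ _ (is_derive1_powR (p + 1) nz0) d1.
  by rewrite addrK (powRr_pred p)// mulrN1 -!mulrN opprK.
(* At 0 the difference quotient has absolute value |h|^p, which tends to 0. *)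
- have cv : h^-1 *: (((fun y : R => `|y| `^ (p + 1)) \o shift (0 : R)) (h *: (1 : R)) - `|0 : R| `^ (p + 1))
      @[h --> 0^'] --> (0 : R).
    apply/cvgr0Pnorm_le => e e0; near=> h.
    have h0 : h != 0 by near: h; exact: nbhs_dnbhs_neq.
    rewrite normr0 powR0 ?subr0; last by rewrite gt_eqF// ltr_wpDr.
    rewrite /= addr0 [h *: 1]mulr1 [_ *: _]/GRing.scale/= normrM normfV.
    rewrite (ger0_norm (powR_ge0 _ _)) (powRr_pred (p + 1)) ?normr_gt0// addrK.
    rewrite mulrCA mulVf ?normr_eq0// mulr1; apply: powR_small => //.
    near: h; apply: dnbhs0_le; exact: powR_gt0.
  have := cv; rewrite mulr0 mulr0.
  move=> _; apply: DeriveDef; first by apply/cvg_ex; exists 0.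
  exact: (cvg_lim _ cv).
Unshelve. all: by end_near. Qed.

Lemma continuous_norm_powR r : 0 < r -> continuous (fun z : R => `|z| `^ r).
Proof.
move=> r0 z; have [->|z0] := eqVneq z 0.
  rewrite /continuous_at normr0 powR0 ?gt_eqF//.
  apply/cvgr0Pnorm_le => e e0; near=> h.
  rewrite (ger0_norm (powR_ge0 _ _)); apply: powR_small => //.
  near: h; exact: (@nbhs0_le _ R _ (powR_gt0 r^-1 e0)).
apply: (continuous_comp (f := fun z : R => `|z|) (g := fun x => x `^ r)); first exact: norm_continuous.
apply: differentiable_continuous; apply/derivable1_diffP.
by have d := @is_derive1_powR R r `|z|; apply: ex_derive; apply: d; rewrite normr_gt0.
Unshelve. all: by end_near. Qed.

Lemma continuous_sgn_powR p : 1 <= p -> continuous (fun z : R => `|z| `^ (p - 1) * z).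
Proof.
rewrite le_eqVlt => /orP[/eqP <-|p1].
  rewrite subrr (_ : (fun z => _) = id); first by move=> z; exact: cvg_id.
  by apply/funext => z; rewrite powRr0 mul1r.
move=> z; apply: cvgM; last exact: cvg_id.
by apply: continuous_norm_powR; rewrite subr_gt0.
Qed.

Lemma is_derive_sumr (I : Type) (s : seq I) (F : I -> R -> R) (F' : I -> R) (z : R) :
  (forall i, is_derive z 1 (F i) (F' i)) ->
  is_derive z 1 (fun y => \sum_(i <- s) F i y) (\sum_(i <- s) F' i).
Proof.
move=> h; elim: s => [|i s IH].
  rewrite big_nil (_ : (fun y => _) = cst 0); first exact: is_derive_cst.
  by apply/funext => y; rewrite big_nil.
rewrite big_cons (_ : (fun y => _) = F i + (fun y => \sum_(i <- s) F i y)).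
  exact: is_deriveD.
by apply/funext => y; rewrite big_cons.
Qed.

Lemma continuous_sumr (I : Type) (s : seq I) (F : I -> R -> R) :
  (forall i, continuous (F i)) -> continuous (fun y => \sum_(i <- s) F i y).
Proof.
move=> h z; elim: s => [|i s IH].
  by rewrite (_ : (fun y => _) = cst 0); [exact: cst_continuous|apply/funext => y; rewrite big_nil].
rewrite (_ : (fun y => _) = F i + (fun y => \sum_(i <- s) F i y)).
  by apply: continuousD; [exact: h|exact: IH].
by apply/funext => y; rewrite big_cons.
Qed.

End powers.

Section source.
Context {R : realType} (P : problem R).
Hypotheses (p1 : forall i, 1 <= @pexp R P i) (q1 : forall j, 1 <= @qexp R P j).

Definition primitive (z : R) : R :=
  \sum_i @acoef R P i / (@pexp R P i + 1) * `|z| `^ (@pexp R P i + 1) -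
  \sum_j @bcoef R P j / (@qexp R P j + 1) * `|z| `^ (@qexp R P j + 1).

Lemma source_continuous : continuous (source P).
Proof.
move=> z; apply: continuousB; apply: continuous_sumr => i y.
  rewrite /= (_ : (fun y => _) = (fun y => @acoef R P i * (`|y| `^ (pexp i - 1) * y))).
    by apply: cvgM; [exact: cvg_cst|exact: continuous_sgn_powR].
  by apply/funext => x; rewrite mulrA.
rewrite /= (_ : (fun y => _) = (fun y => @bcoef R P i * (`|y| `^ (qexp i - 1) * y))).
  by apply: cvgM; [exact: cvg_cst|exact: continuous_sgn_powR].
by apply/funext => x; rewrite mulrA.
Qed.

Lemma is_derive_primitive (z : R) : is_derive z (1 : R) primitive (source P z).
Proof.
have D (c p : R) : 1 <= p ->
    is_derive z (1 : R) (fun y => c / (p + 1) * `|y| `^ (p + 1)) (c * `|z| `^ (p - 1) * z).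
  move=> p_ge1; have p0 : 0 < p by exact: lt_le_trans p_ge1.
  have d := is_derive_norm_powR z p0.
  apply: (@is_derive_eq _ _ _ _ _ _ _ _ (is_deriveZ (c / (p + 1)) d)).
  rewrite -[LHS]/(c / (p + 1) * ((p + 1) * (`|z| `^ (p - 1) * z))).
  by field; rewrite gt_eqF// addr_gt0.
by apply: is_deriveB; apply: is_derive_sumr => i; apply: D.
Qed.

Lemma primitive0 : primitive 0 = 0.
Proof.
rewrite /primitive !big1 ?subrr// => i _; rewrite normr0 powR0 ?mulr0// gt_eqF//.
  by apply: (lt_le_trans ltr01); rewrite lerDr (le_trans ler01).
by apply: (lt_le_trans ltr01); rewrite lerDr (le_trans ler01).
Qed.

Lemma sourceFE z : sourceF P z = primitive z.
Proof.
have I x y : x < y -> \int[@lebesgue_measure R]_(s in `[x, y]) source P s = primitive y - primitive x.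
  by move=> xy; rewrite /Rintegral (FTC2_all xy is_derive_primitive source_continuous).
rewrite /sourceF; case: ifPn => [|/negbTE]; last first.
  by move=> /negbT; rewrite -ltNge => z0; rewrite I// primitive0 sub0r opprK.
rewrite le_eqVlt => /orP[/eqP <-|z0]; last by rewrite I// primitive0 subr0.
by rewrite set_itv1 Rintegral_set1 primitive0.
Qed.

End source.

(** * The potential well *)

Section embedding_constants.
Context {R : realType} (P : problem R) (i : 'I_(nr P).+1).
Local Notation Om := (Om P).
Local Notation q := (@pexp R P i + 1).
Hypotheses (oO : open Om) (bO : bounded_set Om) (q0 : 0 < q) (q6 : q <= 6).
Local Notation gamma_set :=
  [set nrm Om q v | v in [set v | H10 Om v /\ gradnrm Om v = 1]].

Lemma nrm_ge0 p v : 0 <= nrm Om p v.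
Proof. by rewrite fine_ge0// Lnorm_ge0. Qed.

(** The supremum of an unbounded set of reals is a default value, so [gam] is meaningful only
    through this bound, which the Sobolev inequality provides. *)
Lemma gam_has_ubound : has_ubound gamma_set.
Proof.
exists (sobolev_cst Om `^ q^-1) => _ [v [hv g1] <-].
have qn : q != 0 by rewrite gt_eqF.
have -> : nrm Om q v = (nrm Om q v `^ q) `^ q^-1.
  by rewrite -powRrM mulfV// powRr1// nrm_ge0.
apply: ge0_ler_powR; rewrite ?nnegrE ?powR_ge0 ?invr_ge0 ?(ltW q0)//.
  by rewrite ltW// sobolev_cst_gt0.
rewrite nrm_powR//; apply: le_trans (sobolev_Rintegral oO bO q0 q6 hv) _.
by rewrite -gradnrm_sqr// g1 expr1n powR1 mulr1.
Qed.

Lemma gam_ge0 : 0 <= gam i.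
Proof.
rewrite /gam; set S := (X in sup X).
have [/eqP S0|/set0P[x Sx]] := boolP (S == set0); first by rewrite S0 sup0.
apply: (@le_trans _ _ x); first by case: Sx => v _ <-; exact: nrm_ge0.
by apply: sup_upper_bound => //; split; [exists x|exact: gam_has_ubound].
Qed.

Lemma gam_bound v : H10 Om v -> nrm Om q v <= gam i * gradnrm Om v.
Proof.
move=> hv; have qn : q != 0 by rewrite gt_eqF.
have := gradnrm_ge0 Om v; rewrite le_eqVlt => /orP[/eqP g0|g0].
  rewrite -g0 mulr0 leNgt; apply/negP => /(powR_gt0 q).
  rewrite nrm_powR// ltNge; apply/negP/negPn.
  apply: le_trans (sobolev_Rintegral oO bO q0 q6 hv) _.
  by rewrite -gradnrm_sqr// -g0 expr0n powR0 ?mulr0// mulf_neq0 ?invr_neq0.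
have gn : gradnrm Om v != 0 by rewrite gt_eqF.
have hw : H10 Om (fun x => (gradnrm Om v)^-1 * v x) by exact: H10Z.
have g1 : gradnrm Om (fun x => (gradnrm Om v)^-1 * v x) = 1.
  apply/eqP; rewrite -(eqrXn2 (n := 2)) ?gradnrm_ge0// gradnrm_sqr// gradipZ//; last exact: H10_H1.
  by rewrite -gradnrm_sqr// -exprMn mulVf.
have : nrm Om q (fun x => (gradnrm Om v)^-1 * v x) <= gam i.
  apply: sup_upper_bound; last by exists (fun x => (gradnrm Om v)^-1 * v x).
  by split; [exists (nrm Om q (fun x => (gradnrm Om v)^-1 * v x)); exists (fun x => (gradnrm Om v)^-1 * v x)|exact: gam_has_ubound].
rewrite nrmZ//; last exact: H10_Lp.
by rewrite normfV (gtr0_norm g0) mulrC ler_pdivrMr.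
Qed.

(** The form in which the embedding enters [Gfun], with the half squared gradient norm as its
    argument. *)
Lemma gam_bound_powR v : H10 Om v ->
  nrm Om q v `^ q <= (2 * gam i ^+ 2 * (gradip Om v v / 2)) `^ (q / 2).
Proof.
move=> hv; have -> : 2 * gam i ^+ 2 * (gradip Om v v / 2) = (gam i * gradnrm Om v) ^+ 2.
  by rewrite -gradnrm_sqr//; field.
rewrite -powR_mulrn ?mulr_ge0 ?gam_ge0 ?gradnrm_ge0// -powRrM.
rewrite (_ : 2%:R * (q / 2) = q); last by field.
apply: ge0_ler_powR; rewrite ?nnegrE ?nrm_ge0 ?mulr_ge0 ?gam_ge0 ?gradnrm_ge0 ?(ltW q0)//.
exact: gam_bound.
Qed.

End embedding_constants.

Section well.
Context {R : realType}.

(** Young's inequality for the product of [t] and 1, with exponent [r] and its conjugate, multiplied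
    by [r]. *)
Lemma bernoulli_powR (r t : R) : 1 < r -> 0 <= t -> 1 + r * (t - 1) <= t `^ r.
Proof.
move=> r1 t0; have r0 : 0 < r by exact: lt_trans r1.
have r10 : 0 < 1 - r^-1 by rewrite subr_gt0 invf_lt1.
have := @conjugate_powR R t 1 r (1 - r^-1)^-1 t0 ler01 r0.
rewrite invr_gt0 invrK => /(_ r10); rewrite addrC subrK powR1 mulr1 mul1r.
move=> /(_ erefl); rewrite -(ler_pM2l r0) mulrDr mulrBr mulr1 mulfV ?gt_eqF//.
have -> : r * (t `^ r / r) = t `^ r by field; rewrite gt_eqF.
by rewrite mulrBr mulr1; lra.
Qed.

Variables (n : nat) (a p c : 'I_n.+1 -> R) (y0 : R).
Hypotheses (a0 : forall i, 0 < a i) (p1 : 1 < p ord0) (p_ge : forall i, p ord0 <= p i)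
  (c0 : forall i, 0 <= c i).
Let G y := y - \sum_i a i / (p i + 1) * (c i * y) `^ ((p i + 1) / 2).
Hypothesis maxG : forall y, 0 <= y -> G y <= G y0.

Let p1' i : 1 < p i. Proof. exact: lt_le_trans (p_ge i). Qed.

(* Convexity of the subtracted sum and maximality of [G] at [y0] bound its slope
   by 1 to the left of [y0]. *)
Lemma well_slope y : 0 < y -> y < y0 ->
  \sum_i a i * (c i * y) `^ ((p i + 1) / 2) <= 2 * y.
Proof.
move=> y_gt0 yy0; have t1 : 0 < y0 / y - 1 by rewrite subr_gt0 ltr_pdivlMr// mul1r.
(* Bernoulli with exponent (p + 1) / 2 and ratio y0 / y: the coefficient a / (p + 1) turns into a /
   2, hence the division by 2. *)
suff h : \sum_i a i / (p i + 1) * (c i * y) `^ ((p i + 1) / 2) +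
    \sum_i a i * (c i * y) `^ ((p i + 1) / 2) * ((y0 / y - 1) / 2) <=
    \sum_i a i / (p i + 1) * (c i * y0) `^ ((p i + 1) / 2).
  have := maxG (ltW y_gt0); rewrite /G -mulr_suml in h * => h'.
  have : (\sum_i a i * (c i * y) `^ ((p i + 1) / 2)) * ((y0 / y - 1) / 2) <= y0 - y by lra.
  have -> : y0 - y = (2 * y) * ((y0 / y - 1) / 2) by field; rewrite gt_eqF.
  by rewrite ler_pM2r// divr_gt0.
rewrite -big_split /=; apply: ler_sum => i _.
have pi0 : 0 < p i + 1 by have := p1' i; lra.
have r1 : 1 < (p i + 1) / 2 by have := p1' i; lra.
have -> : c i * y0 = (c i * y) * (y0 / y) by field; rewrite gt_eqF.
have cy0 : 0 <= c i * y by rewrite mulr_ge0// ltW.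
have t0 : 0 <= y0 / y by lra.
rewrite (powRM _ cy0 t0); have := bernoulli_powR r1 t0.
move: (_ `^ _) => X hX; move: (_ `^ _) (powR_ge0 (c i * y) ((p i + 1) / 2)) => Y Y0.
have -> : a i / (p i + 1) * Y + a i * Y * ((y0 / y - 1) / 2) =
    a i / (p i + 1) * Y * (1 + (p i + 1) / 2 * (y0 / y - 1)) by field; rewrite !gt_eqF.
by rewrite mulrA ler_wpM2l// mulr_ge0// divr_ge0// ltW.
Qed.

(** Every term is superlinear in [y], of order at least (p_1 + 1) / 2. The slope bound at an
    intermediate point therefore improves by a factor below 1 at all smaller arguments. *)
Lemma well_absorb y1 : 0 <= y1 -> y1 < y0 -> exists rho, [/\ 0 <= rho, rho < 1 &
  forall y, 0 <= y -> y <= y1 -> \sum_i a i * (c i * y) `^ ((p i + 1) / 2) <= 2 * rho * y].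
Proof.
(* The slope bound requires 0 < y2 < y0; the midpoint qualifies even for y1 = 0, and y2 > y1 makes
   the factor strictly less than 1. *)
move=> y1_ge0 y10; have [y2 [y2_gt0 y12 h2]] : exists y2, [/\ 0 < y2, y1 < y2 & y2 < y0].
  by exists ((y1 + y0) / 2); split; lra.
exists ((y1 / y2) `^ ((p ord0 - 1) / 2)); split; first exact: powR_ge0.
  have h1 : y1 / y2 < 1 by rewrite ltr_pdivrMr// mul1r.
  have := @gt0_ltr_powR R ((p ord0 - 1) / 2) _ (y1 / y2) 1.
  have h0 : 0 <= y1 / y2 by rewrite divr_ge0// ltW.
  by rewrite powR1; apply => //; rewrite ?nnegrE//; have := p1; lra.
move=> y; rewrite le_eqVlt => /orP[/eqP <- _|y_gt0 yy1].
  rewrite mulr0 big1// => i _; rewrite mulr0 powR0 ?mulr0//.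
  by rewrite gt_eqF//; have := p1' i; lra.
apply: (@le_trans _ _ (\sum_i a i * (c i * y2) `^ ((p i + 1) / 2) *
   ((y / y2) * (y1 / y2) `^ ((p ord0 - 1) / 2)))).
  apply: ler_sum => i _; rewrite -mulrA ler_pM2l//.
  have t0 : 0 < y / y2 by rewrite divr_gt0.
  have -> : c i * y = (c i * y2) * (y / y2) by field; rewrite gt_eqF.
  rewrite (powRM _ (mulr_ge0 (c0 i) (ltW y2_gt0)) (ltW t0)).
  rewrite ler_wpM2l ?powR_ge0// (powRr_pred _ t0) mulrC ler_pM2l//.
  have s1 : 0 < y1 / y2 by rewrite divr_gt0//; lra.
  have s2 : y1 / y2 <= 1 by rewrite ler_pdivrMr// mul1r ltW.
  have -> : (p i + 1) / 2 - 1 = (p i - 1) / 2 by field.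
  apply: (@le_trans _ _ ((y1 / y2) `^ ((p i - 1) / 2))).
    apply: ge0_ler_powR; rewrite ?nnegrE ?(ltW t0) ?(ltW s1)//.
      by have := p1' i; lra.
    by rewrite ler_pM2r ?invr_gt0.
  by apply: ger_powR; rewrite ?s1// ler_pM2r// lerB// p_ge.
rewrite -mulr_suml.
apply: (@le_trans _ _ (2 * y2 * (y / y2 * (y1 / y2) `^ ((p ord0 - 1) / 2)))).
  apply: ler_wpM2r; last exact: well_slope.
  by apply: mulr_ge0; [apply: divr_ge0; exact: ltW|exact: powR_ge0].
by rewrite le_eqVlt; apply/orP; left; apply/eqP; field; rewrite gt_eqF.
Qed.

Lemma well_gap E0 : 0 < y0 -> E0 < G y0 ->
  exists y1, [/\ 0 <= y1, y1 < y0 & forall y, y1 <= y -> y <= y0 -> E0 < G y].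
Proof.
(* With absolute values the sum is continuous on the whole line; it agrees with [G] on nonnegative
   arguments. *)
move=> y0_gt0 E0G; pose Gc y := y - \sum_i a i / (p i + 1) * `|c i * y| `^ ((p i + 1) / 2).
have GcE y : 0 <= y -> Gc y = G y.
  move=> y_ge0; rewrite /Gc /G; congr (_ - _); apply: eq_bigr => i _.
  by rewrite ger0_norm ?mulr_ge0.
have cG : continuous Gc.
  move=> y; apply: (continuousB (f := id)); first exact: cvg_id.
  apply: (continuous_sumr (F := fun i y => a i / (p i + 1) * `|c i * y| `^ ((p i + 1) / 2))) => i z.
  apply: cvgM; first exact: cvg_cst.
  apply: (continuous_comp (f := fun y => c i * y) (g := fun y => `|y| `^ ((p i + 1) / 2))).
    by apply: cvgM; [exact: cvg_cst|exact: cvg_id].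
  by apply: continuous_norm_powR; have := p1' i; lra.
have : \forall y \near y0, E0 < Gc y.
  have /cvgr_gt := cG y0; apply; by rewrite GcE// ltW.
move=> /nbhs_ballP[e /= e0 he]; exists (Num.max 0 (y0 - e / 2)); split.
- by rewrite le_max lexx.
- by rewrite gt_max y0_gt0/=; lra.
- move=> y; rewrite ge_max => /andP[y_ge0 h1] h2.
  rewrite -GcE//; apply: he; rewrite /ball/= ger0_norm; lra.
Qed.

End well.

(** * Continuity on the half-line and the trapping argument *)

Section half_line_continuity.
Context {R : realType}.
Implicit Types f g : R -> R.

Definition half_continuous f := forall t, 0 <= t -> forall e, 0 < e ->
  exists2 dl, 0 < dl & forall s, 0 <= s -> `|s - t| < dl -> `|f s - f t| < e.

Lemma half_continuousP f : half_continuous f <->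
  forall t : R, 0 <= t -> f s @[s --> within `[0%R, +oo[ (nbhs t)] --> f t.
Proof.
split=> cf t t0.
  apply/cvgrPdist_lt => e e0; have [dl dl0 h] := cf t t0 e e0.
  rewrite near_withinE; near=> s => s0; rewrite distrC; apply: h.
    by move: s0; rewrite /= in_itv/= andbT.
  by rewrite distrC; near: s; apply/nbhs_ballP; exists dl => //= y; rewrite /ball/= distrC.
move=> e e0; have /cvgrPdist_lt/(_ e e0) := cf t t0.
rewrite near_withinE => /nbhs_ballP[dl /= dl0 h]; exists dl => // s s0 st.
by rewrite distrC; apply: h; rewrite /= ?in_itv/= ?s0// /ball/= distrC.
Unshelve. all: by end_near. Qed.

Lemma half_continuous_measurable f : half_continuous f -> measurable_fun (`[0%R, +oo[%classic : set R) f.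
Proof.
move=> /half_continuousP cf; apply: subspace_continuous_measurable_fun => //.
by apply/subspace_continuousP => t /=; rewrite in_itv/= andbT; exact: cf.
Qed.

Lemma half_continuous_cst c : half_continuous (fun=> c).
Proof. by move=> t _ e e0; exists 1 => // s _ _; rewrite subrr normr0. Qed.

Lemma half_continuousD f g : half_continuous f -> half_continuous g ->
  half_continuous (fun t => f t + g t).
Proof.
move=> /half_continuousP cf /half_continuousP cg; apply/half_continuousP => t t0.
by apply: cvgD; [exact: cf|exact: cg].
Qed.

Lemma half_continuousM f g : half_continuous f -> half_continuous g ->
  half_continuous (fun t => f t * g t).
Proof.
move=> /half_continuousP cf /half_continuousP cg; apply/half_continuousP => t t0.
by apply: cvgM; [exact: cf|exact: cg].
Qed.

Lemma half_continuous_comp f (h : R -> R) : half_continuous f -> continuous h ->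
  half_continuous (h \o f).
Proof.
move=> /half_continuousP cf ch; apply/half_continuousP => t t0.
by apply: (cvg_comp _ _ (cf t t0)); exact: ch.
Qed.

Lemma half_continuous_sum (I : Type) (s : seq I) (F : I -> R -> R) :
  (forall i, half_continuous (F i)) -> half_continuous (fun t => \sum_(i <- s) F i t).
Proof.
move=> h; elim: s => [|i s IH].
  by under eq_fun do rewrite big_nil; exact: half_continuous_cst.
by under eq_fun do rewrite big_cons; exact: half_continuousD.
Qed.

End half_line_continuity.

Section trap.
Context {R : realType}.

(* [E] only jumps downwards and [Phi] is continuous, so [E + Phi] cannot jump
   over the forbidden interval. *)
Lemma trap (E Phi G : R -> R) (y0 y1 E0 : R) : y1 < y0 ->
  (forall s t, 0 <= s -> s <= t -> E t <= E s) ->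
  half_continuous Phi ->
  (forall t, 0 <= t -> G (E t + Phi t) <= E0) ->
  (forall y, y1 <= y -> y <= y0 -> E0 < G y) ->
  E 0 + Phi 0 <= y0 ->
  forall t, 0 <= t -> E t + Phi t < y1.
Proof.
move=> y10 Edec cPhi GE gap e0 t t_ge0; rewrite ltNge; apply/negP => et.
(* No value between [y1] and [y0] is possible, so reaching [y1] means having passed [y0]. *)
have alt s : 0 <= s -> y1 <= E s + Phi s -> y0 < E s + Phi s.
  move=> s0 ys; rewrite ltNge; apply/negP => sy.
  by have := GE s s0; rewrite leNgt gap.
have e0' : E 0 + Phi 0 < y1.
  by rewrite ltNge; apply/negP => /(alt _ (lexx _)); rewrite ltNge e0.
pose Z := [set s | 0 <= s /\ y1 <= E s + Phi s].
have Zt : Z t by [].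
have hiZ : has_inf Z by split; [exists t|exists 0 => s []].
pose s0 := inf Z.
have s0_ge0 : 0 <= s0 by apply: lb_le_inf; [exists t|move=> s []].
have below s : 0 <= s -> s < s0 -> E s + Phi s < y1.
  move=> s_ge0 ss0; rewrite ltNge; apply/negP => ys.
  by have : s0 <= s by [apply: (ge_inf hiZ.2)]; rewrite leNgt ss0.
have s0t : s0 <= t by apply: (ge_inf hiZ.2).
(* [s0] is the first time at which the level [y1] is reached. If the sum is still below [y1] at
   [s0], it exceeds [y0] just afterwards, although [E] has not increased and [Phi] has hardly moved.
   If it exceeds [y0] at [s0], it was below [y1] just before, when [E] was at least as large. *)
have [ys0|] := ltP (E s0 + Phi s0) y1.
  have [dl dl0 hdl] := cPhi s0 s0_ge0 (y0 - (E s0 + Phi s0)) ltac:(by rewrite subr_gt0 (lt_trans ys0)).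
  have [s [s_ge0 ys] ss0] := inf_adherent dl0 hiZ.
  have s0s : s0 <= s by apply: (ge_inf hiZ.2).
  have := hdl s s_ge0; rewrite ger0_norm ?subr_ge0// ltrBlDl => /(_ ss0).
  rewrite ltr_norml => /andP[_ h].
  have := alt s s_ge0 ys; have := Edec s0 s s0_ge0 s0s; lra.
move=> /(alt _ s0_ge0) ys0.
have s0_gt0 : 0 < s0.
  by rewrite lt_neqAle s0_ge0 andbT; apply/eqP => h; move: ys0 e0'; rewrite -h; lra.
have [dl dl0 hdl] := cPhi s0 s0_ge0 (y0 - y1) ltac:(by rewrite subr_gt0).
pose s := Num.max 0 (s0 - dl / 2).
have s_ge0 : 0 <= s by rewrite le_max lexx.
have ss0 : s < s0 by rewrite gt_max s0_gt0/=; lra.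
have ss1 : s0 - dl < s by rewrite lt_max; apply/orP; right; lra.
have := hdl s s_ge0; rewrite ltr0_norm ?subr_lt0// ltr_norml opprB => /(_ _)/andP[]; first lra.
by have := below s s_ge0 ss0; have := Edec s s0 s_ge0 (ltW ss0); lra.
Qed.

End trap.

(** * The memory kernel *)

Section translation.
Context {R : realType}.
Local Notation L := (@lebesgue_measure R).

Lemma integral_translation (g : R -> \bar R) (c : R) : measurable_fun setT g ->
  (forall x, 0 <= g x)%E -> (\int[L]_x g (x - c)%R = \int[L]_x g x)%E.
Proof.
move=> mg g0; pose phi (x : R) : measurableTypeR R := x - c.
have mphi : measurable_fun setT phi by exact: measurable_funB.
have E : (\int[pushforward L phi]_x g x = \int[L]_x g x)%E.
  apply/esym/eq_measure_integral => A mA _.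
  have H := @lebesgue_measure_unique R (pushforward L phi).
  apply: H mA => X [[a b] _ <-].
  have E1 : phi @^-1` `]a, b]%classic = `]a + c, b + c]%classic.
    by apply/seteqP; split => x; rewrite /phi/= !in_itv/= ltrBrDr lerBlDr.
  transitivity (L `]a + c, b + c]%classic); last by rewrite -E1.
  by rewrite !lebesgue_measure_itv/= !lte_fin ltrD2r -!EFinD opprD addrACA subrr addr0.
have H := @ge0_integral_pushforward _ _ (measurableTypeR R) (measurableTypeR R) R phi mphi L
  setT g measurableT mg (fun x _ => g0 x).
exact: etrans (esym H) E.
Qed.

End translation.

Section half_line_calculus.
Context {R : realType}.
Implicit Types (f : R -> R) (s : R).
Local Notation L := (@lebesgue_measure R).

Lemma dfilter_gt0 s : 0 < s -> dfilter s = (0 : R)^'.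
Proof.
move=> s0; have H : \forall h \near (0 : R)^', 0 <= s + h.
  apply: nbhs_dnbhs; apply/nbhs_ballP; exists s => //= h.
  by rewrite /ball/= sub0r normrN ltr_norml => /andP[h1 _]; lra.
apply/seteqP; split => A; rewrite /dfilter /within/=.
  by move=> h; apply: filterS2 h H => x; apply.
by apply: filterS => h Ah _.
Qed.

Lemma dfilter0 : dfilter 0 = (0 : R)^'+.
Proof.
apply/seteqP; split => A H.
  have H' : nbhs (0 : R) [set h | h != 0 -> 0 <= 0 + h -> A h] := H.
  have : nbhs (0 : R) [set h | 0 < h -> A h].
    by apply: filterS H' => h hA h0; apply: hA; rewrite ?gt_eqF// add0r ltW.
  by [].
have H' : nbhs (0 : R) [set h | 0 < h -> A h] := H.
have : nbhs (0 : R) [set h | h != 0 -> 0 <= 0 + h -> A h].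
  apply: filterS H' => h /=; rewrite add0r => hA h0 h1.
  by apply: hA; rewrite lt_neqAle eq_sym h0.
by [].
Qed.

Lemma C1_Rp_derive f s : C1_Rp f -> 0 < s -> is_derive s (1 : R) f (dRp f s).
Proof.
move=> [cf _] s0; have := cf s (ltW s0); rewrite /dRp (dfilter_gt0 s0).
have -> : dquot f s = fun h => h^-1 *: ((f \o shift s) (h *: (1 : R)) - f s).
  by apply/funext => h; rewrite /dquot [h *: 1]mulr1 /= [s + h]addrC.
by move=> c; apply: DeriveDef.
Qed.

Lemma C1_Rp_cvg0 f : C1_Rp f -> f s @[s --> 0^'+] --> f 0.
Proof.
move=> [/(_ 0 (lexx _)) + _]; rewrite dfilter0 => /cvg_ex[l cl].
have : (f 0 + h * dquot f 0 h) @[h --> (0 : R)^'+] --> f 0 + 0 * l.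
  apply: cvgD; first exact: cvg_cst.
  by apply: cvgM => //; apply: cvg_at_right_filter; exact: cvg_id.
rewrite mul0r addr0; apply: cvg_trans; apply: near_eq_cvg; near=> h.
rewrite /dquot add0r mulrA mulfV ?mul1r ?subrKC//.
Unshelve. all: by end_near. Qed.

Lemma C1_Rp_half_continuous f : C1_Rp f -> half_continuous f.
Proof.
move=> cf; apply/half_continuousP => t; rewrite le_eqVlt => /orP[/eqP <-|t0].
  apply/cvgrPdist_lt => e e0; rewrite near_withinE.
  have /cvgrPdist_lt/(_ e e0) := C1_Rp_cvg0 cf.
  rewrite near_withinE; apply: filterS => s h; rewrite /= in_itv/= andbT le_eqVlt.
  by move=> /orP[/eqP <-|/h//]; rewrite subrr normr0.
have d := C1_Rp_derive cf t0.
have : {for t, continuous f}.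
  by apply: differentiable_continuous; apply/derivable1_diffP; exact: ex_derive.
exact: cvg_within_filter.
Qed.

Lemma half_continuous_cvg0 f : half_continuous f -> f s @[s --> 0^'+] --> f 0.
Proof.
move=> cf; apply/cvgrPdist_lt => e e0; have [dl dl0 h] := cf 0 (lexx _) e e0.
near=> s; rewrite distrC; apply: h; first by near: s; exact: nbhs_right_ge.
rewrite subr0 ger0_norm; last by near: s; exact: nbhs_right_ge.
by near: s; exact: nbhs_right_lt.
Unshelve. all: by end_near. Qed.

Lemma half_continuous_within f : half_continuous f -> {within `[0, +oo[, continuous f}.
Proof.
by move=> /half_continuousP cf; apply/subspace_continuousP => t /=; rewrite in_itv/= andbT; exact: cf.
Qed.

Lemma within_half_continuous f : {within `[0, +oo[, continuous f} -> half_continuous f.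
Proof.
move=> /subspace_continuousP cf; apply/half_continuousP => t t0.
by apply: cf; rewrite /= in_itv/= t0.
Qed.

Lemma C1_Rp_dRp f : C1_Rp f -> half_continuous (dRp f).
Proof. by move=> [_]; exact: within_half_continuous. Qed.

Lemma C1_Rp_nonincreasing f : C1_Rp f -> (forall s, 0 < s -> dRp f s <= 0) ->
  forall s t, 0 <= s -> s <= t -> f t <= f s.
Proof.
move=> cf d0 s t s0; rewrite le_eqVlt => /orP[/eqP ->//|st].
have D x : x \in `]s, t[ -> is_derive x (1 : R) f (dRp f x).
  by rewrite in_itv/= => /andP[sx _]; apply: C1_Rp_derive => //; exact: le_lt_trans sx.
apply: (@ler0_derive1_le_cc R f s t) (ltW st); rewrite ?in_itv/= ?lexx ?(ltW st)//.
- by move=> x /D[].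
- move=> x xst; have d := D x xst; rewrite derive1E (derive_val (is_derive := d)).
  by apply: d0; move: xst; rewrite in_itv/= => /andP[sx _]; exact: le_lt_trans sx.
- apply: continuous_subspaceW (half_continuous_within (C1_Rp_half_continuous cf)).
  by move=> x /=; rewrite !in_itv/= andbT => /andP[sx _]; exact: le_trans sx.
Qed.

End half_line_calculus.

Section kernel.
Context {R : realType} (P : problem R).
Local Notation L := (@lebesgue_measure R).
Local Notation mu := (mu P).
Local Notation dmu := (dmu P).
Local Notation Linf := (`[0%R, +oo[%classic : set R).
Hypotheses (h3 : assumptions_iii P) (h4 : assumptions_iv P).

Lemma mu_half_continuous : half_continuous mu.
Proof. by case: h4 => + _ _ _; exact: C1_Rp_half_continuous. Qed.

Lemma mu_nonincreasing s t : 0 <= s -> s <= t -> mu t <= mu s.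
Proof. by case: h4 => c _ d _; exact: C1_Rp_nonincreasing. Qed.

Lemma mu_gt0 s : 0 <= s -> 0 < mu s.
Proof.
(* The derivative of k is assumed negative at positive arguments only, so [s] is compared with
   [s + 1]. *)
move=> s0; have [_ h _] := h3; apply: (@lt_le_trans _ _ (mu (s + 1))).
  by rewrite oppr_gt0 h// ltr_wpDl.
by apply: mu_nonincreasing => //; rewrite lerDl.
Qed.

Lemma mu_ge0 s : 0 <= s -> 0 <= mu s.
Proof. by move=> /mu_gt0/ltW. Qed.

Lemma mu_measurable : measurable_fun Linf mu.
Proof. exact: half_continuous_measurable mu_half_continuous. Qed.

Lemma integral_mu : \int[L]_(s in Linf) mu s = ker P 0 - 1.
Proof.
have [[ck _] _ cv] := h3.
rewrite (@Rintegral_ge0_continuous_FTC2y _ mu (fun s => - ker P s) 0 (- 1)).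
- by rewrite opprK addrC.
- by move=> s; exact: mu_ge0.
- exact: half_continuous_within mu_half_continuous.
- exact: cvgN.
- by move=> s s0; have d := C1_Rp_derive ck s0; apply: derivableN; exact: ex_derive.
- by apply: cvgN; exact: C1_Rp_cvg0.
- move=> s; rewrite in_itv/= andbT => s0; have d := C1_Rp_derive ck s0.
  by rewrite derive1E deriveN ?derive_val//; exact: ex_derive.
Qed.

Lemma dmu_half_continuous : half_continuous dmu.
Proof. by case: h4 => c _ _ _; exact: C1_Rp_dRp. Qed.

Lemma mu_powR_half_continuous e : half_continuous (fun s => mu s `^ e).
Proof.
apply/half_continuousP => t t0.
apply: (cvg_comp mu (fun x => x `^ e) ((half_continuousP _).1 mu_half_continuous t t0)).
have d := is_derive1_powR e (mu_gt0 t0).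
have : {for mu t, continuous (fun x : R => x `^ e)}.
  by apply: differentiable_continuous; apply/derivable1_diffP; exact: ex_derive.
by [].
Qed.

(** With e = 2 - sigma - theta > 0, the condition on the kernel gives mu^(1-sigma) = mu^theta
    mu^(e-1) <= - mu' mu^(e-1) / b, and the right-hand side has the bounded primitive - mu^e / (e
    b). This is where sigma < 2 - theta enters. *)
Lemma integral_mu_powR_lty (b theta sigma : R) : 0 < b -> 1 < theta ->
  0 < sigma -> sigma < 2 - theta ->
  (forall s : R, 0 <= s -> dmu s + b * mu s `^ theta <= 0) ->
  (\int[L]_(s in Linf) (mu s `^ (1 - sigma))%:E < +oo)%E.
Proof.
move=> b0 th1 s0 sth hmu; pose e := 2 - sigma - theta.
have e0 : 0 < e by rewrite /e; lra.
pose f s := - dmu s * mu s `^ (e - 1).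
have dmu0 s : 0 <= s -> 0 <= - dmu s.
  by move=> /hmu h; have := mulr_ge0 (ltW b0) (powR_ge0 (mu s) theta); lra.
have [cm _ _ mu0] := h4.
have I : (\int[L]_(s in Linf) (f s)%:E = 0%:E - (- (mu 0 `^ e / e))%:E)%E.
  apply: (@ge0_continuous_FTC2y _ f (fun s => - (mu s `^ e / e))).
  - by move=> s s_ge0; rewrite mulr_ge0 ?powR_ge0 ?dmu0.
  - apply: half_continuous_within; apply: half_continuousM; last exact: mu_powR_half_continuous.
    have := half_continuousM (half_continuous_cst (-1)) dmu_half_continuous.
    by congr half_continuous; apply/funext => s; rewrite mulN1r.
  - rewrite -oppr0 -(mul0r e^-1); apply: cvgN; apply: cvgM; last exact: cvg_cst.
    apply/cvgrPdist_le => x x0; have x1 : 0 < x `^ e^-1 by exact: powR_gt0.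
    have /cvgrPdist_le/(_ _ x1) := mu0; apply: filterS2 (nbhs_pinfty_gt (num_real 0)).
    move=> s /ltW s_ge0 h; rewrite sub0r normrN (ger0_norm (powR_ge0 _ _)).
    apply: powR_small => //; first exact: mu_ge0.
    by move: h; rewrite sub0r normrN ger0_norm// mu_ge0.
  - move=> s s_gt0; have d1 := C1_Rp_derive cm s_gt0.
    have d2 := @is_derive1_comp R (fun x => x `^ e) mu s _ _ (is_derive1_powR e (mu_gt0 (ltW s_gt0))) d1.
    by apply: derivableN; apply: derivableM => //; exact: ex_derive.
  - apply: cvgN; apply: cvgM; last exact: cvg_cst.
    exact: half_continuous_cvg0 (mu_powR_half_continuous e).
  - move=> s; rewrite in_itv/= andbT => s_gt0; have d1 := C1_Rp_derive cm s_gt0.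
    have d2 := @is_derive1_comp R (fun x => x `^ e) mu s _ _ (is_derive1_powR e (mu_gt0 (ltW s_gt0))) d1.
    rewrite derive1E.
    have d3 : is_derive s (1 : R) (fun s => - (mu s `^ e / e)) (f s).
      have -> : (fun s => - (mu s `^ e / e)) = (- e^-1) *: ((fun x => x `^ e) \o mu).
        by apply/funext => x; rewrite -[RHS]/(- e^-1 * mu x `^ e) mulNr mulrC.
      apply: (@is_derive_eq _ _ _ _ _ _ _ _ (is_deriveZ (- e^-1) d2)).
      rewrite -[LHS]/(- e^-1 * (e * mu s `^ (e - 1) * dmu s)) /f.
      by field; rewrite gt_eqF.
    by rewrite derive_val.
have fi : (\int[L]_(s in Linf) (mu s `^ (1 - sigma))%:E <= \int[L]_(s in Linf) (b^-1 * f s)%:E)%E.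
  apply: le_integral_ge0 => s; rewrite /= in_itv/= andbT => s_ge0; rewrite lee_fin ?powR_ge0//.
  have -> : 1 - sigma = theta + (e - 1) by rewrite /e; ring.
  rewrite powRD ?(gt_eqF (mu_gt0 s_ge0)) ?implybT// /f mulrA ler_wpM2r ?powR_ge0//.
  by rewrite ler_pdivlMl//; have := hmu s s_ge0; lra.
apply: le_lt_trans fi _.
under eq_integral do rewrite EFinM.
rewrite ge0_integralZl_EFin ?invr_ge0 ?(ltW b0)//.
- by rewrite I -EFinB -EFinM ltry.
- move=> s; rewrite /= in_itv/= andbT => s_ge0.
  by rewrite lee_fin mulr_ge0 ?powR_ge0 ?dmu0.
- apply/measurable_EFinP; apply: measurable_funM.
    by apply: measurableT_comp => //; exact: half_continuous_measurable dmu_half_continuous.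
  exact: half_continuous_measurable (mu_powR_half_continuous _).
Qed.

End kernel.

(** * The memory term *)

Section semi_inner_limits.
Context (R : realType) (T : Type) (X : (T -> R) -> Prop) (B : (T -> R) -> (T -> R) -> R).
Hypothesis SI : semi_inner X B.

Lemma si_dist_le v w z : X v -> X w -> X z ->
  `|B v z - B w z| <= Num.sqrt (B (v - w) (v - w)) * Num.sqrt (B z z).
Proof.
move=> hv hw hz; have hd := si_XB SI hv hw.
have -> : B v z - B w z = B (v - w) z by rewrite (si_D SI)// ?(si_N SI)//; exact: (si_XN SI).
rewrite -sqrtrM ?(si_ge0 SI)// -sqrtr_sqr ler_wsqrtr//; exact: (si_CS SI).
Qed.

Lemma si_sqr_dist_le v w : X v -> X w ->
  `|B v v - B w w| <= B (v - w) (v - w) +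
    2 * (Num.sqrt (B (v - w) (v - w)) * Num.sqrt (B w w)).
Proof.
move=> hv hw; have hd := si_XB SI hv hw.
have -> : B v v - B w w = B (v - w) (v - w) + 2 * (B v w - B w w).
  by rewrite (si_sqrB SI)//; ring.
apply: le_trans (ler_normD _ _) _; rewrite (ger0_norm (si_ge0 SI _)) lerD2l.
by rewrite normrM ger0_norm// ler_pM2l//; exact: si_dist_le.
Qed.

Context (I : Type) (F : set_system I) (FF : Filter F).
Variables (v_ : I -> T -> R) (v : T -> R).
Hypotheses (hv_ : \forall i \near F, X (v_ i)) (hv : X v).
Hypothesis cv : B (v_ i - v) (v_ i - v) @[i --> F] --> (0 : R).

Let cvs (c : R) : Num.sqrt (B (v_ i - v) (v_ i - v)) * c @[i --> F] --> (0 : R).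
Proof.
rewrite -(mul0r c); apply: cvgM; last exact: cvg_cst.
by rewrite -[X in _ --> X]sqrtr0; apply: (cvg_comp _ _ cv); exact: sqrt_continuous.
Qed.

Lemma si_cvg w : X w -> B (v_ i) w @[i --> F] --> B v w.
Proof.
move=> hw; apply/cvgrPdist_le => e e0.
have /cvgrPdist_le/(_ e e0) := cvs (Num.sqrt (B w w)).
apply: filterS2 hv_ => i hi; rewrite sub0r normrN => h.
rewrite distrC; apply: le_trans (si_dist_le hi hv hw) _.
by apply: le_trans h; exact: ler_norm.
Qed.

Lemma si_sqr_cvg : B (v_ i) (v_ i) @[i --> F] --> B v v.
Proof.
have c2 : B (v_ i - v) (v_ i - v) +
    2 * (Num.sqrt (B (v_ i - v) (v_ i - v)) * Num.sqrt (B v v)) @[i --> F] --> (0 : R).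
  rewrite -(addr0 0) -[X in _ + X](mulr0 2); apply: cvgD => //.
  by apply: cvgM; [exact: cvg_cst|exact: cvs].
apply/cvgrPdist_le => e e0; have /cvgrPdist_le/(_ e e0) := c2.
apply: filterS2 hv_ => i hi; rewrite sub0r normrN => h.
rewrite distrC; apply: le_trans (si_sqr_dist_le hi hv) _.
by apply: le_trans h; exact: ler_norm.
Qed.

End semi_inner_limits.

(** * Continuity and measurability in time of inner products *)

Section time_measurability.
Context {R : realType} (X : (E3 R -> R) -> Prop) (B : (E3 R -> R) -> (E3 R -> R) -> R)
  (nX : (E3 R -> R) -> \bar R).
Hypotheses (SI : semi_inner X B)
  (nXE : forall v, X v -> nX v = (Num.sqrt (B v v))%:E).
Implicit Types v : R -> E3 R -> R.

Lemma nX_cvg (I : Type) (F : set_system I) (FF : Filter F) (z : I -> E3 R -> R) :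
  (\forall i \near F, X (z i)) -> nX (z i) @[i --> F] --> 0%E ->
  B (z i) (z i) @[i --> F] --> (0 : R).
Proof.
move=> hz cz; have c1 : (Num.sqrt (B (z i) (z i)))%:E @[i --> F] --> (0 : R)%:E.
  apply: cvg_trans cz; apply: near_eq_cvg.
  by apply: filterS hz => i /nXE ->.
have /fine_cvgP[_ c2] := c1.
have : Num.sqrt (B (z i) (z i)) * Num.sqrt (B (z i) (z i)) @[i --> F] --> (0 * 0 : R).
  by apply: cvgM.
have -> : (fun i => Num.sqrt (B (z i) (z i)) * Num.sqrt (B (z i) (z i))) = (fun i => B (z i) (z i)).
  by apply/funext => i; rewrite -expr2 sqr_sqrtr ?(si_ge0 SI).
by rewrite mul0r.
Qed.

Lemma CT_cvg v t : (forall T, 0 < T -> CT X nX T v) -> 0 <= t ->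
  B (v s - v t) (v s - v t) @[s --> within `[0%R, +oo[ (nbhs t)] --> (0 : R).
Proof.
move=> cv t0; have t1 : 0 < t + 1 by rewrite ltr_wpDl.
have tt : t \in `[0, t + 1] by rewrite in_itv/= t0 lerDl ler01.
have [hvt ct] := cv _ t1 t tt.
(* Near [t] the half-line coincides with [0, t + 1], the interval to which [CT] refers. *)
have E : within `[0%R, +oo[ (nbhs t) `=>` within `[0%R, t + 1] (nbhs t).
  move=> A; rewrite /within/= => h.
  have : \forall s \near t, s < t + 1 by apply: lt_nbhsl; rewrite ltrDl.
  apply: filterS2 h => s hs s1; rewrite in_itv/= andbT => s0.
  by apply: hs; rewrite in_itv/= s0 ltW.
apply: nX_cvg; last exact: cvg_trans (cvg_app _ E) ct.
rewrite near_withinE; apply: nearW => s; rewrite /= in_itv/= andbT => s0.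
apply: (si_XB SI) => //; have s1 : 0 < s + 1 by rewrite ltr_wpDl.
by have [] := cv _ s1 s; rewrite ?in_itv/= ?s0 ?lerDl ?ler01.
Qed.

Lemma CT_X v t : (forall T, 0 < T -> CT X nX T v) -> 0 <= t -> X (v t).
Proof.
move=> cv t0; have t1 : 0 < t + 1 by rewrite ltr_wpDl.
by have [] := cv _ t1 t; rewrite ?in_itv/= ?t0 ?lerDl ?ler01.
Qed.

Lemma CT_half_continuous v w : (forall T, 0 < T -> CT X nX T v) -> X w ->
  half_continuous (fun t => B (v t) w).
Proof.
move=> cv hw; apply/half_continuousP => t t0; apply: (si_cvg SI) => //.
- by rewrite near_withinE; apply: nearW => s; rewrite /= in_itv/= andbT; exact: CT_X.
- exact: CT_X.
- exact: CT_cvg.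
Qed.

Lemma CT_half_continuous_sqr v : (forall T, 0 < T -> CT X nX T v) ->
  half_continuous (fun t => B (v t) (v t)).
Proof.
move=> cv; apply/half_continuousP => t t0; apply: (si_sqr_cvg SI) => //.
- by rewrite near_withinE; apply: nearW => s; rewrite /= in_itv/= andbT; exact: CT_X.
- exact: CT_X.
- exact: CT_cvg.
Qed.

(** At a fixed time all coefficients are 0 or 1, so closure of [X] under sums, together with its
    zero, is enough. *)
Lemma simple_evolP n (A : 'I_n -> set R) (c : 'I_n -> E3 R -> R) w t : X w ->
  (forall i, X (c i)) -> X (fun x => \sum_(i < n) \1_(A i) t * c i x) /\
  B (fun x => \sum_(i < n) \1_(A i) t * c i x) w = \sum_(i < n) \1_(A i) t * B (c i) w.
Proof.
move=> hw; have X0 : X (fun=> 0).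
  by have := si_XB SI hw hw; rewrite subrr.
have B0 : B (fun=> 0) w = 0.
  have := si_D SI X0 X0 hw; rewrite addr0 => /eqP.
  by rewrite -subr_eq subrr => /eqP.
elim: n A c => [|n IH] A c hc.
  rewrite !big_ord0; split; first by under eq_fun do rewrite big_ord0.
  by under eq_fun do rewrite big_ord0.
have [h1 h2] := IH (fun i => A (lift ord0 i)) (fun i => c (lift ord0 i)) (fun i => hc _).
have hs : X (fun x => \1_(A ord0) t * c ord0 x) /\
    B (fun x => \1_(A ord0) t * c ord0 x) w = \1_(A ord0) t * B (c ord0) w.
  rewrite indicE; case: (t \in A ord0).
    by under eq_fun do rewrite mul1r; rewrite mul1r.
  by under eq_fun do rewrite mul0r; rewrite mul0r.
have E : (fun x => \sum_(i < n.+1) \1_(A i) t * c i x) =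
    (fun x => \1_(A ord0) t * c ord0 x) +
    (fun x => \sum_(i < n) \1_(A (lift ord0 i)) t * c (lift ord0 i) x).
  by apply/funext => x; rewrite big_ord_recl.
rewrite E big_ord_recl; split; first by apply: (si_XD SI) => //; case: hs.
by rewrite (si_D SI)//; [rewrite h2 hs.2|case: hs].
Qed.

Variables (D : set R) (mD : measurable D).

Lemma simple_evol_X v t : simple_evol X D v -> D t -> (exists w, X w) -> X (v t).
Proof.
move=> [n [A [c [mA hc E]]]] Dt [w hw].
have -> : v t = (fun x => \sum_(i < n) \1_(A i) t * c i x) by apply/funext => x; exact: E.
by case: (simple_evolP A t hw hc).
Qed.

Lemma simple_evol_measurable v w : simple_evol X D v -> X w ->
  measurable_fun D (fun t => B (v t) w).
Proof.
move=> [n [A [c [mA hc E]]]] hw.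
apply: (eq_measurable_fun (fun t => \sum_(i < n) \1_(A i) t * B (c i) w)).
  move=> t; rewrite inE => Dt.
  have -> : v t = (fun x => \sum_(i < n) \1_(A i) t * c i x) by apply/funext => x; exact: E.
  by case: (simple_evolP A t hw hc).
by apply: measurable_sum => i; apply: measurable_funM.
Qed.

(** Only one of the two arguments is expanded into its finitely many values; the pairing of [v] with
    each value is already measurable. *)
Lemma simple_evol_measurable_sqr v : simple_evol X D v ->
  measurable_fun D (fun t => B (v t) (v t)).
Proof.
move=> sv; have [n [A [c [mA hc E]]]] := sv.
have [->|/set0P[t0 Dt0]] := eqVneq D set0; first exact: measurable_fun_set0.
case: n A c mA hc E => [|n] A c mA hc E.
  apply: (eq_measurable_fun (fun t => B 0 0)) => // t; rewrite inE => Dt.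
  by have -> : v t = 0 by apply/funext => x; rewrite E// big_ord0.
apply: (eq_measurable_fun (fun t => \sum_(i < n.+1) \1_(A i) t * B (v t) (c i))).
  move=> t; rewrite inE => Dt.
  have hv : X (v t) by apply: (simple_evol_X sv Dt); exists (c ord0).
  have Ev : v t = (fun x => \sum_(i < n.+1) \1_(A i) t * c i x) by apply/funext => x; exact: E.
  transitivity (B (fun x => \sum_(i < n.+1) \1_(A i) t * c i x) (v t)); last by rewrite -Ev.
  have [_ ->] := simple_evolP A t hv hc.
  by apply: eq_bigr => i _; rewrite (si_sym SI).
apply: measurable_sum => i; apply: measurable_funM.
  by apply: measurable_funTS; exact: measurable_indic.
exact: simple_evol_measurable.
Qed.

Variable v : R -> E3 R -> R.
Hypotheses (sv : strongly_measurable X nX D v) (hv : forall t, D t -> X (v t)).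

Let approx : exists s : nat -> R -> E3 R -> R, (forall n, simple_evol X D (s n)) /\
  forall t, D t -> (forall n, X (s n t)) /\
    B (s n t - v t) (s n t - v t) @[n --> \oo] --> (0 : R).
Proof.
have [s [ss cs]] := sv; exists s; split => // t Dt.
have hs n : X (s n t) by apply: (simple_evol_X (ss n) Dt); exists (v t); exact: hv.
split => //; have : B (v t - s n t) (v t - s n t) @[n --> \oo] --> (0 : R).
  apply: nX_cvg; last exact: cs.
  by apply: nearW => n; apply: (si_XB SI) => //; exact: hv.
have -> : (fun n => B (v t - s n t) (v t - s n t)) = (fun n => B (s n t - v t) (s n t - v t)).
  apply/funext => n.
  by rewrite -(si_sqrN SI) ?opprB//; apply: (si_XB SI) => //; exact: hv.
by [].
Qed.

Lemma strongly_measurable_ip w : X w -> measurable_fun D (fun t => B (v t) w).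
Proof.
move=> hw; have [s [ss cs]] := approx.
apply: (@measurable_fun_cvg _ _ _ D (fun n t => B (s n t) w)) => //.
  by move=> n; exact: simple_evol_measurable.
move=> t Dt; have [h1 h2] := cs t Dt; apply: (si_cvg SI) => //; last exact: hv.
exact: nearW.
Qed.

Lemma strongly_measurable_sqr : measurable_fun D (fun t => B (v t) (v t)).
Proof.
have [s [ss cs]] := approx.
apply: (@measurable_fun_cvg _ _ _ D (fun n t => B (s n t) (s n t))) => //.
  by move=> n; exact: simple_evol_measurable_sqr.
move=> t Dt; have [h1 h2] := cs t Dt; apply: (si_sqr_cvg SI) => //; last exact: hv.
exact: nearW.
Qed.

End time_measurability.

Section memory_algebra.
Context d (T : measurableType d) (R : realType) (nu : {measure set T -> \bar R}).
Variables (D : set T) (mD : measurable D) (m x y z : T -> R) (b : R).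
Hypotheses (m0 : forall s, D s -> 0 <= m s) (b0 : 0 <= b)
  (im : nu.-integrable D (EFin \o m)) (ix : nu.-integrable D (fun s => (m s * x s)%:E))
  (my : measurable_fun D y) (x0 : forall s, D s -> 0 <= x s)
  (yxb : forall s, D s -> `|y s| <= x s + b)
  (zE : forall s, D s -> z s = b - 2 * y s + x s).

Let ib : nu.-integrable D (fun s => (m s * b)%:E).
Proof. exact: (integrableZr mD b im). Qed.

(** To be read with [m] the kernel, [b] and [x s] the squared gradient norms now and at delay [s],
    [y s] their inner product and [z s] the squared norm of the difference. *)
Lemma weighted_ip_integrable : nu.-integrable D (fun s => (m s * y s)%:E).
Proof.
apply: (le_integrable mD _ _ (integrableD mD ix ib)).
  apply/measurable_EFinP; apply: measurable_funM => //.
  by case/integrableP : im => /measurable_EFinP.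
move=> s Ds /=; rewrite -mulrDr normrM lee_fin normrM.
rewrite ler_wpM2l ?normr_ge0// [leRHS]ger0_norm; last by rewrite addr_ge0// x0.
exact: yxb.
Qed.

Lemma weighted_dist_integrable : nu.-integrable D (fun s => (m s * z s)%:E).
Proof.
have i4 := integrableZl mD (- 2) weighted_ip_integrable.
have := integrableD mD (integrableD mD ib i4) ix; apply: eq_integrable => // s.
by rewrite inE => Ds; rewrite zE//= -EFinM -!EFinD; congr EFin; ring.
Qed.

Lemma weighted_dist_integral : \int[nu]_(s in D) (m s * z s) =
  (\int[nu]_(s in D) m s) * b - 2 * \int[nu]_(s in D) (m s * y s) +
  \int[nu]_(s in D) (m s * x s).
Proof.
have iy := weighted_ip_integrable.
have i4 : nu.-integrable D (fun s => (- 2 * (m s * y s))%:E) := integrableZl mD (- 2) iy.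
have i5 : nu.-integrable D (fun s => (m s * b + - 2 * (m s * y s))%:E) := integrableD mD ib i4.
rewrite -mulNr -(RintegralZr b mD im) -(RintegralZl (- 2) mD iy).
rewrite -(RintegralD mD ib i4) -(RintegralD mD i5 ix).
by apply: eq_Rintegral => s; rewrite inE => Ds; rewrite zE//; ring.
Qed.

Lemma weighted_ip_le e : 0 < e ->
  (forall s, D s -> y s <= (1 + e) * b + z s / (4 * e)) ->
  \int[nu]_(s in D) (m s * y s) <=
    (1 + e) * ((\int[nu]_(s in D) m s) * b) + (\int[nu]_(s in D) (m s * z s)) / (4 * e).
Proof.
move=> e0 h; have iz := weighted_dist_integrable.
have i1 : nu.-integrable D (fun s => ((1 + e) * (m s * b))%:E) := integrableZl mD (1 + e) ib.
have i2 : nu.-integrable D (fun s => (m s * z s / (4 * e))%:E) := integrableZr mD (4 * e)^-1 iz.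
rewrite -(RintegralZr b mD im) -(RintegralZl (1 + e) mD ib) -(RintegralZr _ mD iz).
rewrite -(RintegralD mD i1 i2); apply: le_Rintegral => //.
- exact: weighted_ip_integrable.
- exact: (integrableD mD i1 i2).
- move=> s Ds; have -> : (1 + e) * (m s * b) + m s * z s / (4 * e) =
    m s * ((1 + e) * b + z s / (4 * e)) by ring.
  by rewrite ler_wpM2l ?m0// h.
Qed.

End memory_algebra.

Lemma si_norm_le (R : realType) (V : zmodType) (X : V -> Prop) (B : V -> V -> R) v w :
  semi_inner X B -> X v -> X w -> `|B v w| <= B v v + B w w.
Proof.
move=> SI hv hw; have := si_ge0 SI (v + w); have := si_ge0 SI (v - w).
rewrite (si_sqrD SI hv hw) (si_sqrB SI hv hw).
have := si_ge0 SI v; have := si_ge0 SI w.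
by move=> *; rewrite ler_norml; apply/andP; split; lra.
Qed.

Lemma si_young (R : realType) (V : zmodType) (X : V -> Prop) (B : V -> V -> R) v w e :
  semi_inner X B -> X v -> X w -> 0 < e ->
  `|B v w| <= e * B w w + B v v / (4 * e).
Proof.
move=> SI hv hw e0; have z0 := si_ge0 SI v; have b0 := si_ge0 SI w.
have e4 : 0 < 4 * e by rewrite mulr_gt0.
rewrite -(ler_pXn2r (n := 2)) ?nnegrE ?addr_ge0 ?mulr_ge0 ?invr_ge0 ?(ltW e0) ?(ltW e4)//.
rewrite real_normK ?num_real//; apply: le_trans (si_CS SI hv hw) _.
have : 0 <= (e * B w w - B v v / (4 * e)) ^+ 2 by exact: sqr_ge0.
have -> : (e * B w w - B v v / (4 * e)) ^+ 2 = (e * B w w + B v v / (4 * e)) ^+ 2 - B v v * B w w.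
  by field; rewrite gt_eqF.
by lra.
Qed.

Lemma subr_le_of_opp_le (R : realDomainType) (x y z e : R) :
  - (e * y + z) <= x -> y - x <= (1 + e) * y + z.
Proof. lra. Qed.

Section gradient_norm.
Context {R : realType} (Om : set (E3 R)).
Hypotheses (oO : open Om) (bO : bounded_set Om).
Local Notation gradip := (gradip Om).

Lemma egradnrm_ae_congr v v' : aeeq Om v v' -> egradnrm Om v = egradnrm Om v'.
Proof. by move=> h; rewrite /egradnrm (wgrad_ae_congr h). Qed.

Lemma gradip_ae_congr v v' w : aeeq Om v v' -> gradip v w = gradip v' w.
Proof. by move=> h; rewrite /Defs.gradip (wgrad_ae_congr h). Qed.

Lemma egradnrm_sqrt v : H10 Om v -> egradnrm Om v = (Num.sqrt (gradip v v))%:E.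
Proof.
move=> hv; rewrite egradnrmE; [|exact: oO|exact: H10_H1].
by rewrite -gradnrm_sqr// sqrtr_sqr ger0_norm// gradnrm_ge0.
Qed.

End gradient_norm.

Section memory.
Context {R : realType} (P : problem R).
Local Notation L := (@lebesgue_measure R).
Local Notation mu := (mu P).
Local Notation Om := (Om P).
Local Notation Linf := (`[0%R, +oo[%classic : set R).
Local Notation gradip := (gradip Om).
Hypotheses (oO : open Om) (bO : bounded_set Om)
  (h3 : assumptions_iii P) (h4 : assumptions_iv P).
Let SH := semi_inner_H10 oO bO.

Lemma patch_half (f : R -> \bar R) s : (f \_ Linf) s = if 0 <= s then f s else 0%E.
Proof.
rewrite /patch; congr (if _ then _ else _).
by apply/idP/idP; rewrite inE/= in_itv/= andbT.
Qed.

Variables (u0 u : R -> E3 R -> R).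
Hypotheses (hu : forall T, 0 < T -> CT (H10 Om) (egradnrm Om) T u)
  (h0 : L2mu (H10 Om) (egradnrm Om) mu u0)
  (hu0 : forall t, t <= 0 -> aeeq Om (u t) (u0 t)).

(* [u] agrees with [u0] only almost everywhere for negative times, where it need
   not be measurable; this representative is in H^1_0 at every time. *)
Definition glue r := if r < 0 then u0 r else u r.

Lemma glue_ge0 r : 0 <= r -> glue r = u r.
Proof. by move=> r0; rewrite /glue ltNge r0. Qed.

Lemma glue_H10 r : H10 Om (glue r).
Proof.
rewrite /glue; case: ltP => r0; last exact: (CT_X hu).
by have [h _ _] := h0; apply: h; exact: ltW.
Qed.

Lemma glue_ae r : aeeq Om (u r) (glue r).
Proof. by rewrite /glue; case: ltP => r0; [exact/hu0/ltW|exact: aeeq_refl]. Qed.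

Lemma measurable_half_line (f : R -> R) :
  measurable_fun (`]-oo, 0%R[%classic : set R) f -> measurable_fun Linf f ->
  measurable_fun setT f.
Proof.
move=> m1 m2; have -> : [set: R] = `]-oo, 0[%classic `|` `[0, +oo[%classic.
  by apply/esym/seteqP; split => // x _ /=; rewrite !in_itv/= andbT; case: ltP => h; [left|right].
exact/measurable_funU.
Qed.

Lemma glue_ip_measurable w : H10 Om w -> measurable_fun setT (fun r => gradip (glue r) w).
Proof.
move=> hw; have [hX hs _] := h0; apply: measurable_half_line.
  apply: (eq_measurable_fun (fun r => gradip (u0 r) w)).
    by move=> r; rewrite inE/= in_itv/= /glue => ->.
  apply: (@measurable_funS _ _ _ _ (`]-oo, 0%R]%classic : set R)) => //.
    by move=> r /=; rewrite !in_itv/= => /ltW.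
  apply: (strongly_measurable_ip SH (egradnrm_sqrt oO) hs); last exact: hw.
  by move=> t /=; rewrite in_itv/=; exact: hX.
apply: (eq_measurable_fun (fun r => gradip (u r) w)).
  by move=> r; rewrite inE/= in_itv/= andbT => r0; rewrite glue_ge0.
apply: half_continuous_measurable; exact: (CT_half_continuous SH (egradnrm_sqrt oO)).
Qed.

Local Notation G := (fun r => gradip (glue r) (glue r)).

Lemma glue_sqr_measurable : measurable_fun setT G.
Proof.
have [hX hs _] := h0; apply: measurable_half_line.
  apply: (eq_measurable_fun (fun r => gradip (u0 r) (u0 r))).
    by move=> r; rewrite inE/= in_itv/= /glue => ->.
  apply: (@measurable_funS _ _ _ _ (`]-oo, 0%R]%classic : set R)) => //.
    by move=> r /=; rewrite !in_itv/= => /ltW.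
  apply: (strongly_measurable_sqr SH (egradnrm_sqrt oO) hs).
  by move=> t /=; rewrite in_itv/=; exact: hX.
apply: (eq_measurable_fun (fun r => gradip (u r) (u r))).
  by move=> r; rewrite inE/= in_itv/= andbT => r0; rewrite glue_ge0.
apply: half_continuous_measurable; exact: (CT_half_continuous_sqr SH (egradnrm_sqrt oO)).
Qed.

Lemma gradnrm_hist t s : gradnrm Om (hist u t s) ^+ 2 =
  gradip (glue t - glue (t - s)) (glue t - glue (t - s)).
Proof.
transitivity (gradnrm Om (glue t - glue (t - s)) ^+ 2); last exact: gradnrm_sqr.
have H : aeeq Om (hist u t s) (glue t - glue (t - s)).
  apply: (ae_imp (ae_and (glue_ae t) (glue_ae (t - s)))) => x [h1 h2] Ox.
  by rewrite /hist/= h1// h2.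
by rewrite /gradnrm (egradnrm_ae_congr H).
Qed.

Lemma gradnrm_hist_le t s : gradnrm Om (hist u t s) ^+ 2 <= 2 * (G t + G (t - s)).
Proof.
rewrite gradnrm_hist; apply: le_trans (si_sqrD_le SH _ (si_XN SH _)) _; try exact: glue_H10.
by rewrite (si_sqrN SH)//; exact: glue_H10.
Qed.

Let G0 r : 0 <= G r. Proof. exact: (si_ge0 SH). Qed.

Variables (K : R).
Hypothesis GK : forall r, 0 <= r -> G r <= K.

Let K0 : 0 <= K. Proof. exact: le_trans (G0 0) (GK (lexx _)). Qed.

(** Extension by zero, so that delays can be integrated and translated on the whole line. *)
Let mup s := if 0 <= s then mu s else 0.

Let mup_measurable : measurable_fun setT mup.
Proof.
apply: measurable_half_line.
  apply: (eq_measurable_fun (fun=> 0 : R)) => // r; rewrite inE/= in_itv/= /mup => r0.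
  by rewrite leNgt r0.
apply: (eq_measurable_fun mu); last exact: mu_measurable h4.
by move=> r; rewrite inE/= in_itv/= andbT /mup => ->.
Qed.

Let mup_ge0 s : 0 <= mup s.
Proof. by rewrite /mup; case: ifP => // /(mu_ge0 h3 h4). Qed.

Let past_lty : (\int[L]_s (mup s * gradip (u0 (- s)) (u0 (- s)))%:E < +oo)%E.
Proof.
have [hX _ fin] := h0; apply: le_lt_trans fin; rewrite [leRHS]integral_mkcond.
rewrite le_eqVlt; apply/orP; left; apply/eqP; congr (integral _ _ _).
apply/funext => s; rewrite /patch; case: ifPn; rewrite ?inE ?notin_setE/= in_itv/= andbT.
  move=> s0; rewrite /mup s0 EFinM (egradnrm_sqrt oO); last by apply: hX; rewrite oppr_le0.
  by rewrite poweR_EFin powR_mulrn ?sqrtr_ge0// sqr_sqrtr// (si_ge0 SH).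
by move=> /negP s0; rewrite /mup (negbTE s0) mul0r.
Qed.

(** Delays up to [t] see the solution, whose gradient is bounded by [K]. Longer delays see the
    initial history: as the kernel decreases, mu(s) <= mu(s - t), and a translation reduces them to
    the finite history integral of [u0]. *)
Lemma delay_sqr_integrable t : 0 <= t -> L.-integrable Linf (fun s => (mu s * G (t - s))%:E).
Proof.
move=> t0.
have mG : measurable_fun setT (fun s : R => G (t - s)).
  by apply: (measurableT_comp glue_sqr_measurable); exact: measurable_funB.
(* At delay 0 the glued function is [u 0], not [u0 0]; the value 0 at this single point avoids
   comparing them. *)
pose q s := mup s * (if s == 0 then 0 else G (- s)).
pose h s := K * mup s + q (s - t).
have mq : measurable_fun setT q.
  apply: measurable_funM; first exact: mup_measurable.
  apply: measurable_fun_ifT; [exact: measurable_fun_eqr|exact: measurable_cst|].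
  by apply: (measurableT_comp glue_sqr_measurable); apply: measurable_funN; exact: measurable_id.
have q0 s : 0 <= q s by rewrite /q mulr_ge0//; case: ifP.
have mh : measurable_fun setT h.
  apply: measurable_funD; first exact: measurable_funM.
  by apply: (measurableT_comp mq); exact: measurable_funB.
have h_ge0 s : 0 <= h s by exact: addr_ge0 (mulr_ge0 K0 (mup_ge0 s)) (q0 _).
have ih : (\int[L]_s (h s)%:E < +oo)%E.
  under eq_integral do rewrite EFinD.
  rewrite ge0_integralD//; last 4 first.
  - by move=> s _; rewrite lee_fin mulr_ge0.
  - by apply/measurable_EFinP; exact: measurable_funM.
  - by move=> s _; rewrite lee_fin.
  - by apply/measurable_EFinP; apply: (measurableT_comp mq); exact: measurable_funB.
  have -> : (\int[L]_s (q (s - t))%:E = \int[L]_s (q s)%:E)%E.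
    by apply: (@integral_translation _ (EFin \o q)) => [|s]; [exact/measurable_EFinP|rewrite lee_fin].
  apply: lte_add_pinfty.
    under eq_integral do rewrite EFinM.
    rewrite ge0_integralZl_EFin//; last 2 first.
    - by move=> s _; rewrite lee_fin.
    - exact/measurable_EFinP.
    apply: lte_mul_pinfty => //.
    have [_ /integrableP[_ fin] _ _] := h4; apply: le_lt_trans fin.
    rewrite [leRHS]integral_mkcond; apply: le_integral_ge0 => s _; first by rewrite lee_fin.
    rewrite /patch /mup; case: ifPn => s0.
      by rewrite mem_set/= ?in_itv/= ?s0// lee_fin ler_norm.
    by case: ifP => // _; rewrite abse_ge0.
  apply: le_lt_trans past_lty; apply: le_integral_ge0 => s _; first by rewrite lee_fin.
  rewrite lee_fin /q; have [->|s0] := eqVneq s 0.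
    by rewrite mulr0 mulr_ge0// (si_ge0 SH).
  have [s1|s1] := ltP 0 s.
    have -> : glue (- s) = u0 (- s) by rewrite /glue oppr_lt0 s1.
    exact: lexx.
  have -> : mup s = 0 by rewrite /mup leNgt lt_neqAle s0 s1.
  by rewrite [leLHS]mul0r [leRHS]mul0r.
apply/integrableP; split.
  apply/measurable_EFinP; apply: measurable_funM; first exact: mu_measurable h4.
  exact: measurable_funTS.
apply: le_lt_trans ih; rewrite integral_mkcond; apply: le_integral_ge0 => s _.
  by rewrite /patch; case: ifP => // _; rewrite abse_ge0.
rewrite /patch; case: ifPn => [|_]; last by rewrite lee_fin.
rewrite inE/= in_itv/= andbT => s0; rewrite lee_fin ger0_norm; last first.
  by rewrite mulr_ge0// (mu_ge0 h3 h4).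
rewrite /h {1}/mup s0; have [st|ts] := leP s t.
  by rewrite -[leLHS]addr0 lerD// mulrC ler_wpM2r ?(mu_ge0 h3 h4)// GK// subr_ge0.
rewrite -[leLHS]add0r lerD ?mulr_ge0 ?(mu_ge0 h3 h4)//.
have -> : q (s - t) = mu (s - t) * G (t - s).
  by rewrite /q /mup subr_ge0 (ltW ts) subr_eq0 (gt_eqF ts) opprB.
apply: ler_wpM2r; first exact: G0.
by apply: (mu_nonincreasing h4); rewrite ?subr_ge0 ?(ltW ts)// gerBl.
Qed.

Let imu : L.-integrable Linf (EFin \o mu). Proof. by case: h4. Qed.

Let delay_ip_measurable t : measurable_fun Linf (fun s => gradip (glue (t - s)) (glue t)).
Proof.
apply: measurable_funTS; apply: (measurableT_comp (glue_ip_measurable (glue_H10 t))).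
exact: measurable_funB.
Qed.

Let mLinf : measurable Linf. Proof. exact: measurable_itv. Qed.

Let mu_ge0' s : Linf s -> 0 <= mu s.
Proof. by rewrite /= in_itv/= andbT; exact: mu_ge0. Qed.

Let delay_norm t s : `|gradip (glue (t - s)) (glue t)| <= G (t - s) + G t.
Proof. by apply: (si_norm_le SH); exact: glue_H10. Qed.

Let hist_expand t s : gradnrm Om (hist u t s) ^+ 2 =
  G t - 2 * gradip (glue (t - s)) (glue t) + G (t - s).
Proof. by rewrite gradnrm_hist (si_sqrB SH) ?(si_sym SH (glue t))//; exact: glue_H10. Qed.

Lemma hist_measurable t : measurable_fun Linf (fun s => gradnrm Om (hist u t s) ^+ 2).
Proof.
apply: (eq_measurable_fun (fun s : R => G t - 2 * gradip (glue (t - s)) (glue t) + G (t - s))).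
  by move=> s _; rewrite hist_expand.
apply: measurable_funD; last first.
  by apply: measurable_funTS; apply: (measurableT_comp glue_sqr_measurable); exact: measurable_funB.
apply: measurable_funB; first exact: measurable_cst.
by apply: measurable_funM; [exact: measurable_cst|exact: delay_ip_measurable].
Qed.

Definition delay_ip t := \int[L]_(s in Linf) (mu s * gradip (glue (t - s)) (glue t)).
Definition delay_sqr t := \int[L]_(s in Linf) (mu s * G (t - s)).

(** The mixed term is the one that occurs in the tested equation. The expansion also yields its
    measurability in time from that of the other terms. *)
Lemma memory_expand t : 0 <= t ->
  memory P u t = (ker P 0 - 1) * G t - 2 * delay_ip t + delay_sqr t.
Proof.
move=> t0; rewrite -(integral_mu h3 h4).
exact: (@weighted_dist_integral _ _ _ L Linf mLinf mu (fun s => G (t - s))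
  (fun s => gradip (glue (t - s)) (glue t)) (fun s => gradnrm Om (hist u t s) ^+ 2) (G t)
  (G0 t) imu (delay_sqr_integrable t0) (delay_ip_measurable t) (fun s _ => G0 _)
  (fun s _ => delay_norm t s) (fun s _ => hist_expand t s)).
Qed.

Lemma memory_ge0 t : 0 <= memory P u t.
Proof.
by apply: Rintegral_ge0 => s h; rewrite mulr_ge0 ?sqr_ge0// mu_ge0'.
Qed.

Lemma hist_integrable t : 0 <= t ->
  L.-integrable Linf (fun s => (mu s * gradnrm Om (hist u t s) ^+ 2)%:E).
Proof.
move=> t0.
exact: (@weighted_dist_integrable _ _ _ L Linf mLinf mu (fun s => G (t - s))
  (fun s => gradip (glue (t - s)) (glue t)) (fun s => gradnrm Om (hist u t s) ^+ 2) (G t)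
  (G0 t) imu (delay_sqr_integrable t0) (delay_ip_measurable t) (fun s _ => G0 _)
  (fun s _ => delay_norm t s) (fun s _ => hist_expand t s)).
Qed.

(** Write the delayed gradient as the present one minus the history difference and apply Young's
    inequality to the latter; a small [e] leaves almost exactly the mass k(0) - 1 in front of the
    gradient. *)
Lemma delay_ip_le t e : 0 <= t -> 0 < e ->
  delay_ip t <= (1 + e) * ((ker P 0 - 1) * G t) + memory P u t / (4 * e).
Proof.
move=> t0 e0; rewrite -(integral_mu h3 h4).
apply: (@weighted_ip_le _ _ _ L Linf mLinf mu (fun s => G (t - s))
  (fun s => gradip (glue (t - s)) (glue t)) (fun s => gradnrm Om (hist u t s) ^+ 2) (G t)
  mu_ge0' (G0 t) imu (delay_sqr_integrable t0) (delay_ip_measurable t) (fun s _ => G0 _)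
  (fun s _ => delay_norm t s) (fun s _ => hist_expand t s)) => // s _.
have ht := glue_H10 t; have hd : H10 Om (glue t - glue (t - s)) by exact: (si_XB SH ht (glue_H10 (t - s))).
have E : gradip (glue (t - s)) (glue t) = G t - gradip (glue t - glue (t - s)) (glue t).
  have hs := glue_H10 (t - s).
  by rewrite (si_D SH ht (si_XN SH hs) ht) (si_N SH hs ht) opprD opprK addrA subrr add0r.
have := si_young SH hd ht e0; rewrite gradnrm_hist E ler_norml => /andP[+ _].
exact: subr_le_of_opp_le.
Qed.

Lemma delay_sqr_measurable : measurable_fun Linf delay_sqr.
Proof.
pose F (z : R * R) : \bar R := (mup z.2 * G (z.1 - z.2))%:E.
have mF : measurable_fun setT F.
  apply/measurable_EFinP; apply: measurable_funM.
    by apply: (measurableT_comp mup_measurable); exact: measurable_snd.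
  apply: (measurableT_comp glue_sqr_measurable); apply: measurable_funB; first exact: measurable_fst.
  exact: measurable_snd.
have F0 z : (0 <= F z)%E by rewrite lee_fin mulr_ge0.
have := @measurable_fun_fubini_tonelli_F _ _ _ _ R L F mF F0.
move=> m; apply: measurable_funTS.
have -> : delay_sqr = fine \o fubini_F L F.
  apply/funext => t; rewrite /delay_sqr /Rintegral /= /fubini_F [in LHS]integral_mkcond; congr fine.
  by congr (integral _ _ _); apply/funext => s; rewrite patch_half /F/= /mup; case: ifP; rewrite ?mul0r.
exact: (measurableT_comp (fine_measurable measurableT)).
Qed.

End memory.

(** * Joint measurability and the damping term *)

Section uniform.
Context {R : realType}.

(** Heine's theorem for a squared distance: the triangle inequality holds only up to a factor 2,
    hence the tolerance e / 4. *)
Lemma uniform_on_segment (T : R) (d : R -> R -> R) :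
  (forall s r t, 0 <= s -> 0 <= r -> 0 <= t -> d s t <= 2 * (d s r + d t r)) ->
  (forall t : R, 0 <= t -> d s t @[s --> within `[0%R, +oo[ (nbhs t)] --> (0 : R)) ->
  forall e, 0 < e -> exists2 dl, 0 < dl &
    forall s t, 0 <= s -> 0 <= t -> t <= T -> `|s - t| < dl -> d s t < e.
Proof.
move=> tri cv e e0.
have /compact_near_coveringP K := @segment_compact R 0 T.
have := K R (0 : R)^'+ (fun dl t => forall s, 0 <= s -> 0 <= t -> `|s - t| < dl -> d s t < e) _.
case=> [|dl /= dl0 H].
  move=> t; rewrite /= in_itv/= => /andP[t0 tT].
  have e4 : 0 < e / 4 by rewrite divr_gt0.
  have /cvgr0Pnorm_lt/(_ _ e4) := cv t t0.
  rewrite near_withinE => /nbhs_ballP[n /= n0 hn].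
  have cl s : 0 <= s -> `|s - t| < n -> d s t < e / 4.
    move=> s0 st; have := hn s; rewrite /ball/= distrC => /(_ st).
    by rewrite in_itv/= s0 => /(_ isT); apply: le_lt_trans; exact: ler_norm.
  exists (ball t (n / 2), [set dl | dl < n / 2]).
    split; first by apply: nbhsx_ballx; rewrite divr_gt0.
    by apply: nbhs_right_lt; rewrite divr_gt0.
  move=> [t' dl]; rewrite /ball/= => -[tt' dln] s s0 t'0 st'.
  apply: le_lt_trans (tri s t t' s0 t0 t'0) _.
  have h2 : d s t < e / 4.
    by apply: cl => //; apply: le_lt_trans (ler_distD t' _ _) _; rewrite (distrC t' t); lra.
  have h3 : d t' t < e / 4 by apply: cl => //; rewrite distrC; lra.
  by lra.
have dl2 : 0 < dl / 2 by rewrite divr_gt0.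
exists (dl / 2) => // s t s0 t0 tT st; apply: (H (dl / 2)) => //.
- by rewrite /ball/= sub0r normrN gtr0_norm//; lra.
- by rewrite /= in_itv/= t0.
Qed.

End uniform.

Section joint_representative.
Context d (T1 : measurableType d) (R : realType) (m1 : {measure set T1 -> \bar R}).
Variables (D : set T1) (mD : measurable D) (v : R -> T1 -> R) (T : R).
Hypotheses (hv : forall t, 0 <= t -> sqint m1 D (v t))
  (cv : forall t : R, 0 <= t -> \int[m1]_(x in D) ((v s x - v t x) ^+ 2)
     @[s --> within `[0%R, +oo[ (nbhs t)] --> (0 : R)).

Let dist s t := \int[m1]_(x in D) ((v s x - v t x) ^+ 2).

Let sdist s t : 0 <= s -> 0 <= t -> sqint m1 D (fun x => v s x - v t x).
Proof. by move=> s0 t0; apply: (sqintD mD (hv s0)); exact: (sqintN mD (hv t0)). Qed.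

Let dist_tri s r t : 0 <= s -> 0 <= r -> 0 <= t -> dist s t <= 2 * (dist s r + dist t r).
Proof.
move=> s0 r0 t0; have [_ i1] := sdist s0 r0; have [_ i2] := sdist t0 r0.
have [_ i3] := sdist s0 t0; rewrite /dist -(RintegralD mD i1 i2) -RintegralZl//; last first.
  exact: (integrableD mD i1 i2).
apply: le_Rintegral => //; first exact: (integrableZl mD 2 (integrableD mD i1 i2)).
by move=> x _; have := sqr_ge0 ((v s x - v r x) + (v t x - v r x)); nra.
Qed.

(** Sampling in time with step [dl]: a finite sum of products of a function of time and a function
    of space, hence jointly measurable. *)
Let grid (dl : R) (n : nat) (z : T1 * R) : R :=
  \sum_(k < n) \1_(`[k%:R * dl, k.+1%:R * dl[%classic : set R) z.2 *
    (\1_D z.1 * v (k%:R * dl) z.1).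

Let grid_measurable dl n : 0 <= dl -> measurable_fun setT (grid dl n).
Proof.
move=> dl0; apply: measurable_sum => k; apply: measurable_funM.
  by apply: (measurableT_comp _ measurable_snd); exact: measurable_indic.
have m : measurable_fun setT (fun x => \1_D x * v (k%:R * dl) x).
  have [mv _] := hv (mulr_ge0 (ler0n R k) dl0).
  have -> : (fun x => \1_D x * v (k%:R * dl) x) = (v (k%:R * dl)) \_ D.
    apply/funext => x; rewrite patchE indicE; case: ifP => _; rewrite ?mul1r ?mul0r//.
  exact/(measurable_restrictT _ mD).
exact: (measurableT_comp m measurable_fst).
Qed.

Let gridE dl n t : 0 < dl -> 0 <= t -> t < n%:R * dl ->
  exists s, [/\ 0 <= s, `|s - t| < dl & forall x, D x -> grid dl n (x, t) = v s x].
Proof.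
move=> dl0 t0 tn; pose k := Num.truncn (t / dl).
have /truncn_itv/andP[] : 0 <= t / dl by rewrite divr_ge0// ltW.
rewrite -/k ler_pdivlMr// ltr_pdivrMr// => k1 k2.
have kn : (k < n)%N.
  by rewrite -(ltr_nat R) -(ltr_pM2r dl0); exact: le_lt_trans tn.
exists (k%:R * dl); split => [||x Dx]; first by rewrite mulr_ge0// ltW.
  rewrite ler0_norm ?subr_le0// opprB ltrBlDr.
  by move: k2; rewrite -natr1 mulrDl mul1r addrC.
rewrite /grid (bigD1 (Ordinal kn))//= big1 ?addr0.
  by rewrite !indicE !mem_set//= ?in_itv/= ?k1// !mul1r.
move=> i ik; rewrite indicE memNset ?mul0r//= in_itv/= => /andP[i1 i2].
move/eqP : ik; apply; apply/val_inj => /=; apply/eqP; rewrite eqn_leq.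
have cmp (a b : nat) : a%:R * dl <= t -> t < b.+1%:R * dl -> (a <= b)%N.
  by move=> h1 h2; rewrite -ltnS -(ltr_nat R) -(ltr_pM2r dl0); exact: le_lt_trans h2.
by rewrite (cmp _ _ i1 k2) (cmp _ _ k1 i2).
Qed.

(* Summably fast sampling in time gives step functions that converge almost
   everywhere at each time. *)
Lemma joint_representative : exists h : T1 * R -> R, measurable_fun setT h /\
  forall t, 0 <= t -> t < T -> {ae m1, forall x, D x -> v t x = h (x, t)}.
Proof.
have U := @uniform_on_segment R T dist dist_tri cv.
have dlP n : {dl : R | 0 < dl & forall s t, 0 <= s -> 0 <= t -> t <= T ->
    `|s - t| < dl -> dist s t < (2^-1) ^+ n}.
  by apply: cid2; apply: U; rewrite exprn_gt0.
pose dl n := s2val (dlP n); have dl0 n : 0 < dl n by rewrite /dl; case: (dlP n).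
pose N n := (Num.truncn (`|T| / dl n)).+1.
have TN n : T < (N n)%:R * dl n.
  rewrite -ltr_pdivrMr//; have /truncn_itv/andP[_ +] : 0 <= `|T| / dl n by rewrite divr_ge0// ltW.
  by apply: le_lt_trans; rewrite ler_pM2r ?invr_gt0// ler_norm.
pose g n := grid (dl n) (N n).
have mg n : measurable_fun setT (g n) by apply: grid_measurable; exact: ltW.
(* The upper limit exists at every point and is jointly measurable; [fine] gives a harmless default
   value where it is infinite. *)
exists (fun z => fine (limn_esup (fun n => (g n z)%:E))); split.
  apply: (measurableT_comp (@fine_measurable _ setT measurableT)).
  by apply: measurable_fun_limn_esup => n; exact/measurable_EFinP.
move=> t t0 tT; have [mvt _] := hv t0.
have mgt n : measurable_fun D (fun x => g n (x, t)).
  by apply: measurable_funTS; apply: (measurableT_comp (mg n)); exact: measurable_pair2.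
have C : {ae m1, forall x, D x -> (fun n => g n (x, t)) @ \oo --> v t x}.
  apply: (ae_cvg_of_summable mD mgt mvt) => n.
  have [s [s0 st gE]] := gridE (dl0 n) t0 (lt_trans tT (TN n)).
  have [_ i1] := sdist s0 t0.
  have -> : (\int[m1]_(x in D) ((g n (x, t) - v t x) ^+ 2)%:E = (dist s t)%:E)%E.
    rewrite /dist /Rintegral fineK; last exact: integrable_fin_num.
    by apply: eq_integral => x; rewrite inE => Dx; rewrite -(gE x Dx).
  rewrite lee_fin ltW//; move: st; rewrite /dl; case: (dlP n) => /= e _ h st.
  by apply: h => //; exact: ltW.
apply: (ae_imp C) => x h Dx; have {}h := h Dx.
have [] // := @cvg_limn_einf_sup R (fun n => (g n (x, t))%:E) (v t x)%:E.
  by apply: cvg_EFin; [exact: nearW|exact: h].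
by move=> _ ->.
Qed.

End joint_representative.

(** If y <= c x the first term alone suffices, otherwise the second one does. *)
Lemma cross_le (R : realType) (r x y : R) : 1 <= r -> 0 <= x -> 0 <= y ->
  forall c, 0 < c -> x `^ r * y <= c * x `^ (r + 1) + c `^ (- r) * y `^ (r + 1).
Proof.
move=> r1 x0 y0 c c0; have r0 : 0 < r by exact: lt_le_trans r1.
have E (z : R) : 0 <= z -> z `^ (r + 1) = z `^ r * z.
  move=> z0; rewrite powRD ?powRr1//.
  by rewrite (gt_eqF (ltr_wpDr ler01 r0)).
rewrite !E//; have [yx|xy] := leP y (c * x).
  apply: (@le_trans _ _ (c * (x `^ r * x))); last by rewrite lerDl !mulr_ge0 ?powR_ge0.
  by rewrite mulrCA ler_wpM2l ?powR_ge0.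
apply: (@le_trans _ _ (c `^ (- r) * (y `^ r * y))); last by rewrite lerDr !mulr_ge0 ?powR_ge0// ltW.
rewrite mulrA ler_wpM2r// powRN mulrC ler_pdivlMr ?powR_gt0// -powRM ?(ltW c0)//.
by apply: ge0_ler_powR; rewrite ?nnegrE ?mulr_ge0 ?(ltW c0) ?(ltW r0)// mulrC ltW.
Qed.

Section cross_term.
Context d (T1 : measurableType d) (R : realType) (m1 : {measure set T1 -> \bar R}).
Hypothesis sf1 : sigma_finite [set: T1] m1.
Local Notation L := (@lebesgue_measure R).
Variables (D : set T1) (mD : measurable D) (v w : R -> T1 -> R) (T K q : R) (h h1 : T1 * R -> R).
Hypotheses (T0 : 0 < T) (K0 : 0 <= K) (q0 : 0 < q).
Local Notation cyl := (D `*` (`]0%R, T[%classic : set R)).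
Hypotheses (mh : measurable_fun setT h)
  (hE : forall t, 0 <= t -> t < T -> {ae m1, forall x, D x -> v t x = h (x, t)})
  (vK : forall t, 0 <= t -> (\int[m1]_(x in D) (`|v t x| `^ q)%:E <= K%:E)%E).

Let mcyl : measurable cyl. Proof. by apply: measurableX. Qed.

Let mpow (g : T1 * R -> R) : measurable_fun cyl g ->
  measurable_fun cyl (fun z => `|g z| `^ q).
Proof.
by move=> mg; apply: (measurableT_comp (measurable_powR q)); exact: measurableT_comp.
Qed.

Lemma joint_powR_lty : (\int[m1 \x L]_(z in cyl) (`|h z| `^ q)%:E < +oo)%E.
Proof.
pose f := (fun z => (`|h z| `^ q)%:E) \_ cyl.
have mf : measurable_fun setT f.
  apply/(measurable_restrictT _ mcyl); apply/measurable_EFinP; apply: mpow.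
  exact: measurable_funTS.
have f0 z : (0 <= f z)%E by apply: erestrict_ge0 => // {}z _; rewrite lee_fin powR_ge0.
have TL := @sf_tonelli2 _ _ T1 _ R m1 sf1 L f mf f0.
rewrite integral_mkcond -/f TL.
apply: (@le_lt_trans _ _ (\int[L]_(t in `]0%R, T[) K%:E)%E); last first.
  rewrite (@integral_cst _ _ _ L _ (measurable_itv `]0%R, T[)).
  have H : (L `]0%R, T[%classic < +oo)%E by rewrite lebesgue_measure_itv/= lte_fin T0 -EFinB ltry.
  by apply: lte_mul_pinfty => //; rewrite lee_fin.
rewrite [leRHS]integral_mkcond; apply: le_integral_ge0 => t _.
  by apply: integral_ge0.
rewrite patchE; case: ifPn => [|/negbTE] tT; last first.
  rewrite integral0_eq// => x _; rewrite /f patchE ifF//; apply/negbTE/negP.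
  by rewrite inE => -[_ /= h2]; move: tT; rewrite mem_set.
have [t0 tT'] : 0 < t /\ t < T by move: tT; rewrite inE/= in_itv/= => /andP[].
apply: le_trans (vK (ltW t0)); rewrite [leRHS]integral_mkcond.
rewrite le_eqVlt; apply/orP; left; apply/eqP; apply: ae_eq_integral_all.
apply: (ae_imp (hE (ltW t0) tT')) => x e _; rewrite /f !patchE.
case: ifPn => [|/negbTE] xD; first by move: xD; rewrite inE => -[/= Dx _]; rewrite mem_set// e.
case: ifPn => // Dx; move: xD; rewrite mem_set//; split; first by rewrite inE in Dx.
by rewrite inE in tT.
Qed.

Variable r : R.
Hypotheses (r1 : 1 <= r) (qE : q = r + 1).
Hypotheses (mh1 : measurable_fun cyl h1)
  (h1q : (\int[m1 \x L]_(z in cyl) (`|h1 z| `^ q)%:E < +oo)%E)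
  (wh1 : {ae L, forall t, t \in `]0%R, T[ -> {ae m1, forall x, D x -> w t x = h1 (x, t)}}).

Local Notation cross t := (\int[m1]_(x in D) (`|w t x| `^ (r - 1) * w t x * v t x)).

(** The slices agree with [w] at almost all times only, and on the exceptional times nothing is
    known about the cross term. The function [C] is an integrable version which at every time equals
    the cross term or 0, so that pointwise bounds by its absolute value survive. *)
Lemma cross_term_integrable : exists C : R -> R,
  [/\ L.-integrable `]0%R, T[ (EFin \o C),
      {ae L, forall t, t \in `]0%R, T[ -> cross t = C t} &
      forall t, t \in `]0%R, T[ -> C t = cross t \/ C t = 0].
Proof.
pose F := (fun z => `|h1 z| `^ (r - 1) * h1 z * h z) \_ cyl.
have mF : measurable_fun setT F.
  apply/(measurable_restrictT _ mcyl); apply: measurable_funM; last exact: measurable_funTS.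
  apply: measurable_funM => //; apply: (measurableT_comp (measurable_powR (r - 1))).
  exact: measurableT_comp.
have iF : (m1 \x L)%E.-integrable setT (EFin \o F).
  apply/integrableP; split; first exact/measurable_EFinP.
  pose S := (fun z => (`|h1 z| `^ q)%:E + (`|h z| `^ q)%:E)%E \_ cyl.
  apply: (@le_lt_trans _ _ (\int[m1 \x L]_z S z)%E).
    apply: le_integral_ge0 => z _ //; rewrite /S /F/= !patchE; case: ifP => _; last by rewrite normr0.
    rewrite -EFinD lee_fin !normrM (ger0_norm (powR_ge0 _ _)) qE.
    have E : `|h1 z| `^ (r - 1) * `|h1 z| = `|h1 z| `^ r.
      have [->|z0] := eqVneq (h1 z) 0; last by rewrite (powRr_pred r)// normr_gt0.
      by rewrite normr0 mulr0 powR0// gt_eqF// (lt_le_trans ltr01).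
    rewrite E; have := cross_le r1 (normr_ge0 (h1 z)) (normr_ge0 (h z)) ltr01.
    by rewrite powR1 !mul1r.
  rewrite -integral_mkcond ge0_integralD//.
  - by apply: lte_add_pinfty; [exact: h1q|exact: joint_powR_lty].
  - by apply/measurable_EFinP; exact: mpow.
  - by apply/measurable_EFinP; apply: mpow; exact: measurable_funTS.
pose phi t := (\int[m1]_x (F (x, t))%:E)%E.
have iphi : L.-integrable setT phi := @sf_integrable_fubini2 _ _ T1 _ R m1 sf1 L _ iF.
(* A measurable null set of times containing all exceptional ones; [C] is set to 0 on it. *)
have [Z [mZ Z0 subZ]] := wh1.
have phiE t : t \in `]0%R, T[ -> {ae m1, forall x, D x -> w t x = h1 (x, t)} ->
    fine (phi t) = cross t.
  move=> tT wt; have [t0 tT'] : 0 < t /\ t < T by move: tT; rewrite in_itv/= => /andP[].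
  rewrite /Rintegral [in RHS]integral_mkcond; congr fine; apply: ae_eq_integral_all.
  apply: (ae_imp (ae_and (hE (ltW t0) tT') wt)) => x [e1 e2] _; rewrite /F !patchE.
  case: ifPn => [|/negbTE] xD.
    by move: xD; rewrite inE => -[/= Dx _]; rewrite mem_set// e1// e2.
  by case: ifPn => // Dx; move: xD; rewrite mem_set//; split => //; rewrite inE in Dx.
exists (fun t => \1_(~` Z) t * fine (phi t)); split.
- have [mphi iphi'] : measurable_fun setT phi /\ True by case/integrableP: iphi.
  apply: (@le_integrable _ _ _ L _ _ _ phi) => //.
  + apply/measurable_EFinP; apply: measurable_funTS; apply: measurable_funM.
      by apply: measurable_indic; exact: measurableC.
    exact: (measurableT_comp (fine_measurable measurableT)).
  + move=> t _ /=; have [->|->] : \1_(~` Z) t = 0 :> R \/ \1_(~` Z) t = 1 :> R.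
    * by rewrite indicE; case: (_ \in _); [right|left].
    * by rewrite mul0r normr0; exact: abse_ge0.
    * by rewrite mul1r; case: (phi t) => //= [|]; rewrite ?normr0 ?leey.
  + exact: (integrableS measurableT).
- exists Z; split => // t /= /not_implyP[tT ct]; apply: contrapT => nZ; apply: ct.
  rewrite indicE mem_set//= mul1r; apply/esym/phiE => //.
  by apply: contrapT => H; apply: nZ; apply: subZ => /= H'; apply: H; exact: H'.
- move=> t tT; rewrite indicE; have [tZ|tZ] := boolP (t \in ~` Z); last by right; rewrite mul0r.
  left; rewrite mul1r; apply: phiE => //; apply: contrapT => H.
  by move: tZ; rewrite inE; apply; apply: subZ => /= H'; apply: H; exact: H'.
Qed.

End cross_term.

(** * Decay of sequences and of monotone functions *)

Section decay.
Context {R : realType}.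

Lemma powR_onem_le (al t : R) : 0 <= al -> 0 <= t -> t <= 1 ->
  (1 + t) `^ al <= 1 + al * expR al * t.
Proof.
move=> al0 t0 t1; have t1_gt0 : 0 < 1 + t by rewrite ltr_wpDr.
have -> : (1 + t) `^ al = expR (al * ln (1 + t)) by rewrite /powR gt_eqF.
have h1 : al * ln (1 + t) <= al * t.
  by rewrite ler_wpM2l//; have := le_ln1Dx (lt_le_trans (ltrN10 R) t0).
apply: (@le_trans _ _ (expR (al * t))); first by rewrite ler_expR.
have at0 : 0 <= al * t by exact: mulr_ge0.
apply: (@le_trans _ _ (1 + (al * t) * expR (al * t))).
  have e0 := expR_gt0 (al * t); have := expR_ge1Dx (- (al * t)).
  by rewrite expRN -(ler_pM2r e0) mulVf ?gt_eqF//; lra.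
rewrite lerD2l [leRHS]mulrAC; apply: ler_wpM2l => //; rewrite ler_expR.
by rewrite -[leRHS]mulr1 ler_wpM2l.
Qed.

(** A discrete form of the derivative of x^(-al); the factor 2 comes from 1 / x <= 2 / (x + 1) for x
    >= 1. *)
Lemma powR_sub_le (al x : R) : 0 <= al -> 1 <= x ->
  x `^ (- al) - (x + 1) `^ (- al) <= 2 * (al * expR al) * (x + 1) `^ (- al - 1).
Proof.
move=> al0 x1; have x0 : 0 < x by exact: lt_le_trans x1.
have x10 : 0 < x + 1 by rewrite ltr_wpDr.
have t1 : x^-1 <= 1 by rewrite invf_le1.
have t0 : 0 <= x^-1 by rewrite invr_ge0 ltW.
have := powR_onem_le al0 t0 t1.
have -> : 1 + x^-1 = (x + 1) / x by field; rewrite gt_eqF.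
rewrite powRM ?(ltW x10)// -powR_inv1 ?(ltW x0)// -powRrM mulN1r => h.
have e0 : 0 <= al * expR al by rewrite mulr_ge0// expR_ge0.
have E : (x + 1) `^ (- al - 1) = (x + 1) `^ (- al) / (x + 1).
  by rewrite powRB ?powRr1 ?(ltW x10)// (gt_eqF x10) implybT.
have -> : x `^ (- al) - (x + 1) `^ (- al) =
    (x + 1) `^ (- al) * ((x + 1) `^ al * x `^ (- al) - 1).
  by rewrite mulrBr mulr1 mulrA (powRN (x + 1)) mulVf ?mul1r// gt_eqF// powR_gt0.
rewrite E [leRHS]mulrCA ler_wpM2l ?powR_ge0//.
rewrite powR_inv1 ?(ltW x0)// in h; apply: (@le_trans _ _ (al * expR al * x^-1)); first lra.
rewrite (_ : 2 * (al * expR al) / (x + 1) = al * expR al * (2 / (x + 1))); last by ring.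
apply: ler_wpM2l => //.
by rewrite -div1r ler_pdivrMr// mulrAC ler_pdivlMr//; lra.
Qed.

(** Suppose that the bound holds at n and fails at n + 1. The drop between them is at most that of
    the model sequence, of order K (n+2)^(-1/r-1), while the recursion demands a drop of order
    K^(1+r) (n+2)^(-1/r-1). A large K excludes this. *)
Lemma discrete_decay (C r x0 : R) : 0 < C -> 0 < r -> exists2 K, 0 < K &
  forall x : nat -> R, (forall n, 0 <= x n) -> x 0%N <= x0 ->
    (forall n, x n.+1 `^ (1 + r) <= C * (x n - x n.+1)) ->
    forall n, x n <= K * n.+1%:R `^ (- r^-1).
Proof.
move=> C0 r0; pose al := r^-1; pose c := 2 * (al * expR al).
have al0 : 0 < al by rewrite invr_gt0.
have c0 : 0 < c by rewrite !mulr_gt0// expR_gt0.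
(* [K] dominates the initial value and, as al r = 1, satisfies K^r > c C. *)
pose K := Num.max `|x0| ((c * C) `^ al) + 1.
have K0 : 0 < K by rewrite ltr_wpDl// le_max normr_ge0.
exists K => // x xge0 xx0 step; elim=> [|n IH].
  rewrite powR1 mulr1 (le_trans xx0)// (le_trans (ler_norm _))//.
  by rewrite /K -[leLHS]addr0 lerD// le_max lexx.
rewrite leNgt; apply/negP => H; pose y := n.+2%:R : R.
have y0 : 0 < y by rewrite ltr0n.
have Ky : 0 < K * y `^ (- al) by rewrite mulr_gt0// powR_gt0.
have h1 : (K * y `^ (- al)) `^ (1 + r) <= C * (x n - x n.+1).
  apply: le_trans (step n); apply: ge0_ler_powR; rewrite ?nnegrE ?(ltW Ky)//.
    by rewrite addr_ge0// ltW.
  exact: ltW.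
have h2 : x n - x n.+1 <= K * (c * y `^ (- al - 1)).
  have n1 : 1 <= n.+1%:R :> R by rewrite ler1n.
  have := powR_sub_le (ltW al0) n1; rewrite natr1 -/y -/c => h.
  apply: (@le_trans _ _ (K * (n.+1%:R `^ (- al) - y `^ (- al)))); last by rewrite ler_pM2l.
  by rewrite mulrBr; apply: lerB => //; exact: ltW.
have h3 : (K * y `^ (- al)) `^ (1 + r) = K * K `^ r * y `^ (- al - 1).
  rewrite powRM ?(ltW K0) ?powR_ge0// -powRrM.
  have -> : - al * (1 + r) = - al - 1 by rewrite mulrDr mulr1 /al mulNr mulVf ?gt_eqF.
  by rewrite powRD ?powRr1 ?(ltW K0)// (gt_eqF K0) implybT.
have y1 : 0 < y `^ (- al - 1) by exact: powR_gt0.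
have : K * K `^ r * y `^ (- al - 1) <= C * (K * (c * y `^ (- al - 1))).
  by rewrite -h3; apply: le_trans h1 _; rewrite ler_pM2l.
have -> : C * (K * (c * y `^ (- al - 1))) = K * (c * C) * y `^ (- al - 1) by ring.
rewrite ler_pM2r// ler_pM2l// leNgt => /negP; apply.
have cC : 0 < c * C by rewrite mulr_gt0.
have -> : c * C = ((c * C) `^ al) `^ r by rewrite -powRrM /al mulVf ?gt_eqF// powRr1// ltW.
apply: gt0_ltr_powR; rewrite ?nnegrE ?powR_ge0 ?(ltW K0)//.
by rewrite /K; apply: (@le_lt_trans _ _ (Num.max `|x0| ((c * C) `^ al))); rewrite ?le_max ?lexx ?orbT// ltrDl.
Qed.

Variables (C T E0 : R) (C0 : 0 < C) (T0 : 0 < T).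

Lemma truncn_step (t : R) : 0 <= t ->
  (Num.truncn (t / T))%:R * T <= t /\ (1 + t) / (1 + T) <= (Num.truncn (t / T)).+1%:R.
Proof.
move=> t0; have /truncn_itv/andP[] : 0 <= t / T by rewrite divr_ge0// ltW.
move: (Num.truncn _) => n; rewrite ler_pdivlMr// => h1; rewrite ltr_pdivrMr// => h2; split => //.
rewrite ler_pdivrMr ?ltr_wpDl// mulrDr mulr1; apply: lerD; last exact: ltW.
by rewrite ler1n.
Qed.

Lemma polynomial_decay r : 0 < r -> exists2 K, 0 < K & forall E : R -> R,
  (forall t, 0 <= t -> 0 <= E t) -> (forall s t, 0 <= s -> s <= t -> E t <= E s) ->
  E 0 <= E0 ->
  (forall S la, 0 <= S -> 1 <= la ->
     E (S + T) <= C * (la `^ r * (E S - E (S + T)) + la^-1)) ->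
  forall t, 0 <= t -> E t <= K * (1 + t) `^ (- r^-1).
Proof.
(* [C1] is at least [C] and at least every value of [E], so that [la] below is at least 1. *)
move=> r0; pose C1 := C + `|E0|; have C10 : 0 < C1 by rewrite ltr_wpDr.
pose C2 := (2 * C1) `^ (1 + r); have C20 : 0 < C2 by rewrite powR_gt0// mulr_gt0.
have [K K0 HK] := @discrete_decay C2 r E0 C20 r0.
have T1 : 0 < 1 + T by rewrite ltr_wpDl.
exists (K * (1 + T) `^ r^-1); first by rewrite mulr_gt0// powR_gt0.
move=> E Ege0 Edec EE0 step t t0.
have nT n : 0 <= n%:R * T by rewrite mulr_ge0// ltW.
have X n : E (n%:R * T) <= K * n.+1%:R `^ (- r^-1).
  apply: (HK (fun n => E (n%:R * T))) => {n} [n||n]; rewrite ?mul0r//; first exact: Ege0.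
  have -> : n.+1%:R * T = n%:R * T + T by rewrite -natr1 mulrDl mul1r.
  set S := n%:R * T; have S0 : 0 <= S by exact: nT.
  have ST0 : 0 <= S + T by rewrite addr_ge0// ltW.
  have D0 : 0 <= E S - E (S + T) by rewrite subr_ge0 Edec// lerDl ltW.
  have := Ege0 _ ST0; rewrite le_eqVlt => /orP[/eqP <-|x0].
    have r10 : 1 + r != 0 by rewrite gt_eqF// ltr_wpDr// ltW.
    rewrite (powR0 r10); apply: mulr_ge0; first exact: ltW.
    by rewrite subr0 Ege0.
  move: x0 D0 (step S) ; have := Edec 0 (S + T) (lexx _) ST0.
  move: (E S) (E (S + T)) => y x xE x0 D0 {}step.
  have xC : x <= C1 by rewrite (le_trans xE)// (le_trans EE0)// (le_trans (ler_norm _))// lerDr ltW.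
  (* This choice makes C1 / la equal to x / 2, which is absorbed by the left-hand side. *)
  pose la := 2 * C1 / x; have la0 : 0 < la by rewrite divr_gt0// mulr_gt0.
  have la1 : 1 <= la by rewrite ler_pdivlMr// mul1r; lra.
  have := step la S0 la1; have CC1 : C <= C1 by rewrite lerDl.
  have P0 : 0 <= la `^ r * (y - x) + la^-1.
    by rewrite addr_ge0 ?mulr_ge0 ?powR_ge0// invr_ge0 ltW.
  move=> h; have {h} : x <= C1 * (la `^ r * (y - x) + la^-1).
    by apply: le_trans h _; rewrite ler_wpM2r.
  have e1 : C1 * la^-1 = x / 2 by rewrite /la; field; rewrite !gt_eqF.
  rewrite mulrDr e1 => h; have {h} : x <= 2 * C1 * la `^ r * (y - x) by lra.
  have -> : la `^ r = (2 * C1) `^ r / x `^ r.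
    by rewrite /la powRM ?(ltW (mulr_gt0 _ C10))// ?invr_ge0 ?(ltW x0)// -powR_inv1 ?(ltW x0)// -powRrM mulN1r powRN.
  have xr : 0 < x `^ r by exact: powR_gt0.
  rewrite -(ler_pM2r xr) => h.
  have -> : x `^ (1 + r) = x * x `^ r.
    by rewrite powRD ?powRr1 ?(ltW x0)// (gt_eqF x0) implybT.
  apply: le_trans h _; rewrite /C2 powRD; last by rewrite (gt_eqF (mulr_gt0 _ C10)) ?implybT.
  rewrite powRr1; last by rewrite mulr_ge0// ltW.
  by rewrite le_eqVlt; apply/orP; left; apply/eqP; field; rewrite gt_eqF.
have [h1 h2] := truncn_step t0.
apply: (le_trans (Edec _ _ (nT (Num.truncn (t / T))) h1)).
apply: (le_trans (X _)); rewrite -mulrA ler_pM2l//.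
rewrite [in leRHS]powRN ler_pdivlMr ?powR_gt0 ?ltr_wpDr//.
rewrite powRN mulrC ler_pdivrMr ?powR_gt0// -powRM ?(ltW T1)//.
apply: ge0_ler_powR; rewrite ?nnegrE ?invr_ge0 ?(ltW r0) ?addr_ge0 ?mulr_ge0 ?(ltW T1)//.
by rewrite mulrC -ler_pdivrMr.
Qed.

(** Letting [la] tend to infinity gives E(S+T) <= C (E(S) - E(S+T)), a contraction by C / (1 + C)
    over each period. The division by [rho] in the constant pays for the incomplete last period. *)
Lemma exponential_decay : exists K ka : R, [/\ 0 < K, 0 < ka & forall E : R -> R,
  (forall t, 0 <= t -> 0 <= E t) -> (forall s t, 0 <= s -> s <= t -> E t <= E s) ->
  E 0 <= E0 ->
  (forall S la, 0 <= S -> 1 <= la -> E (S + T) <= C * ((E S - E (S + T)) + la^-1)) ->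
  forall t, 0 <= t -> E t <= K * expR (- ka * t)].
Proof.
pose rho := C / (1 + C); have C1 : 0 < 1 + C by rewrite ltr_wpDl.
have rho0 : 0 < rho by rewrite divr_gt0.
have rho1 : rho < 1 by rewrite ltr_pdivrMr// mul1r ltrDr.
pose ka := - ln rho / T; have lnrho : ln rho < 0 by rewrite ln_lt0// rho0.
have ka0 : 0 < ka by rewrite divr_gt0// oppr_gt0.
exists ((`|E0| + 1) / rho), ka; split => //; first by rewrite divr_gt0// ltr_wpDl.
move=> E Ege0 Edec EE0 step t t0.
have nT n : 0 <= n%:R * T by rewrite mulr_ge0// ltW.
have X n : E (n%:R * T) <= (`|E0| + 1) * rho ^+ n.
  elim: n => [|n IH].
    by rewrite mul0r expr0 mulr1 (le_trans EE0)// (le_trans (ler_norm _))// lerDl.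
  have -> : n.+1%:R * T = n%:R * T + T by rewrite -natr1 mulrDl mul1r.
  set S := n%:R * T in IH *; have S0 : 0 <= S by exact: nT.
  have st := step S ^~ S0; rewrite exprS.
  move: (E S) (E (S + T)) IH st => y x IH st.
  have h : x <= C * (y - x).
    apply/ler_addgt0Pr => e e0; pose la := Num.max 1 (C / e).
    have la1 : 1 <= la by rewrite le_max lexx.
    have la0 : 0 < la by exact: lt_le_trans la1.
    apply: le_trans (st la la1) _; rewrite mulrDr lerD2l ler_pdivrMr//.
    by rewrite mulrC -ler_pdivrMr// le_max lexx orbT.
  apply: (@le_trans _ _ (rho * y)); last by rewrite mulrCA ler_pM2l.
  by rewrite /rho mulrAC ler_pdivlMr//; lra.
have [h1 _] := truncn_step t0.
apply: (le_trans (Edec _ _ (nT (Num.truncn (t / T))) h1)).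
apply: (le_trans (X _)); rewrite -mulrA ler_pM2l ?ltr_wpDl//.
rewrite ler_pdivlMl// -exprS.
have -> : rho ^+ (Num.truncn (t / T)).+1 = expR (ln rho * (Num.truncn (t / T)).+1%:R).
  by rewrite expRM_natr lnK.
rewrite ler_expR; have -> : - ka * t = ln rho * (t / T) by rewrite /ka; field; rewrite gt_eqF.
rewrite ler_nM2l//.
have /truncn_itv/andP[_ +] : 0 <= t / T by rewrite divr_ge0// ltW.
exact: ltW.
Qed.

End decay.

(** * Continuity of the norms and integrals of the source *)

Section power_sums.
Context d (T : measurableType d) (R : realType) (nu : {measure set T -> \bar R}).
Variables (D : set T) (mD : measurable D) (f : T -> R).

Lemma Rintegral_power_sums n k (c e : 'I_n -> R) (b g : 'I_k -> R) :
  (forall i, nu.-integrable D (fun x => (`|f x| `^ e i)%:E)) ->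
  (forall j, nu.-integrable D (fun x => (`|f x| `^ g j)%:E)) ->
  \int[nu]_(x in D) (\sum_i c i * `|f x| `^ e i - \sum_j b j * `|f x| `^ g j) =
  \sum_i c i * \int[nu]_(x in D) (`|f x| `^ e i) -
  \sum_j b j * \int[nu]_(x in D) (`|f x| `^ g j).
Proof.
move=> ie ig.
have i1 i : nu.-integrable D (EFin \o (fun x => c i * `|f x| `^ e i)) := integrableZl mD (c i) (ie i).
have i2 j : nu.-integrable D (EFin \o (fun x => b j * `|f x| `^ g j)) := integrableZl mD (b j) (ig j).
have s1 := integrable_sum_ord mD i1; have s2 := integrable_sum_ord mD i2.
rewrite (RintegralB mD s1 s2) (Rintegral_sum_ord mD i1) (Rintegral_sum_ord mD i2).
by congr (_ - _); apply: eq_bigr => i _; [rewrite (RintegralZl _ mD (ie i))|rewrite (RintegralZl _ mD (ig i))].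
Qed.

Lemma powR_integrable q : measurable_fun D f ->
  (\int[nu]_(x in D) (`|f x| `^ q)%:E < +oo)%E ->
  nu.-integrable D (fun x => (`|f x| `^ q)%:E).
Proof.
move=> mf fq; apply/integrableP; split.
  apply/measurable_EFinP; apply: (measurableT_comp (measurable_powR q)).
  exact: measurableT_comp.
by move: fq; congr (_ < _)%E; congr (integral _ _ _); apply/funext => x; rewrite gee0_abs// lee_fin powR_ge0.
Qed.

End power_sums.

Lemma dist_le_of_triangle (R : realDomainType) (a b c c' k : R) :
  a <= b + c -> b <= a + c' -> c <= k -> c' <= k -> `|a - b| <= k.
Proof. by move=> *; rewrite ler_distl; apply/andP; split; lra. Qed.

Section norms.
Context {R : realType} (Om : set (E3 R)).
Hypotheses (oO : open Om) (bO : bounded_set Om).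
Local Notation L3 := (@leb3 R).
Local Notation gradip := (gradip Om).
Implicit Types v w : E3 R -> R.
Let mO : measurable Om := open_measurable3 oO.
Let SH := semi_inner_H10 oO bO.

Lemma nrm_triangle q v w : 1 <= q -> Lp Om q v -> Lp Om q w ->
  nrm Om q (v + w) <= nrm Om q v + nrm Om q w.
Proof.
move=> q1 [mv fv] [mw fw].
have m (z : E3 R -> R) : measurable_fun Om z -> measurable_fun setT (fun x => \1_Om x * z x).
  move=> mz; have -> : (fun x => \1_Om x * z x) = z \_ Om.
    by apply/funext => x; rewrite patchE indicE; case: ifP => _; rewrite ?mul1r ?mul0r.
  exact/(measurable_restrictT _ mO).
have := @minkowski_EFin _ _ R L3 _ _ q (m _ mv) (m _ mw) q1.
have -> : Lnorm L3 q%:E (EFin \o ((fun x => \1_Om x * v x) \+ (fun x => \1_Om x * w x))) = enrm Om q (v + w).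
  rewrite /enrm; congr (Lnorm _ _ _); apply/funext => x; congr EFin.
  by rewrite -[(v + w) x]/(v x + w x) mulrDr.
move=> h0; have {h0} h : (enrm Om q (v + w)%R <= enrm Om q v + enrm Om q w)%E := h0.
have Fv : enrm Om q v = (nrm Om q v)%:E by rewrite /nrm fineK// ge0_fin_numE// Lnorm_ge0.
have Fw : enrm Om q w = (nrm Om q w)%:E by rewrite /nrm fineK// ge0_fin_numE// Lnorm_ge0.
have Fs : enrm Om q (v + w) = (nrm Om q (v + w))%:E.
  rewrite /nrm fineK// ge0_fin_numE ?Lnorm_ge0//; apply: le_lt_trans h _.
  exact: lte_add_pinfty.
by move: h; rewrite Fs Fv Fw -EFinD lee_fin.
Qed.

Lemma nrm_sobolev q v : 0 < q -> q <= 6 -> H10 Om v ->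
  nrm Om q v <= sobolev_cst Om `^ q^-1 * Num.sqrt (gradip v v).
Proof.
move=> q0 q6 hv; have qn : q != 0 by rewrite gt_eqF.
have G0 := si_ge0 SH v; have S0 := sobolev_cst_gt0 Om.
have -> : nrm Om q v = (nrm Om q v `^ q) `^ q^-1.
  by rewrite -powRrM mulfV// powRr1// fine_ge0// Lnorm_ge0.
rewrite nrm_powR//.
have -> : sobolev_cst Om `^ q^-1 * Num.sqrt (gradip v v) =
    (sobolev_cst Om * gradip v v `^ (q / 2)) `^ q^-1.
  rewrite powRM ?(ltW S0) ?powR_ge0// -powRrM (_ : q / 2 / q = 2^-1); last by field.
  by rewrite powR12_sqrt.
apply: ge0_ler_powR; rewrite ?nnegrE ?invr_ge0 ?(ltW q0)//.
- by apply: Rintegral_ge0 => x _; exact: powR_ge0.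
- by rewrite mulr_ge0 ?powR_ge0// ltW.
- exact: sobolev_Rintegral.
Qed.

(** Minkowski's inequality in both directions, then the Sobolev inequality for the difference. *)
Lemma nrm_dist_le q v w : 1 <= q -> q <= 6 -> H10 Om v -> H10 Om w ->
  `|nrm Om q v - nrm Om q w| <= sobolev_cst Om `^ q^-1 * Num.sqrt (gradip (v - w) (v - w)).
Proof.
move=> q1 q6 hv hw; have q0 : 0 < q by exact: lt_le_trans q1.
have hd := si_XB SH hv hw; have hd' := si_XB SH hw hv.
have lv := H10_Lp oO bO q0 q6 hv; have lw := H10_Lp oO bO q0 q6 hw.
have h1 := nrm_triangle q1 lw (H10_Lp oO bO q0 q6 hd).
have h2 := nrm_triangle q1 lv (H10_Lp oO bO q0 q6 hd').
have e1 : w + (v - w) = v by rewrite addrC subrK.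
have e2 : v + (w - v) = w by rewrite addrC subrK.
rewrite e1 in h1; rewrite e2 in h2.
have s1 := nrm_sobolev q0 q6 hd; have s2 := nrm_sobolev q0 q6 hd'.
have e3 : gradip (w - v) (w - v) = gradip (v - w) (v - w).
  by rewrite -(si_sqrN SH hd) opprB.
rewrite e3 in s2.
exact: dist_le_of_triangle h1 h2 s1 s2.
Qed.

Lemma nrm_half_continuous q (u : R -> E3 R -> R) : 1 <= q -> q <= 6 ->
  (forall T, 0 < T -> CT (H10 Om) (egradnrm Om) T u) ->
  half_continuous (fun t => nrm Om q (u t)).
Proof.
move=> q1 q6 hu; apply/half_continuousP => t t0.
have c := CT_cvg SH (egradnrm_sqrt oO) hu t0.
have c2 : sobolev_cst Om `^ q^-1 * Num.sqrt (gradip (u s - u t) (u s - u t))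
    @[s --> within `[0%R, +oo[ (nbhs t)] --> (0 : R).
  rewrite -[X in _ --> X](mulr0 (sobolev_cst Om `^ q^-1)); apply: cvgM; first exact: cvg_cst.
  by rewrite -[X in _ --> X]sqrtr0; apply: (cvg_comp _ _ c); exact: sqrt_continuous.
apply/cvgrPdist_le => e e0; have /cvgrPdist_le/(_ e e0) := c2.
rewrite !near_withinE; apply: filterS => s hs s0; have {}hs := hs s0.
rewrite distrC; apply: le_trans (nrm_dist_le q1 q6 _ _) _.
- by apply: (CT_X hu); move: s0; rewrite /= in_itv/= andbT.
- exact: (CT_X hu).
- by apply: le_trans hs; rewrite sub0r normrN; exact: ler_norm.
Qed.

End norms.

Section source_integrals.
Context {R : realType} (P : problem R).
Local Notation Om := (Om P).
Local Notation L3 := (@leb3 R).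
Hypotheses (oO : open Om) (bO : bounded_set Om).
Hypotheses (p_bnd : forall i, 1 <= @pexp R P i <= 5) (q_bnd : forall j, 1 <= @qexp R P j <= 5).
Let mO : measurable Om := open_measurable3 oO.

Lemma H10_powR_integrable e v : 0 < e -> e <= 6 -> H10 Om v ->
  L3.-integrable Om (fun x => (`|v x| `^ e)%:E).
Proof.
move=> e0 e6 hv; have [mv fv] := H10_Lp oO bO e0 e6 hv.
apply: (@powR_integrable _ _ _ L3 Om) => //.
by rewrite -enrm_lty.
Qed.

Lemma exponent_bnd (p : R) : 1 <= p <= 5 -> 0 < p + 1 /\ p + 1 <= 6.
Proof. by move=> /andP[*]; split; lra. Qed.

Lemma integral_sourceF v : H10 Om v -> \int[L3]_(x in Om) sourceF P (v x) =
  \sum_i @acoef R P i / (@pexp R P i + 1) * nrm Om (@pexp R P i + 1) v `^ (@pexp R P i + 1) -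
  \sum_j @bcoef R P j / (@qexp R P j + 1) * nrm Om (@qexp R P j + 1) v `^ (@qexp R P j + 1).
Proof.
move=> hv.
have p1 i : 1 <= @pexp R P i by case/andP: (p_bnd i).
have q1 j : 1 <= @qexp R P j by case/andP: (q_bnd j).
have -> : (fun x => sourceF P (v x)) = (fun x => primitive P (v x)).
  by apply/funext => x; exact: sourceFE.
rewrite /primitive (@Rintegral_power_sums _ _ _ L3 Om mO v); last 2 first.
- by move=> i; have [e0 e6] := exponent_bnd (p_bnd i); exact: H10_powR_integrable.
- by move=> i; have [e0 e6] := exponent_bnd (q_bnd i); exact: H10_powR_integrable.
congr (_ - _); apply: eq_bigr => i _; rewrite nrm_powR// gt_eqF//.
  by have [] := exponent_bnd (p_bnd i).
by have [] := exponent_bnd (q_bnd i).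
Qed.

Lemma powR_sqr (p z : R) : 1 <= p -> `|z| `^ (p - 1) * z * z = `|z| `^ (p + 1).
Proof.
move=> p1; have [->|z0] := eqVneq z 0.
  by rewrite mulr0 normr0 powR0// gt_eqF//; lra.
have n0 : 0 < `|z| by rewrite normr_gt0.
rewrite (powRr_pred (p + 1) n0) addrK (powRr_pred p n0) -!mulrA.
by congr (_ * _); rewrite -expr2 -expr2 real_normK ?num_real.
Qed.

Lemma ip_source v : H10 Om v -> ip Om (fun x => source P (v x)) v =
  \sum_i @acoef R P i * nrm Om (@pexp R P i + 1) v `^ (@pexp R P i + 1) -
  \sum_j @bcoef R P j * nrm Om (@qexp R P j + 1) v `^ (@qexp R P j + 1).
Proof.
move=> hv; rewrite /ip.
have -> : (fun x => source P (v x) * v x) = (fun x =>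
  \sum_i @acoef R P i * `|v x| `^ (@pexp R P i + 1) -
  \sum_j @bcoef R P j * `|v x| `^ (@qexp R P j + 1)).
  apply/funext => x; rewrite /source mulrBl !mulr_suml; congr (_ - _).
    apply: eq_bigr => i _; rewrite -powR_sqr; first by rewrite !mulrA.
    by case/andP: (p_bnd i).
  apply: eq_bigr => i _; rewrite -powR_sqr; first by rewrite !mulrA.
  by case/andP: (q_bnd i).
rewrite (@Rintegral_power_sums _ _ _ L3 Om mO v); last 2 first.
- by move=> i; have [e0 e6] := exponent_bnd (p_bnd i); exact: H10_powR_integrable.
- by move=> i; have [e0 e6] := exponent_bnd (q_bnd i); exact: H10_powR_integrable.
congr (_ - _); apply: eq_bigr => i _; rewrite nrm_powR// gt_eqF//.
  by have [] := exponent_bnd (p_bnd i).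
by have [] := exponent_bnd (q_bnd i).
Qed.

Lemma nrm_powR_half_continuous (u : R -> E3 R -> R) q :
  (forall T, 0 < T -> CT (H10 Om) (egradnrm Om) T u) -> 1 <= q -> q <= 6 ->
  half_continuous (fun t => nrm Om q (u t) `^ q).
Proof.
move=> hu q1 q6; have q0 : 0 < q by exact: lt_le_trans q1.
have := half_continuous_comp (nrm_half_continuous oO bO q1 q6 hu) (continuous_norm_powR q0).
congr half_continuous; apply/funext => t; rewrite /= ger0_norm//.
by rewrite fine_ge0// Lnorm_ge0.
Qed.

End source_integrals.

Section half_line_integrals.
Context {R : realType}.
Local Notation L := (@lebesgue_measure R).
Implicit Types f : R -> R.

Lemma half_continuous_integrable f T : half_continuous f -> L.-integrable `[0%R, T] (EFin \o f).
Proof.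
move=> cf; apply: continuous_compact_integrable; first exact: segment_compact.
apply: continuous_subspaceW (half_continuous_within cf).
by move=> x /=; rewrite !in_itv/= andbT => /andP[].
Qed.

Lemma half_nonincreasing_measurable f :
  (forall s t, 0 <= s -> s <= t -> f t <= f s) -> measurable_fun (`[0%R, +oo[%classic : set R) f.
Proof.
move=> h; apply: (eq_measurable_fun (fun t : R => f (Num.max 0 t))).
  by move=> t; rewrite inE/= in_itv/= andbT => t0; rewrite max_r.
apply: nonincreasing_measurable => // s t st.
apply: h; first by rewrite le_max lexx.
by rewrite ge_max !le_max lexx/= st orbT.
Qed.

Lemma half_measurable_bounded_integrable f T K :
  measurable_fun (`[0%R, +oo[%classic : set R) f ->
  (forall t, 0 <= t -> `|f t| <= K) -> L.-integrable `[0%R, T] (EFin \o f).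
Proof.
move=> mf fK.
have iK : L.-integrable `[0%R, T] (EFin \o (fun=> K : R)).
  exact: half_continuous_integrable (@half_continuous_cst R K).
apply: (le_integrable _ _ _ iK) => //.
  apply/measurable_EFinP; apply: measurable_funS mf => //.
  by move=> x /=; rewrite !in_itv/= andbT => /andP[].
move=> t /=; rewrite in_itv/= => /andP[t0 _]; rewrite lee_fin.
by rewrite (le_trans (fK t t0))// ler_norm.
Qed.

End half_line_integrals.

(** * Consequences of the energy identity *)

Section energy_identity.
Context {R : realType}.
Local Notation L := (@lebesgue_measure R).
Variables (E : R -> R) (N J : R -> \bar R).
Hypotheses (N0 : forall t, (0 <= N t)%E) (J0 : forall t, (0 <= J t)%E).
Hypothesis EI : forall t, 0 <= t ->
  ((E t)%:E + \int[L]_(s in `[0%R, t]) N s - (2^-1)%:E * \int[L]_(s in `[0%R, t]) (- J s)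
   = (E 0)%:E)%E.

(** The right-hand side of the identity is finite and both integrals have a favourable sign, so both
    are finite. Superadditivity over [0, s] and ]s, t] then bounds the dissipation between the two
    times by the drop of the energy, without measurability of [N] and [J]. *)
Lemma energy_dissipation s t : 0 <= s -> s <= t ->
  [/\ E t <= E s, (\int[L]_(r in `]s, t]) N r <= (E s - E t)%:E)%E &
   (\int[L]_(r in `]s, t]) J r <= (2 * (E s - E t))%:E)%E].
Proof.
move=> s0 st; have t0 := le_trans s0 st.
have I0 (f : R -> \bar R) r : (forall x, 0 <= f x)%E -> (0 <= \int[L]_(x in `[0%R, r]) f x)%E.
  by move=> f0; apply: integral_ge0.
have split_ge f : (forall x, (0 <= f x)%E) ->
    (\int[L]_(x in `[0%R, s]) f x + \int[L]_(x in `]s, t]) f x <= \int[L]_(x in `[0%R, t]) f x)%E.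
  move=> f0; have -> : `[0, t]%classic = `[0, s]%classic `|` `]s, t]%classic.
    apply/seteqP; split => x /=; rewrite !in_itv/=.
      by move=> /andP[x0 xt]; rewrite x0 xt andbT/=; case: leP => h; [left|right].
    move=> [/andP[-> xs]|/andP[sx ->]]; first by rewrite (le_trans xs).
    by rewrite (le_trans s0 (ltW sx)).
  apply: integral_setU_ge => //.
  by apply/disj_setPS => x /=; rewrite !in_itv/= => -[/andP[_ xs] /andP[sx _]]; move: (lt_le_trans sx xs); rewrite ltxx.
have EI' r : 0 <= r -> exists V K : R, [/\ (\int[L]_(x in `[0%R, r]) N x = V%:E)%E,
    (\int[L]_(x in `[0%R, r]) J x = K%:E)%E, 0 <= V, 0 <= K & E r + V + 2^-1 * K = E 0].
  move=> r0; have := EI r0; rewrite integral_ge0N// muleN oppeK.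
  have := I0 N r N0; have := I0 J r J0.
  case: (\int[L]_(x in _) N x)%E => [V| |]; case: (\int[L]_(x in _) J x)%E => [K| |] //.
  - rewrite !lee_fin => K0 V0 /eqP; rewrite -EFinM -!EFinD eqe => /eqP h.
    by exists V, K.
  - by move=> _ _; rewrite gt0_muley ?lte_fin.
  - by move=> _ _; rewrite gt0_muley ?lte_fin.
have [Vs [Ks [eVs eKs Vs0 Ks0 Es]]] := EI' s s0.
have [Vt [Kt [eVt eKt Vt0 Kt0 Et]]] := EI' t t0.
have hN := split_ge N N0; have hJ := split_ge J J0.
rewrite eVs eVt in hN; rewrite eKs eKt in hJ.
have nN : (0 <= \int[L]_(r in `]s, t]) N r)%E by apply: integral_ge0.
have nJ : (0 <= \int[L]_(r in `]s, t]) J r)%E by apply: integral_ge0.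
move: hN hJ nN nJ; case: (\int[L]_(r in _) N r)%E => [v| |]; case: (\int[L]_(r in _) J r)%E => [k| |] //.
rewrite -!EFinD !lee_fin => h1 h2 h3 h4.
by split; lra.
Qed.

End energy_identity.

Section setting_facts.
Context {R : realType} (P : problem R).
Local Notation Om := (Om P).

(** The assumption covers s > 0; continuity of the derivative extends the sign to s = 0. *)
Lemma dmu_le0 : assumptions_iv P -> forall s, 0 <= s -> dmu P s <= 0.
Proof.
move=> h4 s; have [_ _ dle _] := h4; rewrite le_eqVlt => /orP[/eqP <-|]; last exact: dle.
rewrite leNgt; apply/negP => d0.
have [dl dl0 h] := dmu_half_continuous h4 (lexx 0) d0.
have dl2 : 0 < dl / 2 by rewrite divr_gt0.
have := h (dl / 2) (ltW dl2); rewrite subr0 gtr0_norm// => /(_ _).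
rewrite ltr_pdivrMr// ltr_pMr// (_ : 1 < 2)//; last by rewrite ltr1n.
move=> /(_ isT); have := dle _ dl2; move: (dmu P (dl / 2)) (dmu P 0) d0 => x y y0 x0.
by rewrite ltr_norml => /andP[h1 _]; lra.
Qed.

Lemma pexp_bnd : assumptions_i P -> forall i, 1 < @pexp R P i <= 5 /\ @pexp R P ord0 <= @pexp R P i.
Proof.
move=> [[_ inc p1 p5] _ _] i.
have h0 : @pexp R P ord0 <= @pexp R P i.
  have [->//|i0] := eqVneq i ord0; apply/ltW/inc.
  by rewrite lt0n; apply: contraNneq i0 => h; apply/eqP/val_inj.
have h1 : @pexp R P i <= @pexp R P ord_max.
  have [->//|i0] := eqVneq i ord_max; apply/ltW/inc.
  by rewrite ltn_neqAle -ltnS ltn_ord andbT; apply: contraNneq i0 => h; apply/eqP/val_inj.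
by split=> //; rewrite (lt_le_trans p1 h0) (le_trans h1).
Qed.

Lemma qexp_bnd : assumptions_i P -> forall j, 1 <= @qexp R P j <= 5.
Proof.
move=> [_ [_ inc q1 q5] _] i.
have h0 : @qexp R P ord0 <= @qexp R P i.
  have [->//|i0] := eqVneq i ord0; apply/ltW/inc.
  by rewrite lt0n; apply: contraNneq i0 => h; apply/eqP/val_inj.
have h1 : @qexp R P i <= @qexp R P ord_max.
  have [->//|i0] := eqVneq i ord_max; apply/ltW/inc.
  by rewrite ltn_neqAle -ltnS ltn_ord andbT; apply: contraNneq i0 => h; apply/eqP/val_inj.
by rewrite (le_trans q1 h0) (le_trans h1).
Qed.

End setting_facts.

(** * Trapping of the solution in the well *)

Section solution.
Context {R : realType} (P : problem R) (l0 : nat) (y0 : R).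
Hypothesis HP : setting P l0 y0.
Local Notation L := (@lebesgue_measure R).
Local Notation L3 := (@leb3 R).
Local Notation Om := (Om P).
Local Notation m := (dmp P).
Local Notation mu := (mu P).
Local Notation dmu := (dmu P).
Local Notation Linf := (`[0%R, +oo[%classic : set R).
Local Notation gradip := (gradip Om).
Local Notation p := (@pexp R P).
Local Notation q := (@qexp R P).
Local Notation a := (@acoef R P).
Local Notation b := (@bcoef R P).

Lemma set_open : open Om. Proof. by have [[]] := HP. Qed.
Lemma set_bounded : bounded_set Om. Proof. by have [[]] := HP. Qed.
Lemma set_i : assumptions_i P. Proof. by have [_ [[]]] := HP. Qed.
Lemma set_ii : assumptions_ii P. Proof. by have [_ [[]]] := HP. Qed.
Lemma set_iii : assumptions_iii P. Proof. by have [_ [[]]] := HP. Qed.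
Lemma set_iv : assumptions_iv P. Proof. by have [_ [[]]] := HP. Qed.
Lemma set_max : G_max_at P y0. Proof. by have [_ [_ []]] := HP. Qed.

Let oO := set_open.
Let bO := set_bounded.
Let SH := semi_inner_H10 oO bO.
Let SL := semi_inner_L2 oO.

Lemma set_p i : 1 <= p i <= 5.
Proof. by have [/andP[/ltW -> ->]] := pexp_bnd set_i i. Qed.

Lemma set_q j : 1 <= q j <= 5.
Proof. exact: qexp_bnd set_i j. Qed.

Lemma set_p1 i : 0 < p i + 1 /\ p i + 1 <= 6.
Proof. exact: exponent_bnd (set_p i). Qed.

Lemma set_q1 j : 0 < q j + 1 /\ q j + 1 <= 6.
Proof. exact: exponent_bnd (set_q j). Qed.

Lemma acoef_gt0 i : 0 < a i. Proof. by have [[]] := set_i. Qed.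
Lemma bcoef_gt0 j : 0 < b j. Proof. by have [_ []] := set_i. Qed.

(** No solution occurs here: the threshold and the absorption factor depend on the problem, [y0] and
    [E0] only. *)
Lemma well_constants E0 : 0 < y0 -> E0 < Gfun P y0 -> exists y1 rho : R,
  [/\ 0 <= y1, y1 < y0, 0 <= rho, rho < 1 &
  (forall y, y1 <= y -> y <= y0 -> E0 < Gfun P y) /\
  forall y, 0 <= y -> y <= y1 ->
    \sum_i a i * (2 * gam i ^+ 2 * y) `^ ((p i + 1) / 2) <= 2 * rho * y].
Proof.
move=> y00 E0G; have c0 i : 0 <= 2 * @gam R P i ^+ 2 by rewrite mulr_ge0// sqr_ge0.
have p1 : 1 < p ord0 by have [/andP[]] := pexp_bnd set_i ord0.
have pge i : p ord0 <= p i by have [] := pexp_bnd set_i i.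
have [y1 [h1 h2 h3]] := well_gap p1 pge c0 y00 E0G.
have [rho [r0 r1 hr]] := well_absorb acoef_gt0 p1 pge c0 set_max.2 h1 h2.
by exists y1, rho; split.
Qed.

Variables (E0 M1 : R) (u0 v0 u ut : R -> E3 R -> R).
Hypothesis HW : well_solution P l0 y0 E0 M1 u0 v0 u ut.

Lemma sol_weak T : 0 < T -> weak_solution P u0 v0 T u ut.
Proof. by have [_ [h _] _ _ _] := HW; exact: h. Qed.

Lemma sol_CT T : 0 < T -> CT (H10 Om) (egradnrm Om) T u.
Proof. by move=> /sol_weak[[]]. Qed.

Lemma sol_CTt T : 0 < T -> CT (Lp Om 2) (enrm Om 2) T ut.
Proof. by move=> /sol_weak[[]]. Qed.

Lemma sol_H10 t : 0 <= t -> H10 Om (u t).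
Proof. exact: (CT_X sol_CT). Qed.

Lemma sol_Lp2 t : 0 <= t -> Lp Om 2 (ut t).
Proof. exact: (CT_X sol_CTt). Qed.

Lemma sol_past t : t <= 0 -> aeeq Om (u t) (u0 t).
Proof. by have [_ h _ _] := sol_weak ltr01; exact: h. Qed.

Lemma sol_L2mu : L2mu (H10 Om) (egradnrm Om) mu u0.
Proof. by have [[[]]] := HW. Qed.

Local Notation A := (fun t => ip Om (ut t) (ut t)).
Local Notation B := (fun t => gradip (u t) (u t)).
Local Notation E := (En P u ut).
Local Notation e := (Ecal P u ut).

Lemma enrm_sqrt v : Lp Om 2 v -> enrm Om 2 v = (Num.sqrt (ip Om v v))%:E.
Proof.
by move=> lv; rewrite (nrm2E lv) -nrm2_sqr// sqrtr_sqr ger0_norm// fine_ge0// Lnorm_ge0.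
Qed.

Lemma sol_A_continuous : half_continuous A.
Proof. exact: (CT_half_continuous_sqr SL enrm_sqrt sol_CTt). Qed.

Lemma sol_B_continuous : half_continuous B.
Proof. exact: (CT_half_continuous_sqr SH (egradnrm_sqrt oO) sol_CT). Qed.

Lemma sol_A_ge0 t : 0 <= A t. Proof. exact: (si_ge0 SL). Qed.
Lemma sol_B_ge0 t : 0 <= B t. Proof. exact: (si_ge0 SH). Qed.

Lemma sol_Ecal t : e t = 2^-1 * (A t + B t + memory P u t).
Proof. by rewrite /Ecal nrm2_sqr// gradnrm_sqr. Qed.

Lemma sol_memory_ge0 t : 0 <= memory P u t.
Proof. exact: (memory_ge0 set_iii set_iv). Qed.

Lemma sol_Ecal_bounds t :
  [/\ A t <= 2 * e t, B t <= 2 * e t, memory P u t <= 2 * e t & 0 <= e t].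
Proof.
rewrite sol_Ecal; have := sol_A_ge0 t; have := sol_B_ge0 t; have := sol_memory_ge0 t.
move: (memory _ _ _) (gradip _ _) (ip _ _ _) => x y z *.
by split; lra.
Qed.

Definition potential t := \int[L3]_(x in Om) sourceF P (u t x).

Lemma sol_En t : E t = e t - potential t.
Proof. by []. Qed.

Local Notation pterm i t := (nrm Om (p i + 1) (u t) `^ (p i + 1)).
Local Notation qterm j t := (nrm Om (q j + 1) (u t) `^ (q j + 1)).

Lemma sol_potential t : 0 <= t -> potential t =
  \sum_i a i / (p i + 1) * pterm i t - \sum_j b j / (q j + 1) * qterm j t.
Proof. by move=> t0; apply: (integral_sourceF oO bO set_p set_q); exact: sol_H10. Qed.

Lemma pterm_continuous i : half_continuous (fun t => pterm i t).
Proof.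
have [h1 h2] := set_p1 i; apply: (nrm_powR_half_continuous oO bO sol_CT) => //.
by have /andP[] := set_p i => *; lra.
Qed.

Lemma qterm_continuous j : half_continuous (fun t => qterm j t).
Proof.
have [h1 h2] := set_q1 j; apply: (nrm_powR_half_continuous oO bO sol_CT) => //.
by have /andP[] := set_q j => *; lra.
Qed.

Lemma half_continuous_eq (f g : R -> R) : (forall t, 0 <= t -> f t = g t) ->
  half_continuous f -> half_continuous g.
Proof.
move=> fg cf t t0 x x0; have [dl dl0 h] := cf t t0 x x0.
by exists dl => // s s0 st; rewrite -!fg//; exact: h.
Qed.

Lemma power_sum_continuous n (c : 'I_n -> R) (F : 'I_n -> R -> R) :
  (forall i, half_continuous (F i)) -> half_continuous (fun t => \sum_i c i * F i t).
Proof.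
move=> h; apply: half_continuous_sum => i.
by apply: half_continuousM; [exact: half_continuous_cst|exact: h].
Qed.

Lemma half_continuousB (f g : R -> R) : half_continuous f -> half_continuous g ->
  half_continuous (fun t => f t - g t).
Proof.
move=> hf hg; apply: half_continuousD => //.
have := half_continuousM (half_continuous_cst (-1)) hg.
by congr half_continuous; apply/funext => t; rewrite mulN1r.
Qed.

Lemma potential_continuous : half_continuous potential.
Proof.
apply: (half_continuous_eq (fun t t0 => esym (sol_potential t0))).
apply: half_continuousB; apply: power_sum_continuous => i.
  exact: pterm_continuous.
exact: qterm_continuous.
Qed.

Lemma pterm_le i t : 0 <= t -> pterm i t <= (2 * gam i ^+ 2 * (B t / 2)) `^ ((p i + 1) / 2).
Proof.
by move=> t0; have [h1 h2] := set_p1 i; apply: (gam_bound_powR oO bO) => //; exact: sol_H10.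
Qed.

Lemma pterm_le_Ecal i t : 0 <= t -> pterm i t <= (2 * gam i ^+ 2 * e t) `^ ((p i + 1) / 2).
Proof.
move=> t0; apply: le_trans (pterm_le i t0) _.
have [h1 _] := set_p1 i; have [_ hB _ e0] := sol_Ecal_bounds t.
have g0 : 0 <= 2 * @gam R P i ^+ 2 by rewrite mulr_ge0// sqr_ge0.
apply: ge0_ler_powR; rewrite ?nnegrE; first by rewrite divr_ge0// ltW.
- by rewrite mulr_ge0// divr_ge0// sol_B_ge0.
- exact: mulr_ge0.
- by rewrite ler_wpM2l// ler_pdivrMr// mulrC.
Qed.

(** The absorption terms of the potential are discarded and each source term is bounded by its
    embedding constant; what remains is [Gfun]. *)
Lemma sol_G_le t : 0 <= t -> Gfun P (e t) <= E t.
Proof.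
move=> t0; rewrite sol_En sol_potential// /Gfun lerD2l lerN2.
apply: (@le_trans _ _ (\sum_i a i / (p i + 1) * pterm i t)).
  rewrite gerBl; apply: sumr_ge0 => j _; rewrite mulr_ge0 ?powR_ge0//.
  by rewrite divr_ge0// ltW ?bcoef_gt0//; have [] := set_q1 j.
apply: ler_sum => i _; apply: ler_wpM2l; last exact: pterm_le_Ecal.
by rewrite divr_ge0// ltW ?acoef_gt0//; have [] := set_p1 i.
Qed.

Definition dissip t : \bar R := (enrm Om (m + 1) (ut t) `^ (m + 1))%E.
Definition mem_dissip t : \bar R :=
  (\int[L]_(s in Linf) ((- dmu s)%:E * egradnrm Om (hist u t s) `^ 2))%E.

Lemma mem_dissip_integrand_ge0 t s : Linf s ->
  (0 <= (- dmu s)%:E * egradnrm Om (hist u t s) `^ 2)%E.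
Proof.
rewrite /= in_itv/= andbT => s0; apply: mule_ge0; last exact: poweR_ge0.
by rewrite lee_fin oppr_ge0 (dmu_le0 set_iv).
Qed.

Lemma sol_dissipation s t : 0 <= s -> s <= t ->
  [/\ E t <= E s, (\int[L]_(r in `]s, t]) dissip r <= (E s - E t)%:E)%E &
   (\int[L]_(r in `]s, t]) mem_dissip r <= (2 * (E s - E t))%:E)%E].
Proof.
apply: energy_dissipation => [r|r|r r0]; first exact: poweR_ge0.
  by apply: integral_ge0 => x; exact: mem_dissip_integrand_ge0.
have [_ [_ h] _ _ _] := HW; have := h r r0; rewrite /energy_identity.
have -> : (fun tau => \int[L]_(s in Linf) ((dmu s)%:E * egradnrm Om (hist u tau s) `^ 2))%E =
    (fun tau => - mem_dissip tau)%E.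
  apply/funext => tau; rewrite /mem_dissip -integral_ge0N; last exact: mem_dissip_integrand_ge0.
  by apply: eq_integral => x _; rewrite EFinN mulNe oppeK.
by [].
Qed.

Lemma sol_initial : [/\ e 0 <= y0, E 0 = E0 & E0 < Gfun P y0].
Proof. by have [] := HW. Qed.

(** If y0 <= 0, nonnegativity forces [e 0 = y0], and then Gfun(y0) <= E(0) = E0 contradicts E0 <
    Gfun(y0). *)
Lemma sol_y0 : 0 < y0.
Proof.
have [h1 h2 h3] := sol_initial; have [_ _ _ e0] := sol_Ecal_bounds 0.
rewrite ltNge; apply/negP => y00.
have e00 : e 0 = y0 by apply/eqP; rewrite eq_le h1 (le_trans y00 e0).
by have := sol_G_le (lexx 0); rewrite e00 h2 leNgt h3.
Qed.

Variables (y1 rho : R).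
Hypotheses (y1_ge0 : 0 <= y1) (y10 : y1 < y0) (rho0 : 0 <= rho) (rho1 : rho < 1)
  (gap : forall y, y1 <= y -> y <= y0 -> E0 < Gfun P y)
  (absorb : forall y, 0 <= y -> y <= y1 ->
    \sum_i a i * (2 * gam i ^+ 2 * y) `^ ((p i + 1) / 2) <= 2 * rho * y).

Lemma sol_trap t : 0 <= t -> e t < y1.
Proof.
have e_E s : e s = E s + potential s by rewrite sol_En subrK.
move=> t0; rewrite e_E.
apply: (@trap R E potential (Gfun P) y0 y1 E0 y10 _ potential_continuous _ gap _ t t0).
- by move=> s r s0 sr; have [] := sol_dissipation s0 sr.
- move=> s s0; rewrite -e_E; apply: le_trans (sol_G_le s0) _.
  by have [h _ _] := sol_dissipation (lexx 0) s0; have [_ <- _] := sol_initial.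
- by rewrite -e_E; have [] := sol_initial.
Qed.

Lemma sol_B_le t : 0 <= t -> B t <= 2 * y1.
Proof.
move=> t0; have [_ h _ _] := sol_Ecal_bounds t; apply: le_trans h _.
by rewrite ler_pM2l// ltW// sol_trap.
Qed.

Lemma sol_absorb t : 0 <= t -> \sum_i a i * pterm i t <= rho * B t.
Proof.
move=> t0; have B2 : 0 <= B t / 2 by rewrite divr_ge0// sol_B_ge0.
have B1 : B t / 2 <= y1 by rewrite ler_pdivrMr// mulrC sol_B_le.
apply: (@le_trans _ _ (2 * rho * (B t / 2))); last first.
  by rewrite le_eqVlt; apply/orP; left; apply/eqP; field.
apply: le_trans (absorb B2 B1); apply: ler_sum => i _.
by apply: ler_wpM2l; [exact/ltW/acoef_gt0|exact: pterm_le].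
Qed.

(** Since 1 / (p + 1) <= 1 / 2, the sources take at most the fraction [rho] of half the squared
    gradient norm. *)
Lemma sol_coercive t : 0 <= t -> (1 - rho) * e t <= E t.
Proof.
move=> t0; rewrite sol_En sol_potential//.
have h := sol_absorb t0; have [_ hB _ _] := sol_Ecal_bounds t.
have h1 : \sum_i a i / (p i + 1) * pterm i t <= 2^-1 * \sum_i a i * pterm i t.
  rewrite mulr_sumr; apply: ler_sum => i _; rewrite mulrA; apply: ler_wpM2r; first exact: powR_ge0.
  rewrite mulrC ler_pM2r ?acoef_gt0// lef_pV2 ?posrE//; last by have [] := set_p1 i.
  by have /andP[] := set_p i => *; lra.
have h2 : 0 <= \sum_j b j / (q j + 1) * qterm j t.
  apply: sumr_ge0 => j _; rewrite mulr_ge0 ?powR_ge0//.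
  by rewrite divr_ge0// ltW ?bcoef_gt0//; have [] := set_q1 j.
have := ler_wpM2l rho0 hB.
move: (\sum_i a i / _ * _) (\sum_i a i * _) (\sum_j b j / _ * _) (gradip _ _) (e t) h h1 h2 => *.
lra.
Qed.

Lemma sol_E_ge0 t : 0 <= t -> 0 <= E t.
Proof.
move=> t0; apply: le_trans (sol_coercive t0); have [_ _ _ e0] := sol_Ecal_bounds t.
by rewrite mulr_ge0// subr_ge0 ltW.
Qed.

Definition qsum t := \sum_j b j * qterm j t.

(** The absorption terms are kept, to be balanced later by those of the tested equation. *)
Lemma sol_E_le t : 0 <= t -> E t <= 2^-1 * (A t + B t + memory P u t + qsum t).
Proof.
move=> t0; rewrite sol_En sol_potential// sol_Ecal /qsum.
have h1 : 0 <= \sum_i a i / (p i + 1) * pterm i t.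
  apply: sumr_ge0 => i _; rewrite mulr_ge0 ?powR_ge0//.
  by rewrite divr_ge0// ltW ?acoef_gt0//; have [] := set_p1 i.
have h2 : \sum_j b j / (q j + 1) * qterm j t <= 2^-1 * \sum_j b j * qterm j t.
  rewrite mulr_sumr; apply: ler_sum => j _; rewrite mulrA; apply: ler_wpM2r; first exact: powR_ge0.
  rewrite mulrC ler_pM2r ?bcoef_gt0// lef_pV2 ?posrE//; last by have [] := set_q1 j.
  by have /andP[] := set_q j => *; lra.
move: (\sum_i a i / _ * _) (\sum_j b j / _ * _) (\sum_j b j * _) h1 h2 => x y z.
move: (ip _ _ _) (gradip _ _) (memory _ _ _) => *; lra.
Qed.

End solution.

(** * The decay estimate *)

Section pointwise_bounds.
Context {R : realType}.

(** Either y^2 is below 1 / la, or la y^2 > 1 and the factor (la y^2)^((m-1)/2) is at least 1. *)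
Lemma sqr_le_powR (m la y : R) : 1 <= m -> 1 <= la ->
  y ^+ 2 <= la `^ ((m - 1) / 2) * `|y| `^ (m + 1) + la^-1.
Proof.
move=> m1 la1; have la0 : 0 < la by exact: lt_le_trans la1.
rewrite -real_normK ?num_real//; move: `|y| (normr_ge0 y) => {}y y0.
have P0 : 0 <= la `^ ((m - 1) / 2) * y `^ (m + 1) by rewrite mulr_ge0 ?powR_ge0.
have [h|h] := leP (y ^+ 2) la^-1; first by rewrite (le_trans h)// lerDr.
rewrite -[leLHS]addr0; apply: lerD; last by rewrite invr_ge0 ltW.
have y_gt0 : 0 < y by rewrite lt_neqAle y0 andbT; apply: contraTneq h => <-; rewrite expr0n/= -leNgt invr_ge0 ltW.
have -> : y `^ (m + 1) = y ^+ 2 * (y ^+ 2) `^ ((m - 1) / 2).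
  rewrite -powR_mulrn// -powRrM -powRD ?(gt_eqF y_gt0) ?implybT//; congr (_ `^ _); by field.
rewrite mulrCA ler_peMr ?sqr_ge0// -powRM ?(ltW la0) ?sqr_ge0//.
rewrite -[leLHS](congr1 (@^~ ((m - 1) / 2)) (@powR1 R)).
apply: ge0_ler_powR; rewrite ?nnegrE ?mulr_ge0 ?sqr_ge0 ?(ltW la0)//.
  by rewrite subr_ge0.
by rewrite mulrC -ler_pdivrMr// div1r ltW.
Qed.

(** The same dichotomy, with z^sg compared with 1 / la: the small case leaves the power 1 - sg, the
    other case the power th. *)
Lemma interpolation_le (z la th sg : R) : 0 < z -> 1 <= la -> 1 < th -> 0 < sg ->
  z <= la `^ ((th - 1) / sg) * z `^ th + z `^ (1 - sg) / la.
Proof.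
move=> z0 la1 th1 sg0; have la0 : 0 < la by exact: lt_le_trans la1.
have P0 : 0 <= la `^ ((th - 1) / sg) * z `^ th by rewrite mulr_ge0 ?powR_ge0.
have P1 : 0 <= z `^ (1 - sg) / la by rewrite mulr_ge0 ?powR_ge0 ?invr_ge0// ltW.
have E s : z = z `^ (1 - s) * z `^ s.
  by rewrite -powRD ?subrK ?powRr1 ?(ltW z0)// (gt_eqF z0) implybT.
have [h|h] := leP (z `^ sg) la^-1.
  rewrite [leLHS](E sg) (@le_trans _ _ (z `^ (1 - sg) / la))//; last by rewrite lerDr.
  by rewrite ler_wpM2l ?powR_ge0.
rewrite (@le_trans _ _ (la `^ ((th - 1) / sg) * z `^ th))//; last by rewrite lerDl.
rewrite [leLHS](E th) ler_wpM2r ?powR_ge0//.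
have -> : z `^ (1 - th) = ((z `^ sg)^-1) `^ ((th - 1) / sg).
  rewrite -powR_inv1 ?powR_ge0// -!powRrM; congr (_ `^ _); by field; rewrite gt_eqF.
apply: ge0_ler_powR; rewrite ?nnegrE ?invr_ge0 ?powR_ge0 ?(ltW la0)//.
  by apply: divr_ge0; rewrite ?subr_ge0 ltW.
by rewrite -[leRHS]invrK lef_pV2 ?posrE ?invr_gt0 ?powR_gt0// ltW.
Qed.

End pointwise_bounds.

Section integral_bounds.
Context d (T : measurableType d) (R : realType) (nu : {measure set T -> \bar R}).
Variables (D : set T) (mD : measurable D).

Lemma sqr_integral_le (m la : R) (f : T -> R) : (nu D < +oo)%E -> sqint nu D f ->
  1 <= m -> 1 <= la ->
  ((\int[nu]_(x in D) (f x * f x))%:E <=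
   (la `^ ((m - 1) / 2))%:E * \int[nu]_(x in D) (`|f x| `^ (m + 1))%:E + (fine (nu D) / la)%:E)%E.
Proof.
move=> Doo [mf fi] m1 la1; have la0 : 0 < la by exact: lt_le_trans la1.
have mp : measurable_fun D (fun x => `|f x| `^ (m + 1)).
  by apply: (measurableT_comp (measurable_powR _)); exact: measurableT_comp.
have -> : (\int[nu]_(x in D) (f x * f x))%:E = (\int[nu]_(x in D) (f x ^+ 2)%:E)%E.
  rewrite /Rintegral fineK; last exact: (integrable_fin_num mD fi).
  by apply: eq_integral => x _; rewrite expr2.
apply: (@le_trans _ _ (\int[nu]_(x in D) ((la `^ ((m - 1) / 2))%:E * (`|f x| `^ (m + 1))%:E + (la^-1)%:E))%E).
  apply: le_integral_ge0 => x _; first by rewrite lee_fin sqr_ge0.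
  by rewrite -EFinM -EFinD lee_fin; exact: sqr_le_powR.
rewrite ge0_integralD//; last 3 first.
- by move=> x _; rewrite -EFinM lee_fin mulr_ge0 ?powR_ge0.
- by apply: emeasurable_funM => //; exact/measurable_EFinP.
- by move=> x _; rewrite lee_fin invr_ge0 ltW.
rewrite ge0_integralZl_EFin ?powR_ge0//; last exact/measurable_EFinP.
rewrite leeD2l// integral_cst// mulrC EFinM fineK// ge0_fin_numE//.
Qed.

(** The bound is stated in the extended reals because the L^(m+1) norm of the velocity may be
    infinite at a given time. *)
Lemma cross_integral_le (m k W : R) (f g : T -> R) : 1 <= m -> 0 < k ->
  measurable_fun D f -> measurable_fun D g ->
  (\int[nu]_(x in D) (`|g x| `^ (m + 1))%:E <= W%:E)%E ->
  (`|\int[nu]_(x in D) (`|f x| `^ (m - 1) * f x * g x)|%:E <=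
   k%:E * \int[nu]_(x in D) (`|f x| `^ (m + 1))%:E + (k `^ (- m) * W)%:E)%E.
Proof.
move=> m1 k0 mf mg gW; have m0 : 0 < m by exact: lt_le_trans m1.
have mp (h : T -> R) (r : R) : measurable_fun D h -> measurable_fun D (fun x => `|h x| `^ r).
  by move=> mh; apply: (measurableT_comp (measurable_powR _)); exact: measurableT_comp.
have mfg : measurable_fun D (fun x => `|f x| `^ (m - 1) * f x * g x).
  by apply: measurable_funM => //; apply: measurable_funM => //; exact: mp.
apply: (@le_trans _ _ `|\int[nu]_(x in D) (`|f x| `^ (m - 1) * f x * g x)%:E|%E).
  (* An infinite integral has the real value 0 by convention, which keeps the inequality true. *)
  by rewrite /Rintegral; case: (integral _ _ _) => //= [|]; rewrite normr0 leey.
apply: le_trans (le_abse_integral _ mD _) _; first exact/measurable_EFinP.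
apply: (@le_trans _ _ (\int[nu]_(x in D) (k%:E * (`|f x| `^ (m + 1))%:E + (k `^ (- m))%:E * (`|g x| `^ (m + 1))%:E))%E).
  apply: le_integral_ge0 => x _ //; rewrite /= -!EFinM -EFinD lee_fin !normrM (ger0_norm (powR_ge0 _ _)).
  have -> : `|f x| `^ (m - 1) * `|f x| = `|f x| `^ m.
    have [->|z0] := eqVneq (f x) 0; last by rewrite (powRr_pred m)// normr_gt0.
    by rewrite normr0 mulr0 powR0// gt_eqF.
  exact: cross_le.
rewrite ge0_integralD//; last 4 first.
- by move=> x _; rewrite -EFinM lee_fin mulr_ge0 ?powR_ge0// ltW.
- by apply: emeasurable_funM => //; apply/measurable_EFinP; exact: mp.
- by move=> x _; rewrite -EFinM lee_fin mulr_ge0 ?powR_ge0.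
- by apply: emeasurable_funM => //; apply/measurable_EFinP; exact: mp.
rewrite !ge0_integralZl_EFin ?powR_ge0 ?(ltW k0)//; try by move=> x _; rewrite lee_fin powR_ge0.
- by rewrite leeD2l// EFinM lee_wpmul2l// lee_fin powR_ge0.
- by apply/measurable_EFinP; exact: mp.
- by apply/measurable_EFinP; exact: mp.
Qed.

(** To be read with [w] the kernel, [dw] minus its derivative, [g] the squared gradient of the
    history and [v] a remainder of integral at most [V], where [W] stands for a bound on [g]. *)
Lemma memory_integral_le (w dw v g : T -> R) (c W V : R) : 0 <= c -> 0 <= W ->
  nu.-integrable D (fun s => (w s * g s)%:E) -> measurable_fun D dw -> measurable_fun D v ->
  measurable_fun D g -> (forall s, D s -> 0 <= w s) -> (forall s, D s -> 0 <= dw s) ->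
  (forall s, D s -> 0 <= v s) -> (forall s, D s -> 0 <= g s) ->
  (forall s, D s -> w s <= c * dw s + v s) -> (forall s, D s -> v s * g s <= W * v s) ->
  (\int[nu]_(s in D) (v s)%:E <= V%:E)%E ->
  ((\int[nu]_(s in D) (w s * g s))%:E <=
   c%:E * \int[nu]_(s in D) (dw s * g s)%:E + (W * V)%:E)%E.
Proof.
move=> c0 W0 iwg mdw mv mg w0 dw0 v0 g0 wle vg vV.
rewrite /Rintegral fineK; last exact: (integrable_fin_num mD iwg).
apply: (@le_trans _ _ (\int[nu]_(s in D) (c%:E * (dw s * g s)%:E + W%:E * (v s)%:E))%E).
  apply: le_integral_ge0 => s Ds; first by rewrite lee_fin mulr_ge0 ?w0 ?g0.
  rewrite -!EFinM -EFinD lee_fin; apply: (@le_trans _ _ ((c * dw s + v s) * g s)).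
    by rewrite ler_wpM2r ?g0 ?wle.
  by rewrite mulrDl mulrA lerD2l vg.
rewrite ge0_integralD//; last 4 first.
- by move=> s Ds; rewrite -EFinM lee_fin !mulr_ge0 ?dw0 ?g0.
- by apply: emeasurable_funM => //; apply/measurable_EFinP; exact: measurable_funM.
- by move=> s Ds; rewrite -EFinM lee_fin mulr_ge0 ?v0.
- by apply: emeasurable_funM => //; exact/measurable_EFinP.
rewrite (ge0_integralZl_EFin _ mD (f1 := fun s => (dw s * g s)%:E))//; last 2 first.
- by move=> s Ds; rewrite lee_fin mulr_ge0 ?dw0 ?g0.
- by apply/measurable_EFinP; exact: measurable_funM.
rewrite (ge0_integralZl_EFin _ mD (f1 := fun s => (v s)%:E))//; last exact/measurable_EFinP.
by rewrite leeD2l// EFinM lee_wpmul2l// lee_fin.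
Qed.

End integral_bounds.

Section linear_combination.
Context d (T : measurableType d) (R : realType) (nu : {measure set T -> \bar R}).

Lemma Rintegral_combination (D : set T) (k : R) (f1 f2 f3 f4 f5 : T -> R) : measurable D ->
  nu.-integrable D (EFin \o f1) -> nu.-integrable D (EFin \o f2) ->
  nu.-integrable D (EFin \o f3) -> nu.-integrable D (EFin \o f4) ->
  nu.-integrable D (EFin \o f5) ->
  nu.-integrable D (EFin \o (fun x => f1 x - k * f2 x + f3 x - f4 x + f5 x)) /\
  \int[nu]_(x in D) (f1 x - k * f2 x + f3 x - f4 x + f5 x) =
  \int[nu]_(x in D) f1 x - k * \int[nu]_(x in D) f2 x + \int[nu]_(x in D) f3 x
  - \int[nu]_(x in D) f4 x + \int[nu]_(x in D) f5 x.
Proof.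
move=> mD i1 i2 i3 i4 i5.
have j2 : nu.-integrable D (EFin \o (fun x => k * f2 x)) := integrableZl mD k i2.
have j3 : nu.-integrable D (EFin \o (fun x => f1 x - k * f2 x)) := integrableB mD i1 j2.
have j4 : nu.-integrable D (EFin \o (fun x => f1 x - k * f2 x + f3 x)) := integrableD mD j3 i3.
have j5 : nu.-integrable D (EFin \o (fun x => f1 x - k * f2 x + f3 x - f4 x)) :=
  integrableB mD j4 i4.
split; first exact: (integrableD mD j5 i5).
by rewrite RintegralD// RintegralB// RintegralD// RintegralB// RintegralZl.
Qed.

End linear_combination.

Lemma multiplier_rearrange (R : realDomainType) (x y i j d c s : R) :
  x - y - i + j - d + c = s -> x - y = i - j + d - c + s.
Proof. by move=> <-; ring. Qed.

(** * Testing the equation with the solution *)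

Section multiplier.
Context {R : realType} (P : problem R) (l0 : nat) (y0 : R).
Hypothesis HP : setting P l0 y0.
Local Notation L := (@lebesgue_measure R).
Local Notation L3 := (@leb3 R).
Local Notation Om := (Om P).
Local Notation m := (dmp P).
Local Notation mu := (mu P).
Local Notation dmu := (dmu P).
Local Notation Linf := (`[0%R, +oo[%classic : set R).
Local Notation gradip := (gradip Om).
Variables (E0 M1 : R) (u0 v0 u ut : R -> E3 R -> R).
Hypothesis HW : well_solution P l0 y0 E0 M1 u0 v0 u ut.
Variable K : R.
Hypothesis eK : forall t, 0 <= t -> Ecal P u ut t <= K.
Local Notation A := (fun t => ip Om (ut t) (ut t)).
Local Notation B := (fun t => gradip (u t) (u t)).
Local Notation E := (En P u ut).

Let oO := set_open HP.
Let bO := set_bounded HP.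
Let SH := semi_inner_H10 oO bO.
Let h3 := set_iii HP.
Let h4 := set_iv HP.
Let hu := @sol_CT _ _ _ _ _ _ _ _ _ _ HW.
Let h0 := sol_L2mu HW.
Let hp := sol_past HW.
Let mO : measurable Om := open_measurable3 oO.

Let BK t : 0 <= t -> B t <= 2 * K.
Proof.
move=> t0; have [_ h _ _] := sol_Ecal_bounds HP u ut t.
by apply: (le_trans h); rewrite ler_pM2l// eK.
Qed.

Let GK r : 0 <= r -> gradip (glue u0 u r) (glue u0 u r) <= 2 * K.
Proof. by move=> r0; rewrite glue_ge0//; exact: BK. Qed.

Lemma damping_ge1 : 1 <= m. Proof. by have [] := set_ii HP. Qed.
Let m0 : 0 < m + 1. Proof. have := damping_ge1; lra. Qed.

Lemma sol_powR_bound t : 0 <= t ->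
  (\int[L3]_(x in Om) (`|u t x| `^ (m + 1))%:E <= (`|M1| `^ (m + 1))%:E)%E.
Proof.
move=> t0; rewrite -enrm_poweR ?gt_eqF// -poweR_EFin.
have [_ _ _ _ hM] := HW.
have h : (enrm Om (m + 1) (u t) <= M1%:E)%E.
  by rewrite -hM; apply: ereal_sup_ubound; exists t => //=; rewrite in_itv/= t0.
apply: gt0_ler_poweR; first exact: ltW.
- by rewrite in_itv/= leey andbT; exact: Lnorm_ge0.
- by rewrite in_itv/= leey andbT lee_fin.
- by apply: le_trans h _; rewrite lee_fin ler_norm.
Qed.

(** The energy is monotone in time, hence measurable, and the memory differs from twice the energy
    by continuous terms. *)
Lemma memory_measurable : measurable_fun Linf (memory P u).
Proof.
apply: (eq_measurable_fun (fun t => 2 * (E t + potential P u t) - A t - B t)).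
  move=> t _; rewrite sol_En subrK (sol_Ecal P u ut).
  by move: (ip _ _ _) (gradip _ _) (memory _ _ _) => x y z; field.
apply: measurable_funB; last exact: half_continuous_measurable (sol_B_continuous HP HW).
apply: measurable_funB; last exact: half_continuous_measurable (sol_A_continuous HP HW).
apply: measurable_funM; first exact: measurable_cst.
apply: measurable_funD; last exact: half_continuous_measurable (potential_continuous HP HW).
apply: half_nonincreasing_measurable => s t s0 st.
by have [] := sol_dissipation HP HW s0 st.
Qed.

Lemma memory_le t : 0 <= t -> memory P u t <= 2 * K.
Proof.
move=> t0; have [_ _ h _] := sol_Ecal_bounds HP u ut t.
by apply: (le_trans h); rewrite ler_pM2l// eK.
Qed.

Lemma memory_integrable T : L.-integrable `[0%R, T] (EFin \o memory P u).
Proof.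
apply: (@half_measurable_bounded_integrable _ _ T (2 * K)); first exact: memory_measurable.
by move=> t t0; rewrite ger0_norm ?memory_le// (sol_memory_ge0 HP).
Qed.

Let k1_ge0 : 0 <= ker P 0 - 1.
Proof.
rewrite -(integral_mu h3 h4); apply: Rintegral_ge0 => s; rewrite /= in_itv/= andbT.
exact: (mu_ge0 h3 h4).
Qed.

(** Expanding the memory expresses this mixed term through functions already known to be measurable;
    the same expansion and Young's inequality bound it from both sides. *)
Lemma delay_ip_integrable_time T : L.-integrable `[0%R, T] (EFin \o delay_ip P u0 u).
Proof.
have ex t : 0 <= t -> memory P u t =
    (ker P 0 - 1) * B t - 2 * delay_ip P u0 u t + delay_sqr P u0 u t.
  by move=> t0; rewrite (memory_expand oO bO h3 h4 hu h0 hp GK t0) glue_ge0.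
apply: (@half_measurable_bounded_integrable _ _ T (2 * ((ker P 0 - 1) * (2 * K)) + 2 * K)).
  apply: (eq_measurable_fun (fun t => 2^-1 * ((ker P 0 - 1) * B t + delay_sqr P u0 u t - memory P u t))).
    move=> t; rewrite inE/= in_itv/= andbT => t0; rewrite ex//.
    by move: (gradip _ _) (delay_ip _ _ _ _) (delay_sqr _ _ _ _) => x y z; field.
  apply: measurable_funM; first exact: measurable_cst.
  apply: measurable_funB; last exact: memory_measurable.
  apply: measurable_funD; last exact: (delay_sqr_measurable oO bO h3 h4 hu h0).
  apply: measurable_funM; first exact: measurable_cst.
  exact: half_continuous_measurable (sol_B_continuous HP HW).
move=> t t0; have := delay_ip_le oO bO h3 h4 hu h0 hp GK t0 (ltr01 : 0 < 1).
have := ex t t0; rewrite glue_ge0//.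
have : 0 <= delay_sqr P u0 u t.
  apply: Rintegral_ge0 => s; rewrite /= in_itv/= andbT => s0.
  by apply: mulr_ge0; [exact: (mu_ge0 h3 h4)|exact: (si_ge0 SH)].
have := memory_le t0; have := sol_memory_ge0 HP u t.
have : (ker P 0 - 1) * B t <= (ker P 0 - 1) * (2 * K) by apply: ler_wpM2l => //; exact: BK.
have : 0 <= (ker P 0 - 1) * B t by apply: mulr_ge0 => //; exact: (si_ge0 SH).
move: ((ker P 0 - 1) * B t) ((ker P 0 - 1) * (2 * K)) (2 * K) (delay_ip _ _ _ _) (delay_sqr _ _ _ _) (memory _ _ _).
by move=> x X k d z w *; rewrite ler_norml; apply/andP; split; lra.
Qed.

(** Poincare's inequality, as the case q = 2 of the Sobolev inequality. *)
Lemma sol_ip_le v : H10 Om v -> ip Om v v <= sobolev_cst Om * gradip v v.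
Proof.
move=> hv; have := sobolev_Rintegral oO bO (q := 2) ltac:(lra) ltac:(lra) hv.
rewrite divff// powRr1; last exact: (si_ge0 SH).
congr (_ <= _); congr (Rintegral _ _ _); apply/funext => x.
by rewrite powR2 expr2.
Qed.

Lemma sol_joint T : 0 < T -> exists h : E3 R * R -> R,
  measurable_fun setT h /\ forall t, 0 <= t -> t < T -> aeeq Om (u t) (fun x => h (x, t)).
Proof.
move=> T0; apply: (@joint_representative _ _ R L3 Om mO u T).
  by move=> t t0; apply/Lp2P/H10_Lp2; exact: (sol_H10 HW).
move=> t t0.
have c := CT_cvg SH (egradnrm_sqrt oO) hu t0.
have c2 : sobolev_cst Om * gradip (u s - u t) (u s - u t)
    @[s --> within `[0%R, +oo[ (nbhs t)] --> (0 : R).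
  by rewrite -[X in _ --> X](mulr0 (sobolev_cst Om)); apply: cvgM => //; exact: cvg_cst.
apply: (squeeze_cvgr _ (cvg_cst 0) c2).
rewrite near_withinE; apply: nearW => s; rewrite /= in_itv/= andbT => s0.
apply/andP; split; first by apply: Rintegral_ge0 => x _; exact: sqr_ge0.
have hd : H10 Om (u s - u t) by exact: (si_XB SH (sol_H10 HW s0) (sol_H10 HW t0)).
apply: le_trans (sol_ip_le hd); rewrite le_eqVlt; apply/orP; left; apply/eqP.
by congr (Rintegral _ _ _).
Qed.

Let sf3 : sigma_finite [set: E3 R] L3.
Proof.
exact: (@sigma_finite_prod _ _ _ _ R _ (sigma_finite_prod (sigma_finiteT L) L) L).
Qed.

(** This is what makes [u] an admissible test function; the integrability comes from the bound
    [M1]. *)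
Lemma sol_Lcyl T : 0 < T -> Lcyl Om (m + 1) T u.
Proof.
move=> T0; have [h [mh hE]] := sol_joint T0; exists h; split.
- exact: measurable_funTS.
- apply: aeW => t; rewrite in_itv/= => /andP[t0 tT]; exact: hE (ltW t0) tT.
- exact: (@joint_powR_lty _ _ R L3 sf3 Om mO u T (`|M1| `^ (m + 1)) (m + 1) h T0 (powR_ge0 _ _) mh hE sol_powR_bound).
Qed.

Local Notation cross := (fun t => ip Om (fun x => `|ut t x| `^ (m - 1) * ut t x) (u t)).
Local Notation src := (fun t => ip Om (fun x => source P (u t x)) (u t)).

(* [C] vanishes where the cross term is not known to be integrable in time. *)
Lemma sol_cross T : 0 < T -> exists C : R -> R,
  [/\ L.-integrable `[0%R, T] (EFin \o C),
    forall t, 0 <= t -> t <= T ->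
      \int[L]_(s in `[0%R, t]) cross s = \int[L]_(s in `[0%R, t]) C s &
    forall t, C t = cross t \/ C t = 0].
Proof.
move=> T0; have T1 : 0 < T + 1 by lra.
have [h [mh hE]] := sol_joint T1.
have [[_ _ [h1 [mh1 h1E h1q]] _] _ _ _] := sol_weak HW T1.
have [C [iC CE C01]] := @cross_term_integrable _ _ R L3 sf3 Om mO u ut (T + 1) (`|M1| `^ (m + 1))
  (m + 1) h h1 T1 (powR_ge0 _ _) mh hE sol_powR_bound m damping_ge1 erefl mh1 h1q h1E.
exists (C \_ `]0%R, T + 1[); split.
- apply: (@integrableS _ _ _ _ setT) => //; rewrite -restrict_EFin.
  by have [+ _] := @integrable_mkcond _ _ R L `]0%R, T + 1[%classic (EFin \o C) (measurable_itv _); exact.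
- move=> t t0 tT; rewrite /Rintegral; congr fine; apply: ae_eq_integral_all.
  have n0 : L.-negligible [set (0 : R)].
    by apply/negligibleP; [exact: measurable_set1|exact: lebesgue_measure_set1].
  have ae0 : {ae L, forall s : R, s <> 0}.
    by apply: negligibleS n0 => s /=; apply: contrapT.
  apply: (ae_imp (ae_and CE ae0)) => s -[Cs s0]; rewrite /= in_itv/= => /andP[s0' st].
  have sI : s \in (`]0%R, T + 1[ : interval R).
    by rewrite in_itv/= lt_neqAle eq_sym s0' andbT; apply/andP; split; [exact/eqP|lra].
  by congr EFin; rewrite patchE mem_setE sI; exact: Cs.
- move=> t; rewrite patchE mem_setE; case: ifP => [tI|_]; last by right.
  exact: C01.
Qed.

Lemma src_continuous : half_continuous src.
Proof.
apply: (@half_continuous_eq _ (fun t =>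
  \sum_i @acoef R P i * nrm Om (@pexp R P i + 1) (u t) `^ (@pexp R P i + 1) -
  \sum_j @bcoef R P j * nrm Om (@qexp R P j + 1) (u t) `^ (@qexp R P j + 1))).
  by move=> t t0; rewrite (ip_source oO bO (set_p HP) (set_q HP) (sol_H10 HW t0)).
apply: half_continuousB; apply: power_sum_continuous => i.
- exact: (pterm_continuous HP HW).
- exact: (qterm_continuous HP HW).
Qed.

Lemma delay_ipE t : 0 <= t ->
  \int[L]_(s in Linf) (mu s * gradip (u (t - s)) (u t)) = delay_ip P u0 u t.
Proof.
move=> t0; rewrite /delay_ip (glue_ge0 _ _ t0); apply: eq_Rintegral => s _.
by rewrite (gradip_ae_congr (u t) (glue_ae hp (t - s))).
Qed.

(** The weak formulation only speaks of intervals starting at 0, so the identities at S + T and at S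
    are subtracted. *)
Lemma sol_test S T : 0 <= S -> 0 < T -> exists C : R -> R,
  [/\ forall t, C t = cross t \/ C t = 0,
   L.-integrable `]S, S + T] (EFin \o C) &
   ip Om (ut (S + T)) (u (S + T)) - ip Om (ut S) (u S) =
   \int[L]_(t in `]S, S + T])
     (A t - ker P 0 * B t + delay_ip P u0 u t - C t + src t)].
Proof.
move=> S0 T0; have X0 : 0 < S + T by lra.
have [C [iC CE C01]] := sol_cross X0.
pose g t := A t - ker P 0 * B t + delay_ip P u0 u t - C t + src t.
have iA Y := @half_continuous_integrable _ _ Y (sol_A_continuous HP HW).
have iB Y := @half_continuous_integrable _ _ Y (sol_B_continuous HP HW).
have isrc Y := @half_continuous_integrable _ _ Y src_continuous.
have iCY t : t <= S + T -> L.-integrable `[0%R, t] (EFin \o C).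
  move=> tX; apply: (integrableS _ _ _ iC) => //.
  by apply: subset_itvl; rewrite bnd_simp.
have lin t (tX : t <= S + T) := @Rintegral_combination _ _ R L `[0%R, t]%classic (ker P 0) A B
    (delay_ip P u0 u) C src (measurable_itv _)
  (iA t) (iB t) (delay_ip_integrable_time t) (iCY t tX) (isrc t).
have key t : 0 <= t -> t <= S + T ->
    ip Om (ut t) (u t) - ip Om (ut 0) (u 0) = \int[L]_(s in `[0%R, t]) g s.
  move=> t0 tX.
  have [[c1 c2 _ c4] _ _ H] := sol_weak HW X0.
  have := H t _ u ut c1 (sol_Lcyl X0) c2 c4; rewrite in_itv/= t0 => /(_ tX) {}H.
  have [_ ->] := lin t tX; rewrite -CE//.
  have dE : \int[L]_(s in `[0%R, t]) delay_ip P u0 u s =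
     \int[L]_(tau in `[0, t]) \int[L]_(s in Linf) (mu s * gradip (u (tau - s)) (u tau)).
    apply: eq_Rintegral => s; rewrite inE/= in_itv/= => /andP[s0 _].
    by rewrite delay_ipE.
  rewrite dE; apply: multiplier_rearrange; exact: H.
exists C; split => //.
- apply: (integrableS _ _ _ iC) => //.
  by apply: subset_itvr; rewrite bnd_simp.
- have -> : ip Om (ut (S + T)) (u (S + T)) - ip Om (ut S) (u S) =
    (ip Om (ut (S + T)) (u (S + T)) - ip Om (ut 0) (u 0)) - (ip Om (ut S) (u S) - ip Om (ut 0) (u 0)).
    by move: (ip _ _ _) (ip _ _ _) (ip _ _ _) => x y z; ring.
  rewrite key//; [|exact: ltW]. rewrite key//; [|lra].
  by apply: Rintegral_itvB; rewrite ?bnd_simp//; [exact: (lin (S + T) _).1|lra].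
Qed.

End multiplier.

(* Real arithmetic of the energy step: the letters stand for the time integrals
   of the energy, kinetic, gradient, memory and damping terms. *)
Lemma step_arithmetic (R : realType) (eta ee ce cb cA cM cD T ES ET iE iA iM iB iC iG d0 d1 la p : R) :
  0 < la -> 0 <= cA -> 0 <= cM -> 0 <= cD -> 0 <= ce -> 0 <= cb -> 1 <= p -> ET <= ES -> 0 <= T ->
  eta * (T * ET) <= eta * iE -> eta * T = 2 * cb + 1 ->
  eta * iE <= 2 * iA + ce * iM - ee * iB - (iG + iC) -> d1 - d0 = iG ->
  iA <= p * (ES - ET) + T * (cA / la) ->
  iM <= cM * p * (2 * (ES - ET)) + T * (cM / la) ->
  - iC <= ee * iB + cD * p * (ES - ET) + T * (cD / la) ->
  `|d0| <= cb * ES -> `|d1| <= cb * ET ->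
  ET <= (2 * (cA * T + 1) + ce * (cM * (T + 2)) + cD * (T + 1) + cb) * (p * (ES - ET) + la^-1).
Proof.
move=> la0 cA0 cM0 cD0 ce0 cb0 p1 EE T0 h1 hT h2 h3 h4 h5 h6 h7 h8.
have := ler_norm d0; have := ler_norm (- d1); rewrite normrN => n1 n0.
have i0 : 0 < la^-1 by rewrite invr_gt0.
have D0 : 0 <= ES - ET by rewrite subr_ge0.
have pD : ES - ET <= p * (ES - ET) by rewrite ler_peMl.
have [X XE] : exists X, X = p * (ES - ET) by eexists.
have [i iE'] : exists i, i = la^-1 by eexists.
have {}h4 : iA <= X + T * (cA * i) by rewrite XE iE'.
have {}h5 : iM <= 2 * (cM * X) + T * (cM * i).
  by apply: (le_trans h5); rewrite XE iE'; lra.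
have {}h6 : - iC <= ee * iB + cD * X + T * (cD * i).
  by apply: (le_trans h6); rewrite XE iE'; lra.
rewrite -XE -iE' in i0 pD *.
have X0 : 0 <= X := le_trans D0 pD.
have q1 : 0 <= cA * T * X by apply: mulr_ge0 => //; exact: mulr_ge0.
have q2 : 0 <= cM * (T * X) by apply: mulr_ge0 => //; exact: mulr_ge0.
have q3 : 0 <= cM * i by apply: mulr_ge0 => //; exact: ltW.
have q4 : 0 <= cD * T * X by apply: mulr_ge0 => //; exact: mulr_ge0.
have q5 : 0 <= cD * i by apply: mulr_ge0 => //; exact: ltW.
have q6 : 0 <= cb * (X - (ES - ET)) by apply: mulr_ge0 => //; lra.
have q7 : 0 <= cb * i by apply: mulr_ge0 => //; exact: ltW.
have q8 : ce * iM <= ce * (cM * (T + 2) * (X + i)).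
  by apply: ler_wpM2l => //; apply: (le_trans h5); lra.
have {}h1 : (2 * cb + 1) * ET <= eta * iE by rewrite -hT -mulrA.
clear XE iE' p1 hT; lra.
Qed.

Lemma step_pointwise_arithmetic (R : realType) (et ep c k a b w q s d EE : R) :
  0 <= et -> et <= 1 -> 0 <= b -> 0 <= a -> 0 <= w -> 0 <= q ->
  ep * (k - 1) * b <= et / 4 * b -> s <= (1 - et) * b - q ->
  d <= (1 + ep) * ((k - 1) * b) + c * w -> et * EE <= et * (2^-1 * (a + b + w + q)) ->
  et * EE <= 2 * a + (2^-1 + c) * w - et / 4 * b - (a - k * b + d + s).
Proof.
move=> et0 et1 b0 a0 w0 q0 hB hs hd e1.
have p1 : 0 <= (1 - et) * a by apply: mulr_ge0 => //; lra.
have p2 : 0 <= (1 - et) * w by apply: mulr_ge0 => //; lra.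
have p3 : 0 <= (1 - et) * q by apply: mulr_ge0 => //; lra.
have p4 : 0 <= et * b by apply: mulr_ge0.
lra.
Qed.

Lemma Rintegral_le_lower_cst d (T : measurableType d) (R : realType)
    (nu : {measure set T -> \bar R}) (D : set T) (f : T -> R) (N : T -> \bar R) (c e k : R) :
  measurable D -> (nu D < +oo)%E -> nu.-integrable D (EFin \o f) -> 0 < c ->
  (forall x, D x -> (0 <= N x)%E) ->
  (forall x, D x -> ((f x)%:E <= c%:E * N x + k%:E)%E) ->
  (\int[nu]_(x in D) N x <= e%:E)%E ->
  \int[nu]_(x in D) f x <= c * e + fine (nu D) * k.
Proof.
move=> mD fD iF c0 N0 fN Ne.
have ik : nu.-integrable D (EFin \o (fun=> k)).
  apply: measurable_bounded_integrable => //.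
  by exists `|k|; split; [exact: num_real|move=> y ky x _; exact: ltW].
have := @Rintegral_le_lower _ _ _ nu D (fun x => f x - k) N c e mD (integrableB mD iF ik) c0 N0.
rewrite RintegralB// Rintegral_cst// lerBlDr (mulrC k); apply => // x Dx.
by rewrite EFinB leeBlDr//; exact: fN.
Qed.

Section step_integrals.
Context d (T : measurableType d) (R : realType) (nu : {measure set T -> \bar R}).
Variables (D : set T) (mD : measurable D).

Lemma Rintegral_opp_sub (k : R) (C B : T -> R) :
  nu.-integrable D (EFin \o C) -> nu.-integrable D (EFin \o B) ->
  nu.-integrable D (EFin \o (fun t => - 1 * C t - k * B t)) /\
  \int[nu]_(t in D) (- 1 * C t - k * B t) =
    - (\int[nu]_(t in D) C t) - k * \int[nu]_(t in D) B t.
Proof.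
move=> iC iB.
have i1 : nu.-integrable D (EFin \o (fun t => - 1 * C t)) := integrableZl mD (-1) iC.
have i2 : nu.-integrable D (EFin \o (fun t => k * B t)) := integrableZl mD k iB.
split; first exact: (integrableB mD i1 i2).
by rewrite RintegralB// !RintegralZl// mulN1r.
Qed.

(** The pointwise bound contains no damping term, whereas the tested identity does; its integral is
    added back at the end. *)
Lemma integrated_step (c ce k k0 : R) (A B M dl C s : T -> R) : (nu D < +oo)%E ->
  nu.-integrable D (EFin \o A) -> nu.-integrable D (EFin \o B) ->
  nu.-integrable D (EFin \o M) -> nu.-integrable D (EFin \o dl) ->
  nu.-integrable D (EFin \o C) -> nu.-integrable D (EFin \o s) ->
  (forall t, D t -> c <= 2 * A t + ce * M t - k * B t - (A t - k0 * B t + dl t + s t)) ->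
  c * fine (nu D) <= 2 * \int[nu]_(t in D) A t + ce * \int[nu]_(t in D) M t
    - k * \int[nu]_(t in D) B t
    - (\int[nu]_(t in D) (A t - k0 * B t + dl t - C t + s t) + \int[nu]_(t in D) C t).
Proof.
move=> fD iA iB iM idl iC isrc h.
have [ig _] := Rintegral_combination k0 mD iA iB idl iC isrc.
have iA2 : nu.-integrable D (EFin \o (fun t => 2 * A t)) := integrableZl mD 2 iA.
have iM2 : nu.-integrable D (EFin \o (fun t => ce * M t)) := integrableZl mD ce iM.
have iC2 : nu.-integrable D (EFin \o (fun t => - 1 * C t)) := integrableZl mD (-1) iC.
have [ic Ic] := Rintegral_combination k mD iA2 iB iM2 ig iC2.
have ik : nu.-integrable D (EFin \o (fun=> c)).
  apply: measurable_bounded_integrable => //.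
  by exists `|c|; split; [exact: num_real|move=> y ky x _; exact: ltW].
rewrite -Rintegral_cst//.
apply: le_trans (le_Rintegral mD ik ic _) _.
  by move=> t /h ht; apply: (le_trans ht); rewrite le_eqVlt; apply/orP; left; apply/eqP; ring.
by rewrite Ic !RintegralZl// le_eqVlt; apply/orP; left; apply/eqP; ring.
Qed.

End step_integrals.

(** * The energy inequality over one period *)

Section step.
Context {R : realType} (P : problem R) (l0 : nat) (y0 : R).
Hypothesis HP : setting P l0 y0.
Local Notation L := (@lebesgue_measure R).
Local Notation L3 := (@leb3 R).
Local Notation Om := (Om P).
Local Notation m := (dmp P).
Local Notation gradip := (gradip Om).
Variables (E0 M1 : R) (u0 v0 u ut : R -> E3 R -> R).
Hypothesis HW : well_solution P l0 y0 E0 M1 u0 v0 u ut.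
Local Notation A := (fun t => ip Om (ut t) (ut t)).
Local Notation B := (fun t => gradip (u t) (u t)).
Local Notation E := (En P u ut).
Local Notation e := (Ecal P u ut).
Local Notation Mem := (memory P u).
Local Notation cross := (fun t => ip Om (fun x => `|ut t x| `^ (m - 1) * ut t x) (u t)).
Local Notation src := (fun t => ip Om (fun x => source P (u t x)) (u t)).

Variables (y1 rho : R).
Hypotheses (y1_ge0 : 0 <= y1) (y10 : y1 < y0) (rho0 : 0 <= rho) (rho1 : rho < 1)
  (gap : forall y, y1 <= y -> y <= y0 -> E0 < Gfun P y)
  (absorb : forall y, 0 <= y -> y <= y1 ->
    \sum_i @acoef R P i * (2 * @gam R P i ^+ 2 * y) `^ ((@pexp R P i + 1) / 2) <= 2 * rho * y).

Let oO := set_open HP.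
Let bO := set_bounded HP.
Let SH := semi_inner_H10 oO bO.
Let SL := semi_inner_L2 oO.
Let h3 := set_iii HP.
Let h4 := set_iv HP.
Let hu := @sol_CT _ _ _ _ _ _ _ _ _ _ HW.
Let h0 := sol_L2mu HW.
Let hp := sol_past HW.
Let mO : measurable Om := open_measurable3 oO.
Let fO : (L3 Om < +oo)%E := leb3_bounded_lty mO bO.

Let eK t : 0 <= t -> e t <= y1.
Proof. by move=> t0; apply/ltW/(sol_trap HP HW). Qed.

Let BK r : 0 <= r -> gradip (glue u0 u r) (glue u0 u r) <= 2 * y1.
Proof. by move=> r0; rewrite glue_ge0//; exact: (sol_B_le HP HW). Qed.

Let eta := 1 - rho.
Let eta0 : 0 < eta. Proof. by rewrite subr_gt0. Qed.

Lemma boundary_le t : 0 <= t ->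
  `|ip Om (ut t) (u t)| <= 2 * (1 + sobolev_cst Om) / eta * E t.
Proof.
move=> t0; have hv := sol_H10 HW t0.
have h1 := si_norm_le SL (sol_Lp2 HW t0) (H10_Lp2 hv).
have h2 := sol_ip_le HP hv.
have [bA bB _ _] := sol_Ecal_bounds HP u ut t.
have h5 := sol_coercive HP HW y10 rho0 gap absorb t0.
have C0 := sobolev_cst_gt0 Om.
have h6 : e t <= E t / eta by rewrite ler_pdivlMr// mulrC.
move: (ip _ _ _) (ip _ _ _) (ip _ _ _) (gradip _ _) (Ecal _ _ _ _) (En _ _ _ _) (sobolev_cst _) h1 h2 bA bB h6 C0 => x y z g ee EE c h1 h2 bA bB h6 C0.
have : c * g <= c * (2 * ee) by apply: ler_wpM2l => //; exact: ltW.
have : c * ee <= c * (EE / eta) by apply: ler_wpM2l => //; exact: ltW.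
have -> : 2 * (1 + c) / eta * EE = 2 * (1 + c) * (EE / eta) by rewrite mulrAC mulrA.
move: (EE / eta) h6 => w *; lra.
Qed.

Variable ep : R.
Hypotheses (ep0 : 0 < ep) (epk : ep * (ker P 0 - 1) <= eta / 4).

(** The sources leave [eta * B] of the gradient term. Half of it pays for the energy, a quarter for
    Young's inequality in the delay term, and a quarter is kept for the damping term. The absorption
    terms of the energy are covered by those of the source. *)
Lemma step_pointwise t : 0 <= t ->
  eta * E t <= 2 * A t + (2^-1 + (4 * ep)^-1) * Mem t - eta / 4 * B t -
   (A t - ker P 0 * B t + delay_ip P u0 u t + src t).
Proof.
move=> t0.
have hE := sol_E_le HP HW t0.
have hs := ip_source oO bO (set_p HP) (set_q HP) (sol_H10 HW t0).
have ha := sol_absorb HP HW y10 gap absorb t0.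
have hd := delay_ip_le oO bO h3 h4 hu h0 hp BK t0 ep0.
rewrite glue_ge0// in hd.
have hB : ep * (ker P 0 - 1) * B t <= eta / 4 * B t by apply: ler_wpM2r => //; exact: (si_ge0 SH).
have B0 : 0 <= B t by exact: (si_ge0 SH).
have A0 : 0 <= A t by exact: (si_ge0 SL).
have M0 := sol_memory_ge0 HP u t.
have Q0 : 0 <= qsum P u t.
  apply: sumr_ge0 => j _; apply: mulr_ge0; [exact/ltW/(bcoef_gt0 HP)|exact: powR_ge0].
have {}hs : src t <= rho * B t - qsum P u t by rewrite hs; apply: lerB.
have e1 : eta * E t <= eta * (2^-1 * (A t + B t + Mem t + qsum P u t)) by apply: ler_wpM2l => //; exact: ltW.
have hmu : Mem t / (4 * ep) = (4 * ep)^-1 * Mem t by rewrite mulrC.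
rewrite hmu in hd.
have rE : rho = 1 - eta by rewrite /eta; ring.
have eta1 : eta <= 1 by rewrite /eta lerBlDr lerDl.
move: hs hd e1 hB; rewrite rE.
move=> hs' hd' e1' hB'.
exact: (step_pointwise_arithmetic (ltW eta0) eta1 B0 A0 M0 Q0 hB' hs' hd' e1').
Qed.

Variables (cM rM cD rD : R).
Hypotheses (cM0 : 0 < cM) (cD0 : 0 < cD).
Hypothesis memory_bound : forall la t, 1 <= la -> 0 <= t ->
  ((Mem t)%:E <= (cM * la `^ rM)%:E * mem_dissip P u t + (cM / la)%:E)%E.
Hypothesis cross_bound : forall la t, 1 <= la -> 0 <= t ->
  (`|cross t|%:E <= (cD * la `^ rD)%:E * dissip P ut t + (eta / 4 * B t + cD / la)%:E)%E.

Let cb := 2 * (1 + sobolev_cst Om) / eta.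
(** The boundary terms cost at most 2 cb E(S+T) plus a multiple of the drop of the energy; with this
    length exactly one E(S+T) is left over. *)
Let T := (2 * cb + 1) / eta.
Let ce := 2^-1 + (4 * ep)^-1.
Let cA := fine (L3 Om).

Lemma dissipE t : dissip P ut t = (\int[L3]_(x in Om) (`|ut t x| `^ (m + 1))%:E)%E.
Proof. by rewrite /dissip enrm_poweR// gt_eqF//; have := damping_ge1 HP; lra. Qed.

Lemma dissip_ge0 t : (0 <= dissip P ut t)%E. Proof. exact: poweR_ge0. Qed.

Lemma mem_dissip_ge0 t : (0 <= mem_dissip P u t)%E.
Proof. by apply: integral_ge0 => s; exact: (mem_dissip_integrand_ge0 HP). Qed.

(** As la >= 1, a single exponent above those of the kinetic, memory and damping terms serves for
    all three. *)
Lemma energy_step r S la : (m - 1) / 2 <= r -> rM <= r -> rD <= r -> 0 <= S -> 1 <= la ->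
  E (S + T) <= (2 * (cA * T + 1) + ce * (cM * (T + 2)) + cD * (T + 1) + cb) *
    (la `^ r * (E S - E (S + T)) + la^-1).
Proof.
move=> r1 r2 r3 S0 la1.
have la0 : 0 < la by lra.
have C0 := sobolev_cst_gt0 Om.
have cb0 : 0 < cb by rewrite /cb !mulr_gt0 ?invr_gt0//; lra.
have T0 : 0 < T by rewrite /T mulr_gt0 ?invr_gt0//; lra.
have ST : S <= S + T by lra.
have ST0 : 0 <= S + T by lra.
have [C [C01 iC HC]] := sol_test HP HW eK S0 T0.
pose I := `]S, S + T]%classic.
have mI : measurable I by exact: measurable_itv.
have I0 t : I t -> 0 <= t by rewrite /I/= in_itv/= => /andP[/ltW St _]; exact: le_trans St.
have IS t : I t -> t <= S + T by rewrite /I/= in_itv/= => /andP[].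
have sub (f : R -> R) : L.-integrable `[0%R, S + T] (EFin \o f) -> L.-integrable I (EFin \o f).
  by move=> iF; apply: (integrableS _ _ _ iF) => //; apply: subset_itvr; rewrite bnd_simp.
have iA := sub _ (half_continuous_integrable (S + T) (sol_A_continuous HP HW)).
have iB := sub _ (half_continuous_integrable (S + T) (sol_B_continuous HP HW)).
have isrc := sub _ (half_continuous_integrable (S + T) (src_continuous HP HW)).
have idl := sub _ (delay_ip_integrable_time HP HW eK (S + T)).
have iM := sub _ (memory_integrable HP HW eK (S + T)).
have [EE hN hJ] := sol_dissipation HP HW S0 ST.
have LI : L I = T%:E.
  by rewrite lebesgue_measure_itv/= lte_fin ltrDl T0 -EFinB addrAC subrr add0r.
have LIy : (L I < +oo)%E by rewrite LI ltry.
have fLI : fine (L I) = T by rewrite LI.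
have p0 q : 0 < la `^ q by exact: powR_gt0.
have pq q : q <= r -> la `^ q <= la `^ r by move=> qr; apply: ler_powR.
pose D := E S - E (S + T).
have D0 : 0 <= D by rewrite /D subr_ge0.
have stA : \int[L]_(t in I) A t <= la `^ ((m - 1) / 2) * D + T * (cA / la).
  rewrite -fLI; apply: (@Rintegral_le_lower_cst _ _ _ L I A (dissip P ut)) => //.
  - by move=> t _; exact: dissip_ge0.
  - move=> t /I0 t0; rewrite dissipE.
    apply: (@sqr_integral_le _ _ R L3 Om mO m la (ut t) fO _ (damping_ge1 HP) la1).
    by apply/Lp2P; exact: (sol_Lp2 HW t0).
have stM : \int[L]_(t in I) Mem t <= cM * la `^ rM * (2 * D) + T * (cM / la).
  rewrite -fLI; apply: (@Rintegral_le_lower_cst _ _ _ L I Mem (mem_dissip P u)) => //.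
  - exact: mulr_gt0.
  - by move=> t _; exact: mem_dissip_ge0.
  - by move=> t /I0 t0; exact: memory_bound.
have [iCB ICB] := @Rintegral_opp_sub _ _ R L I mI (eta / 4) C B iC iB.
have stC : \int[L]_(t in I) (- 1 * C t - eta / 4 * B t) <= cD * la `^ rD * D + T * (cD / la).
  rewrite -fLI; apply: (@Rintegral_le_lower_cst _ _ _ L I _ (dissip P ut)) => //.
  - exact: mulr_gt0.
  - by move=> t _; exact: dissip_ge0.
  - move=> t /I0 t0.
    have hc := cross_bound la1 t0.
    have B0 : 0 <= gradip (u t) (u t) by exact: (si_ge0 SH).
    (* Both possible values of [C] satisfy the bound, which is why the value 0 was allowed for
       it. *)
    have hC : ((- 1 * C t)%:E <= `|cross t|%:E)%E.
      rewrite lee_fin mulN1r; case: (C01 t) => ->; last by rewrite oppr0.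
      by rewrite -normrN ler_norm.
    rewrite EFinB leeBlDr// -addeA -EFinD; apply: (le_trans hC).
    by rewrite [cD / la + _]addrC.
rewrite ICB in stC.
(* By monotonicity the constant E(S+T) is below the energy throughout the interval, so no time
   integral of the energy is needed. *)
have key := @integrated_step _ _ R L I mI (eta * E (S + T)) ce (eta / 4) (ker P 0) A B Mem
  (delay_ip P u0 u) C src LIy iA iB iM idl iC isrc.
have {}key := key (fun t It => le_trans (ler_wpM2l (ltW eta0)
  (let: And3 h _ _ := sol_dissipation HP HW (I0 _ It) (IS _ It) in h)) (step_pointwise (I0 _ It))).
rewrite fLI -HC in key.
have p1 : 1 <= la `^ r.
  by rewrite -(powRr0 la) ler_powR//; apply: le_trans r1; rewrite divr_ge0// subr_ge0 (damping_ge1 HP).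
have b0 := boundary_le S0.
have b1 := boundary_le ST0.
have D0' := D0; rewrite /D in D0'.
have hT : eta * T = 2 * cb + 1 by rewrite /T mulrC divfK// gt_eqF.
have ce0 : 0 <= ce by rewrite /ce addr_ge0// invr_ge0 mulr_ge0// ltW.
have cA0 : 0 <= cA by exact: fine_ge0 (measure_ge0 _ _).
have stA' : \int[L]_(t in I) A t <= la `^ r * D + T * (cA / la).
  by apply: (le_trans stA); rewrite lerD2r; apply: ler_wpM2r => //; exact: pq.
have stM' : \int[L]_(t in I) Mem t <= cM * la `^ r * (2 * D) + T * (cM / la).
  apply: (le_trans stM); rewrite lerD2r; apply: ler_wpM2r; first exact: mulr_ge0.
  by apply: ler_wpM2l; [exact: ltW|exact: pq].
have stC' : - (\int[L]_(t in I) C t) <=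
    eta / 4 * (\int[L]_(t in I) B t) + cD * la `^ r * D + T * (cD / la).
  have : cD * la `^ rD * D <= cD * la `^ r * D.
    by apply: ler_wpM2r => //; apply: ler_wpM2l; [exact: ltW|exact: pq].
  move=> hcD; rewrite lerBlDl addrA in stC; apply: (le_trans stC).
  by rewrite lerD2r lerD2l.
rewrite [eta * E _ * T]mulrAC -mulrA in key.
exact: (step_arithmetic la0 cA0 (ltW cM0) (ltW cD0) ce0 (ltW cb0) p1 EE (ltW T0) (lexx _) hT key
  erefl stA' stM' stC' b0 b1).
Qed.

End step.

(** * Uniform bounds of the damping and memory terms *)

Section solution_bounds.
Context {R : realType} (P : problem R) (l0 : nat) (y0 : R).
Hypothesis HP : setting P l0 y0.
Local Notation L := (@lebesgue_measure R).
Local Notation L3 := (@leb3 R).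
Local Notation Om := (Om P).
Local Notation m := (dmp P).
Local Notation mu := (mu P).
Local Notation dmu := (dmu P).
Local Notation Linf := (`[0%R, +oo[%classic : set R).
Local Notation gradip := (gradip Om).
Variables (E0 M1 : R).

Let oO := set_open HP.
Let bO := set_bounded HP.
Let SH := semi_inner_H10 oO bO.
Let h3 := set_iii HP.
Let h4 := set_iv HP.
Let mO : measurable Om := open_measurable3 oO.
Let m1 := damping_ge1 HP.

(** In the well B <= 2 y0, so that the Sobolev bound by B^((m+1)/2) is at most [w0] times B. *)
Let w0 := sobolev_cst Om * (2 * y0) `^ ((m - 1) / 2).

(* When [m + 1 <= 6], Sobolev absorbs the [u] part of Young's inequality into the
   gradient term; otherwise the bound by [M1] is used and the weight is a power
   of [la]. *)
Definition cross_cst ep : R :=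
  if m <= 5 then ((w0 + 1) / ep) `^ m^-1 else 1 + `|M1| `^ (m + 1).

Definition cross_exp : R := if m <= 5 then 0 else m^-1.

Lemma cross_cst_gt0 ep : 0 < ep -> 0 < cross_cst ep.
Proof.
move=> ep0; rewrite /cross_cst; case: ifP => _; last by rewrite ltr_wpDr// powR_ge0.
rewrite powR_gt0// divr_gt0// ltr_wpDl// mulr_ge0// ?powR_ge0//.
exact/ltW/sobolev_cst_gt0.
Qed.

Lemma cross_exp_le : cross_exp <= (m - 1) / 2.
Proof.
rewrite /cross_exp; case: ifPn => [_|]; first by rewrite divr_ge0// subr_ge0.
rewrite -ltNge => m5.
have : m^-1 <= 1 by rewrite invf_le1//; lra.
move: m5; move: (m^-1) => i *; lra.
Qed.

Variables (u0 v0 u ut : R -> E3 R -> R).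
Hypothesis HW : well_solution P l0 y0 E0 M1 u0 v0 u ut.
Local Notation B := (fun t => gradip (u t) (u t)).
Local Notation e := (Ecal P u ut).
Local Notation cross := (fun t => ip Om (fun x => `|ut t x| `^ (m - 1) * ut t x) (u t)).
Let hu := @sol_CT _ _ _ _ _ _ _ _ _ _ HW.
Let h0 := sol_L2mu HW.
Let hp := sol_past HW.

Lemma sol_Ecal_le t : 0 <= t -> e t <= y0.
Proof.
move=> t0; have [_ _ hE] := sol_initial HW.
have [y1 [rho [_ y10 _ _ [gap _]]]] := well_constants HP (sol_y0 HP HW) hE.
by apply/ltW/(lt_trans _ y10)/(sol_trap HP HW y10 gap).
Qed.

Lemma sol_B_le_y0 t : 0 <= t -> B t <= 2 * y0.
Proof.
move=> t0; have [_ h _ _] := sol_Ecal_bounds HP u ut t.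
by apply: (le_trans h); rewrite ler_pM2l// sol_Ecal_le.
Qed.

Lemma cross_bound ep la t : 0 < ep -> 1 <= la -> 0 <= t ->
  (`|cross t|%:E <= (cross_cst ep * la `^ cross_exp)%:E * dissip P ut t +
     (ep * B t + cross_cst ep / la)%:E)%E.
Proof.
move=> ep0 la1 t0; have hv := sol_H10 HW t0.
have la0 : 0 < la by lra.
have m0 : 0 < m by exact: lt_le_trans ltr01 m1.
have cc0 := cross_cst_gt0 ep0.
have B0 : 0 <= B t by exact: (si_ge0 SH).
have mut : measurable_fun Om (ut t) by have [] := sol_Lp2 HW t0.
have mu' : measurable_fun Om (u t) by have [] := H10_Lp2 hv.
have cr := @cross_integral_le _ _ R L3 Om mO m _ _ (ut t) (u t) m1 _ mut mu'.
have N0 : (0 <= dissip P ut t)%E by exact: dissip_ge0.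
have m5' : m <= 5 -> m + 1 <= 6 by lra.
have mp : 0 < m + 1 by rewrite addr_gt0.
move: cc0; rewrite /cross_cst /cross_exp; case: ifPn => [m5|m5] cc0.
(* With this [k] the weight k^(-m) is ep / (w0 + 1), so the term in [u] costs at most [ep * B t]. *)
- set k := _ `^ _ in cc0 *.
  pose W := sobolev_cst Om * B t `^ ((m + 1) / 2).
  have hW : (\int[L3]_(x in Om) (`|u t x| `^ (m + 1))%:E <= W%:E)%E.
    have hi := H10_powR_integrable oO bO mp (m5' m5) hv.
    rewrite -[leLHS]fineK; last exact: integrable_fin_num.
    by rewrite lee_fin; exact: (sobolev_Rintegral oO bO mp (m5' m5) hv).
  apply: (le_trans (cr k W cc0 hW)).
  rewrite powRr0 mulr1 -(dissipE HP ut) leeD2l// lee_fin.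
  apply: ler_wpDr; first by rewrite divr_ge0// ltW.
  have w1 : 0 < w0 + 1.
    by rewrite ltr_wpDl// mulr_ge0 ?powR_ge0//; exact/ltW/sobolev_cst_gt0.
  have kE : k `^ (- m) = ep / (w0 + 1).
    rewrite /k -powRrM mulrN mulVf ?gt_eqF// powR_inv1; last by rewrite divr_ge0// ltW.
    by rewrite invf_div.
  have WB : W <= w0 * B t.
    rewrite /W; have -> : (m + 1) / 2 = (m - 1) / 2 + 1 by field.
    rewrite /w0 powRD; last by rewrite gt_eqF// ltr_wpDl// divr_ge0// subr_ge0.
    rewrite powRr1// mulrA; apply: ler_wpM2r => //; apply: ler_wpM2l.
      exact/ltW/sobolev_cst_gt0.
    apply: ge0_ler_powR; rewrite ?nnegrE//; first by rewrite divr_ge0// subr_ge0.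
      by apply: le_trans (sol_B_le_y0 t0).
    exact: sol_B_le_y0.
  rewrite kE mulrAC ler_pdivrMr// -mulrA ler_pM2l//.
  by apply: (le_trans WB); rewrite mulrC ler_wpM2l// lerDl.
(* With this weight k^(-m) is exactly 1 / la. *)
- have k0 : 0 < la `^ m^-1 by exact: powR_gt0.
  apply: (le_trans (cr _ _ k0 (sol_powR_bound HP HW t0))).
  rewrite -(dissipE HP ut) -powRrM mulrN mulVf ?gt_eqF// powR_inv1; last exact: ltW.
  apply: leeD.
    by apply: lee_wpmul2r => //; rewrite lee_fin mulrDl mul1r lerDl mulr_ge0 ?powR_ge0.
  rewrite lee_fin; apply: ler_wpDl; first by rewrite mulr_ge0// ltW.
  by rewrite mulrC; apply: ler_wpM2r; [rewrite invr_ge0 ltW|rewrite lerDr].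
Qed.

Lemma mem_dissipE t : mem_dissip P u t =
  (\int[L]_(s in Linf) ((- dmu s) * gradnrm Om (hist u t s) ^+ 2)%:E)%E.
Proof.
apply: eq_integral => s _.
have hg : H10 Om (glue u0 u t - glue u0 u (t - s)).
  by apply: (si_XB SH); exact: (glue_H10 hu h0).
have ae : aeeq Om (hist u t s) (glue u0 u t - glue u0 u (t - s)).
  apply: (ae_imp (ae_and (glue_ae hp t) (glue_ae hp (t - s)))) => x -[a1 a2] Ox.
  by rewrite /hist /= a1// a2.
have -> : egradnrm Om (hist u t s) = (gradnrm Om (hist u t s))%:E.
  by rewrite /gradnrm (egradnrm_ae_congr ae) (egradnrm_sqrt oO hg).
have g0 : 0 <= gradnrm Om (hist u t s) by exact: fine_ge0 (Lnorm_ge0 _ _ _).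
by rewrite poweR_EFin -EFinM (powR_mulrn 2 g0).
Qed.

(** A common frame for both kernels: the part of [mu] controlled by its derivative is dissipated,
    the remainder [v] has to be small in integral. *)
Lemma memory_bound_of_kernel (v : R -> R) (c W V : R) t : 0 <= t -> 0 <= c -> 0 <= W ->
  measurable_fun Linf v -> (forall s, 0 <= s -> 0 <= v s) ->
  (forall s, 0 <= s -> mu s <= c * - dmu s + v s) ->
  (forall s, 0 <= s -> v s * gradnrm Om (hist u t s) ^+ 2 <= W * v s) ->
  (\int[L]_(s in Linf) (v s)%:E <= V%:E)%E ->
  ((memory P u t)%:E <= c%:E * mem_dissip P u t + (W * V)%:E)%E.
Proof.
move=> t0 c0 W0 mv v_ge0 muv vW hV; rewrite mem_dissipE.
have GK r : 0 <= r -> gradip (glue u0 u r) (glue u0 u r) <= 2 * y0.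
  by move=> r0; rewrite glue_ge0//; exact: sol_B_le_y0.
have hi := hist_integrable oO bO h3 h4 hu h0 hp GK t0.
have inE' (s : R) : Linf s -> 0 <= s by rewrite /= in_itv/= andbT.
apply: (@memory_integral_le _ _ R L Linf _ mu (fun s => - dmu s) v _ c W V c0 W0 hi _ mv) => //.
- apply: measurableT_comp => //; exact: half_continuous_measurable (dmu_half_continuous h4).
- exact: (hist_measurable oO bO hu h0 hp).
- by move=> s /inE'; exact: (mu_ge0 h3 h4).
- by move=> s /inE' s0; rewrite oppr_ge0; exact: (dmu_le0 h4).
- by move=> s /inE'; exact: v_ge0.
- by move=> s _; exact: sqr_ge0.
- by move=> s /inE'; exact: muv.
- by move=> s /inE'; exact: vW.
Qed.

Lemma memory_bound_exponential a la t : 0 < a ->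
  (forall s, 0 <= s -> dmu s + a * mu s <= 0) -> 1 <= la -> 0 <= t ->
  ((memory P u t)%:E <= (a^-1 * la `^ 0)%:E * mem_dissip P u t + (a^-1 / la)%:E)%E.
Proof.
move=> a0 h la1 t0; rewrite powRr0 mulr1.
(* The exponential condition bounds [mu] by its derivative outright, so the remainder is zero. *)
have := @memory_bound_of_kernel (fun=> 0) a^-1 0 0 t t0 _ (lexx _) _ _ _ _ _.
rewrite mulr0 adde0 => hm; apply: le_trans (hm _ _ _ _ _ _) _.
- by rewrite invr_ge0 ltW.
- exact: measurable_cst.
- by [].
- move=> s /h hs; rewrite addr0 mulrC ler_pdivlMr//; lra.
- by move=> s _; rewrite mul0r.
- by rewrite integral0.
- by rewrite leeDl// lee_fin mulr_ge0// invr_ge0; lra.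
Qed.

(* The factor in front of the integral bounds the squared gradient norm of
   [u t - u (t - s)]. *)
Definition memory_cst (b sigma M2 : R) : R := b^-1 +
  (2 * (2 * y0 + (2 * y0 + M2 ^+ 2))) * fine (\int[L]_(s in Linf) (mu s `^ (1 - sigma))%:E)%E.

Lemma memory_cst_gt0 b sigma M2 : 0 < b -> 0 < memory_cst b sigma M2.
Proof.
move=> b0; have y0_gt0 := sol_y0 HP HW.
apply: ltr_wpDr; last by rewrite invr_gt0.
apply: mulr_ge0.
  by apply: mulr_ge0 => //; rewrite !addr_ge0 ?sqr_ge0// mulr_ge0// ltW.
by apply: fine_ge0; apply: integral_ge0 => s _; rewrite lee_fin powR_ge0.
Qed.

Lemma memory_bound_polynomial b theta sigma M2 la t : 0 < b -> 1 < theta ->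
  0 < sigma -> sigma < 2 - theta ->
  (forall s, 0 <= s -> dmu s + b * mu s `^ theta <= 0) ->
  (forall s, s <= 0 -> (egradnrm Om (u0 s) <= M2%:E)%E) -> 1 <= la -> 0 <= t ->
  ((memory P u t)%:E <=
   (memory_cst b sigma M2 * la `^ ((theta - 1) / sigma))%:E * mem_dissip P u t +
   (memory_cst b sigma M2 / la)%:E)%E.
Proof.
move=> b0 th1 s0 sth h hM2 la1 t0; have la0 : 0 < la by lra.
set p := (theta - 1) / sigma.
set W := 2 * (2 * y0 + (2 * y0 + M2 ^+ 2)).
have y0_gt0 := sol_y0 HP HW.
have W0 : 0 <= W.
  by rewrite /W; apply: mulr_ge0 => //; rewrite !addr_ge0 ?sqr_ge0// mulr_ge0// ltW.
have fin := integral_mu_powR_lty h3 h4 b0 th1 s0 sth h.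
have I0 : (0 <= \int[L]_(s in Linf) (mu s `^ (1 - sigma))%:E)%E.
  by apply: integral_ge0 => s _; rewrite lee_fin powR_ge0.
pose V := fine (\int[L]_(s in Linf) (mu s `^ (1 - sigma))%:E)%E.
have VE : (V%:E = \int[L]_(s in Linf) (mu s `^ (1 - sigma))%:E)%E by rewrite fineK// ge0_fin_numE.
have V0 : 0 <= V by rewrite -lee_fin VE.
have mv : measurable_fun Linf (fun s => mu s `^ (1 - sigma)).
  exact: half_continuous_measurable (mu_powR_half_continuous h3 h4 _).
have lap0 : 0 < la `^ p by exact: powR_gt0.
(* Interpolation between the powers theta and 1 - sigma of the kernel: the first is dissipated, the
   second is integrable and carries the factor 1 / la. *)
have hm := @memory_bound_of_kernel (fun s => mu s `^ (1 - sigma) / la) (la `^ p / b) W (V / la) t t0.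
apply: le_trans (hm _ W0 _ _ _ _ _) _.
- by rewrite divr_ge0// ltW.
- by apply: measurable_funM => //; exact: measurable_cst.
- by move=> s _; rewrite divr_ge0 ?powR_ge0// ltW.
- move=> s s0'; apply: le_trans (interpolation_le (mu_gt0 h3 h4 s0') la1 th1 s0) _.
  rewrite lerD2r -/p -mulrA ler_pM2l//.
  have := h s s0'; rewrite ler_pdivlMl//; move: (dmu s) (b * _) => x y; lra.
- move=> s s0'; rewrite mulrC; apply: ler_wpM2r; first by rewrite divr_ge0 ?powR_ge0// ltW.
  apply: (le_trans (gradnrm_hist_le oO bO hu h0 hp t s)); rewrite /W ler_pM2l//.
  apply: lerD; first by rewrite glue_ge0//; exact: sol_B_le_y0.
  (* Delayed times after 0 are controlled by the well, those before 0 by [M2]. *)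
  have [ts|ts] := leP 0 (t - s).
    by rewrite glue_ge0//; apply: ler_wpDr; [exact: sqr_ge0|exact: sol_B_le_y0].
  apply: ler_wpDl; first by rewrite mulr_ge0// ltW.
  rewrite /glue ts; have := hM2 _ (ltW ts).
  have [hu0 _ _] := h0; have hv := hu0 _ (ltW ts).
  rewrite (egradnrm_sqrt oO hv) lee_fin => hs.
  by rewrite -[leLHS]sqr_sqrtr; [rewrite ler_sqr// nnegrE; [exact: sqrtr_ge0|exact: le_trans (sqrtr_ge0 _) hs]|exact: (si_ge0 SH)].
- under eq_integral do rewrite mulrC EFinM.
  rewrite ge0_integralZl_EFin//; last by rewrite invr_ge0 ltW.
  - by rewrite -VE -EFinM mulrC.
  - by move=> s _; rewrite lee_fin powR_ge0.
  - exact/measurable_EFinP.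
- apply: leeD.
    apply: lee_wpmul2r; first exact: (mem_dissip_ge0 HP).
    by rewrite lee_fin mulrC ler_pM2r// lerDl mulr_ge0.
  by rewrite lee_fin mulrA ler_wpM2r// ?invr_ge0 ?(ltW la0)// lerDr invr_ge0 ltW.
Qed.

End solution_bounds.

Lemma step_constant_gt0 (R : realType) (cA T ce cM cD cb : R) :
  0 <= cA -> 0 < T -> 0 <= ce -> 0 < cM -> 0 < cD -> 0 < cb ->
  0 < 2 * (cA * T + 1) + ce * (cM * (T + 2)) + cD * (T + 1) + cb.
Proof.
move=> A0 T0 e0 M0 D0 b0.
have p1 : 0 <= cA * T by rewrite mulr_ge0// ltW.
have p2 : 0 <= ce * (cM * (T + 2)) by rewrite !mulr_ge0 ?addr_ge0// ltW.
have p3 : 0 <= cD * (T + 1) by rewrite !mulr_ge0 ?addr_ge0// ltW.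
lra.
Qed.

(** * Decay with constants uniform over the solutions *)

Section energy_decay.
Context {R : realType} (P : problem R) (l0 : nat) (y0 : R).
Hypothesis HP : setting P l0 y0.
Local Notation Om := (Om P).
Local Notation m := (dmp P).
Variables (E0 M1 cM rM : R).
Hypothesis cM0 : 0 < cM.

Definition memory_bounded (u : R -> E3 R -> R) : Prop := forall la t, 1 <= la -> 0 <= t ->
  ((memory P u t)%:E <= (cM * la `^ rM)%:E * mem_dissip P u t + (cM / la)%:E)%E.

(** The order of the quantifiers is the point: [C] and [T] are fixed before the solution, so that
    the decay constants are shared by all solutions with the same data. *)
Lemma uniform_energy_step r : rM <= r -> (m - 1) / 2 <= r -> 0 < y0 -> E0 < Gfun P y0 ->
  exists C T : R, [/\ 0 < C, 0 < T & forall u0 v0 u ut,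
    well_solution P l0 y0 E0 M1 u0 v0 u ut -> memory_bounded u ->
    [/\ forall t, 0 <= t -> 0 <= En P u ut t,
      forall s t, 0 <= s -> s <= t -> En P u ut t <= En P u ut s,
      En P u ut 0 <= E0 &
      forall S la, 0 <= S -> 1 <= la -> En P u ut (S + T) <=
        C * (la `^ r * (En P u ut S - En P u ut (S + T)) + la^-1)]].
Proof.
move=> rMr mr y0_gt0 hE0.
have [y1 [rho [y1_ge0 y10 rho0 rho1 [gap absorb]]]] := well_constants HP y0_gt0 hE0.
have eta0 : 0 < 1 - rho by rewrite subr_gt0.
have k1 : 0 <= ker P 0 - 1.
  rewrite -(integral_mu (set_iii HP) (set_iv HP)); apply: Rintegral_ge0 => s.
  by rewrite /= in_itv/= andbT; exact: (mu_ge0 (set_iii HP) (set_iv HP)).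
(* The mass k(0) - 1 is only known to be nonnegative here; the added 1 makes the denominator
   positive. *)
pose ep := (1 - rho) / 4 / (ker P 0 - 1 + 1).
have ep0 : 0 < ep by rewrite !divr_gt0// ltr_wpDl.
have epk : ep * (ker P 0 - 1) <= (1 - rho) / 4.
  rewrite /ep mulrAC ler_pdivrMr; last by rewrite ltr_wpDl.
  by rewrite ler_pM2l ?divr_gt0// lerDl.
have e4 : 0 < (1 - rho) / 4 by rewrite divr_gt0.
have cD0 := @cross_cst_gt0 _ P y0 M1 _ e4.
set cD := cross_cst _ _ _ _ in cD0.
have S0 := sobolev_cst_gt0 Om.
pose cb := 2 * (1 + sobolev_cst Om) / (1 - rho).
have cb0 : 0 < cb by rewrite divr_gt0// mulr_gt0// ltr_wpDl.
pose T := (2 * cb + 1) / (1 - rho).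
have T0 : 0 < T by rewrite divr_gt0// ltr_wpDl// mulr_ge0// ltW.
exists ((2 * (fine (leb3 Om) * T + 1) + (2^-1 + (4 * ep)^-1) * (cM * (T + 2)) + cD * (T + 1) + cb)), T.
have f0 : 0 <= fine (@leb3 R Om) by exact: fine_ge0 (measure_ge0 _ _).
have c0 : 0 <= 2^-1 + (4 * ep)^-1.
  by apply: addr_ge0; rewrite invr_ge0//; apply: mulr_ge0; [|exact: ltW].
split; [exact: step_constant_gt0 f0 T0 c0 cM0 cD0 cb0|exact: T0|].
move=> u0 v0 u ut HW hM; split.
- by move=> t t0; exact: (sol_E_ge0 HP HW y10 rho0 rho1 gap absorb t0).
- by move=> s t s0 st; have [] := sol_dissipation HP HW s0 st.
- by have [_ -> _] := sol_initial HW.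
- move=> S la S_ge0 la1.
  apply: (energy_step HP HW y10 rho0 rho1 gap absorb ep0 epk cM0 cD0 hM _ mr rMr _ S_ge0 la1).
    move=> la' t la1' t0; exact: (cross_bound HP HW e4 la1' t0).
  exact: le_trans (cross_exp_le HP) mr.
Qed.

Lemma polynomial_energy_decay r : 0 < r -> rM <= r -> (m - 1) / 2 <= r ->
  exists2 K : R, 0 < K & forall u0 v0 u ut,
    well_solution P l0 y0 E0 M1 u0 v0 u ut -> memory_bounded u ->
    forall t, 0 <= t -> En P u ut t <= K * (1 + t) `^ (- r^-1).
Proof.
move=> r0 rMr mr.
(* If one of these inequalities fails, no solution has such data and any constant will do. *)
have [[y0_gt0 hE0]|vac] := pselect (0 < y0 /\ E0 < Gfun P y0); last first.
  exists 1 => // u0 v0 u ut HW; exfalso; apply: vac; split; first exact: (sol_y0 HP HW).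
  by have [] := sol_initial HW.
have [C [T [C0 T0 H]]] := uniform_energy_step rMr mr y0_gt0 hE0.
have [K K0 HK] := polynomial_decay E0 C0 T0 r0; exists K => // u0 v0 u ut HW hM.
by have [E_ge0 E_le E_0 E_step] := H _ _ _ _ HW hM; exact: HK.
Qed.

Lemma exponential_energy_decay : rM = 0 -> m = 1 ->
  exists K ka : R, 0 < K /\ 0 < ka /\ forall u0 v0 u ut,
    well_solution P l0 y0 E0 M1 u0 v0 u ut -> memory_bounded u ->
    forall t, 0 <= t -> En P u ut t <= K * expR (- ka * t).
Proof.
move=> rM0 m1.
have [[y0_gt0 hE0]|vac] := pselect (0 < y0 /\ E0 < Gfun P y0); last first.
  exists 1, 1; do 2!split => //; move=> u0 v0 u ut HW; exfalso; apply: vac; split.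
    exact: (sol_y0 HP HW).
  by have [] := sol_initial HW.
have rMr : rM <= 0 by rewrite rM0.
have mr : (m - 1) / 2 <= 0 by rewrite m1 subrr mul0r.
have [C [T [C0 T0 H]]] := uniform_energy_step rMr mr y0_gt0 hE0.
have [K [ka [K0 ka0 HK]]] := exponential_decay E0 C0 T0.
exists K, ka; do 2!split => //; move=> u0 v0 u ut HW hM.
have [E_ge0 E_le E_0 E_step] := H _ _ _ _ HW hM; apply: HK => // S la S0 la1.
by have := E_step S la S0 la1; rewrite powRr0 mul1r.
Qed.

End energy_decay.

Theorem theorem5p5 (R : realType) (P : problem R) (l0 : nat) (y0 : R)
    (HP : setting P l0 y0) :
  (forall a E0 M1 : R, 0 < a ->
     (forall s : R, 0 <= s -> dmu P s + a * mu P s <= 0) ->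
     (dmp P = 1 ->
        exists K1 kappa : R, 0 < K1 /\ 0 < kappa /\
        forall u0 v0 u ut : R -> E3 R -> R,
          well_solution P l0 y0 E0 M1 u0 v0 u ut ->
          forall t : R, 0 <= t -> En P u ut t <= K1 * expR (- kappa * t)) /\
     (1 < dmp P ->
        exists K2 : R, 0 < K2 /\
        forall u0 v0 u ut : R -> E3 R -> R,
          well_solution P l0 y0 E0 M1 u0 v0 u ut ->
          forall t : R, 0 <= t ->
            En P u ut t <= K2 * (1 + t) `^ (2 / (1 - dmp P)))) /\
  (forall b theta sigma E0 M1 M2 : R, 0 < b -> 1 < theta -> theta < 2 ->
     0 < sigma -> sigma < 2 - theta ->
     (forall s : R, 0 <= s -> dmu P s + b * mu P s `^ theta <= 0) ->
     (dmp P = 1 ->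
        exists K3 : R, 0 < K3 /\
        forall u0 v0 u ut : R -> E3 R -> R,
          well_solution P l0 y0 E0 M1 u0 v0 u ut ->
          ereal_sup [set egradnrm (Om P) (u0 tau) | tau in `]-oo, 0%R]]
            = M2%:E ->
          forall t : R, 0 <= t ->
            En P u ut t <= K3 * (1 + t) `^ (- (sigma / (theta - 1)))) /\
     (1 < dmp P ->
        exists K4 : R, 0 < K4 /\
        forall u0 v0 u ut : R -> E3 R -> R,
          well_solution P l0 y0 E0 M1 u0 v0 u ut ->
          ereal_sup [set egradnrm (Om P) (u0 tau) | tau in `]-oo, 0%R]]
            = M2%:E ->
          forall t : R, 0 <= t ->
            En P u ut t <=
              K4 * (1 + t) `^
                (- Num.min (sigma / (theta - 1)) (2 / (dmp P - 1))))).
Proof.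
split.
- move=> a E0 M1 a0 ha.
  have a1 : 0 < a^-1 by rewrite invr_gt0.
  have hM u0 v0 u ut : well_solution P l0 y0 E0 M1 u0 v0 u ut -> memory_bounded P a^-1 0 u.
    by move=> HW la t la1 t0; exact: (memory_bound_exponential HP HW a0 ha la1 t0).
  split=> [m1|m1].
    have [K [ka [K0 [ka0 H]]]] := exponential_energy_decay HP E0 M1 a1 erefl m1.
    exists K, ka; do 2!split => //; move=> u0 v0 u ut HW.
    exact: H HW (hM _ _ _ _ HW).
  have r0 : 0 < (dmp P - 1) / 2 by rewrite divr_gt0// subr_gt0.
  have [K K0 H] := polynomial_energy_decay HP E0 M1 a1 r0 (ltW r0) (lexx _).
  exists K; split=> // u0 v0 u ut HW t t0.
  have -> : 2 / (1 - dmp P) = - ((dmp P - 1) / 2)^-1 by rewrite invf_div -mulrN -invrN opprB.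
  exact: H HW (hM _ _ _ _ HW) t t0.
- move=> b theta sigma E0 M1 M2 b0 th1 th2 s0 sth h.
  pose cM := memory_cst P y0 b sigma M2.
  pose rM := (theta - 1) / sigma.
  have rM0 : 0 < rM by rewrite divr_gt0// subr_gt0.
  have rMV : rM^-1 = sigma / (theta - 1) by rewrite invf_div.
  have hM u0 v0 u ut : well_solution P l0 y0 E0 M1 u0 v0 u ut ->
      ereal_sup [set egradnrm (Om P) (u0 tau) | tau in `]-oo, 0%R]] = M2%:E ->
      0 < cM /\ memory_bounded P cM rM u.
    move=> HW hsup; split; first exact: (memory_cst_gt0 HP HW).
    move=> la t la1 t0; apply: (memory_bound_polynomial HP HW b0 th1 s0 sth h _ la1 t0).
    move=> s s_le0; rewrite -hsup; apply: ereal_sup_ubound.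
    by exists s => //=; rewrite in_itv.
  have decay r : 0 < r -> rM <= r -> (dmp P - 1) / 2 <= r -> exists K, 0 < K /\
    forall u0 v0 u ut : R -> E3 R -> R,
      well_solution P l0 y0 E0 M1 u0 v0 u ut ->
      ereal_sup [set egradnrm (Om P) (u0 tau) | tau in `]-oo, 0%R]] = M2%:E ->
      forall t : R, 0 <= t -> En P u ut t <= K * (1 + t) `^ (- r^-1).
    (* [cM] involves [y0], whose sign is known only once a solution is given; if [cM] is not
       positive there is none. *)
    move=> r0 rMr mr; have [cM0|cM0] := ltP 0 cM; last first.
      exists 1; split=> // u0 v0 u ut HW hsup.
      by have [] := hM _ _ _ _ HW hsup; rewrite ltNge cM0.
    have [K K0 H] := polynomial_energy_decay HP E0 M1 cM0 r0 rMr mr.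
    exists K; split=> // u0 v0 u ut HW hsup.
    exact: H HW (hM _ _ _ _ HW hsup).2.
  split=> m1.
    by rewrite -rMV; apply: decay; rewrite ?lexx// m1 subrr mul0r ltW.
  have r0 : 0 < (dmp P - 1) / 2 by rewrite divr_gt0// subr_gt0.
  (* The slower of the two rates belongs to the larger of the memory and damping exponents. *)
  have -> : Num.min (sigma / (theta - 1)) (2 / (dmp P - 1)) =
      (Num.max rM ((dmp P - 1) / 2))^-1.
    rewrite -rMV -(invf_div (dmp P - 1)).
    have [rr|rr] := leP rM ((dmp P - 1) / 2).
      by rewrite min_r// lef_pV2.
    by rewrite min_l// ltW// ltf_pV2.
  by apply: decay; rewrite ?lt_max ?rM0// le_max lexx ?orbT.
Qed.
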